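(* Let $b\in\mathcal{B}_3$ be a (not necessarily pure) braid which is not a power of $\Delta_3$, write $b=\sigma_j^k\,b_1\,\Delta_3^{\ell}$ in the unique form described in the context, put $\vartheta(b)=\sigma_j^{q(k)}b_1$, and let $w$ be the reduced word in $a_1,a_2$ representing the image of the pure braid $\vartheta(b)$ in $\mathcal{PB}_3/\langle\Delta_3^2\rangle$. Then $$\frac{1}{2\pi}\mathcal{L}(w)\le\Lambda_{tr}(b)\le300\cdot\mathcal{L}(w),$$ except in the case $b=\sigma_j^k\Delta_3^{\ell}$ with $j\in\{1,2\}$, $k\neq0$ an integer and $\ell$ an arbitrary integer; in this case $\Lambda_{tr}(b)=0$.
   Context: $\mathcal{B}_3$ is the fundamental group of $C_3(\mathbb{C})/\mathcal{S}_3$ (unordered triples of distinct complex numbers), with standard generators $\sigma_1,\sigma_2$ and Garside element $\Delta_3=\sigma_1\sigma_2\sigma_1$. Every $b\in\mathcal{B}_3$ that is not a power of $\Delta_3$ can be written uniquely as $b=\sigma_j^k b_1\Delta_3^\ell$ with $j\in\{1,2\}$, $k\ne0$, $\ell\in\mathbb{Z}$, $b_1$ a reduced word in $\sigma_1^2,\sigma_2^2$ whose first term (if $b_1\ne1$) is a nonzero even power of $\sigma_2$ if $j=1$ and of $\sigma_1$ if $j=2$. For an integer $k\ne0$, $q(k)$ is $k$ if $k$ is even and $k-\mathrm{sgn}(k)$ if $k$ is odd. $\mathcal{E}^{tr}=C_3(\mathbb{R})/\mathcal{S}_3$ is connected and simply connected, so $\mathcal{B}_3\cong\pi_1(C_3(\mathbb{C})/\mathcal{S}_3,\mathcal{E}^{tr})$;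 $b_{tr}$ is the image of $b$. A map $f$ from an open rectangle $R$ (sides parallel to the axes), continuous on $\bar R$, represents $b_{tr}$ if it maps the open horizontal sides into $\mathcal{E}^{tr}$ and its restriction to the closure of each maximal vertical segment in $R$ represents $b_{tr}$. $\Lambda_{tr}(b)$ is the infimum of $\lambda(R)=$ (vertical side length)/(horizontal side length) over rectangles admitting a holomorphic map to $C_3(\mathbb{C})/\mathcal{S}_3$ representing $b_{tr}$. $\mathcal{PB}_3/\langle\Delta_3^2\rangle$ is free on $a_1,a_2$, the classes of $\sigma_1^2,\sigma_2^2$. Syllables of a nontrivial reduced word $w=w_1^{n_1}w_2^{n_2}\cdots$ (terms $w_j^{n_j}$, $n_j\ne0$, $w_j$ alternately $a_1,a_2$): (1) each term with $|n_j|\ge2$; (2) each maximal sequence of at least two consecutive terms all with exponent $+1$, or all with exponent $-1$; (3) each remaining term. Degree of a syllable = sum of absolute values of exponents of its terms; $\mathcal{L}(w)=\sum_j\log(4d_j-1)$ over syllables. *)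

(* Defs.v *)
From Stdlib Require Import Reals ZArith List.
From Coquelicot Require Import Coquelicot.
Import ListNotations.
Open Scope R_scope.

(* An unordered triple {z1,z2,z3} is identified with its elementary symmetric
   functions (z1+z2+z3, z1z2+z1z3+z2z3, z1z2z3) in C^3; this is the standard
   biholomorphism of C_3(C)/S_3 onto its image in C^3. *)
Definition C3 : Type := (C * C * C)%type.

Definition sym3 (z1 z2 z3 : C) : C3 :=
  ((z1 + z2 + z3)%C, (z1 * z2 + z1 * z3 + z2 * z3)%C, (z1 * z2 * z3)%C).

Definition inX (p : C3) : Prop :=
  exists z1 z2 z3 : C, z1 <> z2 /\ z1 <> z3 /\ z2 <> z3 /\ p = sym3 z1 z2 z3.

Definition inEtr (p : C3) : Prop :=
  exists x1 x2 x3 : R, x1 <> x2 /\ x1 <> x3 /\ x2 <> x3 /\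
    p = sym3 (RtoC x1) (RtoC x2) (RtoC x3).

Definition cont_on {T U : UniformSpace} (D : T -> Prop) (f : T -> U) : Prop :=
  forall x, D x -> filterlim f (within D (locally x)) (locally (f x)).

Definition unit_sq (st : R * R) : Prop :=
  0 <= fst st <= 1 /\ 0 <= snd st <= 1.

(* Two paths [0,1] -> C_3(C)/S_3 with endpoints in E^tr are homotopic through
   such paths (endpoints free to move in E^tr); the classes form
   pi_1(C_3(C)/S_3, E^tr) = B_3. *)
Definition rel_homotopic (g0 g1 : R -> C3) : Prop :=
  exists H : R * R -> C3,
    cont_on unit_sq H /\
    (forall st, unit_sq st -> inX (H st)) /\
    (forall s, 0 <= s <= 1 -> inEtr (H (s, 0)) /\ inEtr (H (s, 1))) /\
    (forall t, 0 <= t <= 1 -> H (0, t) = g0 t /\ H (1, t) = g1 t).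

(* A braid word is a list of terms (i, e) meaning sigma_i ^ e, i in {1,2}. *)
Definition bword := list (nat * Z).

Definition base : C3 := sym3 (RtoC 1) (RtoC 2) (RtoC 3).

(* the half twist sigma_i (pos = true) or sigma_i^{-1} (pos = false),
   t in [0,1]: the strands at positions i, i+1 of {1,2,3} rotate
   (counterclockwise for sigma_i) about their midpoint and exchange. *)
Definition half_twist (i : nat) (pos : bool) (t : R) : C3 :=
  let c := if Nat.eqb i 1 then 3 / 2 else 5 / 2 in
  let r := if Nat.eqb i 1 then 3 else 1 in
  let th := if pos then PI * t else - (PI * t) in
  sym3 (c - cos th / 2, - sin th / 2) (c + cos th / 2, sin th / 2) (RtoC r).

Definition letters (w : bword) : list (nat * bool) :=
  flat_map (fun ie => repeat (fst ie, Z.ltb 0 (snd ie)) (Z.abs_nat (snd ie))) w.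

Fixpoint letters_path (l : list (nat * bool)) (t : R) : C3 :=
  match l with
  | [] => base
  | x :: r => if Rle_dec t 1 then half_twist (fst x) (snd x) t
              else letters_path r (t - 1)
  end.

Definition std_path (w : bword) (s : R) : C3 :=
  let l := letters w in letters_path l (INR (length l) * s).

Definition delta_pow (l : Z) : bword :=
  if Z.leb 0 l then concat (repeat [(1%nat, 1%Z); (2%nat, 1%Z); (1%nat, 1%Z)] (Z.to_nat l))
  else concat (repeat [(1%nat, (-1)%Z); (2%nat, (-1)%Z); (1%nat, (-1)%Z)] (Z.to_nat (- l))).

Fixpoint alt_even (prev : nat) (b1 : bword) : Prop :=
  match b1 with
  | [] => True
  | (i, e) :: r => (i = 1%nat \/ i = 2%nat) /\ i <> prev /\ e <> 0%Z /\
                   Z.Even e /\ alt_even i r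
  end.

Definition braid_nf (j : nat) (k : Z) (b1 : bword) (l : Z) : bword :=
  (j, k) :: b1 ++ delta_pow l.

Definition closed_rect (x0 x1 y0 y1 : R) (z : C) : Prop :=
  x0 <= fst z <= x1 /\ y0 <= snd z <= y1.
Definition open_rect (x0 x1 y0 y1 : R) (z : C) : Prop :=
  x0 < fst z < x1 /\ y0 < snd z < y1.

Definition represents (x0 x1 y0 y1 : R) (f : C -> C3) (b : bword) : Prop :=
  cont_on (closed_rect x0 x1 y0 y1) f /\
  (forall z, closed_rect x0 x1 y0 y1 z -> inX (f z)) /\
  (forall z, open_rect x0 x1 y0 y1 z -> ex_derive f z) /\
  (forall x, x0 < x < x1 -> inEtr (f (x, y0)) /\ inEtr (f (x, y1))) /\
  (forall x, x0 < x < x1 ->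
     rel_homotopic (fun s => f (x, y0 + s * (y1 - y0))) (std_path b)).

Definition Lambda_tr (b : bword) : Rbar :=
  Glb_Rbar (fun lam => exists (x0 x1 y0 y1 : R) (f : C -> C3),
    x0 < x1 /\ y0 < y1 /\ lam = (y1 - y0) / (x1 - x0) /\
    represents x0 x1 y0 y1 f b).

Definition q (k : Z) : Z := if Z.even k then k else (k - Z.sgn k)%Z.

Definition vartheta (j : nat) (k : Z) (b1 : bword) : bword := (j, q k) :: b1.

Fixpoint freduce (w : list (nat * Z)) : list (nat * Z) :=
  match w with
  | [] => []
  | (i, e) :: r =>
      let s := freduce r in
      if Z.eqb e 0 then s else
      match s with
      | (i', e') :: s' =>
          if Nat.eqb i i' then (if Z.eqb (e + e') 0 then s' else (i, (e + e')%Z) :: s')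
          else (i, e) :: s
      | [] => [(i, e)]
      end
  end.

(* image in PB_3/<Delta^2> = F(a_1,a_2) of a word in even powers of the
   sigma_i: sigma_i^{2m} |-> a_i^m, then freely reduced *)
Definition pb_image (v : bword) : list (nat * Z) :=
  freduce (map (fun ie => (fst ie, Z.div (snd ie) 2)) v).

(* syllables of a reduced word, from its exponent sequence (generators
   alternate): (tag, degree), tag 0 for a term with |n| >= 2, tag +-1 for a
   maximal run of consecutive terms all with exponent +1 (resp. -1) *)
Fixpoint syllables (l : list Z) : list (Z * nat) :=
  match l with
  | [] => []
  | n :: t =>
      let s := syllables t in
      if Z.leb 2 (Z.abs n) then (0%Z, Z.abs_nat n) :: s
      else match s with
           | (m, d) :: s' => if Z.eqb m n then (m, S d) :: s' else (n, 1%nat) :: s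
           | [] => [(n, 1%nat)]
           end
  end.

Definition Lcal (w : list (nat * Z)) : R :=
  fold_right (fun md acc => ln (4 * INR (snd md) - 1) + acc) 0
    (syllables (map snd w)).

(* Main.v *)
Require Import Defs.
From Stdlib Require Import Reals Ranalysis5 ZArith List Lra Lia Psatz.
From Stdlib Require Import Classical ClassicalEpsilon FunctionalExtensionality.
From Coquelicot Require Import Coquelicot.
Import ListNotations.
Open Scope R_scope.

(* Every triple of distinct complex numbers is an affine image of {0, lambda(tau), 1} with tau in the upper
   half-plane H, where lambda is the elliptic modular function; tau is a coordinate on the universal covering
   of the space of triples modulo affine maps.  Real triples correspond to the imaginary axis iR+ and its
   images under SL(2,Z), and continuation of tau along the standard path of sigma_1^{+-1}, sigma_2^{+-1} is the
   action of [1 +-1; 0 1], [1 0; -+1 1].  So the lift of a map representing b_tr sends the horizontal sides of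
   the rectangle into iR+ and M_b iR+.  If M_b = [a b; c d] has abcd > 0, the strip -PI < x < 0 is mapped onto H
   with y = 0 going to iR+ and y = h to M_b iR+, where cosh h = |ad + bc|; applying Cauchy's theorem to the
   lifted map gives Lambda_tr(b) >= h / PI, and the strip map itself provides a representative, so that
   Lambda_tr(b) <= h on a sub-rectangle of width 1.  If b_1 = 1, the two geodesics share an endpoint and H
   contains rectangles of arbitrary width.  Along the reduced word the entries of M_b satisfy the recursion
   (s, s') -> (2 n s - s', s), which bounds (ad + bc)^2 from below by the product of the numbers 4 d_j - 1 over
   the syllables and |ad + bc| from above by 9 times its cube.

   The facts on lambda come from theta constants: lambda = theta_2^4 / theta_3^4, where nonvanishing of the theta
   constants and of the derivative of lambda is transported by the doubling tau -> 2 tau from a neighbourhood of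
   the cusp, and the behaviour under tau -> -1 / tau follows from the uniqueness of Fourier coefficients. *)

(** Only the geodesic M_b iR+ enters, not M_b itself: Delta acts as tau -> -1/tau, which preserves
    iR+, so its exponent drops out; abcd > 0 says that this geodesic and iR+ are disjoint and share
    no end point. The affine normalization forgets the vector c - a between two strands. A
    representative must reproduce its half-turns: a factor exp(k z) does so, and the homotopy to the
    standard braid is linear in log(c - a) and in the uniformizing coordinate. End points of paths
    move in E^tr, so a lift is determined only once the real triple is ordered: increasing on the
    lower side, an order that cannot change along it. The fibres of lambda are infinite, so local
    invertibility alone gives no covering. A uniform radius comes from reducing tau to a compact
    rectangle, at the cost of six anharmonic substitutions of lambda. With P the product of the
    numbers 4 d_j - 1, N = |ad + bc| and e^h = N + sqrt(N^2 - 1), the bounds P <= N^2 and N <= 9 P^3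
    yield log(P)/2 <= h <= 6 log(P). This is the origin of 1/(2 PI), and the upper constant obtained
    is 6, well below 300. *)

(** * Estimates for the modulus *)

Lemma Cmod_fst (z : C) : Rabs (fst z) <= Cmod z.
Proof. eapply Rle_trans; [apply Rmax_l | apply Rmax_Cmod]. Qed.

Lemma Cmod_snd (z : C) : Rabs (snd z) <= Cmod z.
Proof. eapply Rle_trans; [apply Rmax_r | apply Rmax_Cmod]. Qed.

Lemma Cmod_le_abs (z : C) : Cmod z <= Rabs (fst z) + Rabs (snd z).
Proof.
  unfold Cmod. apply Rsqr_incr_0_var; [|generalize (Rabs_pos (fst z)) (Rabs_pos (snd z)); lra].
  rewrite Rsqr_sqrt; [|nra]. unfold Rsqr.
  rewrite <- (pow2_abs (fst z)), <- (pow2_abs (snd z)).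
  generalize (Rabs_pos (fst z)) (Rabs_pos (snd z)); nra.
Qed.

Lemma Cmod_sym (x y : C) : Cmod (x - y) = Cmod (y - x).
Proof. rewrite <- Cmod_opp. f_equal. ring. Qed.

Lemma Cmod_tri (x y z : C) : Cmod (x - z) <= Cmod (x - y) + Cmod (y - z).
Proof. replace (x - z)%C with ((x - y) + (y - z))%C by ring. apply Cmod_triangle. Qed.

Lemma Cmod_rev (x y : C) : Cmod x - Cmod y <= Cmod (x - y).
Proof.
  assert (H := Cmod_triangle (x - y) y).
  replace (x - y + y)%C with x in H by ring. lra.
Qed.

Lemma Cmod_pos (z : C) : z <> 0%C -> 0 < Cmod z.
Proof. apply Cmod_gt_0. Qed.

Lemma Cmod_sub0 (x y : C) : Cmod (x - y) = 0 -> x = y.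
Proof. intros H. apply Cmod_eq_0 in H. replace x with (x - y + y)%C by ring. rewrite H. ring. Qed.

Lemma Cmod_sub_small (x y : C) : (forall e, 0 < e -> Cmod (x - y) < e) -> x = y.
Proof.
  intros H. apply Cmod_sub0. destruct (Rle_lt_or_eq_dec _ _ (Cmod_ge_0 (x - y))) as [L|L]; auto.
  specialize (H _ L). lra.
Qed.

Lemma Ceq (a b : C) : fst a = fst b -> snd a = snd b -> a = b.
Proof. destruct a, b; simpl; congruence. Qed.

Ltac cparts := apply Ceq; simpl.

Ltac cmod_tri := eapply Rle_trans; [apply Cmod_triangle|].

Lemma Cmod_sq (z : C) : Cmod z ^ 2 = fst z ^ 2 + snd z ^ 2.
Proof. apply Cmod2_alt. Qed.

(** * Complex exponential and derivatives *)

Definition cexp (z : C) : C := (exp (fst z) * cos (snd z), exp (fst z) * sin (snd z)).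

Lemma cexp_add (x y : C) : cexp (x + y) = (cexp x * cexp y)%C.
Proof.
  cparts; rewrite exp_plus, ?cos_plus, ?sin_plus; ring.
Qed.

Lemma cexp_0 : cexp 0 = 1%C.
Proof. cparts; rewrite exp_0, ?cos_0, ?sin_0; ring. Qed.

Lemma Cmod_cexp (z : C) : Cmod (cexp z) = exp (fst z).
Proof.
  unfold Cmod, cexp; simpl.
  replace (_ + _) with (exp (fst z) * exp (fst z) * (Rsqr (sin (snd z)) + Rsqr (cos (snd z))))
    by (unfold Rsqr; ring).
  rewrite sin2_cos2, Rmult_1_r. apply sqrt_square. left; apply exp_pos.
Qed.

Lemma cexp_neq0 (z : C) : cexp z <> 0%C.
Proof. apply Cmod_gt_0. rewrite Cmod_cexp. apply exp_pos. Qed.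

Lemma cexp_opp (z : C) : cexp (- z) = (/ cexp z)%C.
Proof.
  assert (H : (cexp (- z) * cexp z)%C = 1%C).
  { rewrite <- cexp_add. replace (- z + z)%C with (RtoC 0) by ring. apply cexp_0. }
  rewrite <- (Cmult_1_l (/ cexp z)), <- H. field. apply cexp_neq0.
Qed.

Lemma cexp_nat (n : nat) (z : C) : cexp (INR n * z) = (cexp z ^ n)%C.
Proof.
  induction n.
  - simpl INR. rewrite Cmult_0_l. apply cexp_0.
  - rewrite S_INR. replace (RtoC (INR n + 1) * z)%C with (INR n * z + z)%C
      by (rewrite RtoC_plus; ring).
    rewrite cexp_add, IHn. simpl. ring.
Qed.

(* Project on the direction of the increment and use the real mean value theorem. *)
Lemma mean_value_C (f1 f2 d1 d2 : R -> R) (B : R) :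
  (forall t, 0 <= t <= 1 -> is_derive f1 t (d1 t) /\ is_derive f2 t (d2 t)) ->
  (forall t, 0 <= t <= 1 -> Cmod (d1 t, d2 t) <= B) ->
  Cmod (f1 1 - f1 0, f2 1 - f2 0) <= B.
Proof.
  intros Hd HB.
  set (u := f1 1 - f1 0). set (v := f2 1 - f2 0).
  destruct (MVT_gen (fun t => u * f1 t + v * f2 t) 0 1 (fun t => u * d1 t + v * d2 t))
    as [c [Hc Heq]].
  - rewrite Rmin_left, Rmax_right by lra. intros x Hx. destruct (Hd x) as [H1 H2]; [lra|].
    apply (is_derive_plus (fun t => u * f1 t) (fun t => v * f2 t)); apply (is_derive_scal _ _ _); assumption.
  - rewrite Rmin_left, Rmax_right by lra. intros x Hx. destruct (Hd x) as [H1 H2]; [lra|].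
    apply continuity_pt_filterlim, (ex_derive_continuous (fun t => u * f1 t + v * f2 t)).
    exists (u * d1 x + v * d2 x).
    apply (is_derive_plus (fun t => u * f1 t) (fun t => v * f2 t)); apply (is_derive_scal _ _ _); assumption.
  - rewrite Rmin_left, Rmax_right in Hc by lra.
    assert (Heq' : u * u + v * v = u * d1 c + v * d2 c) by (unfold u, v in *; lra).
    assert (HB' := HB c Hc).
    assert (Hs : Cmod (u, v) ^ 2 = u * u + v * v) by (rewrite Cmod_sq; simpl; ring).
    assert (Ht : Cmod (d1 c, d2 c) ^ 2 = d1 c * d1 c + d2 c * d2 c) by (rewrite Cmod_sq; simpl; ring).
    generalize (Cmod_ge_0 (u, v)) (Cmod_ge_0 (d1 c, d2 c)); intros P1 P2.
    set (X := Cmod (u, v)) in *. set (Y := Cmod (d1 c, d2 c)) in *.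
    apply Rle_trans with Y; auto.
    destruct (Rle_or_lt X Y) as [|L]; auto. exfalso.
    assert (0 <= (u * d2 c - v * d1 c) ^ 2) by apply pow2_ge_0.
    assert (E : (u * d1 c + v * d2 c) ^ 2 + (u * d2 c - v * d1 c) ^ 2 = X ^ 2 * Y ^ 2)
      by (rewrite Hs, Ht; ring).
    rewrite <- Heq', <- Hs in E.
    assert (X ^ 2 * X ^ 2 <= X ^ 2 * Y ^ 2) by nra.
    assert (0 < X) by lra. assert (Y ^ 2 < X ^ 2) by nra. nra.
Qed.

(** The derivative with explicit moduli, convenient for series and lifts; [ex_derive_cder] ties it
    to differentiability of maps into [C3]. *)
Definition cder (f : C -> C) (z l : C) : Prop :=
  forall eps, 0 < eps -> exists del, 0 < del /\ forall w, Cmod (w - z) < del ->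
    Cmod (f w - f z - l * (w - z)) <= eps * Cmod (w - z).

Lemma cexp_ray (w : C) (t : R) :
  is_derive (fun t : R => fst (cexp (t * w))) t (fst (w * cexp (t * w))%C) /\
  is_derive (fun t : R => snd (cexp (t * w))) t (snd (w * cexp (t * w))%C).
Proof.
  destruct w as [a b].
  assert (E : forall s : R, (s * (a, b))%C = (s * a, s * b)) by (intros; cparts; ring).
  split; (eapply is_derive_ext; [intros s; rewrite E; reflexivity|]); rewrite E; simpl;
    auto_derive; auto; ring.
Qed.

Lemma exp_le_incr (x y : R) : x <= y -> exp x <= exp y.
Proof. intros [H| ->]; [left; now apply exp_increasing | lra]. Qed.

Lemma Cmod_ray (w : C) (t : R) : 0 <= t <= 1 -> Cmod (t * w) <= Cmod w.
Proof.
  intros Ht. rewrite Cmod_mult, Cmod_R, Rabs_pos_eq by lra. generalize (Cmod_ge_0 w); nra.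
Qed.

Lemma Cmod_cexp_le (w : C) : Cmod (cexp w) <= exp (Cmod w).
Proof.
  rewrite Cmod_cexp. apply exp_le_incr. eapply Rle_trans; [apply Rle_abs | apply Cmod_fst].
Qed.

Lemma cexp_lip (w : C) : Cmod (cexp w - 1) <= Cmod w * exp (Cmod w).
Proof.
  assert (H := mean_value_C (fun t : R => fst (cexp (t * w))) (fun t : R => snd (cexp (t * w)))
    (fun t : R => fst (w * cexp (t * w))%C) (fun t : R => snd (w * cexp (t * w))%C) (Cmod w * exp (Cmod w))
    (fun t _ => cexp_ray w t)).
  replace (cexp w - 1)%C with (fst (cexp (1 * w)) - fst (cexp (0 * w)), snd (cexp (1 * w)) - snd (cexp (0 * w))).
  - apply H. intros t Ht. rewrite <- surjective_pairing, Cmod_mult.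
    apply Rmult_le_compat_l; [apply Cmod_ge_0|].
    eapply Rle_trans; [apply Cmod_cexp_le | apply exp_le_incr, Cmod_ray, Ht].
  - rewrite Cmult_1_l, Cmult_0_l, cexp_0. reflexivity.
Qed.

(** Mean value inequality along the ray for [cexp (t * w) - t * w], whose velocity
    [w * (cexp (t * w) - 1)] is of second order by [cexp_lip]. *)
Lemma cexp_quad (w : C) : Cmod (cexp w - 1 - w) <= Cmod w ^ 2 * exp (Cmod w).
Proof.
  assert (H := mean_value_C (fun t : R => fst (cexp (t * w)) - t * fst w) (fun t : R => snd (cexp (t * w)) - t * snd w)
    (fun t : R => fst (w * cexp (t * w) - w)%C) (fun t : R => snd (w * cexp (t * w) - w)%C) (Cmod w ^ 2 * exp (Cmod w))).
  match type of H with _ -> _ -> Cmod ?x <= _ => replace (cexp w - 1 - w)%C with x end.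
  - apply H.
    + intros t _. destruct (cexp_ray w t) as [H1 H2]. split.
      * apply (is_derive_minus (fun t : R => fst (cexp (t * w))) (fun t : R => t * fst w)); auto.
        auto_derive; auto; ring.
      * apply (is_derive_minus (fun t : R => snd (cexp (t * w))) (fun t : R => t * snd w)); auto.
        auto_derive; auto; ring.
    + intros t Ht. rewrite <- surjective_pairing.
      replace (w * cexp (t * w) - w)%C with (w * (cexp (t * w) - 1))%C by ring.
      rewrite Cmod_mult.
      replace (Cmod w ^ 2 * exp (Cmod w)) with (Cmod w * (Cmod w * exp (Cmod w))) by ring.
      apply Rmult_le_compat_l; [apply Cmod_ge_0|].
      eapply Rle_trans; [apply cexp_lip|].
      apply Rmult_le_compat; try apply Cmod_ge_0; try (left; apply exp_pos).
      * apply Cmod_ray, Ht.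
      * apply exp_le_incr, Cmod_ray, Ht.
  - rewrite Cmult_1_l, Cmult_0_l, cexp_0. cparts; ring.
Qed.

Lemma cder_const (c z : C) : cder (fun _ => c) z 0.
Proof.
  intros e He. exists 1; split; [lra|]. intros w _.
  replace (c - c - 0 * (w - z))%C with (RtoC 0) by ring. rewrite Cmod_0.
  generalize (Cmod_ge_0 (w - z)); nra.
Qed.

Lemma cder_id (z : C) : cder (fun w => w) z 1.
Proof.
  intros e He. exists 1; split; [lra|]. intros w _.
  replace (w - z - 1 * (w - z))%C with (RtoC 0) by ring. rewrite Cmod_0.
  generalize (Cmod_ge_0 (w - z)); nra.
Qed.

Lemma cder_plus (f g : C -> C) (z a b : C) :
  cder f z a -> cder g z b -> cder (fun w => f w + g w)%C z (a + b)%C.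
Proof.
  intros Hf Hg e He.
  destruct (Hf (e / 2)) as [d1 [P1 K1]]; [lra|]. destruct (Hg (e / 2)) as [d2 [P2 K2]]; [lra|].
  exists (Rmin d1 d2); split; [now apply Rmin_pos|]. intros w Hw.
  specialize (K1 w (Rlt_le_trans _ _ _ Hw (Rmin_l _ _))).
  specialize (K2 w (Rlt_le_trans _ _ _ Hw (Rmin_r _ _))).
  match goal with |- Cmod ?x <= _ => replace x with
    ((f w - f z - a * (w - z)) + (g w - g z - b * (w - z)))%C by ring end.
  cmod_tri. lra.
Qed.

Lemma cder_bound (f : C -> C) (z l : C) : cder f z l ->
  exists d, 0 < d /\ forall w, Cmod (w - z) < d -> Cmod (f w - f z) <= (Cmod l + 1) * Cmod (w - z).
Proof.
  intros H. destruct (H 1) as [d [P K]]; [lra|]. exists d; split; auto. intros w Hw.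
  specialize (K w Hw).
  replace (f w - f z)%C with ((f w - f z - l * (w - z)) + l * (w - z))%C by ring.
  cmod_tri. rewrite (Cmod_mult l). lra.
Qed.

Lemma cder_cont (f : C -> C) (z l : C) : cder f z l ->
  forall e, 0 < e -> exists d, 0 < d /\ forall w, Cmod (w - z) < d -> Cmod (f w - f z) < e.
Proof.
  intros H e He. destruct (cder_bound _ _ _ H) as [d [P K]].
  assert (0 < Cmod l + 1) by (generalize (Cmod_ge_0 l); lra).
  exists (Rmin d (e / (Cmod l + 1) / 2)); split.
  - apply Rmin_pos; auto. apply Rdiv_lt_0_compat; [apply Rdiv_lt_0_compat|]; lra.
  - intros w Hw. eapply Rle_lt_trans; [apply K; eapply Rlt_le_trans; [apply Hw | apply Rmin_l]|].
    assert (Hw2 := Rlt_le_trans _ _ _ Hw (Rmin_r _ _)).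
    apply Rle_lt_trans with ((Cmod l + 1) * (e / (Cmod l + 1) / 2)).
    + apply Rmult_le_compat_l; lra.
    + replace ((Cmod l + 1) * (e / (Cmod l + 1) / 2)) with (e / 2) by (field; lra). lra.
Qed.

Lemma cder_comp (f g : C -> C) (z a b : C) :
  cder f z a -> cder g (f z) b -> cder (fun w => g (f w)) z (b * a)%C.
Proof.
  intros Hf Hg e He.
  destruct (cder_bound _ _ _ Hf) as [d0 [P0 K0]].
  assert (A0 := Cmod_ge_0 a). assert (B0 := Cmod_ge_0 b).
  set (e1 := e / 2 / (Cmod a + 1)). set (e2 := e / 2 / (Cmod b + 1)).
  assert (E1 : 0 < e1) by (unfold e1; apply Rdiv_lt_0_compat; lra).
  assert (E2 : 0 < e2) by (unfold e2; apply Rdiv_lt_0_compat; lra).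
  destruct (Hg e1 E1) as [d1 [P1 K1]]. destruct (Hf e2 E2) as [d2 [P2 K2]].
  destruct (cder_cont _ _ _ Hf d1 P1) as [d3 [P3 K3]].
  exists (Rmin (Rmin d0 d2) d3); split; [repeat apply Rmin_pos; auto|]. intros w Hw.
  assert (W0 : Cmod (w - z) < d0) by (eapply Rlt_le_trans; [apply Hw|]; eapply Rle_trans; [apply Rmin_l|apply Rmin_l]).
  assert (W2 : Cmod (w - z) < d2) by (eapply Rlt_le_trans; [apply Hw|]; eapply Rle_trans; [apply Rmin_l|apply Rmin_r]).
  assert (W3 : Cmod (w - z) < d3) by (eapply Rlt_le_trans; [apply Hw|]; apply Rmin_r).
  specialize (K0 w W0). specialize (K2 w W2). specialize (K1 (f w) (K3 w W3)).
  match goal with |- Cmod ?x <= _ => replace x with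
    ((g (f w) - g (f z) - b * (f w - f z)) + b * (f w - f z - a * (w - z)))%C by ring end.
  cmod_tri. rewrite (Cmod_mult b).
  assert (F1 : e1 * Cmod (f w - f z) <= e / 2 * Cmod (w - z)).
  { apply Rle_trans with (e1 * ((Cmod a + 1) * Cmod (w - z))).
    - apply Rmult_le_compat_l; lra.
    - right. unfold e1. field. lra. }
  assert (F2 : Cmod b * Cmod (f w - f z - a * (w - z)) <= e / 2 * Cmod (w - z)).
  { apply Rle_trans with ((Cmod b + 1) * (e2 * Cmod (w - z))).
    - apply Rmult_le_compat; auto; try apply Cmod_ge_0; lra.
    - right. unfold e2. field. lra. }
  lra.
Qed.

Lemma cder_scal (c : C) (f : C -> C) (z a : C) :
  cder f z a -> cder (fun w => c * f w)%C z (c * a)%C.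
Proof.
  intros Hf. apply (cder_comp f (fun w => c * w)%C _ _ _ Hf).
  intros e He. exists 1; split; [lra|]. intros w _.
  replace (c * w - c * f z - c * (w - f z))%C with (RtoC 0) by ring. rewrite Cmod_0.
  generalize (Cmod_ge_0 (w - f z)); nra.
Qed.

Lemma cder_sq (z : C) : cder (fun w => w * w)%C z (2 * z)%C.
Proof.
  intros e He. exists e; split; auto. intros w Hw.
  replace (w * w - z * z - 2 * z * (w - z))%C with ((w - z) * (w - z))%C by ring.
  rewrite Cmod_mult. generalize (Cmod_ge_0 (w - z)); nra.
Qed.

Lemma cder_eq (f : C -> C) (z a b : C) : cder f z a -> a = b -> cder f z b.
Proof. now intros H <-. Qed.

(** Polarization: f g = ((f + g)^2 - (f - g)^2) / 4 reduces products to sums and squares. The same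
    device proves the product rules for the notions of continuity below. *)
Lemma cder_mult (f g : C -> C) (z a b : C) :
  cder f z a -> cder g z b -> cder (fun w => f w * g w)%C z (a * g z + f z * b)%C.
Proof.
  intros Hf Hg.
  assert (H : cder (fun w => RtoC (1/4) * ((f w + g w) * (f w + g w)) +
     RtoC (-1/4) * ((f w + -1 * g w) * (f w + -1 * g w)))%C z (a * g z + f z * b)%C).
  { eapply cder_eq.
    - apply cder_plus; apply cder_scal.
      + apply (cder_comp (fun w => f w + g w)%C (fun w => w * w)%C); [apply cder_plus; eauto | apply cder_sq].
      + apply (cder_comp (fun w => f w + -1 * g w)%C (fun w => w * w)%C);
        [apply cder_plus; [eauto | apply cder_scal; eauto] | apply cder_sq].
    - cparts; field. }
  intros e He. destruct (H e He) as [d [P K]]. exists d; split; auto. intros w Hw.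
  specialize (K w Hw). cbv beta in K.
  match type of K with Cmod ?x <= _ => match goal with |- Cmod ?y <= _ => replace y with x; auto end end.
  cparts; field.
Qed.

Lemma cder_Cinv (z : C) : z <> 0%C -> cder (fun w => / w)%C z (- / (z * z))%C.
Proof.
  intros Hz e He. assert (Pz := Cmod_pos z Hz). set (r := Cmod z) in *.
  exists (Rmin (r / 2) (e * r ^ 3 / 2)). split.
  { apply Rmin_pos; [lra|]. assert (0 < r ^ 3) by (apply pow_lt; auto). nra. }
  intros w Hw. destruct (Rmin_Rgt_l _ _ _ Hw) as [W1 W2].
  assert (Hwr : r / 2 <= Cmod w).
  { assert (T := Cmod_rev z w). rewrite Cmod_sym in T. fold r in T. lra. }
  assert (Hw0 : w <> 0%C) by (apply Cmod_gt_0; lra).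
  replace (/ w - / z - - / (z * z) * (w - z))%C with ((w - z) * (w - z) / (w * (z * z)))%C by (field; auto).
  rewrite Cmod_div by (repeat apply Cmult_neq_0; auto).
  rewrite !Cmod_mult. fold r. set (h := Cmod (w - z)) in *. set (v := Cmod w) in *.
  assert (0 <= h) by apply Cmod_ge_0.
  assert (Q : 0 < v * (r * r)) by (apply Rmult_lt_0_compat; nra).
  apply (Rmult_le_reg_r (v * (r * r))); auto.
  replace (h * h / (v * (r * r)) * (v * (r * r))) with (h * h) by (field; lra).
  assert (e * r ^ 3 / 2 <= e * (v * (r * r))).
  { replace (r ^ 3) with (r * (r * r)) by ring. assert (0 < r * r) by nra.
    assert (r / 2 * (r * r) <= v * (r * r)) by nra. nra. }
  nra.
Qed.

Lemma cder_inv (f : C -> C) (z a : C) : f z <> 0%C ->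
  cder f z a -> cder (fun w => / f w)%C z (- / (f z * f z) * a)%C.
Proof. intros H Hf. apply (cder_comp f (fun w => / w)%C); auto. now apply cder_Cinv. Qed.

Lemma cder_ext_loc (f g : C -> C) (z a : C) (r : R) : 0 < r ->
  (forall w, Cmod (w - z) < r -> f w = g w) -> cder f z a -> cder g z a.
Proof.
  intros Hr E H e He. destruct (H e He) as [d [P K]].
  exists (Rmin r d); split; [now apply Rmin_pos|]. intros w Hw.
  rewrite <- (E w (Rlt_le_trans _ _ _ Hw (Rmin_l _ _))), <- (E z).
  - apply K. eapply Rlt_le_trans; [apply Hw | apply Rmin_r].
  - replace (z - z)%C with (RtoC 0) by ring. now rewrite Cmod_0.
Qed.

Lemma cder_cexp (z : C) : cder cexp z (cexp z).
Proof.
  intros e He. assert (Pz := exp_pos (fst z)). assert (E1 := exp_pos 1).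
  exists (Rmin 1 (e / (exp (fst z) * exp 1))); split.
  { apply Rmin_pos; [lra|]. apply Rdiv_lt_0_compat; nra. }
  intros w Hw. destruct (Rmin_Rgt_l _ _ _ Hw) as [W1 W2].
  replace (cexp w) with (cexp z * cexp (w - z))%C
    by (rewrite <- cexp_add; f_equal; ring).
  replace (cexp z * cexp (w - z) - cexp z - cexp z * (w - z))%C
    with (cexp z * (cexp (w - z) - 1 - (w - z)))%C by ring.
  rewrite Cmod_mult, Cmod_cexp. assert (Q := cexp_quad (w - z)). set (h := Cmod (w - z)) in *.
  assert (0 <= h) by apply Cmod_ge_0.
  assert (exp h <= exp 1) by (apply exp_le_incr; lra).
  assert (Hb : Cmod (cexp (w - z) - 1 - (w - z)) <= h * h * exp 1) by nra.
  assert (h * (exp (fst z) * exp 1) <= e).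
  { apply Rmult_lt_compat_r with (r := exp (fst z) * exp 1) in W2; [|nra].
    replace (e / (exp (fst z) * exp 1) * (exp (fst z) * exp 1)) with e in W2 by (field; lra). lra. }
  apply Rle_trans with (exp (fst z) * (h * h * exp 1)); nra.
Qed.

(** Implicit differentiation: a merely continuous [g] solving [F (g w) = m w] becomes differentiable
    where [F] has nonzero derivative. This makes lifts of holomorphic maps holomorphic. *)
Lemma cder_lift (F g m : C -> C) (z a b : C) (r : R) : 0 < r ->
  (forall w, Cmod (w - z) < r -> F (g w) = m w) ->
  (forall e, 0 < e -> exists d, 0 < d /\ forall w, Cmod (w - z) < d -> Cmod (g w - g z) < e) ->
  cder F (g z) a -> a <> 0%C -> cder m z b -> cder g z (b / a)%C.
Proof.
  intros Hr E Hc HF Ha Hm e He. assert (Pa := Cmod_pos a Ha). set (A := Cmod a) in *.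
  assert (PB := Cmod_ge_0 b). set (B := Cmod b) in *.
  set (K := 2 * (B + 1) / A). assert (PK : 0 < K) by (unfold K; apply Rdiv_lt_0_compat; lra).
  set (e1 := Rmin (A / 2) (e * A / 2 / K)).
  assert (P1 : 0 < e1) by (unfold e1; apply Rmin_pos; [lra|]; apply Rdiv_lt_0_compat; nra).
  set (e2 := Rmin 1 (e * A / 2)). assert (P2 : 0 < e2) by (unfold e2; apply Rmin_pos; nra).
  destruct (HF e1 P1) as [d1 [D1 K1]]. destruct (Hm e2 P2) as [d2 [D2 K2]].
  destruct (Hc d1 D1) as [d3 [D3 K3]].
  exists (Rmin r (Rmin d2 d3)); split; [repeat apply Rmin_pos; auto|]. intros w Hw.
  destruct (Rmin_Rgt_l _ _ _ Hw) as [W0 W'].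
  specialize (K2 w (Rlt_le_trans _ _ _ W' (Rmin_l _ _))).
  specialize (K1 (g w) (K3 w (Rlt_le_trans _ _ _ W' (Rmin_r _ _)))).
  assert (Z0 : Cmod (z - z) < r) by (replace (z - z)%C with (RtoC 0) by ring; now rewrite Cmod_0).
  rewrite (E w W0), (E z Z0) in K1.
  set (h := Cmod (w - z)) in *. assert (Ph : 0 <= h) by apply Cmod_ge_0.
  set (G := Cmod (g w - g z)) in *. assert (PG : 0 <= G) by apply Cmod_ge_0.
  assert (e1 <= A / 2) by apply Rmin_l. assert (e1 <= e * A / 2 / K) by apply Rmin_r.
  assert (e2 <= 1) by apply Rmin_l. assert (e2 <= e * A / 2) by apply Rmin_r.
  assert (L1 : A * G <= e1 * G + (B * h + e2 * h)).
  { unfold A, G. rewrite <- Cmod_mult.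
    replace (a * (g w - g z))%C with (- (m w - m z - a * (g w - g z)) + ((m w - m z - b * (w - z)) + b * (w - z)))%C by ring.
    cmod_tri. rewrite Cmod_opp.
    apply Rplus_le_compat; [apply K1|].
    cmod_tri. rewrite (Cmod_mult b). fold B h. lra. }
  (* Since e1 is at most A / 2, the term [e1 * G] of [L1] is absorbed on the left: continuity of g
     improves to a Lipschitz bound at z. *)
  assert (L2 : G <= K * h).
  { apply (Rmult_le_reg_l (A / 2)); [lra|]. replace (A / 2 * (K * h)) with ((B + 1) * h) by (unfold K; field; lra).
    nra. }
  assert (L3 : Cmod (a * (g w - g z - b / a * (w - z))) <= e1 * G + e2 * h).
  { replace (a * (g w - g z - b / a * (w - z)))%C with (- (m w - m z - a * (g w - g z)) + (m w - m z - b * (w - z)))%C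
      by (field; auto).
    cmod_tri. rewrite Cmod_opp. apply Rplus_le_compat; auto. }
  rewrite Cmod_mult in L3. fold A in L3.
  apply (Rmult_le_reg_l A); auto. eapply Rle_trans; [apply L3|].
  assert (e1 * G <= e * A / 2 * h).
  { apply Rle_trans with (e * A / 2 / K * (K * h)).
    - apply Rmult_le_compat; lra.
    - right; field; lra. }
  nra.
Qed.

Lemma cder_ray (f : C -> C) (z w l : C) (t : R) : cder f (z + t * w) l ->
  is_derive (fun t : R => fst (f (z + t * w)%C)) t (fst (l * w)%C) /\
  is_derive (fun t : R => snd (f (z + t * w)%C)) t (snd (l * w)%C).
Proof.
  intros H.
  assert (K : forall e, 0 < e -> exists d, 0 < d /\ forall s : R, Rabs (s - t) < d ->
     Cmod (f (z + s * w)%C - f (z + t * w)%C - l * w * (s - t)) <= e * Rabs (s - t)).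
  { intros e He. assert (Pw := Cmod_ge_0 w).
    destruct (H (e / (Cmod w + 1))) as [d [D KK]]; [apply Rdiv_lt_0_compat; lra|].
    exists (d / (Cmod w + 1)). split; [apply Rdiv_lt_0_compat; lra|]. intros s Hs.
    assert (E : (z + s * w - (z + t * w))%C = ((s - t) * w)%C) by ring.
    assert (M : Cmod ((s - t) * w) = Rabs (s - t) * Cmod w)
      by (rewrite Cmod_mult, <- RtoC_minus, Cmod_R; reflexivity).
    assert (A0 := Rabs_pos (s - t)).
    specialize (KK (z + s * w)%C). rewrite E, M in KK.
    replace (l * w * (s - t))%C with (l * ((s - t) * w))%C by ring.
    eapply Rle_trans; [apply KK|].
    - apply Rle_lt_trans with (Rabs (s - t) * (Cmod w + 1)); [nra|].
      apply Rmult_lt_compat_r with (r := Cmod w + 1) in Hs; [|lra].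
      replace (d / (Cmod w + 1) * (Cmod w + 1)) with d in Hs by (field; lra). lra.
    - apply Rle_trans with (e / (Cmod w + 1) * (Rabs (s - t) * (Cmod w + 1))).
      + apply Rmult_le_compat_l; [left; apply Rdiv_lt_0_compat; lra | nra].
      + right; field; lra. }
  split; apply is_derive_Reals; intros e He; destruct (K (e / 2)) as [d [D KK]]; try lra;
    exists (mkposreal d D); intros h Hh0 Hh; simpl in Hh;
    specialize (KK (t + h)); replace (t + h - t) with h in KK by ring; specialize (KK Hh);
    assert (Ph : 0 < Rabs h) by (apply Rabs_pos_lt; auto);
    set (p := f (z + (t + h)%R * w)%C) in *; set (p0 := f (z + t * w)%C) in *.
  - assert (F := Cmod_fst (p - p0 - l * w * ((t + h)%R - t))).
    replace ((fst p - fst p0) / h - fst (l * w)%C) with ((fst (p - p0 - l * w * ((t + h)%R - t))%C) / h)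
      by (destruct p, p0, l, w; simpl; field; auto).
    unfold Rdiv. rewrite Rabs_mult, Rabs_inv. apply (Rmult_lt_reg_r (Rabs h)); auto.
    rewrite Rmult_assoc, Rinv_l by lra. nra.
  - assert (F := Cmod_snd (p - p0 - l * w * ((t + h)%R - t))).
    replace ((snd p - snd p0) / h - snd (l * w)%C) with ((snd (p - p0 - l * w * ((t + h)%R - t))%C) / h)
      by (destruct p, p0, l, w; simpl; field; auto).
    unfold Rdiv. rewrite Rabs_mult, Rabs_inv. apply (Rmult_lt_reg_r (Rabs h)); auto.
    rewrite Rmult_assoc, Rinv_l by lra. nra.
Qed.

(** The mean value inequality for f(u) - a u on a segment. The free slope [a] is 0 for Lipschitz
    bounds and F'(z0) for the inverse function theorem. *)
Lemma cder_mean_value (f f' : C -> C) (a z w : C) (B : R) :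
  (forall t, 0 <= t <= 1 -> cder f (z + t * (w - z)) (f' (z + t * (w - z)))%C) ->
  (forall t, 0 <= t <= 1 -> Cmod (f' (z + t * (w - z)) - a)%C <= B) ->
  Cmod (f w - f z - a * (w - z)) <= B * Cmod (w - z).
Proof.
  intros Hd HB.
  set (g := fun u => (f u + - a * u)%C).
  assert (Hg : forall t, 0 <= t <= 1 -> cder g (z + t * (w - z)) (f' (z + t * (w - z)) + - a * 1)%C).
  { intros t Ht. apply cder_plus; [now apply Hd | apply cder_scal, cder_id]. }
  assert (K := mean_value_C (fun t : R => fst (g (z + t * (w - z))%C)) (fun t : R => snd (g (z + t * (w - z))%C))
    (fun t : R => fst ((f' (z + t * (w - z)) + - a * 1) * (w - z))%C)
    (fun t : R => snd ((f' (z + t * (w - z)) + - a * 1) * (w - z))%C) (B * Cmod (w - z))).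
  match type of K with _ -> _ -> Cmod ?x <= _ => replace (f w - f z - a * (w - z))%C with x end.
  - apply K.
    + intros t Ht. apply cder_ray, Hg, Ht.
    + intros t Ht. rewrite <- surjective_pairing, Cmod_mult. apply Rmult_le_compat_r; [apply Cmod_ge_0|].
      replace (f' (z + t * (w - z)) + - a * 1)%C with (f' (z + t * (w - z)) - a)%C by ring. now apply HB.
  - replace (z + 1 * (w - z))%C with w by ring. replace (z + 0 * (w - z))%C with z by ring.
    unfold g. cparts; ring.
Qed.

(** * Bisection of rectangles *)

Lemma halving (W d : R) : 0 < d -> exists n, W / 2 ^ n < d.
Proof.
  intros Hd. destruct (Rle_or_lt W 0) as [H|H].
  - exists 0%nat. simpl. lra.
  - destruct (pow_lt_1_zero (/ 2) ltac:(rewrite Rabs_pos_eq; lra) (d / W)) as [N HN].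
    + apply Rdiv_lt_0_compat; auto.
    + exists N. specialize (HN N (le_n _)). rewrite Rabs_pos_eq in HN by (apply pow_le; lra).
      rewrite pow_inv in HN. apply (Rmult_lt_compat_l W) in HN; auto.
      unfold Rdiv. replace (W * (d / W)) with d in HN by (field; lra). exact HN.
Qed.

Section Bisection.

Variable Q : R -> R -> R -> R -> Prop.
Variables x0 x1 y0 y1 : R.
Hypothesis glue_x : forall a m b c d, x0 <= a <= m -> m <= b <= x1 -> y0 <= c <= d -> d <= y1 ->
  Q a m c d -> Q m b c d -> Q a b c d.
Hypothesis glue_y : forall a b c m d, x0 <= a <= b -> b <= x1 -> y0 <= c <= m -> m <= d <= y1 ->
  Q a b c m -> Q a b m d -> Q a b c d.

Let box : Type := (R * R * (R * R))%type.

Let QB (r : box) : Prop := let '((a, b), (c, d)) := r in Q a b c d.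

(** The fourth quarter is returned untested: if [Q] held there as well, gluing would give [Q] on the
    whole box. *)
Let step (r : box) : box :=
  let '((a, b), (c, d)) := r in
  let m := (a + b) / 2 in let n := (c + d) / 2 in
  if excluded_middle_informative (Q a m c n) then
    if excluded_middle_informative (Q a m n d) then
      if excluded_middle_informative (Q m b c n) then ((m, b), (n, d)) else ((m, b), (c, n))
    else ((a, m), (n, d))
  else ((a, m), (c, n)).

Let inside (r : box) : Prop :=
  let '((a, b), (c, d)) := r in x0 <= a <= b /\ b <= x1 /\ y0 <= c <= d /\ d <= y1.

Lemma step_spec (r : box) : inside r -> ~ QB r ->
  ~ QB (step r) /\ inside (step r) /\
  fst (fst r) <= fst (fst (step r)) /\ snd (fst (step r)) <= snd (fst r) /\
  fst (snd r) <= fst (snd (step r)) /\ snd (snd (step r)) <= snd (snd r) /\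
  snd (fst (step r)) - fst (fst (step r)) = (snd (fst r) - fst (fst r)) / 2 /\
  snd (snd (step r)) - fst (snd (step r)) = (snd (snd r) - fst (snd r)) / 2.
Proof.
  destruct r as [[a b] [c d]]. unfold inside, QB, step. intros H NQ.
  destruct (excluded_middle_informative (Q a ((a + b) / 2) c ((c + d) / 2))) as [Q1|Q1];
  [destruct (excluded_middle_informative (Q a ((a + b) / 2) ((c + d) / 2) d)) as [Q2|Q2];
   [destruct (excluded_middle_informative (Q ((a + b) / 2) b c ((c + d) / 2))) as [Q3|Q3]|]|];
  simpl; split; auto; try lra.
  intros Q4. apply NQ. apply (glue_x a ((a + b) / 2) b c d); try lra;
  apply (glue_y _ _ c ((c + d) / 2) d); auto; lra.
Qed.

Let seqb (n : nat) : box := Nat.iter n step ((x0, x1), (y0, y1)).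

(** If [Q] failed, bad quarters would nest down to a point and contradict the local hypothesis
    there. The quarters keep the proportions of the rectangle, which Goursat's lemma exploits.
    Connectedness, continuation of lifts and uniform radii are further instances of this compactness
    principle. *)
Lemma bisect2d : x0 <= x1 -> y0 <= y1 ->
  (forall x y, x0 <= x <= x1 -> y0 <= y <= y1 -> exists del, 0 < del /\
    forall a b c d, x0 <= a <= x -> x <= b <= x1 -> y0 <= c <= y -> y <= d <= y1 ->
      b - a < del -> d - c < del -> (b - a) * (y1 - y0) = (d - c) * (x1 - x0) -> Q a b c d) ->
  Q x0 x1 y0 y1.
Proof.
  intros Hx Hy loc. apply NNPP. intros NQ.
  assert (I : forall n, inside (seqb n) /\ ~ QB (seqb n)).
  { induction n as [|n [IH1 IH2]]; [simpl; split; auto; lra|].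
    destruct (step_spec _ IH1 IH2) as [? [? _]]. now split. }
  assert (HS : forall n, fst (fst (seqb n)) <= fst (fst (seqb (S n))) /\ snd (fst (seqb (S n))) <= snd (fst (seqb n)) /\
    fst (snd (seqb n)) <= fst (snd (seqb (S n))) /\ snd (snd (seqb (S n))) <= snd (snd (seqb n)) /\
    snd (fst (seqb (S n))) - fst (fst (seqb (S n))) = (snd (fst (seqb n)) - fst (fst (seqb n))) / 2 /\
    snd (snd (seqb (S n))) - fst (snd (seqb (S n))) = (snd (snd (seqb n)) - fst (snd (seqb n))) / 2).
  { intros n. destruct (I n) as [I1 I2]. apply (step_spec _ I1 I2). }
  set (A n := fst (fst (seqb n))) in *. set (B n := snd (fst (seqb n))) in *.
  set (Cc n := fst (snd (seqb n))) in *. set (D n := snd (snd (seqb n))) in *.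
  assert (SA : forall n, A n <= A (S n)) by (intros n; apply HS).
  assert (SB : forall n, B (S n) <= B n) by (intros n; apply HS).
  assert (SC : forall n, Cc n <= Cc (S n)) by (intros n; apply HS).
  assert (SD : forall n, D (S n) <= D n) by (intros n; apply HS).
  assert (In : forall n, x0 <= A n <= B n /\ B n <= x1 /\ y0 <= Cc n <= D n /\ D n <= y1).
  { intros n. destruct (I n) as [I1 _]. unfold inside in I1. unfold A, B, Cc, D.
    destruct (seqb n) as [[a b] [c d]]. exact I1. }
  assert (nest : forall (u v : nat -> R), (forall n, u n <= u (S n)) -> (forall n, v (S n) <= v n) ->
     (forall n, u n <= v n) -> exists x, forall n, u n <= x <= v n).
  { intros u v Hu Hv Huv.
    assert (mu : forall n k, u n <= u (n + k)%nat).
    { intros n; induction k; [rewrite Nat.add_0_r; lra|]. rewrite Nat.add_succ_r. specialize (Hu (n + k)%nat). lra. }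
    assert (mv : forall n k, v (n + k)%nat <= v n).
    { intros n; induction k; [rewrite Nat.add_0_r; lra|]. rewrite Nat.add_succ_r. specialize (Hv (n + k)%nat). lra. }
    assert (uv : forall m n, u m <= v n).
    { intros m n. specialize (mu m n). specialize (mv n m). rewrite Nat.add_comm in mv.
      specialize (Huv (m + n)%nat). lra. }
    destruct (completeness (fun x => exists n, x = u n)) as [x [X1 X2]].
    - exists (v 0%nat). intros ? [n ->]. apply uv.
    - exists (u 0%nat). now exists 0%nat.
    - exists x. intros n; split; [apply X1; now exists n|]. apply X2. intros ? [m ->]. apply uv. }
  destruct (nest A B SA SB) as [x X]; [intros n; apply In|].
  destruct (nest Cc D SC SD) as [y Y]; [intros n; apply In|].
  assert (WX : forall n, B n - A n = (x1 - x0) / 2 ^ n).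
  { induction n; [unfold A, B; simpl; lra|]. destruct (HS n) as [_ [_ [_ [_ [E _]]]]].
    change (B (S n) - A (S n) = (B n - A n) / 2) in E. rewrite E, IHn. simpl. field.
    apply pow_nonzero; lra. }
  assert (WY : forall n, D n - Cc n = (y1 - y0) / 2 ^ n).
  { induction n; [unfold Cc, D; simpl; lra|]. destruct (HS n) as [_ [_ [_ [_ [_ E]]]]].
    change (D (S n) - Cc (S n) = (D n - Cc n) / 2) in E. rewrite E, IHn. simpl. field.
    apply pow_nonzero; lra. }
  destruct (loc x y) as [del [Hdel K]].
  { specialize (X 0%nat). specialize (In 0%nat). lra. }
  { specialize (Y 0%nat). specialize (In 0%nat). lra. }
  destruct (halving (x1 - x0 + (y1 - y0)) del Hdel) as [n Hn].
  assert (P2 : 0 < / 2 ^ n) by (apply Rinv_0_lt_compat, pow_lt; lra).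
  unfold Rdiv in Hn. rewrite Rmult_plus_distr_r in Hn.
  assert (0 <= (x1 - x0) * / 2 ^ n) by nra. assert (0 <= (y1 - y0) * / 2 ^ n) by nra.
  destruct (I n) as [_ I2]. apply I2.
  assert (QQ : Q (A n) (B n) (Cc n) (D n)).
  { specialize (In n). specialize (X n). specialize (Y n). specialize (WX n). specialize (WY n).
    apply K; unfold Rdiv in *; try lra. rewrite WX, WY. ring. }
  unfold QB. unfold A, B, Cc, D in QQ. destruct (seqb n) as [[a b] [c d]]. exact QQ.
Qed.

End Bisection.

(** * Continuity on a set, for metric targets *)

(** The target metric is a parameter so that maps into C and, through [d3], maps into the space of
    triples are treated alike. *)
Definition contD {E : Type} (D : C -> Prop) (dE : E -> E -> R) (f : C -> E) : Prop :=
  forall x, D x -> forall eps, 0 < eps -> exists del, 0 < del /\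
    forall y, D y -> Cmod (y - x) < del -> dE (f x) (f y) < eps.

Definition dC (x y : C) : R := Cmod (x - y).

Notation contC D := (contD D dC).

Lemma contD_sub {E : Type} (D D' : C -> Prop) (dE : E -> E -> R) (f : C -> E) :
  (forall z, D' z -> D z) -> contD D dE f -> contD D' dE f.
Proof.
  intros S H x Hx e He. destruct (H x (S x Hx) e He) as [d [P K]]. exists d; split; auto.
Qed.

Lemma contD_ext {E : Type} (D : C -> Prop) (dE : E -> E -> R) (f g : C -> E) :
  (forall z, D z -> f z = g z) -> contD D dE f -> contD D dE g.
Proof.
  intros S H x Hx e He. destruct (H x Hx e He) as [d [P K]]. exists d; split; auto.
  intros y Hy L. rewrite <- !S by auto. auto.
Qed.

Lemma contC_const (D : C -> Prop) (c : C) : contC D (fun _ => c).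
Proof.
  intros x _ e He. exists 1; split; [lra|]. intros. unfold dC.
  replace (c - c)%C with (RtoC 0) by ring. now rewrite Cmod_0.
Qed.

Lemma contC_id (D : C -> Prop) : contC D (fun z => z).
Proof. intros x _ e He. exists e; split; auto. intros. unfold dC. now rewrite Cmod_sym. Qed.

Lemma contC_comp (D U : C -> Prop) (f g : C -> C) :
  contC D f -> contC U g -> (forall z, D z -> U (f z)) -> contC D (fun z => g (f z)).
Proof.
  intros Hf Hg S x Hx e He. destruct (Hg (f x) (S x Hx) e He) as [d [P K]].
  destruct (Hf x Hx d P) as [d' [P' K']]. exists d'; split; auto. intros y Hy L.
  apply K; auto. rewrite Cmod_sym. now apply K'.
Qed.

Lemma contC_cder (U : C -> Prop) (g : C -> C) :
  (forall z, U z -> exists l, cder g z l) -> contC U g.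
Proof.
  intros H x Hx e He. destruct (H x Hx) as [l Hl]. destruct (cder_cont _ _ _ Hl e He) as [d [P K]].
  exists d; split; auto. intros y _ L. unfold dC. rewrite Cmod_sym. auto.
Qed.

Lemma contC_plus (D : C -> Prop) (f g : C -> C) :
  contC D f -> contC D g -> contC D (fun z => f z + g z)%C.
Proof.
  intros Hf Hg x Hx e He. destruct (Hf x Hx (e / 2)) as [d1 [P1 K1]]; [lra|].
  destruct (Hg x Hx (e / 2)) as [d2 [P2 K2]]; [lra|].
  exists (Rmin d1 d2); split; [now apply Rmin_pos|]. intros y Hy L.
  specialize (K1 y Hy (Rlt_le_trans _ _ _ L (Rmin_l _ _))).
  specialize (K2 y Hy (Rlt_le_trans _ _ _ L (Rmin_r _ _))). unfold dC in *.
  replace (f x + g x - (f y + g y))%C with ((f x - f y) + (g x - g y))%C by ring.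
  eapply Rle_lt_trans; [apply Cmod_triangle|]. lra.
Qed.

Lemma contC_scal (D : C -> Prop) (c : C) (f : C -> C) : contC D f -> contC D (fun z => c * f z)%C.
Proof.
  intros Hf. apply (contC_comp D (fun _ => True) f (fun w => c * w)%C); auto.
  apply contC_cder. intros z _. eexists. apply cder_scal, cder_id.
Qed.

Lemma contC_mult (D : C -> Prop) (f g : C -> C) :
  contC D f -> contC D g -> contC D (fun z => f z * g z)%C.
Proof.
  intros Hf Hg.
  assert (sq : forall h, contC D h -> contC D (fun z => h z * h z)%C).
  { intros h Hh. apply (contC_comp D (fun _ => True) h (fun w => w * w)%C); auto.
    apply contC_cder. intros z _. eexists. apply cder_sq. }
  apply contD_ext with (f := fun z => (RtoC (1/4) * ((f z + g z) * (f z + g z)) +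
     RtoC (-1/4) * ((f z + -1 * g z) * (f z + -1 * g z)))%C).
  - intros z _. cparts; field.
  - apply contC_plus; apply contC_scal; apply (sq (fun z => _)); apply contC_plus; auto. now apply contC_scal.
Qed.

Lemma contC_opp (D : C -> Prop) (f : C -> C) : contC D f -> contC D (fun z => - f z)%C.
Proof.
  intros Hf. apply contD_ext with (f := fun z => (-1 * f z)%C); [intros; ring | now apply contC_scal].
Qed.

Lemma contC_minus (D : C -> Prop) (f g : C -> C) :
  contC D f -> contC D g -> contC D (fun z => f z - g z)%C.
Proof. intros. apply contC_plus; auto. now apply contC_opp. Qed.

Lemma contC_div (D : C -> Prop) (f g : C -> C) :
  contC D f -> contC D g -> (forall z, D z -> g z <> 0%C) -> contC D (fun z => f z / g z)%C.
Proof.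
  intros Hf Hg Nz. apply contC_mult; auto.
  apply (contC_comp D (fun w => w <> 0%C) g (fun w => / w)%C); auto.
  apply contC_cder. intros z Hz. eexists. now apply cder_Cinv.
Qed.

Lemma contC_lip (D : C -> Prop) (f : C -> C) (K : R) :
  (forall x y, Cmod (f x - f y) <= K * Cmod (x - y)) -> contC D f.
Proof.
  intros H x _ e He. exists (e / (Rabs K + 1)). assert (A := Rabs_pos K). assert (B := Rle_abs K).
  split; [apply Rdiv_lt_0_compat; lra|]. intros y _ L. unfold dC.
  eapply Rle_lt_trans; [apply H|]. rewrite (Cmod_sym x y).
  apply Rmult_lt_compat_r with (r := Rabs K + 1) in L; [|lra].
  replace (e / (Rabs K + 1) * (Rabs K + 1)) with e in L by (field; lra).
  generalize (Cmod_ge_0 (y - x)); nra.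
Qed.

Lemma contC_conj (D : C -> Prop) (f : C -> C) : contC D f -> contC D (fun z => Cconj (f z)).
Proof.
  intros Hf. apply (contC_comp D (fun _ => True) f Cconj); auto.
  apply contC_lip with 1. intros x y. rewrite Rmult_1_l.
  replace (Cconj x - Cconj y)%C with (Cconj (x - y)) by (cparts; ring).
  rewrite Cmod_conj. lra.
Qed.

Lemma contC_fst (D : C -> Prop) : contC D (fun z => RtoC (fst z)).
Proof.
  apply contC_lip with 1. intros x y. rewrite <- RtoC_minus, Cmod_R, Rmult_1_l.
  apply (Cmod_fst (x - y)).
Qed.

Lemma contC_snd (D : C -> Prop) : contC D (fun z => RtoC (snd z)).
Proof.
  apply contC_lip with 1. intros x y. rewrite <- RtoC_minus, Cmod_R, Rmult_1_l.
  apply (Cmod_snd (x - y)).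
Qed.

Lemma contC_cexp (D : C -> Prop) (f : C -> C) : contC D f -> contC D (fun z => cexp (f z)).
Proof.
  intros Hf. apply (contC_comp D (fun _ => True) f cexp); auto.
  apply contC_cder. intros z _. eexists. apply cder_cexp.
Qed.

Lemma near_rect (a b c d x y : R) (z : C) :
  a <= x <= b -> c <= y <= d -> closed_rect a b c d z ->
  Cmod (z - (x, y)) <= (b - a) + (d - c).
Proof.
  intros Hx Hy [H1 H2]. eapply Rle_trans; [apply Cmod_le_abs|].
  destruct z as [u v]; simpl in *. apply Rplus_le_compat; apply Rabs_le; lra.
Qed.

Lemma rect_connected (P : C -> Prop) (x0 x1 y0 y1 : R) :
  (forall z, closed_rect x0 x1 y0 y1 z -> exists del, 0 < del /\
     forall w, closed_rect x0 x1 y0 y1 w -> Cmod (w - z) < del -> (P w <-> P z)) ->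
  forall z w, closed_rect x0 x1 y0 y1 z -> closed_rect x0 x1 y0 y1 w -> P z -> P w.
Proof.
  intros H z w Hz Hw.
  assert (X : x0 <= x1) by (unfold closed_rect in Hz; lra).
  assert (Y : y0 <= y1) by (unfold closed_rect in Hz; lra).
  assert (K : (forall z, closed_rect x0 x1 y0 y1 z -> P z) \/ (forall z, closed_rect x0 x1 y0 y1 z -> ~ P z)).
  { apply (bisect2d (fun a b c d => (forall z, closed_rect a b c d z -> P z) \/
       (forall z, closed_rect a b c d z -> ~ P z)) x0 x1 y0 y1); auto.
    - intros a m b c d H1 H2 H3 H4 [A|A] [B|B].
      + left; intros u Hu. destruct (Rle_or_lt (fst u) m); [apply A|apply B]; unfold closed_rect in *; lra.
      + exfalso. apply (B (m, c)); [|apply A]; unfold closed_rect; simpl; lra.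
      + exfalso. apply (A (m, c)); [|apply B]; unfold closed_rect; simpl; lra.
      + right; intros u Hu. destruct (Rle_or_lt (fst u) m); [apply A|apply B]; unfold closed_rect in *; lra.
    - intros a b c m d H1 H2 H3 H4 [A|A] [B|B].
      + left; intros u Hu. destruct (Rle_or_lt (snd u) m); [apply A|apply B]; unfold closed_rect in *; lra.
      + exfalso. apply (B (a, m)); [|apply A]; unfold closed_rect; simpl; lra.
      + exfalso. apply (A (a, m)); [|apply B]; unfold closed_rect; simpl; lra.
      + right; intros u Hu. destruct (Rle_or_lt (snd u) m); [apply A|apply B]; unfold closed_rect in *; lra.
    - intros x y Hx Hy. destruct (H (x, y)) as [del [D K]]; [split; simpl; assumption|].
      exists (del / 2); split; [lra|]. intros a b c d Ha Hb Hc Hd L1 L2 _.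
      assert (N : forall u, closed_rect a b c d u -> (P u <-> P (x, y))).
      { intros u Hu. apply K; [unfold closed_rect in *; lra|].
        eapply Rle_lt_trans; [apply (near_rect a b c d x y); auto; lra|]. lra. }
      destruct (classic (P (x, y))); [left|right]; intros u Hu; specialize (N u Hu); tauto. }
  destruct K as [K|K]; auto. intros Pz. exfalso. now apply (K z).
Qed.

(** * Geometrically convergent sums over the integers *)

Fixpoint zpart (f : Z -> C) (N : nat) : C :=
  match N with
  | O => f 0%Z
  | S n => (zpart f n + f (Z.of_nat N) + f (- Z.of_nat N)%Z)%C
  end.

Definition is_zsum (f : Z -> C) (l : C) : Prop :=
  forall e, 0 < e -> exists N0, forall N, (N0 <= N)%nat -> Cmod (zpart f N - l) < e.

Definition zsum (f : Z -> C) : C := epsilon (inhabits (RtoC 0)) (is_zsum f).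

(** Geometric domination is the only form of summability in use: theta series satisfy it, shifts
    preserve it, and tails get explicit bounds. *)
Definition zgeo (K r : R) (f : Z -> C) : Prop :=
  0 < r < 1 /\ forall n, Cmod (f n) <= K * r ^ Z.abs_nat n.

Lemma is_zsum_unique (f : Z -> C) (a b : C) : is_zsum f a -> is_zsum f b -> a = b.
Proof.
  intros Ha Hb. apply Cmod_sub_small. intros e He.
  destruct (Ha (e / 2)) as [n Hn]; [lra|]. destruct (Hb (e / 2)) as [m Hm]; [lra|].
  specialize (Hn (max n m) (Nat.le_max_l _ _)). specialize (Hm (max n m) (Nat.le_max_r _ _)).
  eapply Rle_lt_trans; [apply (Cmod_tri _ (zpart f (max n m)))|]. rewrite Cmod_sym. lra.
Qed.

Lemma zsum_eq (f : Z -> C) (a : C) : is_zsum f a -> zsum f = a.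
Proof.
  intros H. apply (is_zsum_unique f); auto. unfold zsum. apply epsilon_spec. now exists a.
Qed.

Lemma zgeo_K (K r : R) (f : Z -> C) : zgeo K r f -> 0 <= K.
Proof.
  intros [_ H]. specialize (H 0%Z). simpl in H. generalize (Cmod_ge_0 (f 0%Z)); lra.
Qed.

Lemma zpart_ext (f g : Z -> C) (N : nat) : (forall n, f n = g n) -> zpart f N = zpart g N.
Proof. intros H. induction N; simpl; rewrite ?H; auto. now rewrite IHN. Qed.

Lemma zpart_plus (f g : Z -> C) (N : nat) :
  zpart (fun n => f n + g n)%C N = (zpart f N + zpart g N)%C.
Proof. induction N; cbn [zpart]; auto. rewrite IHN. ring. Qed.

Lemma zpart_scal (c : C) (f : Z -> C) (N : nat) :
  zpart (fun n => c * f n)%C N = (c * zpart f N)%C.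
Proof. induction N; cbn [zpart]; auto. rewrite IHN. ring. Qed.

Lemma zpart_diff (K r : R) (f : Z -> C) (N k : nat) : zgeo K r f ->
  Cmod (zpart f (N + k) - zpart f N) <= 2 * K * (r ^ S N - r ^ S (N + k)) / (1 - r).
Proof.
  intros [Hr Hf]. induction k.
  - rewrite Nat.add_0_r. replace (zpart f N - zpart f N)%C with (RtoC 0) by ring. rewrite Cmod_0.
    right. field. lra.
  - rewrite Nat.add_succ_r. cbn [zpart].
    replace (zpart f (N + k) + f (Z.of_nat (S (N + k))) + f (- Z.of_nat (S (N + k)))%Z - zpart f N)%C with
      ((zpart f (N + k) - zpart f N) + (f (Z.of_nat (S (N + k))) + f (- Z.of_nat (S (N + k)))%Z))%C by ring.
    cmod_tri.
    eapply Rle_trans; [apply Rplus_le_compat; [apply IHk | apply Cmod_triangle]|].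
    assert (H1 := Hf (Z.of_nat (S (N + k)))). assert (H2 := Hf (- Z.of_nat (S (N + k)))%Z).
    replace (Z.abs_nat (Z.of_nat (S (N + k)))) with (S (N + k)) in H1 by lia.
    replace (Z.abs_nat (- Z.of_nat (S (N + k)))) with (S (N + k)) in H2 by lia.
    apply Rle_trans with (2 * K * (r ^ S N - r ^ S (N + k)) / (1 - r) + 2 * (K * r ^ S (N + k))); [lra|].
    right. cbn [pow]. field. lra.
Qed.

Lemma zpart_diff' (K r : R) (f : Z -> C) (N M : nat) : zgeo K r f -> (N <= M)%nat ->
  Cmod (zpart f M - zpart f N) <= 2 * K / (1 - r) * r ^ S N.
Proof.
  intros H L. replace M with (N + (M - N))%nat by lia. assert (K0 := zgeo_K _ _ _ H). destruct H as [Hr Hf].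
  eapply Rle_trans; [apply (zpart_diff K r); split; auto|].
  assert (0 <= r ^ S (N + (M - N))) by (apply pow_le; lra).
  assert (0 < / (1 - r)) by (apply Rinv_0_lt_compat; lra). unfold Rdiv.
  assert (0 <= 2 * K * / (1 - r)) by nra. nra.
Qed.

Lemma pow_small (r K e : R) : 0 < r < 1 -> 0 <= K -> 0 < e ->
  exists N0, forall N, (N0 <= N)%nat -> K * r ^ N < e.
Proof.
  intros Hr HK He. destruct (pow_lt_1_zero r ltac:(rewrite Rabs_pos_eq; lra) (e / (K + 1))) as [N HN].
  - apply Rdiv_lt_0_compat; lra.
  - exists N. intros n Hn. specialize (HN n Hn). rewrite Rabs_pos_eq in HN by (apply pow_le; lra).
    assert (0 <= r ^ n) by (apply pow_le; lra).
    apply (Rmult_lt_compat_r (K + 1)) in HN; [|lra].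
    replace (e / (K + 1) * (K + 1)) with e in HN by (field; lra). nra.
Qed.

Lemma C_complete (v : nat -> C) :
  (forall e, 0 < e -> exists N, forall n m, (N <= n)%nat -> (N <= m)%nat -> Cmod (v n - v m) < e) ->
  exists l, forall e, 0 < e -> exists N, forall n, (N <= n)%nat -> Cmod (v n - l) < e.
Proof.
  intros Cau.
  assert (L1 : ex_finite_lim_seq (fun n => fst (v n))).
  { apply ex_lim_seq_cauchy_corr. intros e. destruct (Cau e (cond_pos e)) as [N HN]. exists N. intros n m Hn Hm.
    eapply Rle_lt_trans; [|apply (HN n m Hn Hm)]. apply (Cmod_fst (v n - v m)). }
  assert (L2 : ex_finite_lim_seq (fun n => snd (v n))).
  { apply ex_lim_seq_cauchy_corr. intros e. destruct (Cau e (cond_pos e)) as [N HN]. exists N. intros n m Hn Hm.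
    eapply Rle_lt_trans; [|apply (HN n m Hn Hm)]. apply (Cmod_snd (v n - v m)). }
  destruct L1 as [a Ha]. destruct L2 as [b Hb]. exists (a, b). intros e He.
  apply is_lim_seq_spec in Ha. apply is_lim_seq_spec in Hb.
  assert (He2 : 0 < e / 2) by lra.
  destruct (Ha (mkposreal _ He2)) as [N1 H1]. destruct (Hb (mkposreal _ He2)) as [N2 H2]. simpl in H1, H2.
  exists (max N1 N2). intros N HN. eapply Rle_lt_trans; [apply Cmod_le_abs|].
  specialize (H1 N ltac:(lia)). specialize (H2 N ltac:(lia)). simpl. unfold Rminus in *. lra.
Qed.

Lemma zgeo_sum (K r : R) (f : Z -> C) : zgeo K r f -> is_zsum f (zsum f).
Proof.
  intros H. unfold zsum. apply epsilon_spec. assert (K0 := zgeo_K _ _ _ H).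
  assert (Hr : 0 < r < 1) by apply H.
  assert (Cau : forall e, 0 < e -> exists N0, forall n m, (N0 <= n)%nat -> (N0 <= m)%nat ->
     Cmod (zpart f n - zpart f m) < e).
  { intros e He. destruct (pow_small r (2 * K / (1 - r)) e Hr) as [N0 HN]; auto.
    { apply Rmult_le_pos; [lra | left; apply Rinv_0_lt_compat; lra]. }
    exists N0. intros n m Hn Hm. destruct (Nat.le_ge_cases n m).
    - rewrite Cmod_sym. eapply Rle_lt_trans; [eapply zpart_diff'; eauto | apply HN; lia].
    - eapply Rle_lt_trans; [eapply zpart_diff'; eauto | apply HN; lia]. }
  exact (C_complete _ Cau).
Qed.

Lemma zsum_tail (K r : R) (f : Z -> C) (N : nat) : zgeo K r f ->
  Cmod (zsum f - zpart f N) <= 2 * K / (1 - r) * r ^ S N.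
Proof.
  intros H. apply le_epsilon. intros e He. destruct (zgeo_sum _ _ _ H e He) as [N0 HN].
  specialize (HN (max N N0) ltac:(lia)).
  eapply Rle_trans; [apply (Cmod_tri _ (zpart f (max N N0)))|].
  rewrite Rplus_comm. apply Rplus_le_compat.
  - eapply zpart_diff'; eauto. lia.
  - rewrite Cmod_sym. lra.
Qed.

Lemma zpart_bound (K r : R) (f : Z -> C) (N : nat) : zgeo K r f -> Cmod (zpart f N) <= K * (2 / (1 - r)).
Proof.
  intros H. assert (H' := zpart_diff' _ _ _ 0 N H ltac:(lia)). assert (K0 := zgeo_K _ _ _ H).
  destruct H as [Hr Hf]. specialize (Hf 0%Z). simpl in Hf, H'.
  replace (zpart f N) with ((zpart f N - f 0%Z) + f 0%Z)%C by ring.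
  cmod_tri.
  apply Rle_trans with (2 * K / (1 - r) * (r * 1) + K * 1); [lra|].
  apply Rle_trans with (K * ((1 + r) / (1 - r))); [right; field; lra|].
  apply Rmult_le_compat_l; auto. apply Rmult_le_compat_r; [left; apply Rinv_0_lt_compat|]; lra.
Qed.

Lemma zsum_bound (K r : R) (f : Z -> C) : zgeo K r f -> Cmod (zsum f) <= K * (2 / (1 - r)).
Proof.
  intros H. apply le_epsilon. intros e He. destruct (zgeo_sum _ _ _ H e He) as [N0 HN].
  specialize (HN N0 ltac:(lia)).
  replace (zsum f) with (zpart f N0 + - (zpart f N0 - zsum f))%C by ring.
  cmod_tri. rewrite Cmod_opp.
  assert (B := zpart_bound _ _ _ N0 H). lra.
Qed.

Lemma is_zsum_plus (f g : Z -> C) (a b : C) :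
  is_zsum f a -> is_zsum g b -> is_zsum (fun n => f n + g n)%C (a + b)%C.
Proof.
  intros Hf Hg e He. destruct (Hf (e / 2)) as [n Hn]; [lra|]. destruct (Hg (e / 2)) as [m Hm]; [lra|].
  exists (max n m). intros N HN. rewrite zpart_plus.
  replace (zpart f N + zpart g N - (a + b))%C with ((zpart f N - a) + (zpart g N - b))%C by ring.
  eapply Rle_lt_trans; [apply Cmod_triangle|]. specialize (Hn N ltac:(lia)). specialize (Hm N ltac:(lia)). lra.
Qed.

Lemma is_zsum_scal (c : C) (f : Z -> C) (a : C) : is_zsum f a -> is_zsum (fun n => c * f n)%C (c * a)%C.
Proof.
  intros Hf e He. assert (P := Cmod_ge_0 c). destruct (Hf (e / (Cmod c + 1))) as [n Hn].
  { apply Rdiv_lt_0_compat; lra. }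
  exists n. intros N HN. specialize (Hn N HN). rewrite zpart_scal.
  replace (c * zpart f N - c * a)%C with (c * (zpart f N - a))%C by ring. rewrite Cmod_mult.
  apply (Rmult_lt_compat_r (Cmod c + 1)) in Hn; [|lra].
  replace (e / (Cmod c + 1) * (Cmod c + 1)) with e in Hn by (field; lra).
  generalize (Cmod_ge_0 (zpart f N - a)); nra.
Qed.

Lemma zsum_ext (f g : Z -> C) : (forall n, f n = g n) -> zsum f = zsum g.
Proof. intros E. f_equal. now apply functional_extensionality. Qed.

Lemma zsum_scal (K r : R) (c : C) (f : Z -> C) : zgeo K r f ->
  zsum (fun n => c * f n)%C = (c * zsum f)%C.
Proof. intros H. apply zsum_eq, is_zsum_scal; eapply zgeo_sum; eauto. Qed.

Lemma zgeo_shift (K r : R) (f : Z -> C) (k : Z) : zgeo K r f ->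
  zgeo (K / r ^ Z.abs_nat k) r (fun n => f (n + k)%Z).
Proof.
  intros H. assert (K0 := zgeo_K _ _ _ H). destruct H as [Hr Hf]. split; auto. intros n.
  eapply Rle_trans; [apply Hf|]. assert (P : 0 < r ^ Z.abs_nat k) by (apply pow_lt; lra).
  unfold Rdiv. rewrite Rmult_assoc. apply Rmult_le_compat_l; auto.
  apply (Rmult_le_reg_l (r ^ Z.abs_nat k)); auto. rewrite <- Rmult_assoc, Rinv_r, Rmult_1_l by lra.
  rewrite <- pow_add. destruct (Nat.le_exists_sub (Z.abs_nat n) (Z.abs_nat k + Z.abs_nat (n + k))) as [p [E _]]; [lia|].
  rewrite E, pow_add. assert (r ^ p <= 1) by (rewrite <- (pow1 p); apply pow_incr; lra).
  assert (0 <= r ^ Z.abs_nat n) by (apply pow_le; lra). nra.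
Qed.

Lemma zsum_shift1 (K r : R) (f : Z -> C) : zgeo K r f -> zsum (fun n => f (n + 1)%Z) = zsum f.
Proof.
  intros H. apply zsum_eq. assert (K0 := zgeo_K _ _ _ H).
  (* A shift changes a symmetric partial sum by two boundary terms only, and both tend to 0. *)
  assert (E : forall N, zpart (fun n => f (n + 1)%Z) N =
     (zpart f N + f (Z.of_nat (S N)) - f (- Z.of_nat N)%Z)%C).
  { induction N; [simpl; ring|]. cbn [zpart] in *. rewrite IHN.
    replace (Z.of_nat (S N) + 1)%Z with (Z.of_nat (S (S N))) by lia.
    replace (- Z.of_nat (S N) + 1)%Z with (- Z.of_nat N)%Z by lia. ring. }
  intros e He. destruct (zgeo_sum _ _ _ H (e / 2)) as [N0 HN]; [lra|].
  assert (Hr : 0 < r < 1) by apply H.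
  destruct (pow_small r (2 * K) (e / 2)) as [N1 HN1]; auto; try lra.
  exists (max N0 N1). intros N L. rewrite E.
  replace (zpart f N + f (Z.of_nat (S N)) - f (- Z.of_nat N)%Z - zsum f)%C with
    ((zpart f N - zsum f) + (f (Z.of_nat (S N)) + - f (- Z.of_nat N)%Z))%C by ring.
  eapply Rle_lt_trans; [apply Cmod_triangle|].
  specialize (HN N ltac:(lia)). specialize (HN1 N ltac:(lia)).
  assert (T := Cmod_triangle (f (Z.of_nat (S N))) (- f (- Z.of_nat N)%Z)). rewrite Cmod_opp in T.
  destruct H as [_ Hf]. assert (A1 := Hf (Z.of_nat (S N))). assert (A2 := Hf (- Z.of_nat N)%Z).
  replace (Z.abs_nat (Z.of_nat (S N))) with (S N) in A1 by lia.
  replace (Z.abs_nat (- Z.of_nat N)) with N in A2 by lia. cbn [pow] in A1.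
  assert (0 <= r ^ N) by (apply pow_le; lra). assert (K * (r * r ^ N) <= K * r ^ N).
  { apply Rmult_le_compat_l; auto. nra. }
  lra.
Qed.

Lemma zsum_shift (K r : R) (f : Z -> C) (k : Z) : zgeo K r f -> zsum (fun n => f (n + k)%Z) = zsum f.
Proof.
  intros H. revert k. apply Z.peano_ind.
  - apply zsum_ext. intros n. f_equal. lia.
  - intros k IH. rewrite <- IH. rewrite <- (zsum_shift1 _ _ _ (zgeo_shift _ _ _ k H)).
    apply zsum_ext. intros n. f_equal. lia.
  - intros k IH. rewrite <- IH. rewrite <- (zsum_shift1 _ _ _ (zgeo_shift _ _ _ (Z.pred k) H)).
    apply zsum_ext. intros n. f_equal. lia.
Qed.

Lemma zsum_parity (K r K1 r1 K2 r2 : R) (f : Z -> C) : zgeo K r f ->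
  zgeo K1 r1 (fun n => f (2 * n)%Z) -> zgeo K2 r2 (fun n => f (2 * n + 1)%Z) ->
  zsum f = (zsum (fun n => f (2 * n)%Z) + zsum (fun n => f (2 * n + 1)%Z))%C.
Proof.
  intros H H1 H2.
  apply (is_zsum_unique (fun n => f (2 * n)%Z + f (2 * n + 1)%Z)%C);
    [|apply is_zsum_plus; eapply zgeo_sum; eauto].
  (* The pairs (2n, 2n + 1) with |n| <= N cover the integers from -2N to 2N + 1, which leaves one
     boundary term. *)
  assert (E : forall N, zpart (fun n => f (2 * n)%Z + f (2 * n + 1)%Z)%C N =
     (zpart f (2 * N) + f (Z.of_nat (2 * N + 1)))%C).
  { induction N; [simpl; ring|].
    replace (2 * S N)%nat with (S (S (2 * N))) by lia. cbn [zpart]. rewrite IHN.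
    replace (2 * Z.of_nat (S N))%Z with (Z.of_nat (S (S (2 * N)))) by lia.
    replace (2 * - Z.of_nat (S N))%Z with (- Z.of_nat (S (S (2 * N))))%Z by lia.
    replace (Z.of_nat (S (S (2 * N))) + 1)%Z with (Z.of_nat (S (S (2 * N)) + 1)) by lia.
    replace (- Z.of_nat (S (S (2 * N))) + 1)%Z with (- Z.of_nat (S (2 * N)))%Z by lia.
    replace (Z.of_nat (2 * N + 1)) with (Z.of_nat (S (2 * N))) by lia. ring. }
  assert (K0 := zgeo_K _ _ _ H). assert (Hr : 0 < r < 1) by apply H.
  intros e He. destruct (zgeo_sum _ _ _ H (e / 2)) as [N0 HN]; [lra|].
  destruct (pow_small r K (e / 2)) as [N1 HN1]; auto; try lra.
  exists (max N0 N1). intros N L. rewrite E.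
  replace (zpart f (2 * N) + f (Z.of_nat (2 * N + 1)) - zsum f)%C with
    ((zpart f (2 * N) - zsum f) + f (Z.of_nat (2 * N + 1)))%C by ring.
  eapply Rle_lt_trans; [apply Cmod_triangle|].
  specialize (HN (2 * N)%nat ltac:(lia)). specialize (HN1 (2 * N + 1)%nat ltac:(lia)).
  destruct H as [_ Hf]. specialize (Hf (Z.of_nat (2 * N + 1))).
  replace (Z.abs_nat (Z.of_nat (2 * N + 1))) with (2 * N + 1)%nat in Hf by lia. lra.
Qed.

Definition zgeo2 (K r : R) (F : Z -> Z -> C) : Prop :=
  0 < r < 1 /\ forall m n, Cmod (F m n) <= K * r ^ Z.abs_nat m * r ^ Z.abs_nat n.

Lemma zpart_swap (F : Z -> Z -> C) (M N : nat) :
  zpart (fun m => zpart (F m) N) M = zpart (fun n => zpart (fun m => F m n) M) N.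
Proof.
  induction M; cbn [zpart]; auto. rewrite IHM, !zpart_plus. reflexivity.
Qed.

Lemma zgeo2_row (K r : R) (F : Z -> Z -> C) (m : Z) : zgeo2 K r F -> zgeo (K * r ^ Z.abs_nat m) r (F m).
Proof. intros [Hr H]. split; auto. Qed.

Lemma zgeo2_K (K r : R) (F : Z -> Z -> C) : zgeo2 K r F -> 0 <= K.
Proof.
  intros [_ H]. specialize (H 0%Z 0%Z). simpl in H. generalize (Cmod_ge_0 (F 0%Z 0%Z)); lra.
Qed.

Lemma zgeo2_sum (K r : R) (F : Z -> Z -> C) : zgeo2 K r F ->
  zgeo (K * (2 / (1 - r))) r (fun m => zsum (F m)).
Proof.
  intros H. split; [apply H|]. intros m. eapply Rle_trans; [eapply zsum_bound, (zgeo2_row _ _ _ m H)|].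
  right; ring.
Qed.

Lemma box_sum (K r : R) (F : Z -> Z -> C) (N : nat) : zgeo2 K r F ->
  Cmod (zsum (fun m => zsum (F m)) - zpart (fun m => zpart (F m) N) N) <=
  2 * (2 * K * (2 / (1 - r)) / (1 - r)) * r ^ S N.
Proof.
  intros H. assert (Hr : 0 < r < 1) by apply H. assert (K0 := zgeo2_K _ _ _ H).
  eapply Rle_trans; [apply (Cmod_tri _ (zpart (fun m => zsum (F m)) N))|].
  assert (T1 := zsum_tail _ _ _ N (zgeo2_sum _ _ _ H)).
  assert (T2 : Cmod (zpart (fun m => zsum (F m)) N - zpart (fun m => zpart (F m) N) N) <=
     (2 * K / (1 - r) * r ^ S N) * (2 / (1 - r))).
  { replace (zpart (fun m => zsum (F m)) N - zpart (fun m => zpart (F m) N) N)%C with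
      (zpart (fun m => zsum (F m) + -1 * zpart (F m) N)%C N)
      by (rewrite zpart_plus, zpart_scal; ring).
    apply zpart_bound. split; auto. intros m.
    replace (zsum (F m) + -1 * zpart (F m) N)%C with (zsum (F m) - zpart (F m) N)%C by ring.
    eapply Rle_trans; [eapply zsum_tail, (zgeo2_row _ _ _ m H)|]. right; field; lra. }
  eapply Rle_trans; [apply Rplus_le_compat; [apply T1 | apply T2]|]. right. field. lra.
Qed.

(** Both iterated sums are limits of the same square partial sums, in which the finite order of
    summation can be exchanged. *)
Lemma zsum_fubini (K r : R) (F : Z -> Z -> C) : zgeo2 K r F ->
  zsum (fun m => zsum (F m)) = zsum (fun n => zsum (fun m => F m n)).
Proof.
  intros H. assert (Hr : 0 < r < 1) by apply H. assert (K0 := zgeo2_K _ _ _ H).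
  assert (H' : zgeo2 K r (fun n m => F m n)).
  { split; auto. intros m n. eapply Rle_trans; [apply H|]. right; ring. }
  apply Cmod_sub_small. intros e He.
  set (c := 2 * (2 * K * (2 / (1 - r)) / (1 - r))).
  assert (0 <= c).
  { unfold c. assert (0 < / (1 - r)) by (apply Rinv_0_lt_compat; lra). unfold Rdiv.
    repeat apply Rmult_le_pos; lra. }
  destruct (pow_small r (2 * c) e) as [N HN]; auto; [lra|]. specialize (HN (S N) ltac:(lia)).
  assert (B1 := box_sum _ _ _ N H). assert (B2 := box_sum _ _ _ N H'). fold c in B1, B2.
  rewrite zpart_swap, Cmod_sym in B1. cbv beta in B2.
  eapply Rle_lt_trans; [apply (Cmod_tri _ (zpart (fun n => zpart (fun m => F m n) N) N))|].
  rewrite Cmod_sym in B1. rewrite Cmod_sym in B2. lra.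
Qed.

(* The sublattice [{m = n mod 2}] and its coset are parametrised by [(a + b, a - b)] and
   [(a + b + 1, a - b)]. *)
Lemma zsum_rotate (K r : R) (F : Z -> Z -> C) : zgeo2 K r F ->
  zsum (fun m => zsum (F m)) =
  (zsum (fun b => zsum (fun a => F (a + b)%Z (a - b)%Z)) +
   zsum (fun b => zsum (fun a => F (a + b + 1)%Z (a - b)%Z)))%C.
Proof.
  intros H. assert (Hr : 0 < r < 1) by apply H. assert (K0 := zgeo2_K _ _ _ H).
  (* In the coordinates d = m - n and n one only has |m| + |n| >= (|d| + |n|) / 2; half of the decay
     is lost, hence the square root. *)
  set (s := sqrt r).
  assert (Hs : 0 < s < 1).
  { unfold s. split; [apply sqrt_lt_R0; lra|]. rewrite <- sqrt_1. apply sqrt_lt_1; lra. }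
  assert (Es : s * s = r) by (apply sqrt_sqrt; lra).
  assert (Ep : forall k, r ^ k = s ^ (2 * k)) by (intros; rewrite pow_mult; simpl; now rewrite Rmult_1_r, Es).
  assert (mono : forall i j, (i <= j)%nat -> s ^ j <= s ^ i).
  { intros i j L. replace j with (i + (j - i))%nat by lia. rewrite pow_add.
    assert (s ^ (j - i) <= 1) by (rewrite <- (pow1 (j - i)); apply pow_incr; lra).
    assert (0 <= s ^ i) by (apply pow_le; lra). nra. }
  assert (G : zgeo2 K s (fun d n => F (d + n)%Z n)).
  { split; auto. intros d n. eapply Rle_trans; [apply H|]. rewrite !Rmult_assoc. apply Rmult_le_compat_l; auto.
    rewrite !Ep, <- !pow_add. apply mono. lia. }
  rewrite (zsum_fubini K r F H).
  transitivity (zsum (fun n => zsum (fun d => F (d + n)%Z n))).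
  { apply zsum_ext. intros n. symmetry. apply (zsum_shift (K * r ^ Z.abs_nat n) r (fun m => F m n)).
    split; auto. intros m. eapply Rle_trans; [apply H|]. right; ring. }
  rewrite <- (zsum_fubini K s _ G).
  assert (G1 := zgeo2_sum _ _ _ G). set (K1 := K * (2 / (1 - s))) in *.
  assert (0 <= K1).
  { unfold K1. apply Rmult_le_pos; auto. apply Rmult_le_pos; [lra|]. left; apply Rinv_0_lt_compat; lra. }
  assert (row : forall d c, zgeo (K * s ^ Z.abs_nat d / s ^ Z.abs_nat c) s (fun a => F (d + (a + c))%Z (a + c)%Z)).
  { intros d c. apply (zgeo_shift _ _ (fun n => F (d + n)%Z n)). apply (zgeo2_row _ _ _ d G). }
  rewrite (zsum_parity K1 s K1 s (K1 / s) s); auto.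
  (* On the diagonals m - n = 2 b and m - n = 2 b + 1 the index n is written as a - b, which brings
     the pairs to the stated form. *)
  - f_equal; apply zsum_ext; intros b.
    + rewrite <- (zsum_shift (K * s ^ Z.abs_nat (2 * b)) s _ (- b)) by (apply (zgeo2_row _ _ _ _ G)).
      apply zsum_ext. intros a. f_equal; lia.
    + rewrite <- (zsum_shift (K * s ^ Z.abs_nat (2 * b + 1)) s _ (- b)) by (apply (zgeo2_row _ _ _ _ G)).
      apply zsum_ext. intros a. f_equal; lia.
  - split; auto. intros n. eapply Rle_trans; [apply G1|]. apply Rmult_le_compat_l; auto. apply mono. lia.
  - split; auto. intros n. eapply Rle_trans; [apply G1|]. unfold Rdiv. rewrite Rmult_assoc.
    apply Rmult_le_compat_l; auto. apply (Rmult_le_reg_l s); [lra|].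
    rewrite <- Rmult_assoc, Rinv_r, Rmult_1_l by lra.
    apply (mono (Z.abs_nat n) (S (Z.abs_nat (2 * n + 1)))). lia.
Qed.

Lemma zsum_prod (K r K' r' : R) (f g : Z -> C) : zgeo K r f -> zgeo K' r' g ->
  zsum (fun b => zsum (fun a => f a * g b)%C) = (zsum f * zsum g)%C.
Proof.
  intros H H'. rewrite <- (zsum_scal K' r') by auto. apply zsum_ext. intros b.
  rewrite Cmult_comm, <- (zsum_scal K r) by auto. apply zsum_ext. intros a. ring.
Qed.

(** * Theta constants *)

Definition Ipi : C := (0, PI).

Definition tt (a : R) (t : C) (n : Z) : C := cexp (Ipi * t * RtoC ((IZR n + a) ^ 2)).

(** The j-th derivative in t of the general term of a theta series: a = 0 belongs to theta_3, a =
    1/2 to theta_2. *)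
Definition wt (j : nat) (a : R) (t : C) (n : Z) : C := ((Ipi * RtoC ((IZR n + a) ^ 2)) ^ j * tt a t n)%C.

Definition Theta (j : nat) (a : R) (t : C) : C := zsum (wt j a t).

Lemma exp_INR (c : R) (k : nat) : exp (- (c * INR k)) = exp (- c) ^ k.
Proof.
  induction k; [simpl; rewrite Rmult_0_r, Ropp_0; apply exp_0|].
  rewrite S_INR. replace (- (c * (INR k + 1))) with (- c + - (c * INR k)) by ring.
  rewrite exp_plus, IHk. reflexivity.
Qed.

Lemma Cmod_Ipi : Cmod Ipi = PI.
Proof.
  unfold Ipi, Cmod; simpl. replace (0 * (0 * 1) + PI * (PI * 1)) with (PI * PI) by ring.
  apply sqrt_square. generalize PI_RGT_0; lra.
Qed.

Lemma Cmod_tt (a : R) (t : C) (n : Z) : Cmod (tt a t n) = exp (- (PI * snd t * (IZR n + a) ^ 2)).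
Proof.
  unfold tt. rewrite Cmod_cexp. f_equal. destruct t as [x y]. simpl. ring.
Qed.

Lemma Cmod_wt (j : nat) (a : R) (t : C) (n : Z) :
  Cmod (wt j a t n) = (PI * (IZR n + a) ^ 2) ^ j * exp (- (PI * snd t * (IZR n + a) ^ 2)).
Proof.
  unfold wt. rewrite Cmod_mult, Cmod_pow, Cmod_mult, Cmod_Ipi, Cmod_R, Cmod_tt, Rabs_pos_eq; auto. apply pow2_ge_0.
Qed.

Lemma pow_exp_bound (j : nat) (y : R) : 0 < y -> exists K, 0 < K /\ forall x, 0 <= x -> x ^ j <= K * exp (y * x).
Proof.
  intros Hy. revert y Hy. induction j as [|j IHj]; intros y Hy.
  - exists 1; split; [lra|]. intros x Hx. rewrite Rmult_1_l. simpl. rewrite <- exp_0. apply exp_le_incr. nra.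
  - destruct (IHj (y / 2)) as [K' [HK' IH']]; [lra|].
    exists (2 / y * K'). split; [apply Rmult_lt_0_compat; auto; apply Rdiv_lt_0_compat; lra|].
    intros x Hx. simpl. specialize (IH' x Hx).
    assert (E : exp (y * x) = exp (y / 2 * x) * exp (y / 2 * x)) by (rewrite <- exp_plus; f_equal; field).
    rewrite E. assert (P := exp_pos (y / 2 * x)).
    assert (x <= 2 / y * exp (y / 2 * x)).
    { assert (H := exp_ineq1_le (y / 2 * x)). apply (Rmult_le_reg_l (y / 2)); [lra|].
      replace (y / 2 * (2 / y * exp (y / 2 * x))) with (exp (y / 2 * x)) by (field; lra). lra. }
    replace (2 / y * K' * (exp (y / 2 * x) * exp (y / 2 * x))) with
      ((2 / y * exp (y / 2 * x)) * (K' * exp (y / 2 * x))) by ring.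
    apply Rmult_le_compat; auto. apply pow_le; auto.
Qed.

Lemma sq_ge_abs (a : R) (n : Z) : -1 <= a <= 1 -> INR (Z.abs_nat n) - 1 <= (IZR n + a) ^ 2.
Proof.
  intros Ha. rewrite INR_IZR_INZ, Zabs2Nat.id_abs.
  destruct (Z_le_gt_dec 0 n) as [H|H].
  - rewrite Z.abs_eq by auto. assert (0 <= IZR n) by (apply IZR_le; auto).
    destruct (Z.eq_dec n 0) as [->|]; [nra|]. destruct (Z.eq_dec n 1) as [->|]; [nra|].
    assert (2 <= IZR n) by (apply IZR_le; lia). nra.
  - rewrite Z.abs_neq by lia. rewrite opp_IZR.
    assert (IZR n <= -1) by (apply IZR_le; lia).
    destruct (Z.eq_dec n (-1)) as [->|]; [nra|]. assert (IZR n <= -2) by (apply IZR_le; lia). nra.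
Qed.

Lemma gauss_geo_unif (j : nat) (y : R) : 0 < y -> exists K r, 0 < K /\ 0 < r < 1 /\
  forall a n y', -1 <= a <= 1 -> y <= y' ->
    (PI * (IZR n + a) ^ 2) ^ j * exp (- (PI * y' * (IZR n + a) ^ 2)) <= K * r ^ Z.abs_nat n.
Proof.
  intros Hy. assert (PP := PI_RGT_0).
  destruct (pow_exp_bound j (y / 2)) as [K [HK H]]; [lra|].
  (* One half of the Gaussian decay absorbs the polynomial factor, the other half dominates |n| - 1
     and yields the geometric rate. *)
  set (r := exp (- (PI * (y / 2)))).
  exists (K * exp (PI * (y / 2))), r. split; [apply Rmult_lt_0_compat; auto; apply exp_pos|]. split.
  { split; [apply exp_pos|]. unfold r. rewrite <- exp_0. apply exp_increasing. nra. }
  intros a n y' Ha Hy'. unfold r. rewrite <- exp_INR. assert (Q := pow2_ge_0 (IZR n + a)).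
  set (m := (IZR n + a) ^ 2) in *. specialize (H (PI * m) ltac:(nra)).
  apply Rle_trans with (K * exp (y / 2 * (PI * m)) * exp (- (PI * y' * m))).
  - apply Rmult_le_compat_r; auto. left; apply exp_pos.
  - rewrite !Rmult_assoc, <- !exp_plus. apply Rmult_le_compat_l; [lra|]. apply exp_le_incr.
    assert (S := sq_ge_abs a n Ha). fold m in S.
    assert (PI * (y / 2) * (INR (Z.abs_nat n) - 1) <= PI * (y / 2) * m) by (apply Rmult_le_compat_l; nra).
    assert (PI * m * y <= PI * m * y') by (apply Rmult_le_compat_l; nra). lra.
Qed.

Lemma gauss_geo (j : nat) (a y : R) : -1 <= a <= 1 -> 0 < y -> exists K r, 0 < K /\ 0 < r < 1 /\
  forall n y', y <= y' -> (PI * (IZR n + a) ^ 2) ^ j * exp (- (PI * y' * (IZR n + a) ^ 2)) <= K * r ^ Z.abs_nat n.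
Proof.
  intros Ha Hy. destruct (gauss_geo_unif j y Hy) as [K [r [HK [Hr H]]]]. exists K, r. repeat split; auto; lra.
Qed.

Definition HH (t : C) : Prop := 0 < snd t.

Lemma wt_geo (j : nat) (a : R) (t : C) : -1 <= a <= 1 -> HH t -> exists K r, zgeo K r (wt j a t).
Proof.
  intros Ha Ht. destruct (gauss_geo j a (snd t) Ha Ht) as [K [r [HK [Hr H]]]].
  exists K, r. split; auto. intros n. rewrite Cmod_wt. apply H. lra.
Qed.

Lemma Theta_cder (j : nat) (a : R) (t : C) : -1 <= a <= 1 -> HH t ->
  cder (Theta j a) t (Theta (S j) a t).
Proof.
  intros Ha Ht. unfold HH in Ht. assert (PP := PI_RGT_0).
  destruct (gauss_geo (S (S j)) a (snd t / 2)) as [K [r [HK [Hr H]]]]; auto; [lra|].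
  set (B := K * (2 / (1 - r))).
  assert (HB : 0 < B).
  { unfold B. apply Rmult_lt_0_compat; auto. apply Rdiv_lt_0_compat; lra. }
  intros e He. exists (Rmin (snd t / 2) (e / B)). split.
  { apply Rmin_pos; [lra|]. now apply Rdiv_lt_0_compat. }
  intros w Hw. destruct (Rmin_Rgt_l _ _ _ Hw) as [W1 W2].
  set (h := (w - t)%C) in *. assert (P0 := Cmod_ge_0 h).
  assert (Hh : Rabs (snd h) <= Cmod h) by apply Cmod_snd.
  assert (Sw : snd w = snd t + snd h) by (unfold h; simpl; ring).
  apply Rabs_le_between in Hh.
  assert (HHw : HH w) by (unfold HH; lra).
  destruct (wt_geo j a w Ha HHw) as [K1 [r1 G1]]. destruct (wt_geo j a t Ha Ht) as [K2 [r2 G2]].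
  destruct (wt_geo (S j) a t Ha Ht) as [K3 [r3 G3]].
  assert (E : is_zsum (fun n => wt j a w n + -1 * wt j a t n + (- h) * wt (S j) a t n)%C
     (Theta j a w - Theta j a t - Theta (S j) a t * h)%C).
  { replace (Theta j a w - Theta j a t - Theta (S j) a t * h)%C with
      (Theta j a w + -1 * Theta j a t + (- h) * Theta (S j) a t)%C by ring.
    repeat apply is_zsum_plus; try apply is_zsum_scal; eapply zgeo_sum; eauto. }
  apply zsum_eq in E. rewrite <- E.
  apply Rle_trans with ((K * (Cmod h * Cmod h)) * (2 / (1 - r))).
  2:{ replace (K * (Cmod h * Cmod h) * (2 / (1 - r))) with (B * Cmod h * Cmod h) by (unfold B; ring).
      apply Rmult_le_compat_r; auto. apply (Rmult_lt_compat_l B) in W2; auto.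
      replace (B * (e / B)) with e in W2 by (field; lra). lra. }
  apply zsum_bound. split; auto. intros n.
  set (m := RtoC ((IZR n + a) ^ 2)).
  assert (Em : 0 <= (IZR n + a) ^ 2) by apply pow2_ge_0.
  replace (wt j a w n + -1 * wt j a t n + - h * wt (S j) a t n)%C with
    (wt j a t n * (cexp (Ipi * h * m) - 1 - Ipi * h * m))%C.
  2:{ unfold wt, tt. fold m. replace w with (t + h)%C by (unfold h; ring).
      replace (Ipi * (t + h) * m)%C with (Ipi * t * m + Ipi * h * m)%C by ring. rewrite cexp_add. cbn [Cpow]. ring. }
  rewrite Cmod_mult, Cmod_wt.
  assert (Q := cexp_quad (Ipi * h * m)).
  assert (Cm : Cmod m = (IZR n + a) ^ 2) by (unfold m; now rewrite Cmod_R, Rabs_pos_eq).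
  rewrite !Cmod_mult, Cmod_Ipi, Cm in Q.
  set (M := (IZR n + a) ^ 2) in *.
  eapply Rle_trans; [apply Rmult_le_compat_l; [|apply Q]|].
  { apply Rmult_le_pos; [apply pow_le; nra | left; apply exp_pos]. }
  (* The second-order remainder of each term is dominated by its second derivative at the height
     [snd t - Cmod h], which stays above [snd t / 2]. *)
  specialize (H n (snd t - Cmod h) ltac:(lra)). fold M in H.
  replace (exp (- (PI * snd t * M))) with (exp (- (PI * (snd t - Cmod h) * M)) * exp (- (PI * Cmod h * M)))
    by (rewrite <- exp_plus; f_equal; ring).
  replace (exp (PI * Cmod h * M)) with (/ exp (- (PI * Cmod h * M))) by (rewrite exp_Ropp, Rinv_inv; auto).
  assert (Px := exp_pos (- (PI * Cmod h * M))).
  apply Rle_trans with (((PI * M) ^ S (S j) * exp (- (PI * (snd t - Cmod h) * M))) * (Cmod h * Cmod h)).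
  - right. cbn [pow]. field. lra.
  - replace (K * (Cmod h * Cmod h) * r ^ Z.abs_nat n) with ((K * r ^ Z.abs_nat n) * (Cmod h * Cmod h)) by ring.
    apply Rmult_le_compat_r; auto. nra.
Qed.

Definition th3 (t : C) : C := Theta 0 0 t.

(** The usual theta_4: n^2 and n have the same parity, so replacing t by t + 1 inserts the signs
    (-1)^n. *)
Definition th4 (t : C) : C := th3 (t + 1).

Definition th2 (t : C) : C := Theta 0 (1/2) t.

Lemma wt0 (a : R) (t : C) (n : Z) : wt 0 a t n = tt a t n.
Proof. unfold wt. simpl. ring. Qed.

Lemma Theta0 (a : R) (t : C) : Theta 0 a t = zsum (tt a t).
Proof. apply zsum_ext, wt0. Qed.

Lemma cexp_IZR (k : Z) (z : C) : cexp z = 1%C -> cexp (RtoC (IZR k) * z) = 1%C.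
Proof.
  intros H.
  assert (N : forall n, cexp (RtoC (INR n) * z) = 1%C).
  { intros n. rewrite cexp_nat, H. induction n; simpl; auto. rewrite IHn. ring. }
  destruct (Z_le_gt_dec 0 k) as [L|L].
  - replace (IZR k) with (INR (Z.to_nat k)); auto. rewrite INR_IZR_INZ. f_equal. lia.
  - replace (IZR k) with (- INR (Z.to_nat (- k))).
    + rewrite RtoC_opp. replace (- RtoC (INR (Z.to_nat (- k))) * z)%C with (- (RtoC (INR (Z.to_nat (- k))) * z))%C by ring.
      rewrite cexp_opp, N. field.
    + rewrite INR_IZR_INZ, <- opp_IZR. f_equal. lia.
Qed.

Lemma cexp_2pi : cexp (2 * Ipi) = 1%C.
Proof.
  cparts; replace (2 * 0 - 0 * PI) with 0 by ring; replace (2 * PI + 0 * 0) with (2 * PI) by ring;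
  rewrite exp_0, ?cos_2PI, ?sin_2PI; ring.
Qed.

Lemma cexp_pi : cexp Ipi = (-1)%C.
Proof.
  cparts; rewrite exp_0, ?cos_PI, ?sin_PI; ring.
Qed.

Lemma HH_plus1 (t : C) : HH t -> HH (t + 1).
Proof. unfold HH; simpl; lra. Qed.

Lemma HH_double (t : C) : HH t -> HH (2 * t).
Proof. unfold HH; simpl; lra. Qed.

Lemma th3_period (t : C) : th3 (t + 2) = th3 t.
Proof.
  unfold th3. rewrite !Theta0. apply zsum_ext. intros n. unfold tt.
  replace (Ipi * (t + 2) * RtoC ((IZR n + 0) ^ 2))%C with
    (Ipi * t * RtoC ((IZR n + 0) ^ 2) + RtoC (IZR (n * n)) * (2 * Ipi))%C.
  - rewrite cexp_add, cexp_IZR by apply cexp_2pi. ring.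
  - rewrite mult_IZR. replace ((IZR n + 0) ^ 2) with (IZR n * IZR n) by ring. ring.
Qed.

Lemma th4_plus1 (t : C) : th4 (t + 1) = th3 t.
Proof. unfold th4. rewrite <- (th3_period t). f_equal. ring. Qed.

Lemma th2_plus1 (t : C) : HH t -> th2 (t + 1) = (cexp (Ipi * RtoC (1/4)) * th2 t)%C.
Proof.
  intros Ht. unfold th2. rewrite !Theta0.
  destruct (wt_geo 0 (1/2) t ltac:(lra) Ht) as [K [r G]].
  rewrite <- (zsum_scal K r).
  - apply zsum_ext. intros n. unfold tt.
    destruct (Z.Even_or_Odd n) as [[k Hk]|[k Hk]].
    + replace (Ipi * (t + 1) * RtoC ((IZR n + 1/2) ^ 2))%C with
        (Ipi * RtoC (1/4) + Ipi * t * RtoC ((IZR n + 1/2) ^ 2) + RtoC (IZR (k * (n + 1))) * (2 * Ipi))%C.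
      * rewrite cexp_add, cexp_IZR, cexp_add by apply cexp_2pi. ring.
      * subst n. rewrite !mult_IZR, plus_IZR, mult_IZR.
        set (m := IZR k). replace (RtoC (((2 * m + 1/2) ^ 2))) with (RtoC (1/4) + 2 * RtoC (m * (2 * m + 1)))%C.
        { ring. } cparts; field.
    + replace (Ipi * (t + 1) * RtoC ((IZR n + 1/2) ^ 2))%C with
        (Ipi * RtoC (1/4) + Ipi * t * RtoC ((IZR n + 1/2) ^ 2) + RtoC (IZR (n * (k + 1))) * (2 * Ipi))%C.
      * rewrite cexp_add, cexp_IZR, cexp_add by apply cexp_2pi. ring.
      * subst n. rewrite !mult_IZR, !plus_IZR, mult_IZR.
        set (m := IZR k). replace (RtoC (((2 * m + 1 + 1/2) ^ 2))) with (RtoC (1/4) + 2 * RtoC ((2 * m + 1) * (m + 1)))%C.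
        { ring. } cparts; field.
  - destruct G as [Hr G]. split; auto. intros n. rewrite <- wt0. apply G.
Qed.

Lemma cexp_quarter : (cexp (Ipi * RtoC (1/4)) * cexp (Ipi * RtoC (1/4)) * (cexp (Ipi * RtoC (1/4)) * cexp (Ipi * RtoC (1/4))))%C = (-1)%C.
Proof.
  rewrite <- !cexp_add, <- cexp_pi. f_equal. cparts; field.
Qed.

Lemma tt_geo2 (a : R) (t : C) : -1 <= a <= 1 -> HH t ->
  exists K r, zgeo2 K r (fun m n => tt a t m * tt a t n)%C.
Proof.
  intros Ha Ht. destruct (wt_geo 0 a t Ha Ht) as [K [r [Hr G]]]. exists (K * K), r. split; auto.
  intros m n. rewrite Cmod_mult, <- !wt0.
  replace (K * K * r ^ Z.abs_nat m * r ^ Z.abs_nat n) with ((K * r ^ Z.abs_nat m) * (K * r ^ Z.abs_nat n)) by ring.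
  apply Rmult_le_compat; try apply Cmod_ge_0; apply G.
Qed.

Lemma tt_geo (a : R) (t : C) : -1 <= a <= 1 -> HH t -> exists K r, zgeo K r (tt a t).
Proof.
  intros Ha Ht. destruct (wt_geo 0 a t Ha Ht) as [K [r [Hr G]]]. exists K, r. split; auto.
  intros n. rewrite <- wt0. apply G.
Qed.

(** Intended for k = m + n and l = m - n up to the characteristics, where k^2 + l^2 = 2 m^2 + 2 n^2:
    products of theta terms at t become products at 2 t. *)
Lemma tt_sum2 (a b c d : R) (t : C) (k l m n : Z) :
  (IZR k + a) ^ 2 + (IZR l + b) ^ 2 = 2 * (IZR m + c) ^ 2 + 2 * (IZR n + d) ^ 2 ->
  (tt a t k * tt b t l)%C = (tt c (2 * t) m * tt d (2 * t) n)%C.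
Proof.
  intros E. unfold tt. rewrite <- !cexp_add. f_equal.
  transitivity (Ipi * t * RtoC ((IZR k + a) ^ 2 + (IZR l + b) ^ 2))%C; [rewrite RtoC_plus; ring|].
  rewrite E, RtoC_plus, !RtoC_mult. ring.
Qed.

Lemma th3_sq (t : C) : HH t ->
  (th3 t * th3 t)%C = (th3 (2 * t) * th3 (2 * t) + th2 (2 * t) * th2 (2 * t))%C.
Proof.
  intros Ht. unfold th3, th2. rewrite !Theta0.
  destruct (tt_geo 0 t ltac:(lra) Ht) as [K [r G]]. destruct (tt_geo2 0 t ltac:(lra) Ht) as [K' [r' G']].
  destruct (tt_geo 0 _ ltac:(lra) (HH_double t Ht)) as [K1 [r1 G1]].
  destruct (tt_geo (1/2) _ ltac:(lra) (HH_double t Ht)) as [K2 [r2 G2]].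
  rewrite <- (zsum_prod K r K r), <- (zsum_prod K1 r1 K1 r1), <- (zsum_prod K2 r2 K2 r2) by auto.
  transitivity (zsum (fun m => zsum ((fun m n => tt 0 t m * tt 0 t n)%C m))).
  { apply zsum_ext; intros m; apply zsum_ext; intros n; ring. }
  rewrite (zsum_rotate K' r') by exact G'.
  f_equal; apply zsum_ext; intros b; apply zsum_ext; intros a; apply tt_sum2;
  rewrite ?plus_IZR, minus_IZR, ?plus_IZR; field.
Qed.

Lemma th2_sq (t : C) : HH t -> (th2 t * th2 t)%C = (2 * (th2 (2 * t) * th3 (2 * t)))%C.
Proof.
  intros Ht. unfold th3, th2. rewrite !Theta0.
  destruct (tt_geo (1/2) t ltac:(lra) Ht) as [K [r G]]. destruct (tt_geo2 (1/2) t ltac:(lra) Ht) as [K' [r' G']].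
  destruct (tt_geo 0 _ ltac:(lra) (HH_double t Ht)) as [K1 [r1 G1]].
  destruct (tt_geo (1/2) _ ltac:(lra) (HH_double t Ht)) as [K2 [r2 G2]].
  rewrite <- (zsum_prod K r K r) by auto.
  transitivity (zsum (fun m => zsum ((fun m n => tt (1/2) t m * tt (1/2) t n)%C m))).
  { apply zsum_ext; intros m; apply zsum_ext; intros n; ring. }
  rewrite (zsum_rotate K' r') by exact G'.
  (* On the coset of the sublattice one factor has its index shifted by 1, which does not affect the
     sum over all integers; hence the factor 2. *)
  replace (2 * (zsum (tt (1 / 2) (2 * t)) * zsum (tt 0 (2 * t))))%C with
    (zsum (tt (1 / 2) (2 * t)) * zsum (tt 0 (2 * t)) + zsum (fun n => tt 0 (2 * t) (n + 1)%Z) * zsum (tt (1 / 2) (2 * t)))%C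
    by (rewrite (zsum_shift1 K1 r1) by auto; ring).
  rewrite <- (zsum_prod K2 r2 K1 r1), <- (zsum_prod _ _ K2 r2 _ _ (zgeo_shift _ _ _ 1 G1)) by auto.
  f_equal; apply zsum_ext; intros b; apply zsum_ext; intros a; apply tt_sum2;
  rewrite ?plus_IZR, minus_IZR, ?plus_IZR; field.
Qed.

Lemma th4_sq (t : C) : HH t ->
  (th4 t * th4 t)%C = (th3 (2 * t) * th3 (2 * t) - th2 (2 * t) * th2 (2 * t))%C.
Proof.
  intros Ht. unfold th4. rewrite th3_sq by now apply HH_plus1.
  replace (2 * (t + 1))%C with (2 * t + 1 + 1)%C by ring.
  assert (H2 := HH_double t Ht).
  replace (th3 (2 * t + 1 + 1)) with (th3 (2 * t)) by (rewrite <- (th3_period (2 * t)); f_equal; ring).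
  rewrite !th2_plus1; auto using HH_plus1.
  assert (Q := cexp_quarter). set (c := cexp (Ipi * RtoC (1/4))) in *.
  replace (c * (c * th2 (2 * t)) * (c * (c * th2 (2 * t))))%C with ((c * c * (c * c)) * (th2 (2 * t) * th2 (2 * t)))%C by ring.
  rewrite Q. ring.
Qed.

(** With A and B the values of theta_3 and theta_2 at 2 t, this is (A^2 + B^2)^2 - (A^2 - B^2)^2 =
    (2 A B)^2. *)
Lemma jacobi (t : C) : HH t ->
  (th3 t * th3 t * (th3 t * th3 t) - th4 t * th4 t * (th4 t * th4 t))%C = (th2 t * th2 t * (th2 t * th2 t))%C.
Proof. intros Ht. rewrite (th3_sq t), (th4_sq t), (th2_sq t) by auto. ring. Qed.

(** Through this identity a zero of theta_4 at t passes on to 2 t. *)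
Lemma th34_sq (t : C) : HH t ->
  (th3 t * th3 t * (th4 t * th4 t))%C = (th4 (2 * t) * th4 (2 * t) * (th4 (2 * t) * th4 (2 * t)))%C.
Proof.
  intros Ht. assert (J := jacobi (2 * t) (HH_double t Ht)). rewrite (th3_sq t), (th4_sq t) by auto.
  set (A := th3 (2 * t)) in *. set (B := th2 (2 * t)) in *. set (D := th4 (2 * t)) in *.
  transitivity (A * A * (A * A) - B * B * (B * B))%C; [ring|]. rewrite <- J. ring.
Qed.

(** * Behaviour at the cusp, nonvanishing *)

Lemma exp_PI_small (eta : R) : 0 < eta -> exists Y, 1 <= Y /\ forall y, Y <= y -> exp (- (PI * y - 1)) < eta.
Proof.
  intros He. exists (Rmax 1 (/ eta + 1)). split; [apply Rmax_l|]. intros y Hy.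
  assert (H1 := Rle_trans _ _ _ (Rmax_l _ _) Hy). assert (H2 := Rle_trans _ _ _ (Rmax_r _ _) Hy).
  assert (P : 3 < PI) by (generalize PI2_3_2; unfold PI2; lra).
  rewrite exp_Ropp. rewrite <- (Rinv_inv eta). assert (0 < / eta) by now apply Rinv_0_lt_compat.
  apply Rinv_lt_contravar; [apply Rmult_lt_0_compat; auto; apply exp_pos|].
  assert (E := exp_ineq1_le (PI * y - 1)). nra.
Qed.

(** The indices 0, 1, -1 form the head because they contain the leading pairs of both series
    concerned: 0 and -1 for theta_2, 1 and -1 for the derivative of theta_3. *)
Lemma zsum_near_head (f : Z -> C) (r A : R) : 0 < r <= 1 / 2 -> 0 <= A ->
  (forall n, (n = 1 \/ n = -1)%Z -> Cmod (f n) <= A) ->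
  Cmod (f 0%Z) <= A -> (forall n, (2 <= Z.abs n)%Z -> Cmod (f n) <= A * r ^ Z.abs_nat n) ->
  Cmod (zsum f - (f 0%Z + f 1%Z + f (-1)%Z)) <= 4 * A * r.
Proof.
  intros Hr HA H1 H0 H2.
  assert (G : zgeo (A / r) r f).
  { split; [lra|]. intros n. destruct (Z_le_gt_dec 2 (Z.abs n)) as [L|L].
    - eapply Rle_trans; [apply H2; auto|]. apply Rmult_le_compat_r; [apply pow_le; lra|].
      apply (Rmult_le_reg_r r); [lra|]. unfold Rdiv. rewrite Rmult_assoc, Rinv_l by lra. nra.
    - destruct (Z.eq_dec n 0) as [->|Hn].
      + simpl. eapply Rle_trans; [apply H0|]. rewrite Rmult_1_r.
        apply (Rmult_le_reg_r r); [lra|]. unfold Rdiv. rewrite Rmult_assoc, Rinv_l by lra. nra.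
      + assert (Hn' : (n = 1 \/ n = -1)%Z) by lia. replace (Z.abs_nat n) with 1%nat by lia.
        simpl. replace (A / r * (r * 1)) with A by (field; lra). auto. }
  assert (T := zsum_tail _ _ _ 1 G). simpl in T.
  eapply Rle_trans; [apply T|].
  replace (2 * (A / r) / (1 - r) * (r * (r * 1))) with (2 * A * r * / (1 - r)) by (field; lra).
  assert (/ (1 - r) <= 2).
  { rewrite <- (Rinv_inv 2). apply Rinv_le_contravar; lra. }
  assert (0 <= 2 * A * r) by (apply Rmult_le_pos; lra). nra.
Qed.

Lemma IZR_sq_ge (n : Z) : (2 <= Z.abs n)%Z -> INR (Z.abs_nat n) + 1 <= (IZR n) ^ 2.
Proof.
  intros H. rewrite INR_IZR_INZ, Zabs2Nat.id_abs.
  replace (IZR n ^ 2) with (IZR (n * n)) by (rewrite mult_IZR; ring). rewrite <- plus_IZR. apply IZR_le. nia.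
Qed.

Section Cusp.

Variable t : C.

Let y := snd t.

(** The factor e beyond |exp(i PI t)| pays for the n^2 in the derivative of theta_3, by n^2 <=
    exp(n^2 - 1). *)
Let r := exp (- (PI * y - 1)).

Hypothesis Hr : r <= 1 / 2.
Hypothesis Hy : 1 <= y.

Lemma r_pos : 0 < r.
Proof. apply exp_pos. Qed.

Lemma PIy : 1 <= PI * y - 1.
Proof. assert (P : 3 < PI) by (generalize PI2_3_2; unfold PI2; lra). nra. Qed.

Lemma exp_r (x : R) (k : nat) : INR k <= x -> exp (- (PI * y - 1) * x) <= r ^ k.
Proof.
  intros H. unfold r. rewrite <- exp_INR. apply exp_le_incr. generalize PIy; nra.
Qed.

Lemma th3_cusp : Cmod (th3 t - 1) <= 6 * r.
Proof.
  assert (Rp := r_pos). assert (Py := PIy). unfold th3. rewrite Theta0.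
  assert (B : forall n, (1 <= Z.abs n)%Z -> Cmod (tt 0 t n) <= r ^ Z.abs_nat n).
  { intros n Hn. rewrite Cmod_tt. fold y. rewrite Rplus_0_r. unfold r. rewrite <- exp_INR. apply exp_le_incr.
    assert (INR (Z.abs_nat n) <= IZR n ^ 2).
    { rewrite INR_IZR_INZ, Zabs2Nat.id_abs. replace (IZR n ^ 2) with (IZR (n * n)) by (rewrite mult_IZR; ring).
      apply IZR_le. nia. }
    assert (0 <= IZR n ^ 2) by apply pow2_ge_0. nra. }
  assert (E0 : tt 0 t 0 = 1%C).
  { unfold tt. replace (Ipi * t * RtoC ((IZR 0 + 0) ^ 2))%C with (RtoC 0); [apply cexp_0|].
    replace ((IZR 0 + 0) ^ 2) with 0 by (simpl; ring). ring. }
  assert (B1 := B 1%Z ltac:(lia)). assert (B2 := B (-1)%Z ltac:(lia)). simpl in B1, B2.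
  assert (Q := zsum_near_head (tt 0 t) r 1 ltac:(lra) ltac:(lra)).
  rewrite E0 in Q.
  replace (zsum (tt 0 t) - 1)%C with ((zsum (tt 0 t) - (1 + tt 0 t 1 + tt 0 t (-1))) + (tt 0 t 1 + tt 0 t (-1)))%C by ring.
  cmod_tri. assert (T := Cmod_triangle (tt 0 t 1) (tt 0 t (-1))).
  assert (Cmod (zsum (tt 0 t) - (1 + tt 0 t 1 + tt 0 t (-1))) <= 4 * 1 * r).
  { apply Q; try (rewrite ?Cmod_1; lra).
    - intros n [-> | ->]; lra.
    - intros n Hn. rewrite Rmult_1_l. apply B. lia. }
  lra.
Qed.

(* the derivative of th3 is [2 i pi q (1 + O(r))] with [q = e^{i pi t}] *)
Lemma th3'_cusp : Cmod (Theta 1 0 t / (2 * Ipi * cexp (Ipi * t)) - 1) <= 2 * r.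
Proof.
  assert (Rp := r_pos). assert (Py := PIy). assert (PP := PI_RGT_0).
  destruct (wt_geo 1 0 t ltac:(lra)) as [K [r0 G0]]; [unfold HH; fold y; lra|].
  set (c := (2 * Ipi * cexp (Ipi * t))%C).
  assert (I0 : Ipi <> 0%C) by (apply Cmod_gt_0; rewrite Cmod_Ipi; lra).
  assert (c0 : c <> 0%C).
  { unfold c. repeat apply Cmult_neq_0; auto using cexp_neq0. intros X; inversion X; lra. }
  assert (Cc : Cmod c = 2 * PI * exp (- (PI * y))).
  { unfold c. rewrite !Cmod_mult, Cmod_Ipi, Cmod_cexp, Cmod_R, Rabs_pos_eq by lra. unfold y. destruct t as [u v]; simpl.
    do 2 f_equal. ring. }
  set (g := fun n => (/ c * wt 1 0 t n)%C).
  assert (E : zsum g = (Theta 1 0 t / c)%C) by (unfold g; rewrite (zsum_scal K r0) by auto; unfold Theta; field; auto).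
  rewrite <- E.
  assert (N : forall n, Cmod (g n) = / 2 * (IZR n ^ 2 * exp (- (PI * y * (IZR n ^ 2 - 1))))).
  { intros n. unfold g. rewrite Cmod_mult, Cmod_inv, Cc, Cmod_wt by auto. fold y. rewrite Rplus_0_r.
    replace (- (PI * y * (IZR n ^ 2))) with (- (PI * y * (IZR n ^ 2 - 1)) + - (PI * y)) by ring.
    rewrite exp_plus. assert (Q := exp_pos (- (PI * y))). cbn [pow]. field. lra. }
  assert (G1 : forall n, (n = 1 \/ n = -1)%Z -> g n = RtoC (1/2)).
  { intros n Hn. unfold g, wt, tt, c.
    replace ((IZR n + 0) ^ 2) with 1 by (destruct Hn as [-> | ->]; simpl; ring).
    replace (Ipi * t * 1)%C with (Ipi * t)%C by ring. cbn [Cpow].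
    transitivity (/ 2)%C; [field; repeat split; auto using cexp_neq0|].
    cparts; field. }
  assert (G00 : g 0%Z = 0%C).
  { unfold g, wt. replace ((IZR 0 + 0) ^ 2) with 0 by (simpl; ring). cbn [Cpow]. ring. }
  assert (Q := zsum_near_head g r (1/2) ltac:(lra) ltac:(lra)).
  rewrite G00, (G1 1%Z), (G1 (-1)%Z) in Q by auto.
  replace (zsum g - 1)%C with (zsum g - (0 + RtoC (1/2) + RtoC (1/2)))%C by (cparts; field).
  replace (2 * r) with (4 * (1/2) * r) by field. apply Q.
  - intros n Hn. rewrite G1 by auto. rewrite Cmod_R, Rabs_pos_eq; lra.
  - rewrite Cmod_0. lra.
  - intros n Hn. rewrite N. unfold Rdiv. rewrite Rmult_1_l. apply Rmult_le_compat_l; [lra|].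
    assert (S := IZR_sq_ge n Hn). set (m := IZR n ^ 2) in *. assert (E2 := exp_ineq1_le (m - 1)).
    apply Rle_trans with (exp (m - 1) * exp (- (PI * y * (m - 1)))).
    + apply Rmult_le_compat_r; [left; apply exp_pos|lra].
    + rewrite <- exp_plus. replace (m - 1 + - (PI * y * (m - 1))) with (- (PI * y - 1) * (m - 1)) by ring.
      apply exp_r. lra.
Qed.

Lemma th2_cusp : Cmod (th2 t / (2 * cexp (Ipi * t * RtoC (1/4))) - 1) <= 3 * r.
Proof.
  assert (Rp := r_pos). assert (Py := PIy). assert (PP := PI_RGT_0).
  destruct (tt_geo (1/2) t ltac:(lra)) as [K [r0 G0]]; [unfold HH; fold y; lra|].
  set (c := (2 * cexp (Ipi * t * RtoC (1/4)))%C).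
  assert (c0 : c <> 0%C).
  { unfold c. apply Cmult_neq_0; auto using cexp_neq0. intros X; inversion X; lra. }
  assert (Cc : Cmod c = 2 * exp (- (PI * y * (1/4)))).
  { unfold c. rewrite !Cmod_mult, Cmod_cexp, Cmod_R, Rabs_pos_eq by lra. unfold y. destruct t as [u v]; simpl.
    do 2 f_equal. ring. }
  set (g := fun n => (/ c * tt (1/2) t n)%C).
  assert (E : zsum g = (th2 t / c)%C) by (unfold g; rewrite (zsum_scal K r0) by auto; unfold th2; rewrite Theta0; field; auto).
  rewrite <- E.
  assert (N : forall n, Cmod (g n) = / 2 * exp (- (PI * y * (IZR (n * (n + 1)))))).
  { intros n. unfold g. rewrite Cmod_mult, Cmod_inv, Cc, Cmod_tt by auto. fold y.
    replace (- (PI * y * (IZR n + 1/2) ^ 2)) with (- (PI * y * (IZR (n * (n + 1)))) + - (PI * y * (1/4)))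
      by (rewrite mult_IZR, plus_IZR; field).
    rewrite exp_plus. assert (Q := exp_pos (- (PI * y * (1/4)))). field. lra. }
  assert (G1 : forall n, (n = 0 \/ n = -1)%Z -> g n = RtoC (1/2)).
  { intros n Hn. unfold g, tt, c.
    replace ((IZR n + 1/2) ^ 2) with (1/4) by (destruct Hn as [-> | ->]; simpl; field).
    transitivity (/ 2)%C; [field; repeat split; auto using cexp_neq0|].
    cparts; field. }
  assert (Bd : forall n k, (Z.of_nat k <= n * (n + 1))%Z -> Cmod (g n) <= 1 / 2 * r ^ k).
  { intros n k L. rewrite N. unfold Rdiv. rewrite Rmult_1_l. apply Rmult_le_compat_l; [lra|].
    unfold r. rewrite <- exp_INR. apply exp_le_incr. apply IZR_le in L. rewrite <- INR_IZR_INZ in L.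
    generalize (pos_INR k); nra. }
  assert (Q := zsum_near_head g r (1/2) ltac:(lra) ltac:(lra)).
  rewrite (G1 0%Z), (G1 (-1)%Z) in Q by auto.
  replace (zsum g - 1)%C with ((zsum g - (RtoC (1/2) + g 1%Z + RtoC (1/2))) + g 1%Z)%C
    by (replace (RtoC 1) with (RtoC (1/2) + RtoC (1/2))%C by (cparts; field); ring).
  cmod_tri.
  assert (B1 := Bd 1%Z 1%nat ltac:(lia)). simpl in B1.
  assert (Cmod (zsum g - (RtoC (1/2) + g 1%Z + RtoC (1/2))) <= 4 * (1/2) * r); [apply Q|lra].
  - intros n [-> | ->]; [lra|]. rewrite G1 by auto. rewrite Cmod_R, Rabs_pos_eq; lra.
  - rewrite Cmod_R, Rabs_pos_eq; lra.
  - intros n Hn. apply Bd. nia.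
Qed.

End Cusp.

(** * Integrals of complex-valued functions and Goursat's lemma *)

Definition CI (f : R -> C) (a b : R) : C := (RInt (fun x => fst (f x)) a b, RInt (fun x => snd (f x)) a b).

Definition rcont (f : R -> C) (x : R) : Prop :=
  forall e, 0 < e -> exists d, 0 < d /\ forall y, Rabs (y - x) < d -> Cmod (f y - f x) < e.

Lemma continuous_eps (g : R -> R) (x : R) :
  (forall e, 0 < e -> exists d, 0 < d /\ forall y, Rabs (y - x) < d -> Rabs (g y - g x) < e) -> continuous g x.
Proof.
  intros H P [e He]. destruct (H e (cond_pos e)) as [d [D K]].
  exists (mkposreal d D). intros y Hy. apply He. apply (K y Hy).
Qed.

Lemma rcont_fst (f : R -> C) (x : R) : rcont f x -> continuous (fun x => fst (f x)) x.
Proof.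
  intros H. apply continuous_eps. intros e He. destruct (H e He) as [d [D K]]. exists d; split; auto.
  intros y Hy. eapply Rle_lt_trans; [apply (Cmod_fst (f y - f x)) | auto].
Qed.

Lemma rcont_snd (f : R -> C) (x : R) : rcont f x -> continuous (fun x => snd (f x)) x.
Proof.
  intros H. apply continuous_eps. intros e He. destruct (H e He) as [d [D K]]. exists d; split; auto.
  intros y Hy. eapply Rle_lt_trans; [apply (Cmod_snd (f y - f x)) | auto].
Qed.

Lemma rcont_const (c : C) (x : R) : rcont (fun _ => c) x.
Proof.
  intros e He. exists 1; split; [lra|]. intros. replace (c - c)%C with (RtoC 0) by ring. now rewrite Cmod_0.
Qed.

Lemma rcont_comp (u : R -> C) (f : C -> C) (l : C) (x : R) : rcont u x -> cder f (u x) l -> rcont (fun x => f (u x)) x.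
Proof.
  intros Hu Hf e He. destruct (cder_cont _ _ _ Hf e He) as [d [D K]]. destruct (Hu d D) as [d' [D' K']].
  exists d'; split; auto.
Qed.

Lemma rcont_plus (f g : R -> C) (x : R) : rcont f x -> rcont g x -> rcont (fun x => f x + g x)%C x.
Proof.
  intros Hf Hg e He. destruct (Hf (e / 2)) as [d1 [P1 K1]]; [lra|].
  destruct (Hg (e / 2)) as [d2 [P2 K2]]; [lra|].
  exists (Rmin d1 d2); split; [now apply Rmin_pos|]. intros y L.
  specialize (K1 y (Rlt_le_trans _ _ _ L (Rmin_l _ _))).
  specialize (K2 y (Rlt_le_trans _ _ _ L (Rmin_r _ _))).
  replace (f y + g y - (f x + g x))%C with ((f y - f x) + (g y - g x))%C by ring.
  eapply Rle_lt_trans; [apply Cmod_triangle|]. lra.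
Qed.

Lemma rcont_scal (c : C) (f : R -> C) (x : R) : rcont f x -> rcont (fun x => c * f x)%C x.
Proof. intros Hf. eapply (rcont_comp f (fun w => c * w)%C); auto. apply cder_scal, cder_id. Qed.

Lemma rcont_mult (f g : R -> C) (x : R) : rcont f x -> rcont g x -> rcont (fun x => f x * g x)%C x.
Proof.
  intros Hf Hg.
  assert (sq : forall h, rcont h x -> rcont (fun x => h x * h x)%C x).
  { intros h Hh. eapply (rcont_comp h (fun w => w * w)%C); auto. apply cder_sq. }
  assert (H : rcont (fun z => (RtoC (1/4) * ((f z + g z) * (f z + g z)) +
     RtoC (-1/4) * ((f z + -1 * g z) * (f z + -1 * g z)))%C) x).
  { apply rcont_plus; apply rcont_scal; apply (sq (fun z => _)); apply rcont_plus; auto. now apply rcont_scal. }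
  intros e He. destruct (H e He) as [d [D K]]. exists d; split; auto. intros y Hy. specialize (K y Hy).
  match type of K with Cmod ?a < _ => match goal with |- Cmod ?b < _ => replace b with a; auto end end.
  cparts; field.
Qed.

Lemma rcont_affine (p q : C) (x : R) : rcont (fun x => p + RtoC x * q)%C x.
Proof.
  intros e He. assert (P := Cmod_ge_0 q). exists (e / (Cmod q + 1)). split; [apply Rdiv_lt_0_compat; lra|].
  intros y Hy. replace (p + y * q - (p + x * q))%C with ((y - x) * q)%C by ring.
  rewrite Cmod_mult, <- RtoC_minus, Cmod_R.
  apply Rmult_lt_compat_r with (r := Cmod q + 1) in Hy; [|lra].
  replace (e / (Cmod q + 1) * (Cmod q + 1)) with e in Hy by (field; lra).
  generalize (Rabs_pos (y - x)); nra.
Qed.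

Definition rc (f : R -> C) (a b : R) : Prop := forall x, a <= x <= b -> rcont f x.

Lemma rc_int1 (f : R -> C) (a b : R) : a <= b -> rc f a b -> ex_RInt (fun x => fst (f x)) a b.
Proof.
  intros L H. apply (ex_RInt_continuous (V := R_CompleteNormedModule)). rewrite Rmin_left, Rmax_right by auto.
  intros z Hz. now apply rcont_fst, H.
Qed.

Lemma rc_int2 (f : R -> C) (a b : R) : a <= b -> rc f a b -> ex_RInt (fun x => snd (f x)) a b.
Proof.
  intros L H. apply (ex_RInt_continuous (V := R_CompleteNormedModule)). rewrite Rmin_left, Rmax_right by auto.
  intros z Hz. now apply rcont_snd, H.
Qed.

Lemma CI_plus (f g : R -> C) (a b : R) : a <= b -> rc f a b -> rc g a b ->
  CI (fun x => f x + g x)%C a b = (CI f a b + CI g a b)%C.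
Proof.
  intros L Hf Hg. unfold CI. apply Ceq; simpl.
  - apply (RInt_plus (fun x => fst (f x)) (fun x => fst (g x))); apply rc_int1; auto.
  - apply (RInt_plus (fun x => snd (f x)) (fun x => snd (g x))); apply rc_int2; auto.
Qed.

Lemma RInt_ext_R (f g : R -> R) (a b : R) : (forall x, f x = g x) -> RInt f a b = RInt g a b.
Proof. intros H. f_equal. now apply functional_extensionality. Qed.

Lemma RInt_lin (u v : R -> R) (p q a b : R) : ex_RInt u a b -> ex_RInt v a b ->
  RInt (fun x => p * u x + q * v x) a b = p * RInt u a b + q * RInt v a b.
Proof.
  intros Hu Hv.
  etransitivity; [apply (RInt_plus (V := R_CompleteNormedModule) (fun x => p * u x) (fun x => q * v x))|].
  - now apply (ex_RInt_scal (V := R_NormedModule)).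
  - now apply (ex_RInt_scal (V := R_NormedModule)).
  - apply (f_equal2 Rplus); apply (RInt_scal (V := R_CompleteNormedModule)); auto.
Qed.

Lemma CI_scal (c : C) (f : R -> C) (a b : R) : a <= b -> rc f a b ->
  CI (fun x => c * f x)%C a b = (c * CI f a b)%C.
Proof.
  intros L Hf. assert (H1 := rc_int1 _ _ _ L Hf). assert (H2 := rc_int2 _ _ _ L Hf).
  unfold CI. apply Ceq; cbn [fst snd Cmult].
  - rewrite (RInt_ext_R _ (fun x => fst c * fst (f x) + - snd c * snd (f x))) by (intros; ring).
    rewrite RInt_lin; auto. ring.
  - rewrite RInt_lin; auto.
Qed.

Lemma CI_ext (f g : R -> C) (a b : R) : a <= b -> (forall x, a <= x <= b -> f x = g x) -> CI f a b = CI g a b.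
Proof.
  intros L H. unfold CI. f_equal; apply RInt_ext; rewrite Rmin_left, Rmax_right by auto;
  intros x Hx; rewrite H; auto; lra.
Qed.

Lemma CI_Chasles (f : R -> C) (a m b : R) : a <= m -> m <= b -> rc f a b ->
  CI f a b = (CI f a m + CI f m b)%C.
Proof.
  intros L1 L2 H. unfold CI. cparts; symmetry.
  - apply (RInt_Chasles (fun x => fst (f x))); apply rc_int1; auto; intros x Hx; apply H; lra.
  - apply (RInt_Chasles (fun x => snd (f x))); apply rc_int2; auto; intros x Hx; apply H; lra.
Qed.

Lemma CI_point (f : R -> C) (a : R) : CI f a a = 0%C.
Proof.
  unfold CI. rewrite (RInt_point (V := R_CompleteNormedModule) a (fun x => fst (f x))),
   (RInt_point (V := R_CompleteNormedModule) a (fun x => snd (f x))). reflexivity.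
Qed.

Lemma CI_shift (f : R -> C) (a b p : R) : a <= b -> rc f (a + p) (b + p) ->
  CI (fun x => f (x + p)) a b = CI f (a + p) (b + p).
Proof.
  intros L H. unfold CI. f_equal.
  - transitivity (RInt (fun y => 1 * (fun x => fst (f x)) (1 * y + p)) a b).
    + apply RInt_ext_R. intros. rewrite !Rmult_1_l. reflexivity.
    + rewrite (RInt_comp_lin (V := R_CompleteNormedModule) (fun x => fst (f x))); rewrite !Rmult_1_l; [reflexivity|].
      apply rc_int1; auto; lra.
  - transitivity (RInt (fun y => 1 * (fun x => snd (f x)) (1 * y + p)) a b).
    + apply RInt_ext_R. intros. rewrite !Rmult_1_l. reflexivity.
    + rewrite (RInt_comp_lin (V := R_CompleteNormedModule) (fun x => snd (f x))); rewrite !Rmult_1_l; [reflexivity|].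
      apply rc_int2; auto; lra.
Qed.

Lemma CI_bound_fun (f : R -> C) (g : R -> R) (a b : R) : a <= b -> rc f a b -> ex_RInt g a b ->
  (forall x, a <= x <= b -> Cmod (f x) <= g x) -> Cmod (CI f a b) <= RInt g a b.
Proof.
  intros L H Hg B. set (I := CI f a b).
  (* |I|^2 is the real part of conj(I) I, taken under the integral sign, where it is bounded
     pointwise by |I| g. *)
  assert (E : Cmod I ^ 2 = RInt (fun x => fst I * fst (f x) + snd I * snd (f x)) a b).
  { rewrite (RInt_lin (fun x => fst (f x)) (fun x => snd (f x)) (fst I) (snd I) a b (rc_int1 f a b L H) (rc_int2 f a b L H)).
    rewrite Cmod_sq. unfold I, CI. cbn [fst snd]. ring. }
  assert (E2 : Cmod I ^ 2 <= Cmod I * RInt g a b).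
  { assert (Es : RInt (fun x => Cmod I * g x) a b = Cmod I * RInt g a b)
      by (apply (RInt_scal (V := R_CompleteNormedModule)); auto).
    rewrite E, <- Es.
    apply RInt_le; auto.
    - apply (ex_RInt_plus (V := R_NormedModule) (fun x => fst I * fst (f x)) (fun x => snd I * snd (f x)));
      apply (ex_RInt_scal (V := R_NormedModule)); [apply rc_int1 | apply rc_int2]; auto.
    - apply (ex_RInt_scal (V := R_NormedModule)); auto.
    - intros x Hx. eapply Rle_trans; [apply Rle_abs|].
      replace (fst I * fst (f x) + snd I * snd (f x)) with (fst (Cconj I * f x)%C) by (simpl; ring).
      eapply Rle_trans; [apply Cmod_fst|]. rewrite Cmod_mult, Cmod_conj.
      apply Rmult_le_compat_l; [apply Cmod_ge_0|]. apply B. lra. }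
  destruct (Rle_lt_or_eq_dec _ _ (Cmod_ge_0 I)) as [P|P].
  - apply (Rmult_le_reg_l (Cmod I)); auto. nra.
  - rewrite <- P. apply RInt_ge_0; auto. intros x Hx. eapply Rle_trans; [apply Cmod_ge_0 | apply B; lra].
Qed.

Lemma CI_bound (f : R -> C) (a b B : R) : a <= b -> rc f a b ->
  (forall x, a <= x <= b -> Cmod (f x) <= B) -> Cmod (CI f a b) <= B * (b - a).
Proof.
  intros L H HB.
  eapply Rle_trans; [apply (CI_bound_fun f (fun _ => B)); auto; apply ex_RInt_const|].
  rewrite (RInt_const (V := R_CompleteNormedModule)). right. unfold scal; simpl. unfold mult; simpl. ring.
Qed.

Lemma CI_primitive (F f : C -> C) (p q : C) (a b : R) : a <= b ->
  (forall x, a <= x <= b -> cder F (p + x * q) (f (p + x * q)%C)) ->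
  (forall x, a <= x <= b -> rcont (fun x => f (p + RtoC x * q)%C) x) ->
  (CI (fun x => f (p + RtoC x * q)%C) a b * q)%C = (F (p + b * q)%C - F (p + a * q)%C)%C.
Proof.
  intros L HF Hf.
  rewrite Cmult_comm, <- CI_scal by auto.
  assert (Hc : forall x, a <= x <= b -> rcont (fun x => q * f (p + RtoC x * q)%C)%C x)
    by (intros; now apply rcont_scal, Hf).
  unfold CI. apply Ceq; simpl.
  - change (RInt (fun x => fst (q * f (p + RtoC x * q)%C)%C) a b = fst (F (p + b * q)%C) - fst (F (p + a * q)%C)).
    apply (is_RInt_unique (V := R_CompleteNormedModule)).
    apply (is_RInt_derive (V := R_CompleteNormedModule) (fun x => fst (F (p + x * q)%C)));
      rewrite Rmin_left, Rmax_right by auto; intros x Hx.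
    + rewrite Cmult_comm. apply cder_ray. now apply HF.
    + now apply (rcont_fst (fun x => q * f (p + RtoC x * q)%C)%C), Hc.
  - change (RInt (fun x => snd (q * f (p + RtoC x * q)%C)%C) a b = snd (F (p + b * q)%C) - snd (F (p + a * q)%C)).
    apply (is_RInt_unique (V := R_CompleteNormedModule)).
    apply (is_RInt_derive (V := R_CompleteNormedModule) (fun x => snd (F (p + x * q)%C)));
      rewrite Rmin_left, Rmax_right by auto; intros x Hx.
    + rewrite Cmult_comm. apply cder_ray. now apply HF.
    + now apply (rcont_snd (fun x => q * f (p + RtoC x * q)%C)%C), Hc.
Qed.

Definition hor (f : C -> C) (y : R) (x : R) : C := f (x, y).

Definition ver (f : C -> C) (x : R) (y : R) : C := f (x, y).

Definition bdry (f : C -> C) (a b c d : R) : C :=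
  (CI (hor f c) a b + Ci * CI (ver f b) c d - CI (hor f d) a b - Ci * CI (ver f a) c d)%C.

Definition holo_on (D : C -> Prop) (f : C -> C) : Prop := forall z, D z -> exists l, cder f z l.

Lemma hor_rc (f : C -> C) (a b y : R) : (forall x, a <= x <= b -> exists l, cder f (x, y) l) -> rc (hor f y) a b.
Proof.
  intros H x Hx. destruct (H x Hx) as [l Hl].
  assert (E : forall u, (u, y) = ((0, y) + RtoC u * 1)%C) by (intros; cparts; ring).
  intros e He. destruct (cder_cont _ _ _ Hl e He) as [d [D K]]. exists d; split; auto. intros u Hu.
  apply K. rewrite (E u), (E x). replace ((0, y) + u * 1 - ((0, y) + x * 1))%C with (RtoC (u - x)) by (rewrite RtoC_minus; ring).
  now rewrite Cmod_R.
Qed.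

Lemma ver_rc (f : C -> C) (x c d : R) : (forall y, c <= y <= d -> exists l, cder f (x, y) l) -> rc (ver f x) c d.
Proof.
  intros H y Hy. destruct (H y Hy) as [l Hl].
  assert (E : forall u, (x, u) = (RtoC x + RtoC u * Ci)%C) by (intros; cparts; ring).
  intros e He. destruct (cder_cont _ _ _ Hl e He) as [d' [D K]]. exists d'; split; auto. intros u Hu.
  apply K. rewrite (E u), (E y). replace (x + u * Ci - (x + y * Ci))%C with (RtoC (u - y) * Ci)%C by (rewrite RtoC_minus; ring).
  now rewrite Cmod_mult, Cmod_R, Cmod_Ci, Rmult_1_r.
Qed.

Lemma bdry_split_x (f : C -> C) (a m b c d : R) : a <= m -> m <= b -> c <= d ->
  holo_on (closed_rect a b c d) f -> bdry f a b c d = (bdry f a m c d + bdry f m b c d)%C.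
Proof.
  intros L1 L2 L3 H. unfold bdry.
  rewrite (CI_Chasles (hor f c) a m b), (CI_Chasles (hor f d) a m b); auto; [ring| |];
  apply hor_rc; intros x Hx; apply H; split; simpl; lra.
Qed.

Lemma bdry_split_y (f : C -> C) (a b c m d : R) : c <= m -> m <= d -> a <= b ->
  holo_on (closed_rect a b c d) f -> bdry f a b c d = (bdry f a b c m + bdry f a b m d)%C.
Proof.
  intros L1 L2 L3 H. unfold bdry.
  rewrite (CI_Chasles (ver f a) c m d), (CI_Chasles (ver f b) c m d); auto; [ring| |];
  apply ver_rc; intros x Hx; apply H; split; simpl; lra.
Qed.

Lemma bdry_affine (p l : C) (a b c d : R) : a <= b -> c <= d -> bdry (fun w => p + l * w)%C a b c d = 0%C.
Proof.
  intros L1 L2. set (F := fun w => (p * w + RtoC (1/2) * l * (w * w))%C).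
  assert (HF : forall w, cder F w (p + l * w)%C).
  { intros w. unfold F. eapply cder_eq; [apply cder_plus; [apply cder_scal, cder_id | apply cder_scal, cder_sq]|].
    cparts; field. }
  assert (H1 : forall y, CI (hor (fun w => p + l * w)%C y) a b = (F (b, y) - F (a, y))%C).
  { intros y. assert (E : forall u, (u, y) = ((0, y) + RtoC u * 1)%C) by (intros; cparts; ring).
    rewrite (E a), (E b). rewrite <- (CI_primitive F (fun w => p + l * w)%C (0, y) 1 a b); auto.
    - rewrite Cmult_1_r. apply CI_ext; auto. intros x _. unfold hor. now rewrite E.
    - intros x _. apply (rcont_comp (fun x => ((0, y) + RtoC x * 1)%C) (fun w => p + l * w)%C (0 + l * 1)%C).
      + apply rcont_affine.
      + apply cder_plus; [apply cder_const | apply cder_scal, cder_id]. }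
  assert (H2 : forall x, (CI (ver (fun w => p + l * w)%C x) c d * Ci)%C = (F (x, d) - F (x, c))%C).
  { intros x. assert (E : forall u, (x, u) = (RtoC x + RtoC u * Ci)%C) by (intros; cparts; ring).
    rewrite (E c), (E d). rewrite <- (CI_primitive F (fun w => p + l * w)%C x Ci c d); auto.
    - f_equal. apply CI_ext; auto. intros y _. unfold ver. now rewrite E.
    - intros y _. apply (rcont_comp (fun y => (RtoC x + RtoC y * Ci)%C) (fun w => p + l * w)%C (0 + l * 1)%C).
      + apply rcont_affine.
      + apply cder_plus; [apply cder_const | apply cder_scal, cder_id]. }
  unfold bdry. rewrite !H1, !(Cmult_comm Ci), !H2. ring.
Qed.

Lemma bdry_plus (f g : C -> C) (a b c d : R) : a <= b -> c <= d ->
  holo_on (closed_rect a b c d) f -> holo_on (closed_rect a b c d) g ->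
  bdry (fun w => f w + g w)%C a b c d = (bdry f a b c d + bdry g a b c d)%C.
Proof.
  intros L1 L2 Hf Hg. unfold bdry.
  assert (A : forall y, c <= y <= d -> CI (hor (fun w => f w + g w)%C y) a b = (CI (hor f y) a b + CI (hor g y) a b)%C).
  { intros y Hy. apply (CI_plus (hor f y) (hor g y)); auto; apply hor_rc; intros x Hx; [apply Hf|apply Hg]; split; auto. }
  assert (B : forall x, a <= x <= b -> CI (ver (fun w => f w + g w)%C x) c d = (CI (ver f x) c d + CI (ver g x) c d)%C).
  { intros x Hx. apply (CI_plus (ver f x) (ver g x)); auto; apply ver_rc; intros y Hy; [apply Hf|apply Hg]; split; auto. }
  rewrite !A, !B by lra. ring.
Qed.

Lemma bdry_bound (f : C -> C) (a b c d B : R) : a <= b -> c <= d ->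
  holo_on (closed_rect a b c d) f -> (forall z, closed_rect a b c d z -> Cmod (f z) <= B) ->
  Cmod (bdry f a b c d) <= 2 * B * ((b - a) + (d - c)).
Proof.
  intros L1 L2 Hf HB. unfold bdry.
  assert (A : forall y, c <= y <= d -> Cmod (CI (hor f y) a b) <= B * (b - a)).
  { intros y Hy. apply CI_bound; auto. - apply hor_rc; intros x Hx; apply Hf; split; auto.
    - intros x Hx. apply HB. split; auto. }
  assert (V : forall x, a <= x <= b -> Cmod (CI (ver f x) c d) <= B * (d - c)).
  { intros x Hx. apply CI_bound; auto. - apply ver_rc; intros y Hy; apply Hf; split; auto.
    - intros y Hy. apply HB. split; auto. }
  assert (A1 := A c ltac:(lra)). assert (A2 := A d ltac:(lra)).
  assert (V1 := V a ltac:(lra)). assert (V2 := V b ltac:(lra)).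
  unfold Cminus. repeat (cmod_tri; rewrite ?Cmod_opp).
  assert (T := Cmod_triangle (CI (hor f c) a b + Ci * CI (ver f b) c d) (- CI (hor f d) a b)).
  assert (T2 := Cmod_triangle (CI (hor f c) a b) (Ci * CI (ver f b) c d)).
  rewrite ?Cmod_opp, ?Cmod_mult, ?Cmod_Ci in *. lra.
Qed.

(** For every e the boundary integral is at most e times the area: this bound is additive under
    subdivision, and it holds locally once the affine approximation, whose boundary integral
    vanishes, has been subtracted. *)
Lemma goursat (f : C -> C) (a b c d : R) : a <= b -> c <= d ->
  holo_on (closed_rect a b c d) f -> bdry f a b c d = 0%C.
Proof.
  intros Lx Ly Hf.
  destruct (Rle_lt_or_eq_dec _ _ Lx) as [Lx'|<-].
  2:{ unfold bdry. rewrite !CI_point. ring. }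
  destruct (Rle_lt_or_eq_dec _ _ Ly) as [Ly'|<-].
  2:{ unfold bdry. rewrite !CI_point. ring. }
  replace (bdry f a b c d) with (bdry f a b c d - 0)%C by ring.
  assert (K : forall e, 0 < e -> Cmod (bdry f a b c d) <= e * ((b - a) * (d - c))).
  { intros e He.
    apply (bisect2d (fun a b c d => Cmod (bdry f a b c d) <= e * ((b - a) * (d - c))) a b c d); auto.
    - intros a' m b' c' d' H1 H2 H3 H4 Q1 Q2. rewrite (bdry_split_x f a' m b' c' d'); try lra.
      + cmod_tri. eapply Rle_trans; [apply Rplus_le_compat; eassumption|]. lra.
      + intros z Hz. apply Hf. unfold closed_rect in *; lra.
    - intros a' b' c' m d' H1 H2 H3 H4 Q1 Q2. rewrite (bdry_split_y f a' b' c' m d'); try lra.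
      + cmod_tri. eapply Rle_trans; [apply Rplus_le_compat; eassumption|]. lra.
      + intros z Hz. apply Hf. unfold closed_rect in *; lra.
    - intros x y Hx Hy. destruct (Hf (x, y)) as [l Hl]; [split; simpl; lra|].
      set (W := b - a). set (H := d - c). assert (0 < W) by (unfold W; lra). assert (0 < H) by (unfold H; lra).
      (* For rectangles of the fixed proportions W : H the squared half-perimeter is (W + H)^2 / (W
         H) times the area; e1 compensates this factor and the 2 of [bdry_bound]. *)
      set (e1 := e * (W * H) / (2 * ((W + H) * (W + H)))).
      assert (He1 : 0 < e1) by (unfold e1; apply Rdiv_lt_0_compat; repeat apply Rmult_lt_0_compat; lra).
      destruct (Hl e1 He1) as [del [D K]]. exists (del / 2); split; [lra|].
      intros a' b' c' d' Ha Hb Hc Hd S1 S2 Asp. fold W H in Asp.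
      set (g := fun w => (f w + - (f (x, y) - l * (x, y) + l * w))%C).
      assert (Haff : holo_on (closed_rect a' b' c' d') (fun w => (f (x, y) - l * (x, y)) + l * w)%C).
      { intros z _. eexists. apply cder_plus; [apply cder_const | apply cder_scal, cder_id]. }
      assert (Hg : holo_on (closed_rect a' b' c' d') g).
      { intros z Hz. destruct (Hf z) as [l' Hl']; [unfold closed_rect in *; lra|].
        exists (l' + -1 * (0 + l * 1))%C. unfold g.
        apply (cder_ext_loc (fun w => f w + -1 * ((f (x, y) - l * (x, y)) + l * w))%C _ _ _ 1); [lra|intros; ring|].
        apply cder_plus; auto. apply cder_scal, cder_plus; [apply cder_const | apply cder_scal, cder_id]. }
      assert (E : bdry f a' b' c' d' = bdry g a' b' c' d').
      { transitivity (bdry (fun w => g w + ((f (x, y) - l * (x, y)) + l * w))%C a' b' c' d').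
        - f_equal. apply functional_extensionality. intros w. unfold g. ring.
        - rewrite bdry_plus by (auto; lra). rewrite bdry_affine by lra. ring. }
      rewrite E. set (s := (b' - a') + (d' - c')).
      eapply Rle_trans; [apply (bdry_bound g a' b' c' d' (e1 * s)); auto; try lra|].
      + intros z Hz. assert (N := near_rect a' b' c' d' x y z ltac:(lra) ltac:(lra) Hz). fold s in N.
        unfold g. replace (f z + - (f (x, y) - l * (x, y) + l * z))%C with (f z - f (x, y) - l * (z - (x, y)))%C by ring.
        eapply Rle_trans; [apply K; unfold s in *; lra|]. apply Rmult_le_compat_l; lra.
      + fold s. set (u := b' - a') in *. set (v := d' - c') in *.
        assert (U : u = W / H * v) by (apply (Rmult_eq_reg_r H); [|lra]; rewrite Asp; field; lra).
        right. unfold e1, s. rewrite U. field. lra. }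
  replace (bdry f a b c d - 0)%C with (bdry f a b c d) by ring.
  apply Cmod_eq_0. destruct (Rle_lt_or_eq_dec _ _ (Cmod_ge_0 (bdry f a b c d))) as [P|P]; auto. exfalso.
  set (A := (b - a) * (d - c)) in *. assert (0 < A) by (unfold A; apply Rmult_lt_0_compat; lra).
  specialize (K (Cmod (bdry f a b c d) / (2 * A)) ltac:(apply Rdiv_lt_0_compat; lra)).
  replace (Cmod (bdry f a b c d) / (2 * A) * A) with (Cmod (bdry f a b c d) / 2) in K by (field; lra). lra.
Qed.

(** * The inversion formula for theta constants *)

Definition lim0 (f : nat -> C) : Prop :=
  forall e, 0 < e -> exists N0, forall N, (N0 <= N)%nat -> Cmod (f N) < e.

Lemma lim0_plus (f g : nat -> C) : lim0 f -> lim0 g -> lim0 (fun n => f n + g n)%C.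
Proof.
  intros Hf Hg e He. destruct (Hf (e / 2)) as [n Hn]; [lra|]. destruct (Hg (e / 2)) as [m Hm]; [lra|].
  exists (max n m). intros N L. eapply Rle_lt_trans; [apply Cmod_triangle|].
  specialize (Hn N ltac:(lia)). specialize (Hm N ltac:(lia)). lra.
Qed.

Lemma lim0_mult (f g : nat -> C) (B : R) : lim0 f -> (forall n, Cmod (g n) <= B) -> lim0 (fun n => f n * g n)%C.
Proof.
  intros Hf Hg e He. assert (PB : 0 <= B) by (eapply Rle_trans; [apply Cmod_ge_0 | apply (Hg 0%nat)]).
  destruct (Hf (e / (B + 1))) as [n Hn]; [apply Rdiv_lt_0_compat; lra|].
  exists n. intros N L. rewrite Cmod_mult. specialize (Hn N L). specialize (Hg N).
  apply Rmult_lt_compat_r with (r := B + 1) in Hn; [|lra].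
  replace (e / (B + 1) * (B + 1)) with e in Hn by (field; lra).
  generalize (Cmod_ge_0 (f N)) (Cmod_ge_0 (g N)); nra.
Qed.

Lemma lim0_ext (f g : nat -> C) (N1 : nat) : (forall n, (N1 <= n)%nat -> f n = g n) -> lim0 f -> lim0 g.
Proof.
  intros E H e He. destruct (H e He) as [N0 HN]. exists (max N0 N1). intros N L. rewrite <- E by lia. apply HN. lia.
Qed.

Lemma lim0_scal (c : C) (f : nat -> C) : lim0 f -> lim0 (fun n => c * f n)%C.
Proof.
  intros H. apply (lim0_ext (fun n => f n * c)%C _ 0); [intros; ring|].
  apply (lim0_mult f (fun _ => c) (Cmod c)); auto. intros; lra.
Qed.

Definition ek (k : Z) (x : R) : C := cexp (RtoC (2 * IZR k * x) * Ipi).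

Lemma ek_add (k j : Z) (x : R) : (ek k x * ek j x)%C = ek (k + j) x.
Proof. unfold ek. rewrite <- cexp_add, plus_IZR. f_equal. rewrite !RtoC_mult, RtoC_plus. ring. Qed.

Lemma ek_0 (x : R) : ek 0 x = 1%C.
Proof. unfold ek. rewrite <- cexp_0. f_equal. rewrite !RtoC_mult. ring. Qed.

Lemma ek_int (k n : Z) : ek k (IZR n) = 1%C.
Proof.
  unfold ek. replace (RtoC (2 * IZR k * IZR n) * Ipi)%C with (RtoC (IZR (k * n)) * (2 * Ipi))%C.
  - apply cexp_IZR, cexp_2pi.
  - rewrite mult_IZR, !RtoC_mult. ring.
Qed.

Lemma ek_plus (k : Z) (x y : R) : ek k (x + y) = (ek k x * ek k y)%C.
Proof. unfold ek. rewrite <- cexp_add. f_equal. rewrite !RtoC_mult, RtoC_plus. ring. Qed.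

Lemma Cmod_ek (k : Z) (x : R) : Cmod (ek k x) = 1.
Proof.
  unfold ek. rewrite Cmod_cexp. replace (fst (RtoC (2 * IZR k * x) * Ipi)%C) with 0 by (simpl; ring). apply exp_0.
Qed.

Lemma ek_rc (k : Z) (x : R) : rcont (ek k) x.
Proof.
  unfold ek. eapply (rcont_comp (fun x => RtoC (2 * IZR k * x) * Ipi)%C cexp); [|apply cder_cexp].
  replace (fun x => RtoC (2 * IZR k * x) * Ipi)%C with (fun x => 0 + RtoC x * (2 * IZR k * Ipi))%C.
  - apply rcont_affine.
  - apply functional_extensionality. intros y. rewrite !RtoC_mult. ring.
Qed.

Lemma Ipi_neq0 : Ipi <> 0%C.
Proof. apply Cmod_gt_0. rewrite Cmod_Ipi. apply PI_RGT_0. Qed.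

Lemma ek_orth (k : Z) (p : R) : CI (ek k) p (p + 1) = if Z.eq_dec k 0 then 1%C else 0%C.
Proof.
  destruct (Z.eq_dec k 0) as [->|Hk].
  - rewrite (CI_ext _ (fun _ => 1%C)) by (try lra; intros; apply ek_0).
    unfold CI. rewrite !(RInt_const (V := R_CompleteNormedModule)). cparts; unfold scal; simpl; unfold mult; simpl; ring.
  - set (c := (2 * IZR k * Ipi)%C).
    assert (Hc : c <> 0%C).
    { unfold c. repeat apply Cmult_neq_0; try apply Ipi_neq0.
      - intros X; inversion X; lra.
      - intros X. apply RtoC_inj in X. apply Hk. now apply eq_IZR. }
    assert (E : forall x, ek k x = cexp (c * (0 + RtoC x * 1))).
    { intros x. unfold ek, c. f_equal. rewrite !RtoC_mult. ring. }
    assert (Q := CI_primitive (fun z => / c * cexp (c * z))%C (fun z => cexp (c * z)) 0 1 p (p + 1) ltac:(lra)).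
    rewrite (CI_ext _ (fun x => cexp (c * (0 + RtoC x * 1)))) by (try lra; intros; apply E).
    rewrite <- (Cmult_1_r (CI _ _ _)). rewrite Q.
    + rewrite <- !E. rewrite ek_plus. change 1 with (IZR 1) at 1. rewrite ek_int. ring.
    + intros x _. eapply cder_eq.
      * apply cder_scal. apply (cder_comp (fun z => c * z)%C cexp); [apply cder_scal, cder_id | apply cder_cexp].
      * field. auto.
    + intros x _. eapply (rcont_comp (fun x => 0 + RtoC x * 1)%C (fun z => cexp (c * z))).
      * apply rcont_affine.
      * apply (cder_comp (fun z => c * z)%C cexp); [apply cder_scal, cder_id | apply cder_cexp].
Qed.

Section Inversion.

Variables t u : C.
Hypothesis Ht : HH t.
Hypothesis Hu : HH u.
Hypothesis tu : (t * u)%C = (-1)%C.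

Let g (z : C) : C := cexp (Ipi * t * (z * z)).

Lemma g_cder (z : C) : cder g z (2 * Ipi * t * z * g z)%C.
Proof.
  unfold g. eapply cder_eq.
  - apply (cder_comp (fun z => Ipi * t * (z * z))%C cexp); [apply cder_scal, cder_sq | apply cder_cexp].
  - ring.
Qed.

Lemma g_rc (w : C) (x : R) : rcont (fun x => g (RtoC x + w)) x.
Proof.
  eapply (rcont_comp (fun x => RtoC x + w)%C g); [|apply g_cder].
  replace (fun x => RtoC x + w)%C with (fun x => w + RtoC x * 1)%C by (apply functional_extensionality; intros; ring).
  apply rcont_affine.
Qed.

Lemma tt_g (x : R) (n : Z) : tt x t n = g (RtoC (x + IZR n)).
Proof. unfold tt, g. do 2 f_equal. rewrite <- RtoC_mult. f_equal. ring. Qed.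

Lemma g_taylor (z d : C) (X : R) : Cmod z <= X -> Cmod d <= 1 ->
  Cmod (g (z + d) - g z - d * (2 * Ipi * t * z * g z)) <=
  (exp (PI * Cmod t * (X * X)) * (PI * Cmod t + (PI * Cmod t * (2 * X + 1)) ^ 2 * exp (PI * Cmod t * (2 * X + 1)))) * Cmod d ^ 2.
Proof.
  intros Hz Hd. assert (PP := PI_RGT_0). assert (T0 := Cmod_ge_0 t). assert (Z0 := Cmod_ge_0 z). assert (D0 := Cmod_ge_0 d).
  set (A := PI * Cmod t). assert (0 <= A) by (unfold A; nra).
  set (q := (Ipi * t * (2 * z * d + d * d))%C).
  assert (Eg : g (z + d) = (g z * cexp q)%C).
  { unfold g, q. rewrite <- cexp_add. f_equal. ring. }
  replace (g (z + d) - g z - d * (2 * Ipi * t * z * g z))%C with (g z * ((cexp q - 1 - q) + Ipi * t * (d * d)))%C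
    by (rewrite Eg; unfold q; ring).
  rewrite Cmod_mult.
  assert (Bg : Cmod (g z) <= exp (A * (X * X))).
  { unfold g. eapply Rle_trans; [apply Cmod_cexp_le|]. apply exp_le_incr. rewrite !Cmod_mult, Cmod_Ipi. fold A.
    apply Rmult_le_compat_l; auto. nra. }
  assert (Bq : Cmod q <= A * (2 * X + 1) * Cmod d).
  { unfold q. rewrite Cmod_mult, Cmod_mult, Cmod_Ipi. fold A. rewrite Rmult_assoc. apply Rmult_le_compat_l; auto.
    replace (2 * z * d + d * d)%C with ((2 * z + d) * d)%C by ring. rewrite Cmod_mult.
    apply Rmult_le_compat_r; auto. cmod_tri.
    rewrite Cmod_mult, Cmod_R, Rabs_pos_eq by lra. lra. }
  assert (Bq' : Cmod q <= A * (2 * X + 1)).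
  { eapply Rle_trans; [apply Bq|]. assert (0 <= A * (2 * X + 1)) by (apply Rmult_le_pos; lra). nra. }
  assert (Q := cexp_quad q). assert (Q0 := Cmod_ge_0 q).
  set (Bx := A * (2 * X + 1)) in *.
  assert (B3 : Cmod (cexp q - 1 - q) <= (Bx ^ 2 * exp Bx) * Cmod d ^ 2).
  { eapply Rle_trans; [apply Q|]. replace (Bx ^ 2 * exp Bx * Cmod d ^ 2) with ((Bx * Cmod d) ^ 2 * exp Bx) by ring.
    apply Rmult_le_compat; [apply pow2_ge_0 | left; apply exp_pos | apply pow_incr; lra | apply exp_le_incr; auto]. }
  rewrite Rmult_assoc. apply Rmult_le_compat; auto using Cmod_ge_0.
  cmod_tri. rewrite !Cmod_mult, Cmod_Ipi. fold A. simpl in *. lra.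
Qed.

(** Differentiation under the integral sign followed by integration of the derivative leaves
    boundary values only. This takes the place of moving the contour of a Gaussian integral. *)
Lemma shift_cder (a b : R) (w : C) : a <= b ->
  cder (fun w => CI (fun x => g (RtoC x + w)) a b) w (g (RtoC b + w) - g (RtoC a + w))%C.
Proof.
  intros L. set (X := Rabs a + Rabs b + Cmod w).
  set (M := exp (PI * Cmod t * (X * X)) * (PI * Cmod t + (PI * Cmod t * (2 * X + 1)) ^ 2 * exp (PI * Cmod t * (2 * X + 1)))).
  assert (M0 : 0 <= M).
  { unfold M. assert (0 <= PI * Cmod t) by (apply Rmult_le_pos; [generalize PI_RGT_0; lra | apply Cmod_ge_0]).
    apply Rmult_le_pos; [left; apply exp_pos|]. apply Rplus_le_le_0_compat; auto.
    apply Rmult_le_pos; [apply pow2_ge_0 | left; apply exp_pos]. }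
  intros e He. set (c := M * (b - a) + 1). assert (0 < c) by (unfold c; nra).
  exists (Rmin 1 (e / c)); split; [apply Rmin_pos; [lra | now apply Rdiv_lt_0_compat]|].
  intros v Hv. destruct (Rmin_Rgt_l _ _ _ Hv) as [V1 V2].
  set (d := (v - w)%C) in *. assert (D0 := Cmod_ge_0 d).
  set (g' := fun z => (2 * Ipi * t * z * g z)%C).
  assert (Hg' : forall z, exists l, cder g' z l).
  { intros z. eexists. unfold g'. apply (cder_mult (fun z => 2 * Ipi * t * z)%C g); [apply cder_scal, cder_id | apply g_cder]. }
  assert (Rg' : forall x, rcont (fun x => g' (RtoC x + w)%C) x).
  { intros x. destruct (Hg' (RtoC x + w)%C) as [l Hl]. apply (rcont_comp (fun x => RtoC x + w)%C g' l x); auto.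
    replace (fun x => RtoC x + w)%C with (fun x => w + RtoC x * 1)%C by (apply functional_extensionality; intros; ring).
    apply rcont_affine. }
  assert (E1 : CI (fun x => g' (RtoC x + w)%C) a b = (g (RtoC b + w) - g (RtoC a + w))%C).
  { assert (Ex : forall x : R, (RtoC x + w)%C = (w + RtoC x * 1)%C) by (intros; ring).
    rewrite (Ex a), (Ex b). rewrite <- (CI_primitive g g' w 1 a b); auto.
    - rewrite Cmult_1_r. apply CI_ext; auto. intros x _. now rewrite Ex.
    - intros x _. apply g_cder.
    - intros x _. specialize (Rg' x). intros e' He'. destruct (Rg' e' He') as [d' [P K]]. exists d'; split; auto.
      intros y Hy. rewrite <- !Ex. auto. }
  assert (E2 : (CI (fun x => g (RtoC x + v)) a b - CI (fun x => g (RtoC x + w)) a b - (g (RtoC b + w) - g (RtoC a + w)) * d)%C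
     = CI (fun x => g (RtoC x + v) + (-1 * g (RtoC x + w) + (- d) * g' (RtoC x + w)%C))%C a b).
  { rewrite (CI_plus (fun x => g (RtoC x + v)) (fun x => -1 * g (RtoC x + w) + (- d) * g' (RtoC x + w)%C)%C); auto.
    - rewrite (CI_plus (fun x => -1 * g (RtoC x + w))%C (fun x => (- d) * g' (RtoC x + w)%C)%C); auto.
      + rewrite !CI_scal; auto; try (intros x _; auto; apply g_rc). rewrite E1. ring.
      + intros x _; apply rcont_scal, g_rc.
      + intros x _; now apply rcont_scal.
    - intros x _. apply g_rc.
    - intros x _. apply rcont_plus; apply rcont_scal; [apply g_rc | auto]. }
  rewrite E2. apply Rle_trans with (M * Cmod d ^ 2 * (b - a)).
  - apply CI_bound; auto.
    + intros x _. apply rcont_plus; [apply g_rc|]. apply rcont_plus; apply rcont_scal; [apply g_rc | auto].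
    + intros x Hx. assert (Q := g_taylor (RtoC x + w) d X).
      replace (RtoC x + w + d)%C with (RtoC x + v)%C in Q by (unfold d; ring).
      replace (g (RtoC x + v) + (-1 * g (RtoC x + w) + - d * g' (RtoC x + w)%C))%C with
        (g (RtoC x + v) - g (RtoC x + w) - d * (2 * Ipi * t * (RtoC x + w) * g (RtoC x + w)))%C by (unfold g'; ring).
      apply Q; [|lra]. cmod_tri. rewrite Cmod_R. unfold X.
      apply Rplus_le_compat_r. assert (A1 := Rle_abs b). assert (A2 := Rle_abs (- a)). rewrite Rabs_Ropp in A2.
      generalize (Rabs_pos a) (Rabs_pos b); intros. apply Rabs_le. lra.
  - apply (Rmult_lt_compat_l c) in V2; auto. replace (c * (e / c)) with e in V2 by (field; lra).
    unfold c in V2. assert (0 <= M * (b - a)) by (apply Rmult_le_pos; lra). simpl. nra.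
Qed.

Lemma g_decay (V e : R) : 0 < e -> exists X, 0 <= X /\ forall (x : R) (w : C), Cmod w <= V -> X <= Rabs x ->
  Cmod (g (RtoC x + w)) < e.
Proof.
  intros He. set (V' := Rabs V). set (y := snd t). assert (Hy : 0 < y) by apply Ht.
  set (T := Cmod t). assert (T0 : 0 <= T) by apply Cmod_ge_0. assert (V0 : 0 <= V') by apply Rabs_pos.
  (* Beyond X the term y x^2 exceeds the cross terms by |x|, and exp(-|x|) is below e because |x| >=
     1/e. *)
  set (X := Rmax 1 (Rmax (/ e) ((2 * T * V' + T * V' * V' + 1) / y))).
  exists X. split; [apply Rle_trans with 1; [lra | apply Rmax_l]|].
  intros x w Hw Hx.
  assert (X1 : 1 <= Rabs x) by (eapply Rle_trans; [apply Rmax_l | apply Hx]).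
  assert (X2 : / e <= Rabs x) by (eapply Rle_trans; [eapply Rle_trans; [apply Rmax_l | apply Rmax_r] | apply Hx]).
  assert (X3 : (2 * T * V' + T * V' * V' + 1) / y <= Rabs x) by (eapply Rle_trans; [eapply Rle_trans; [apply Rmax_r | apply Rmax_r] | apply Hx]).
  assert (X4 : 2 * T * V' + T * V' * V' + 1 <= y * Rabs x).
  { apply (Rmult_le_compat_l y) in X3; [|lra]. replace (y * ((2 * T * V' + T * V' * V' + 1) / y)) with (2 * T * V' + T * V' * V' + 1) in X3 by (field; lra). auto. }
  assert (W : Cmod w <= V') by (eapply Rle_trans; [apply Hw | apply Rle_abs]).
  unfold g. rewrite Cmod_cexp.
  replace (Ipi * t * ((RtoC x + w) * (RtoC x + w)))%C with (Ipi * (t * RtoC (x * x) + (t * (2 * RtoC x * w + w * w))))%C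
    by (rewrite RtoC_mult; ring).
  set (R1 := (t * (2 * RtoC x * w + w * w))%C).
  assert (HR : Cmod R1 <= 2 * T * V' * Rabs x + T * V' * V').
  { unfold R1. rewrite Cmod_mult. fold T.
    apply Rle_trans with (T * (2 * Rabs x * V' + V' * V')).
    - apply Rmult_le_compat_l; auto. cmod_tri. rewrite !Cmod_mult, !Cmod_R.
      rewrite (Rabs_pos_eq 2) by lra. generalize (Rabs_pos x) (Cmod_ge_0 w); intros.
      apply Rplus_le_compat; [apply Rmult_le_compat_l; nra | apply Rmult_le_compat; auto].
    - lra. }
  assert (HS := Cmod_snd R1).
  replace (fst (Ipi * (t * RtoC (x * x) + R1))%C) with (- (PI * (y * (x * x) + snd R1)))
    by (unfold y; destruct t, R1; simpl; ring).
  assert (Sq : x * x = Rabs x * Rabs x) by (rewrite <- Rabs_mult, Rabs_pos_eq; nra).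
  assert (Low : Rabs x <= y * (x * x) + snd R1).
  { rewrite Sq. assert (- Cmod R1 <= snd R1) by (apply Rabs_le_between in HS; lra).
    assert (y * (Rabs x * Rabs x) >= (2 * T * V' + T * V' * V' + 1) * Rabs x) by nra.
    assert (T * V' * V' <= T * V' * V' * Rabs x) by (assert (0 <= T * V' * V') by (repeat apply Rmult_le_pos; auto); nra).
    nra. }
  assert (P : 3 < PI) by (generalize PI2_3_2; unfold PI2; lra).
  apply Rle_lt_trans with (exp (- Rabs x)); [apply exp_le_incr; nra|].
  rewrite exp_Ropp. assert (E := exp_ineq1_le (Rabs x)). rewrite <- (Rinv_inv e).
  assert (0 < / e) by now apply Rinv_0_lt_compat.
  apply Rinv_lt_contravar; [apply Rmult_lt_0_compat; auto; apply exp_pos | lra].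
Qed.

(** The derivative in w consists of Gaussian values near the distant ends of the interval, so a
    complex shift is irrelevant in the limit. The value of the Gaussian integral is never
    computed. *)
Lemma shift_lim (p : R) (w : C) :
  lim0 (fun N => CI (fun x => g (RtoC x + w)) (p - INR N) (p + INR N + 1) - CI (fun x => g (RtoC x + 0)) (p - INR N) (p + INR N + 1))%C.
Proof.
  intros e He. assert (W0 := Cmod_ge_0 w).
  destruct (g_decay (Cmod w) (e / 2 / (Cmod w + 1))) as [X [X0 HX]].
  { apply Rdiv_lt_0_compat; lra. }
  destruct (nfloor_ex (X + Rabs p + 1)) as [N0 HN0]; [generalize (Rabs_pos p); lra|].
  exists (S N0). intros N HN. apply le_INR in HN. rewrite S_INR in HN.
  assert (A1 := Rle_abs p). assert (A2 := Rle_abs (- p)). rewrite Rabs_Ropp in A2.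
  set (a := p - INR N). set (b := p + INR N + 1).
  assert (Xa : X <= Rabs a) by (rewrite <- Rabs_Ropp; eapply Rle_trans; [|apply Rle_abs]; unfold a; lra).
  assert (Xb : X <= Rabs b) by (eapply Rle_trans; [|apply Rle_abs]; unfold b; lra).
  assert (Q := cder_mean_value (fun w => CI (fun x => g (RtoC x + w)) a b) (fun w => (g (RtoC b + w) - g (RtoC a + w))%C)
     0 0 w (e / (Cmod w + 1))).
  replace (CI (fun x => g (RtoC x + w)) a b - CI (fun x => g (RtoC x + 0)) a b)%C with
   (CI (fun x => g (RtoC x + w)) a b - CI (fun x => g (RtoC x + 0)) a b - 0 * (w - 0))%C by ring.
  apply Rle_lt_trans with (e / (Cmod w + 1) * Cmod w).
  - assert (W : Cmod (w - 0) = Cmod w) by (f_equal; ring). rewrite W in Q. apply Q.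
    + intros s Hs. apply shift_cder. unfold a, b. generalize (pos_INR N); lra.
    + intros s Hs. replace (0 + RtoC s * (w - 0))%C with (RtoC s * w)%C by ring.
      assert (Hs' := Cmod_ray w s Hs).
      replace (g (RtoC b + RtoC s * w) - g (RtoC a + RtoC s * w) - 0)%C with (g (RtoC b + RtoC s * w) + - g (RtoC a + RtoC s * w))%C by ring.
      cmod_tri. rewrite Cmod_opp.
      assert (H1 := HX a (RtoC s * w)%C Hs' Xa). assert (H2 := HX b (RtoC s * w)%C Hs' Xb).
      replace (e / (Cmod w + 1)) with (e / 2 / (Cmod w + 1) + e / 2 / (Cmod w + 1)) by (field; lra). lra.
  - apply (Rmult_lt_reg_r (Cmod w + 1)); [lra|].
    replace (e / (Cmod w + 1) * Cmod w * (Cmod w + 1)) with (e * Cmod w) by (field; lra). nra.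
Qed.

Definition SN (N : nat) (x : R) : C := zpart (tt x t) N.

Definition TN (N : nat) (x : R) : C := zpart (fun k => tt 0 u k * ek k x)%C N.

(** The Fourier coefficient, over the period starting at [p], of a partial theta series in x. Later
    p = x0 - 1/2, so that the evaluation point x0 is the centre of the period. *)
Definition cN (p : R) (N : nat) (k : Z) : C := CI (fun x => SN N x * ek (- k) x)%C p (p + 1).

Lemma SN_rc (N : nat) (x : R) : rcont (SN N) x.
Proof.
  assert (K : forall n, rcont (fun x => tt x t n) x).
  { intros n. assert (H := g_rc (RtoC (IZR n)) x). intros e He. destruct (H e He) as [d [D Kd]]. exists d; split; auto.
    intros y Hy. rewrite !tt_g, !RtoC_plus. auto. }
  unfold SN. induction N; cbn [zpart]; auto.
  apply (rcont_plus (fun x => zpart (tt x t) N + tt x t (Z.of_nat (S N)))%C); auto.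
  apply (rcont_plus (fun x => zpart (tt x t) N)); auto.
Qed.

Lemma TN_rc (N : nat) (x : R) : rcont (TN N) x.
Proof.
  assert (K : forall n, rcont (fun x => tt 0 u n * ek n x)%C x) by (intros; apply rcont_scal, ek_rc).
  unfold TN. induction N; cbn [zpart]; auto.
  apply (rcont_plus (fun x => zpart (fun k => tt 0 u k * ek k x)%C N + tt 0 u (Z.of_nat (S N)) * ek (Z.of_nat (S N)) x)%C); auto.
  apply (rcont_plus (fun x => zpart (fun k => tt 0 u k * ek k x)%C N)); auto.
Qed.

(** The translates of [p, p + 1] by -N, ..., N tile one long interval, and [ek] has period 1. *)
Lemma cN_unfold (p : R) (N : nat) (k : Z) :
  cN p N k = CI (fun x => g (RtoC x + 0) * ek (- k) x)%C (p - INR N) (p + INR N + 1).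
Proof.
  assert (Rh : forall x, rcont (fun x => g (RtoC x + 0) * ek (- k) x)%C x).
  { intros x. apply (rcont_mult (fun x => g (RtoC x + 0))); [apply g_rc | apply ek_rc]. }
  assert (K : forall n q, q = p + IZR n -> CI (fun x => tt x t n * ek (- k) x)%C p (p + 1) =
     CI (fun x => g (RtoC x + 0) * ek (- k) x)%C q (q + 1)).
  { intros n q ->. replace (p + IZR n + 1) with (p + 1 + IZR n) by ring.
    rewrite <- (CI_shift (fun x => g (RtoC x + 0) * ek (- k) x)%C); [|lra|intros x _; apply Rh].
    apply CI_ext; [lra|]. intros x _. rewrite tt_g, ek_plus, ek_int.
    replace (RtoC (x + IZR n) + 0)%C with (RtoC (x + IZR n)) by ring. ring. }
  assert (Rt : forall n x, rcont (fun x => tt x t n * ek (- k) x)%C x).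
  { intros n x. apply (rcont_mult (fun x => tt x t n)); [|apply ek_rc].
    assert (H := g_rc (RtoC (IZR n)) x). intros e He. destruct (H e He) as [d [D Kd]]. exists d; split; auto.
    intros y Hy. rewrite !tt_g, !RtoC_plus. auto. }
  induction N.
  - unfold cN, SN. cbn [zpart]. rewrite (K 0%Z p) by (simpl; ring). simpl INR. f_equal; ring.
  - assert (Rs : forall x, rcont (fun x => SN N x * ek (- k) x)%C x).
    { intros x. apply (rcont_mult (SN N)); [apply SN_rc | apply ek_rc]. }
    transitivity (cN p N k + CI (fun x => tt x t (Z.of_nat (S N)) * ek (- k) x)%C p (p + 1) +
       CI (fun x => tt x t (- Z.of_nat (S N)) * ek (- k) x)%C p (p + 1))%C.
    + unfold cN. rewrite <- !CI_plus; try lra; try (intros x _; auto).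
      * apply CI_ext; [lra|]. intros x _. unfold SN. cbn [zpart]. ring.
      * apply (rcont_plus (fun x => SN N x * ek (- k) x)%C); auto.
    + rewrite IHN. rewrite (K _ (p + INR N + 1)), (K _ (p - INR (S N))).
      * rewrite S_INR. assert (0 <= INR N) by apply pos_INR.
        replace (p - (INR N + 1) + 1) with (p - INR N) by ring.
        replace (p + (INR N + 1) + 1) with (p + INR N + 1 + 1) by ring.
        rewrite (CI_Chasles _ (p - (INR N + 1)) (p - INR N) (p + INR N + 1 + 1)); try lra; [|intros x _; auto].
        rewrite (CI_Chasles _ (p - INR N) (p + INR N + 1) (p + INR N + 1 + 1)); try lra; [|intros x _; auto].
        ring.
      * rewrite INR_IZR_INZ, opp_IZR. ring.
      * rewrite <- INR_IZR_INZ, S_INR. ring.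
Qed.

Lemma cN_lim (p : R) (k : Z) : lim0 (fun N => cN p N k - tt 0 u k * cN p N 0)%C.
Proof.
  (* Completing the square: t (x + k u)^2 + k^2 u = t x^2 - 2 k x because t u = -1. The coefficient
     is a shifted Gaussian integral times exp(i PI u k^2). *)
  assert (E : forall k N, cN p N k = (tt 0 u k * CI (fun x => g (RtoC x + IZR k * u)) (p - INR N) (p + INR N + 1))%C).
  { intros k' N. assert (0 <= INR N) by apply pos_INR. rewrite cN_unfold, <- CI_scal; [|lra|intros x _; apply g_rc].
    apply CI_ext; [lra|]. intros x _. unfold g, ek, tt. rewrite <- !cexp_add. f_equal.
    rewrite opp_IZR. replace ((IZR k' + 0) ^ 2) with (IZR k' * IZR k') by ring.
    replace (2 * - IZR k' * x) with (- (2 * (IZR k' * x))) by ring.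
    rewrite !RtoC_opp, !RtoC_mult.
    transitivity (Ipi * t * (x * x) + 2 * Ipi * x * IZR k' * (t * u) + Ipi * u * (IZR k' * IZR k') * (1 + t * u))%C; [|ring].
    rewrite tu. ring. }
  apply (lim0_ext (fun N => tt 0 u k * (CI (fun x => g (RtoC x + IZR k * u)) (p - INR N) (p + INR N + 1) -
     CI (fun x => g (RtoC x + 0)) (p - INR N) (p + INR N + 1)))%C _ 0).
  - intros N _. rewrite !E. replace (IZR 0 * u)%C with (RtoC 0) by ring.
    replace (tt 0 u 0) with (RtoC 1); [ring|]. unfold tt. rewrite <- cexp_0. f_equal.
    replace ((IZR 0 + 0) ^ 2) with 0 by (simpl; ring). ring.
  - apply lim0_scal, shift_lim.
Qed.

Lemma cN_indep (p : R) : lim0 (fun N => cN (p + 1/2) N 0 - cN p N 0)%C.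
Proof.
  apply (lim0_ext (fun N => CI (fun x => g (RtoC x + RtoC (1/2))) (p - INR N) (p + INR N + 1) -
     CI (fun x => g (RtoC x + 0)) (p - INR N) (p + INR N + 1))%C _ 0); [|apply shift_lim].
  intros N _. assert (0 <= INR N) by apply pos_INR.
  assert (E0 : forall a b, a <= b -> CI (fun x => g (RtoC x + 0) * ek (- 0) x)%C a b = CI (fun x => g (RtoC x + 0)) a b).
  { intros a b L. apply CI_ext; auto. intros x _. simpl Z.opp. rewrite ek_0. ring. }
  rewrite !cN_unfold, !E0 by lra. f_equal.
  replace (p + 1/2 - INR N) with (p - INR N + 1/2) by ring.
  replace (p + 1/2 + INR N + 1) with (p + INR N + 1 + 1/2) by ring.
  rewrite <- (CI_shift (fun x => g (RtoC x + 0))); [|lra|intros x _; apply g_rc].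
  apply CI_ext; [lra|]. intros x _. f_equal. rewrite RtoC_plus. ring.
Qed.

End Inversion.

(** * Uniqueness of Fourier coefficients *)

Lemma third_le_sin (x : R) : 0 <= x <= PI / 2 -> x / 3 <= sin x.
Proof.
  intros Hx. assert (P4 := PI_4).
  destruct (pre_sin_bound x 0) as [H _]; [lra|lra|].
  unfold sin_approx, sum_f_R0, sin_term in H. simpl in H.
  eapply Rle_trans; [|apply H]. assert (x * x <= 4) by nra. nra.
Qed.

Lemma sq_le_sin_sq (x : R) : Rabs x <= 1 / 2 -> x ^ 2 <= sin (PI * x) ^ 2.
Proof.
  intros Hx. assert (P : 3 < PI) by (generalize PI2_3_2; unfold PI2; lra).
  assert (K : forall y, 0 <= y <= 1 / 2 -> y ^ 2 <= sin (PI * y) ^ 2).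
  { intros y Hy. assert (H := third_le_sin (PI * y) ltac:(nra)). apply pow_incr. nra. }
  destruct (Rle_or_lt 0 x).
  - rewrite Rabs_pos_eq in Hx by auto. apply K; lra.
  - rewrite Rabs_left in Hx by auto. specialize (K (- x) ltac:(lra)).
    replace (PI * - x) with (- (PI * x)) in K by ring. rewrite sin_neg in K.
    replace ((- x) ^ 2) with (x ^ 2) in K by ring. replace ((- sin (PI * x)) ^ 2) with (sin (PI * x) ^ 2) in K by ring. auto.
Qed.

(* The kernels [cos^(2M)(pi (x - x0))] concentrate at [x0]. *)
Definition ker (x0 : R) (M : nat) (x : R) : R := (cos (PI * (x - x0)) ^ 2) ^ M.

Lemma ker_cont (x0 : R) (M : nat) (x : R) : continuous (ker x0 M) x.
Proof.
  apply (ex_derive_continuous (V := R_NormedModule)). unfold ker. auto_derive. auto.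
Qed.

Lemma ker_int (x0 : R) (M : nat) (a b : R) : ex_RInt (ker x0 M) a b.
Proof. apply (ex_RInt_continuous (V := R_CompleteNormedModule)). intros; apply ker_cont. Qed.

Lemma ker_ge0 (x0 : R) (M : nat) (x : R) : 0 <= ker x0 M x.
Proof. apply pow_le, pow2_ge_0. Qed.

Lemma sin2_1 (x : R) : sin x ^ 2 + cos x ^ 2 = 1.
Proof. generalize (sin2_cos2 x); unfold Rsqr; simpl; lra. Qed.

Lemma ker_dec (x0 : R) (M : nat) (x : R) : ker x0 (S M) x <= ker x0 M x.
Proof.
  unfold ker. simpl pow at 1. assert (Q := sin2_1 (PI * (x - x0))). assert (P := pow2_ge_0 (sin (PI * (x - x0)))).
  assert (H := pow_le _ M (pow2_ge_0 (cos (PI * (x - x0))))). simpl in *. nra.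
Qed.

Lemma ker_pos (x0 : R) (M : nat) : 0 < RInt (ker x0 M) (x0 - 1/2) (x0 + 1/2).
Proof.
  apply RInt_gt_0; [lra| |intros; apply ker_cont].
  intros x Hx. apply pow_lt, pow_lt. apply cos_gt_0; assert (P := PI_RGT_0); nra.
Qed.

(** Integration of the derivative of sin cos^(2M+1) over a period. It shows that the second moment
    of the kernel is at most its mass divided by 2 M + 1. *)
Lemma ker_sin (x0 : R) (M : nat) :
  (2 * INR M + 1) * RInt (fun x => sin (PI * (x - x0)) ^ 2 * ker x0 M x) (x0 - 1/2) (x0 + 1/2) =
  RInt (ker x0 (S M)) (x0 - 1/2) (x0 + 1/2).
Proof.
  assert (PP := PI_RGT_0).
  set (G := fun x => sin (PI * (x - x0)) * cos (PI * (x - x0)) * ker x0 M x).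
  assert (I1 : forall a b, ex_RInt (fun x => sin (PI * (x - x0)) ^ 2 * ker x0 M x) a b).
  { intros a b. apply (ex_RInt_continuous (V := R_CompleteNormedModule)). intros z _.
    apply (ex_derive_continuous (V := R_NormedModule)). unfold ker. auto_derive. auto. }
  assert (D : forall x, is_derive G x (PI * (1 * ker x0 (S M) x + - (2 * INR M + 1) * (sin (PI * (x - x0)) ^ 2 * ker x0 M x)))).
  { intros x. unfold G, ker. auto_derive; auto. unfold Rminus.
    generalize (cos (PI * (x + - x0))) (sin (PI * (x + - x0))); intros c s.
    destruct M as [|M]; [simpl; ring|]. rewrite S_INR. simpl Nat.pred. simpl pow. ring. }
  assert (E : RInt (fun x => PI * (1 * ker x0 (S M) x + - (2 * INR M + 1) * (sin (PI * (x - x0)) ^ 2 * ker x0 M x))) (x0 - 1/2) (x0 + 1/2)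
     = G (x0 + 1/2) - G (x0 - 1/2)).
  { apply (is_RInt_unique (V := R_CompleteNormedModule)).
    apply (is_RInt_derive (V := R_CompleteNormedModule) G); intros x _; [apply D|].
    apply (ex_derive_continuous (V := R_NormedModule)). unfold ker. auto_derive. auto. }
  assert (Z : G (x0 + 1/2) - G (x0 - 1/2) = 0).
  { unfold G. replace (PI * (x0 + 1/2 - x0)) with (PI / 2) by field. replace (PI * (x0 - 1/2 - x0)) with (- (PI / 2)) by field.
    rewrite cos_neg, cos_PI2. ring. }
  rewrite Z in E.
  assert (E' : PI * (1 * RInt (ker x0 (S M)) (x0 - 1/2) (x0 + 1/2) + - (2 * INR M + 1) *
    RInt (fun x => sin (PI * (x - x0)) ^ 2 * ker x0 M x) (x0 - 1/2) (x0 + 1/2)) = 0).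
  { rewrite <- E. rewrite <- (RInt_lin (ker x0 (S M)) (fun x => sin (PI * (x - x0)) ^ 2 * ker x0 M x) 1 (- (2 * INR M + 1)) _ _
      (ker_int _ _ _ _) (I1 _ _)).
    symmetry. apply (RInt_scal (V := R_CompleteNormedModule)).
    apply (ex_RInt_plus (V := R_NormedModule) (fun x => 1 * ker x0 (S M) x) (fun x => - (2 * INR M + 1) * (sin (PI * (x - x0)) ^ 2 * ker x0 M x)));
    apply (ex_RInt_scal (V := R_NormedModule)); auto using ker_int. }
  apply Rmult_integral in E'. destruct E'; lra.
Qed.

Lemma ker_abs (x0 : R) (M : nat) (e : R) : 0 < e ->
  RInt (fun x => Rabs (x - x0) * ker x0 M x) (x0 - 1/2) (x0 + 1/2) <=
  (e + / (4 * e * (2 * INR M + 1))) * RInt (ker x0 M) (x0 - 1/2) (x0 + 1/2).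
Proof.
  intros He. assert (M0 := pos_INR M).
  assert (I1 : forall a b, ex_RInt (fun x => sin (PI * (x - x0)) ^ 2 * ker x0 M x) a b).
  { intros a b. apply (ex_RInt_continuous (V := R_CompleteNormedModule)). intros z _.
    apply (ex_derive_continuous (V := R_NormedModule)). unfold ker. auto_derive. auto. }
  set (A := RInt (ker x0 M) (x0 - 1/2) (x0 + 1/2) : R).
  set (D := RInt (fun x => sin (PI * (x - x0)) ^ 2 * ker x0 M x) (x0 - 1/2) (x0 + 1/2) : R).
  assert (HD : (2 * INR M + 1) * D <= A).
  { unfold D, A. rewrite ker_sin. apply RInt_le; try lra; try apply ker_int. intros; apply ker_dec. }
  (* With z = x - x0: |z| <= e + z^2 / (4 e), and z^2 <= sin^2(PI z) on the interval. *)
  apply Rle_trans with (RInt (fun x => e * ker x0 M x + / (4 * e) * (sin (PI * (x - x0)) ^ 2 * ker x0 M x)) (x0 - 1/2) (x0 + 1/2)).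
  - apply RInt_le; try lra.
    + apply (ex_RInt_continuous (V := R_CompleteNormedModule)). intros z _.
      apply (continuous_mult (fun x => Rabs (x - x0)) (ker x0 M)); [|apply ker_cont].
      apply (continuous_comp (fun x => x - x0) Rabs).
      * apply (ex_derive_continuous (V := R_NormedModule)). auto_derive. auto.
      * apply continuous_Rabs.
    + apply (ex_RInt_plus (V := R_NormedModule) (fun x => e * ker x0 M x) (fun x => / (4 * e) * (sin (PI * (x - x0)) ^ 2 * ker x0 M x)));
      apply (ex_RInt_scal (V := R_NormedModule)); auto using ker_int.
    + intros x Hx. rewrite <- Rmult_assoc, <- Rmult_plus_distr_r. apply Rmult_le_compat_r; [apply ker_ge0|].
      assert (Q := sq_le_sin_sq (x - x0) ltac:(apply Rabs_le; lra)). rewrite <- (pow2_abs (x - x0)) in Q.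
      set (z := Rabs (x - x0)) in *. set (s := sin (PI * (x - x0)) ^ 2) in *.
      apply (Rmult_le_reg_l (4 * e)); [lra|].
      replace (4 * e * (e + / (4 * e) * s)) with (4 * e * e + s) by (field; lra).
      assert (0 <= (z - 2 * e) ^ 2) by apply pow2_ge_0. simpl in *. nra.
  - rewrite (RInt_lin (ker x0 M) (fun x => sin (PI * (x - x0)) ^ 2 * ker x0 M x) e (/ (4 * e)) _ _ (ker_int _ _ _ _) (I1 _ _)).
    fold A D. rewrite Rmult_plus_distr_r. apply Rplus_le_compat_l.
    replace (/ (4 * e * (2 * INR M + 1))) with (/ (4 * e) * / (2 * INR M + 1)) by (field; lra).
    rewrite Rmult_assoc. apply Rmult_le_compat_l; [left; apply Rinv_0_lt_compat; lra|].
    apply (Rmult_le_reg_l (2 * INR M + 1)); [lra|]. rewrite <- Rmult_assoc, Rinv_r by lra. lra.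
Qed.

Section Fourier.

Variable V : nat -> R -> C.
Variables x0 L : R.
Hypothesis HL : 0 <= L.
Hypothesis V_rc : forall N x, rcont (V N) x.
Hypothesis V_lip : forall N x, Rabs (x - x0) <= 1 / 2 -> Cmod (V N x - V N x0) <= L * Rabs (x - x0).
Hypothesis V_coef : forall j, lim0 (fun N => CI (fun x => V N x * ek j x)%C (x0 - 1/2) (x0 + 1/2)).

(** The factor cos^2 is a trigonometric polynomial of frequencies -1, 0, 1. By induction,
    multiplication by the kernel keeps coefficients that tend to 0 tending to 0. *)
Lemma ker_S (M : nat) (x : R) : RtoC (ker x0 (S M) x) =
  (RtoC (ker x0 M x) * (RtoC (1/2) + RtoC (1/4) * (ek 1 (- x0) * ek 1 x) + RtoC (1/4) * (ek (-1) (- x0) * ek (-1) x)))%C.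
Proof.
  rewrite <- !ek_plus. unfold ker. simpl pow at 1. rewrite !RtoC_mult, Cmult_comm. f_equal.
  set (s := PI * (x - x0)).
  assert (E1 : ek 1 (- x0 + x) = (cos (2 * s), sin (2 * s))).
  { unfold ek, cexp. simpl. replace (2 * 1 * (- x0 + x) * 0 - 0 * PI) with 0 by ring. rewrite exp_0.
    replace (2 * 1 * (- x0 + x) * PI + 0 * 0) with (2 * s) by (unfold s; ring). now rewrite !Rmult_1_l. }
  assert (E2 : ek (-1) (- x0 + x) = (cos (2 * s), - sin (2 * s))).
  { unfold ek, cexp. simpl. replace (2 * -1 * (- x0 + x) * 0 - 0 * PI) with 0 by ring. rewrite exp_0.
    replace (2 * -1 * (- x0 + x) * PI + 0 * 0) with (- (2 * s)) by (unfold s; ring). rewrite cos_neg, sin_neg. now rewrite !Rmult_1_l. }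
  rewrite E1, E2, cos_2a_cos. cparts; field.
Qed.

Lemma ker_rc (M : nat) (x : R) : rcont (fun x => RtoC (ker x0 M x)) x.
Proof.
  induction M.
  - unfold ker. simpl. apply rcont_const.
  - replace (fun x => RtoC (ker x0 (S M) x)) with (fun x => RtoC (ker x0 M x) * (RtoC (1/2) + RtoC (1/4) * (ek 1 (- x0) * ek 1 x) + RtoC (1/4) * (ek (-1) (- x0) * ek (-1) x)))%C
      by (apply functional_extensionality; intros; now rewrite ker_S).
    apply (rcont_mult (fun x => RtoC (ker x0 M x))); auto.
    apply (rcont_plus (fun x => RtoC (1/2) + RtoC (1/4) * (ek 1 (- x0) * ek 1 x))%C).
    + apply rcont_plus; [apply rcont_const | apply rcont_scal, rcont_scal, ek_rc].
    + apply rcont_scal, rcont_scal, ek_rc.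
Qed.

Lemma V_ker (M : nat) (j : Z) :
  lim0 (fun N => CI (fun x => V N x * RtoC (ker x0 M x) * ek j x)%C (x0 - 1/2) (x0 + 1/2)).
Proof.
  revert j. induction M; intros j.
  - apply (lim0_ext (fun N => CI (fun x => V N x * ek j x)%C (x0 - 1/2) (x0 + 1/2)) _ 0); auto.
    intros N _. apply CI_ext; [lra|]. intros x _. unfold ker. simpl. ring.
  - set (I j N := CI (fun x => V N x * RtoC (ker x0 M x) * ek j x)%C (x0 - 1/2) (x0 + 1/2)).
    apply (lim0_ext (fun N => RtoC (1/2) * I j N + (RtoC (1/4) * ek 1 (- x0) * I (1 + j)%Z N + RtoC (1/4) * ek (-1) (- x0) * I (-1 + j)%Z N))%C _ 0).
    + intros N _. unfold I.
      assert (Rc : forall j x, rcont (fun x => V N x * RtoC (ker x0 M x) * ek j x)%C x).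
      { intros j' x. apply (rcont_mult (fun x => V N x * RtoC (ker x0 M x))%C); [|apply ek_rc].
        apply (rcont_mult (V N)); [apply V_rc | apply ker_rc]. }
      rewrite <- !CI_scal by (first [lra | intros x _; apply Rc]).
      rewrite <- CI_plus; [|lra|intros x _; now apply rcont_scal|intros x _; now apply rcont_scal].
      rewrite <- CI_plus; [|lra|intros x _; now apply rcont_scal|intros x _; apply rcont_plus; now apply rcont_scal].
      apply CI_ext; [lra|]. intros x _. rewrite ker_S, <- !ek_add. ring.
    + apply lim0_plus; [|apply lim0_plus]; apply lim0_scal, IHM.
Qed.

(** The kernel average of [V N] tends to 0 together with the coefficients, and the uniform Lipschitz
    bound keeps it close to the value at x0 times the mass. M is fixed before N, so no uniformity in
    the frequency is required. *)
Lemma fourier_uniqueness : lim0 (fun N => V N x0).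
Proof.
  intros e He. set (eps := e / (4 * (L + 1))). assert (Heps : 0 < eps) by (unfold eps; apply Rdiv_lt_0_compat; lra).
  assert (Eeps : e / 2 = (L + 1) * (eps + eps)) by (unfold eps; field; lra). clearbody eps.
  (* M + 1 > 1 / (4 eps^2) makes the second term in [ker_abs] at most eps. *)
  destruct (nfloor_ex (/ (4 * eps * eps))) as [M [_ HM]].
  { left. apply Rinv_0_lt_compat. repeat apply Rmult_lt_0_compat; lra. }
  set (A := RInt (ker x0 M) (x0 - 1/2) (x0 + 1/2) : R). assert (HA : 0 < A) by apply ker_pos.
  destruct (V_ker M 0 (e / 4 * A)) as [N0 HN]; [apply Rmult_lt_0_compat; lra|].
  exists N0. intros N LN. specialize (HN N LN).
  assert (E : CI (fun x => V N x * RtoC (ker x0 M x) * ek 0 x)%C (x0 - 1/2) (x0 + 1/2) =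
    (V N x0 * A + CI (fun x => (V N x - V N x0) * RtoC (ker x0 M x))%C (x0 - 1/2) (x0 + 1/2))%C).
  { assert (EA : RtoC A = CI (fun x => RtoC (ker x0 M x)) (x0 - 1/2) (x0 + 1/2)).
    { unfold CI, A. cparts; auto. rewrite (RInt_const (V := R_CompleteNormedModule)). unfold scal; simpl. unfold mult; simpl. ring. }
    rewrite EA. rewrite <- CI_scal; [|lra|intros x _; apply ker_rc]. rewrite <- CI_plus; [|lra| |].
    - apply CI_ext; [lra|]. intros x _. rewrite ek_0. ring.
    - intros x _. apply rcont_scal, ker_rc.
    - intros x _. apply (rcont_mult (fun x => V N x - V N x0)%C); [|apply ker_rc].
      apply rcont_plus; [apply V_rc | apply rcont_const]. }
  rewrite E in HN.
  assert (B : Cmod (CI (fun x => (V N x - V N x0) * RtoC (ker x0 M x))%C (x0 - 1/2) (x0 + 1/2)) <= e / 2 * A).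
  { assert (I2 : ex_RInt (fun x => Rabs (x - x0) * ker x0 M x) (x0 - 1/2) (x0 + 1/2)).
    { apply (ex_RInt_continuous (V := R_CompleteNormedModule)). intros z _.
      apply (continuous_mult (fun x => Rabs (x - x0)) (ker x0 M)); [|apply ker_cont].
      apply (continuous_comp (fun x => x - x0) Rabs).
      - apply (ex_derive_continuous (V := R_NormedModule)). auto_derive. auto.
      - apply continuous_Rabs. }
    eapply Rle_trans; [apply (CI_bound_fun _ (fun x => L * (Rabs (x - x0) * ker x0 M x)))|].
    - lra.
    - intros x _. apply (rcont_mult (fun x => V N x - V N x0)%C); [|apply ker_rc].
      apply rcont_plus; [apply V_rc | apply rcont_const].
    - now apply (ex_RInt_scal (V := R_NormedModule)).
    - intros x Hx. rewrite Cmod_mult, Cmod_R, (Rabs_pos_eq (ker x0 M x)) by apply ker_ge0.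
      rewrite <- Rmult_assoc. apply Rmult_le_compat_r; [apply ker_ge0|]. apply V_lip. apply Rabs_le; lra.
    - assert (Es : RInt (fun x => L * (Rabs (x - x0) * ker x0 M x)) (x0 - 1/2) (x0 + 1/2) =
         L * RInt (fun x => Rabs (x - x0) * ker x0 M x) (x0 - 1/2) (x0 + 1/2))
        by (apply (RInt_scal (V := R_CompleteNormedModule)); auto).
      rewrite Es. assert (Q := ker_abs x0 M eps Heps). fold A in Q.
      assert (Q2 : / (4 * eps * (2 * INR M + 1)) <= eps).
      { apply (Rmult_le_reg_l (4 * eps * (2 * INR M + 1))).
        - assert (M0 := pos_INR M). repeat apply Rmult_lt_0_compat; lra.
        - assert (M0 := pos_INR M). rewrite Rinv_r by (apply Rgt_not_eq; repeat apply Rmult_lt_0_compat; lra).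
          apply (Rmult_lt_compat_l (4 * eps * eps)) in HM; [|repeat apply Rmult_lt_0_compat; lra].
          rewrite Rinv_r in HM by (apply Rgt_not_eq; repeat apply Rmult_lt_0_compat; lra). nra. }
      apply Rle_trans with (L * ((eps + eps) * A)).
      + apply Rmult_le_compat_l; auto. eapply Rle_trans; [apply Q|]. apply Rmult_le_compat_r; lra.
      + rewrite <- Rmult_assoc. apply Rmult_le_compat_r; [lra|].
        rewrite Eeps. nra. }
  assert (T := Cmod_rev (V N x0 * A) (- CI (fun x => (V N x - V N x0) * RtoC (ker x0 M x))%C (x0 - 1/2) (x0 + 1/2))).
  replace (V N x0 * A - - CI (fun x => (V N x - V N x0) * RtoC (ker x0 M x))%C (x0 - 1/2) (x0 + 1/2))%C with
    (V N x0 * A + CI (fun x => (V N x - V N x0) * RtoC (ker x0 M x))%C (x0 - 1/2) (x0 + 1/2))%C in T by ring.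
  rewrite Cmod_opp, Cmod_mult, Cmod_R, Rabs_pos_eq in T by lra.
  apply (Rmult_lt_reg_r A); auto. nra.
Qed.

End Fourier.

Lemma tt_lip (t : C) : HH t -> exists K r, 0 < K /\ 0 < r < 1 /\
  forall x x0 n, -1 <= x <= 1 -> -1 <= x0 <= 1 -> Cmod (tt x t n - tt x0 t n) <= K * r ^ Z.abs_nat n * Rabs (x - x0).
Proof.
  intros Ht. unfold HH in Ht. set (y := snd t) in *. assert (PP := PI_RGT_0).
  destruct (gauss_geo_unif 0 (y / 2)) as [K [r [HK [Hr H]]]]; [lra|].
  assert (T0 := Cmod_ge_0 t).
  (* Q bounds (1 + m) exp(- PI y m / 2): half of the decay pays for the factor n + x that
     differentiation in x produces. *)
  set (Q := 1 + 2 / (PI * y)). assert (HQ : 1 <= Q).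
  { unfold Q. assert (0 < 2 / (PI * y)) by (apply Rdiv_lt_0_compat; [lra | apply Rmult_lt_0_compat; lra]). lra. }
  exists (2 * PI * (Cmod t + 1) * Q * K), r.
  assert (0 < 2 * PI * (Cmod t + 1) * Q) by (apply Rmult_lt_0_compat; [apply Rmult_lt_0_compat|]; lra).
  split; [now apply Rmult_lt_0_compat|]. split; auto.
  intros x x0 n Hx Hx0.
  set (g := fun z => cexp (Ipi * t * (z * z))).
  assert (Gc : forall z, cder g z (2 * Ipi * t * z * g z)%C) by (intros; apply g_cder).
  assert (E : forall x, tt x t n = g (RtoC (IZR n + x))).
  { intros x'. unfold tt, g. do 2 f_equal. rewrite <- RtoC_mult. f_equal. ring. }
  assert (M := cder_mean_value g (fun z => 2 * Ipi * t * z * g z)%C 0 (RtoC (IZR n + x0)) (RtoC (IZR n + x))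
    (2 * PI * (Cmod t + 1) * Q * K * r ^ Z.abs_nat n)).
  rewrite <- !E in M.
  replace (RtoC (IZR n + x) - RtoC (IZR n + x0))%C with (RtoC (x - x0)) in M by (rewrite !RtoC_minus, !RtoC_plus; ring).
  replace (tt x t n - tt x0 t n)%C with (tt x t n - tt x0 t n - 0 * RtoC (x - x0))%C by ring.
  rewrite Cmod_R in M. apply M; clear M.
  - intros s Hs. apply Gc.
  - intros s Hs. set (x' := x0 + s * (x - x0)).
    replace (RtoC (IZR n + x0) + RtoC s * RtoC (x - x0))%C with (RtoC (IZR n + x'))
      by (unfold x'; rewrite <- RtoC_mult, <- RtoC_plus; f_equal; ring).
    assert (Hx' : -1 <= x' <= 1) by (unfold x'; nra).
    rewrite <- E.
    replace (2 * Ipi * t * RtoC (IZR n + x') * tt x' t n - 0)%C with (2 * Ipi * t * RtoC (IZR n + x') * tt x' t n)%C by ring.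
    rewrite !Cmod_mult, Cmod_Ipi, !Cmod_R, (Rabs_pos_eq 2), Cmod_tt by lra. fold y.
    specialize (H x' n (y / 2) Hx' ltac:(lra)). simpl pow in H at 1. rewrite Rmult_1_l in H.
    set (m := (IZR n + x') ^ 2) in *. assert (m0 : 0 <= m) by apply pow2_ge_0.
    assert (Ab : Rabs (IZR n + x') <= 1 + m).
    { unfold m. rewrite <- (pow2_abs (IZR n + x')). assert (0 <= (Rabs (IZR n + x') - 1) ^ 2) by apply pow2_ge_0. simpl in *. nra. }
    assert (Eb : 1 + m <= Q * exp (PI * (y / 2) * m)).
    { assert (E1 := exp_ineq1_le (PI * (y / 2) * m)).
      assert (m <= 2 / (PI * y) * exp (PI * (y / 2) * m)).
      { assert (Py : 0 < PI * y) by (apply Rmult_lt_0_compat; lra). apply (Rmult_le_reg_l (PI * y / 2)); [lra|].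
        replace (PI * y / 2 * (2 / (PI * y) * exp (PI * (y / 2) * m))) with (exp (PI * (y / 2) * m)) by (field; lra). lra. }
      assert (0 <= PI * (y / 2) * m) by (apply Rmult_le_pos; [apply Rmult_le_pos|]; lra).
      unfold Q. lra. }
    replace (- (PI * y * m)) with (- (PI * (y / 2) * m) + - (PI * (y / 2) * m)) by field.
    rewrite exp_plus.
    assert (P1 := exp_pos (- (PI * (y / 2) * m))).
    assert (Ei : exp (PI * (y / 2) * m) * exp (- (PI * (y / 2) * m)) = 1) by (rewrite <- exp_plus, Rplus_opp_r; apply exp_0).
    set (X := exp (- (PI * (y / 2) * m))) in *.
    assert (F1 : Rabs (IZR n + x') * X <= Q).
    { apply Rle_trans with (Q * exp (PI * (y / 2) * m) * X); [apply Rmult_le_compat_r; lra|]. rewrite Rmult_assoc, Ei. lra. }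
    replace (2 * PI * Cmod t * Rabs (IZR n + x') * (X * X)) with (2 * PI * Cmod t * (Rabs (IZR n + x') * X) * X) by ring.
    replace (2 * PI * (Cmod t + 1) * Q * K * r ^ Z.abs_nat n) with (2 * PI * (Cmod t + 1) * Q * (K * r ^ Z.abs_nat n)) by ring.
    assert (0 <= Rabs (IZR n + x') * X) by (apply Rmult_le_pos; [apply Rabs_pos | lra]).
    apply Rmult_le_compat; try lra.
    + apply Rmult_le_pos; auto. apply Rmult_le_pos; lra.
    + apply Rmult_le_compat; auto. apply Rmult_le_pos; lra. apply Rmult_le_compat_l; lra.
Qed.

Lemma ek_lip (k : Z) (x x0 : R) : Cmod (ek k x - ek k x0) <= 2 * PI * Rabs (IZR k) * Rabs (x - x0).
Proof.
  set (c := (2 * IZR k * Ipi)%C).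
  assert (E : forall x, ek k x = cexp (c * RtoC x)).
  { intros x'. unfold ek, c. f_equal. rewrite !RtoC_mult. ring. }
  assert (M := cder_mean_value (fun z => cexp (c * z)) (fun z => cexp (c * z) * c)%C 0 (RtoC x0) (RtoC x) (2 * PI * Rabs (IZR k))).
  cbv beta in M. rewrite <- !E, <- RtoC_minus, Cmod_R in M.
  replace (ek k x - ek k x0)%C with (ek k x - ek k x0 - 0 * RtoC (x - x0))%C by ring.
  apply M; clear M.
  - intros s Hs. eapply cder_eq; [apply (cder_comp (fun z => c * z)%C cexp); [apply cder_scal, cder_id | apply cder_cexp]|]. ring.
  - intros s Hs. rewrite <- RtoC_mult, <- RtoC_plus, <- E.
    replace (ek k (x0 + s * (x - x0)) * c - 0)%C with (ek k (x0 + s * (x - x0)) * c)%C by ring.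
    rewrite Cmod_mult, Cmod_ek. unfold c. rewrite !Cmod_mult, Cmod_Ipi, !Cmod_R, (Rabs_pos_eq 2) by lra. right. ring.
Qed.

Section InversionEnd.

Variables t u : C.
Hypothesis Ht : HH t.
Hypothesis Hu : HH u.
Hypothesis tu : (t * u)%C = (-1)%C.

Lemma SN_lip : exists L, 0 <= L /\ forall N x x0, -1 <= x <= 1 -> -1 <= x0 <= 1 ->
  Cmod (SN t N x - SN t N x0) <= L * Rabs (x - x0).
Proof.
  destruct (tt_lip t Ht) as [K [r [HK [Hr H]]]]. exists (K * (2 / (1 - r))). split.
  { apply Rmult_le_pos; [lra|]. left. apply Rdiv_lt_0_compat; lra. }
  intros N x x0 Hx Hx0. unfold SN.
  replace (zpart (tt x t) N - zpart (tt x0 t) N)%C with (zpart (fun n => tt x t n + -1 * tt x0 t n)%C N)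
    by (rewrite zpart_plus, zpart_scal; ring).
  eapply Rle_trans; [apply (zpart_bound (K * Rabs (x - x0)) r)|right; ring].
  split; auto. intros n. replace (tt x t n + -1 * tt x0 t n)%C with (tt x t n - tt x0 t n)%C by ring.
  eapply Rle_trans; [apply H; auto|]. right; ring.
Qed.

Lemma TN_lip : exists L, 0 <= L /\ forall N x x0, Cmod (TN u N x - TN u N x0) <= L * Rabs (x - x0).
Proof.
  destruct (gauss_geo 1 0 (snd u) ltac:(lra) Hu) as [K [r [HK [Hr H]]]]. exists (2 * K * (2 / (1 - r))). split.
  { apply Rmult_le_pos; [lra|]. left. apply Rdiv_lt_0_compat; lra. }
  intros N x x0. unfold TN.
  replace (zpart (fun k => tt 0 u k * ek k x)%C N - zpart (fun k => tt 0 u k * ek k x0)%C N)%C with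
    (zpart (fun k => tt 0 u k * ek k x + -1 * (tt 0 u k * ek k x0))%C N)
    by (rewrite zpart_plus, zpart_scal; ring).
  eapply Rle_trans; [apply (zpart_bound (2 * K * Rabs (x - x0)) r)|right; ring].
  split; auto. intros n. replace (tt 0 u n * ek n x + -1 * (tt 0 u n * ek n x0))%C with (tt 0 u n * (ek n x - ek n x0))%C by ring.
  rewrite Cmod_mult, Cmod_tt. specialize (H n (snd u) ltac:(lra)). rewrite Rplus_0_r in *.
  apply Rle_trans with (2 * (PI * IZR n ^ 2 * exp (- (PI * snd u * IZR n ^ 2))) * Rabs (x - x0)).
  - assert (P1 := exp_pos (- (PI * snd u * IZR n ^ 2))). set (X := exp (- (PI * snd u * IZR n ^ 2))) in *.
    apply Rle_trans with (X * (2 * PI * Rabs (IZR n) * Rabs (x - x0))).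
    + apply Rmult_le_compat_l; [lra | apply ek_lip].
    + replace (X * (2 * PI * Rabs (IZR n) * Rabs (x - x0))) with ((2 * PI * X * Rabs (x - x0)) * Rabs (IZR n)) by ring.
      replace (2 * (PI * IZR n ^ 2 * X) * Rabs (x - x0)) with ((2 * PI * X * Rabs (x - x0)) * IZR n ^ 2) by ring.
      apply Rmult_le_compat_l.
      * generalize PI_RGT_0 (Rabs_pos (x - x0)); intros. apply Rmult_le_pos; auto. apply Rmult_le_pos; lra.
      * rewrite <- abs_IZR. replace (IZR n ^ 2) with (IZR (n * n)) by (rewrite mult_IZR; ring). apply IZR_le. nia.
  - simpl pow in H at 1. rewrite Rmult_1_r in H.
    replace (2 * K * Rabs (x - x0) * r ^ Z.abs_nat n) with (2 * (K * r ^ Z.abs_nat n) * Rabs (x - x0)) by ring.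
    apply Rmult_le_compat_r; [apply Rabs_pos|]. lra.
Qed.

Lemma SN_bound : exists B, forall N x, -1 <= x <= 1 -> Cmod (SN t N x) <= B.
Proof.
  destruct (gauss_geo_unif 0 (snd t) Ht) as [K [r [HK [Hr H]]]]. exists (K * (2 / (1 - r))).
  intros N x Hx. apply zpart_bound. split; auto. intros n. rewrite Cmod_tt.
  specialize (H x n (snd t) Hx ltac:(lra)). simpl pow in H at 1. lra.
Qed.

Lemma TN_bound : exists B, forall N x, Cmod (TN u N x) <= B.
Proof.
  destruct (gauss_geo 0 0 (snd u) ltac:(lra) Hu) as [K [r [HK [Hr H]]]]. exists (K * (2 / (1 - r))).
  intros N x. apply zpart_bound. split; auto. intros n. rewrite Cmod_mult, Cmod_ek, Cmod_tt.
  specialize (H n (snd u) ltac:(lra)). simpl pow in H at 1. lra.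
Qed.

Lemma TN_coef (p : R) (N : nat) (j : Z) : (Z.abs_nat j <= N)%nat ->
  CI (fun x => TN u N x * ek (- j) x)%C p (p + 1) = tt 0 u j.
Proof.
  intros Hj.
  set (dl := fun k => (tt 0 u k * (if Z.eq_dec (k + - j) 0 then 1 else 0))%C).
  assert (T : forall k, CI (fun x => tt 0 u k * ek k x * ek (- j) x)%C p (p + 1) = dl k).
  { intros k. unfold dl. rewrite <- (ek_orth (k + - j) p), <- CI_scal; [|lra|intros x _; apply ek_rc].
    apply CI_ext; [lra|]. intros x _. rewrite <- ek_add. ring. }
  assert (Rt : forall k x, rcont (fun x => tt 0 u k * ek k x * ek (- j) x)%C x).
  { intros k x. apply (rcont_mult (fun x => tt 0 u k * ek k x)%C); [apply rcont_scal, ek_rc | apply ek_rc]. }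
  assert (Z : forall N, CI (fun x => TN u N x * ek (- j) x)%C p (p + 1) = zpart dl N).
  { clear Hj N. induction N; [apply T|].
    assert (Rs : forall x, rcont (fun x => TN u N x * ek (- j) x)%C x)
      by (intros x; apply (rcont_mult (TN u N)); [apply TN_rc | apply ek_rc]).
    cbn [zpart]. rewrite <- IHN, <- !T.
    rewrite <- CI_plus; [|lra|intros x _; auto|intros x _; auto].
    rewrite <- CI_plus; [|lra|intros x _; now apply (rcont_plus (fun x => TN u N x * ek (- j) x)%C)|intros x _; auto].
    apply CI_ext; [lra|]. intros x _. unfold TN. cbn [zpart]. ring. }
  rewrite Z. clear Z T Rt.
  assert (D0 : forall k, k <> j -> dl k = 0%C) by (intros k Hk; unfold dl; destruct (Z.eq_dec (k + - j) 0); [lia | ring]).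
  assert (D1 : dl j = tt 0 u j) by (unfold dl; destruct (Z.eq_dec (j + - j) 0); [ring | lia]).
  assert (Zr : forall n, (n < Z.abs_nat j)%nat -> zpart dl n = 0%C).
  { induction n; intros Hn; cbn [zpart]; [apply D0; lia|]. rewrite IHn, !D0 by lia. ring. }
  destruct (Nat.le_exists_sub (Z.abs_nat j) N Hj) as [m [-> _]]. clear Hj.
  induction m.
  - simpl Nat.add. destruct (Z.abs_nat j) as [|n] eqn:En.
    + simpl. rewrite <- D1. f_equal. lia.
    + cbn [zpart]. rewrite Zr by lia.
      destruct (Z_le_gt_dec 0 j).
      * replace (Z.of_nat (S n)) with j by lia. rewrite D1, D0 by lia. ring.
      * replace (- Z.of_nat (S n))%Z with j by lia. rewrite D1, D0 by lia. ring.
  - cbn [Nat.add zpart]. rewrite IHm, !D0 by lia. ring.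
Qed.

(** By Poisson summation the theta series in x is a constant times the Fourier series with
    coefficients exp(i PI u k^2). [cN] at frequency 0 plays this constant, and the difference [VN]
    is shown to tend to 0. *)
Definition VN (p : R) (N : nat) (x : R) : C := (SN t N x - cN t p N 0 * TN u N x)%C.

Lemma cN_bound : exists B, forall p N, -1 <= p <= 0 -> Cmod (cN t p N 0) <= B.
Proof.
  destruct SN_bound as [B HB]. exists B. intros p N Hp. unfold cN.
  replace B with (B * (p + 1 - p)) by ring. apply CI_bound; [lra| |].
  - intros x _. apply (rcont_mult (SN t N)); [now apply SN_rc | apply ek_rc].
  - intros x Hx. rewrite Cmod_mult, Cmod_ek, Rmult_1_r. apply HB. lra.
Qed.

Lemma VN_lim (x0 : R) : 0 <= x0 <= 1 / 2 -> lim0 (fun N => VN (x0 - 1/2) N x0).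
Proof.
  intros Hx0. destruct SN_lip as [L1 [HL1 S1]]. destruct TN_lip as [L2 [HL2 S2]]. destruct cN_bound as [B HB].
  assert (B0 : 0 <= B) by (eapply Rle_trans; [apply Cmod_ge_0 | apply (HB 0 0%nat); lra]).
  apply (fourier_uniqueness (VN (x0 - 1/2)) x0 (L1 + B * L2)).
  - apply Rplus_le_le_0_compat; auto. apply Rmult_le_pos; auto.
  - intros N x. unfold VN. unfold Cminus.
    assert (Rs := SN_rc t N x).
    apply (rcont_plus (SN t N)); auto.
    assert (H : rcont (fun x => (- cN t (x0 - 1/2) N 0) * TN u N x)%C x) by (apply rcont_scal, TN_rc).
    intros e He. destruct (H e He) as [d [D K]]. exists d; split; auto. intros y Hy. specialize (K y Hy).
    match type of K with Cmod ?a < _ => match goal with |- Cmod ?b < _ => replace b with a; auto; ring end end.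
  - intros N x Hx. apply Rabs_le_between in Hx. unfold VN.
    replace (SN t N x - cN t (x0 - 1/2) N 0 * TN u N x - (SN t N x0 - cN t (x0 - 1/2) N 0 * TN u N x0))%C with
      ((SN t N x - SN t N x0) + - (cN t (x0 - 1/2) N 0 * (TN u N x - TN u N x0)))%C by ring.
    cmod_tri. rewrite Cmod_opp, Cmod_mult, Rmult_plus_distr_r.
    apply Rplus_le_compat; [apply S1; lra|]. rewrite Rmult_assoc.
    apply Rmult_le_compat; auto using Cmod_ge_0. apply HB; lra.
  - intros j. apply (lim0_ext (fun N => cN t (x0 - 1/2) N (- j) - tt 0 u (- j) * cN t (x0 - 1/2) N 0)%C _ (Z.abs_nat j)).
    + intros N HN. replace (x0 + 1/2) with (x0 - 1/2 + 1) by field.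
      rewrite <- (TN_coef (x0 - 1/2) N (- j)) by lia. unfold cN at 1. rewrite Z.opp_involutive.
      transitivity (CI (fun x => SN t N x * ek j x)%C (x0 - 1/2) (x0 - 1/2 + 1) +
        (- cN t (x0 - 1/2) N 0) * CI (fun x => TN u N x * ek j x)%C (x0 - 1/2) (x0 - 1/2 + 1))%C; [ring|].
      rewrite <- CI_scal; [|lra|intros x _; apply (rcont_mult (TN u N)); [apply TN_rc | apply ek_rc]].
      rewrite <- CI_plus; [|lra|intros x _; apply (rcont_mult (SN t N)); [now apply SN_rc | apply ek_rc]|
        intros x _; apply rcont_scal, (rcont_mult (TN u N)); [apply TN_rc | apply ek_rc]].
      apply CI_ext; [lra|]. intros x _. unfold VN. ring.
    + now apply (cN_lim t u).
Qed.

(** Comparison of x = 0 and x = 1/2 eliminates the constant of proportionality, so the factor sqrt(t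
    / i) of the classical formula does not appear. The two evaluation points use different periods,
    which [cN_indep] reconciles. *)
Lemma theta_inversion : (th2 t * th3 u)%C = (th3 t * th4 u)%C.
Proof.
  destruct TN_bound as [B HB]. destruct (tt_geo (1/2) t ltac:(lra) Ht) as [K1 [r1 G1]].
  destruct (tt_geo 0 t ltac:(lra) Ht) as [K2 [r2 G2]]. destruct (tt_geo 0 u ltac:(lra) Hu) as [K3 [r3 G3]].
  destruct (tt_geo 0 (u + 1) ltac:(lra) (HH_plus1 u Hu)) as [K4 [r4 G4]].
  destruct SN_bound as [B' HB'].
  assert (T0 : forall N, TN u N 0 = zpart (tt 0 u) N).
  { intros N. apply zpart_ext. intros n. replace 0 with (IZR 0) at 2 by reflexivity. rewrite ek_int. ring. }
  assert (T1 : forall N, TN u N (1/2) = zpart (tt 0 (u + 1)) N).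
  { intros N. apply zpart_ext. intros n. unfold ek, tt. rewrite <- cexp_add.
    destruct (Z.Even_or_Odd n) as [[k Hk]|[k Hk]].
    - replace (Ipi * (u + 1) * RtoC ((IZR n + 0) ^ 2))%C with
        (Ipi * u * RtoC ((IZR n + 0) ^ 2) + RtoC (2 * IZR n * (1/2)) * Ipi + RtoC (IZR (k * (n - 1))) * (2 * Ipi))%C.
      + rewrite (cexp_add _ (RtoC (IZR (k * (n - 1))) * (2 * Ipi))), cexp_IZR by apply cexp_2pi. ring.
      + rewrite Hk. rewrite !mult_IZR, minus_IZR, mult_IZR. cparts; field.
    - replace (Ipi * (u + 1) * RtoC ((IZR n + 0) ^ 2))%C with
        (Ipi * u * RtoC ((IZR n + 0) ^ 2) + RtoC (2 * IZR n * (1/2)) * Ipi + RtoC (IZR (k * n)) * (2 * Ipi))%C.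
      + rewrite (cexp_add _ (RtoC (IZR (k * n)) * (2 * Ipi))), cexp_IZR by apply cexp_2pi. ring.
      + rewrite Hk. rewrite !mult_IZR, !plus_IZR, !mult_IZR. cparts; field. }
  assert (L0 := VN_lim 0 ltac:(lra)). assert (L1 := VN_lim (1/2) ltac:(lra)).
  assert (LI := cN_indep t u Ht tu (0 - 1/2)).
  replace (0 - 1/2 + 1/2) with (1/2 - 1/2) in LI by ring.
  assert (Lim : lim0 (fun N => SN t N (1/2) * TN u N 0 - SN t N 0 * TN u N (1/2))%C).
  { apply (lim0_ext (fun N => (VN (1/2 - 1/2) N (1/2) + (cN t (1/2 - 1/2) N 0 - cN t (0 - 1/2) N 0) * TN u N (1/2)) * TN u N 0
       + (-1) * (VN (0 - 1/2) N 0 * TN u N (1/2)))%C _ 0).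
    - intros N _. unfold VN. ring.
    - apply lim0_plus.
      + apply (lim0_mult _ _ B); [|intros; apply HB]. apply lim0_plus; auto.
        apply (lim0_mult _ _ B); auto.
      + apply lim0_scal. apply (lim0_mult _ _ B); auto. }
  apply Cmod_sub_small. intros e He.
  assert (Z1 := zgeo_sum _ _ _ G1). assert (Z2 := zgeo_sum _ _ _ G2).
  assert (Z3 := zgeo_sum _ _ _ G3). assert (Z4 := zgeo_sum _ _ _ G4).
  unfold th4, th2, th3. rewrite !Theta0.
  assert (Lim2 : lim0 (fun N => (SN t N (1/2) - zsum (tt (1/2) t)) * TN u N 0 + (TN u N 0 - zsum (tt 0 u)) * zsum (tt (1/2) t)
     + (-1) * ((SN t N 0 - zsum (tt 0 t)) * TN u N (1/2) + (TN u N (1/2) - zsum (tt 0 (u + 1))) * zsum (tt 0 t)))%C).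
  { apply lim0_plus; [|apply lim0_scal]; apply lim0_plus.
    - apply (lim0_mult _ _ B); auto.
    - apply (lim0_mult _ (fun _ => zsum (tt (1/2) t)) (Cmod (zsum (tt (1/2) t)))); [|intros; lra].
      intros e' He'. destruct (Z3 e' He') as [n Hn]. exists n. intros N HN. rewrite T0. auto.
    - apply (lim0_mult _ _ B); auto.
    - apply (lim0_mult _ (fun _ => zsum (tt 0 t)) (Cmod (zsum (tt 0 t)))); [|intros; lra].
      intros e' He'. destruct (Z4 e' He') as [n Hn]. exists n. intros N HN. rewrite T1. auto. }
  assert (Lim3 := lim0_plus _ _ Lim (lim0_scal (-1) _ Lim2)).
  destruct (Lim3 e He) as [N0 HN]. specialize (HN N0 (le_n _)).
  match type of HN with Cmod ?a < _ => match goal with |- Cmod ?b < _ => replace b with a; auto; ring end end.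
Qed.

End InversionEnd.

(** * The modular function lambda *)

Lemma HH_neq0 (t : C) : HH t -> t <> 0%C.
Proof. unfold HH. intros H E. rewrite E in H. simpl in H. lra. Qed.

Lemma HH_inv (t : C) : HH t -> HH (- / t).
Proof.
  intros H. assert (N := HH_neq0 t H). unfold HH in *. destruct t as [x y]; simpl in *.
  replace (- (- y / (x * (x * 1) + y * (y * 1)))) with (y / (x * x + y * y)) by (field; nra).
  apply Rdiv_lt_0_compat; nra.
Qed.

Lemma dbl_large (t : C) (Y : R) : HH t -> exists n, Y <= snd (RtoC (2 ^ n) * t)%C.
Proof.
  intros H. unfold HH in H. destruct (Pow_x_infinity 2 ltac:(rewrite Rabs_pos_eq; lra) (Rabs Y / snd t)) as [N HN].
  exists N. specialize (HN N (le_n _)). rewrite Rabs_pos_eq in HN by (apply pow_le; lra).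
  replace (snd (RtoC (2 ^ N) * t)%C) with (2 ^ N * snd t) by (destruct t; simpl; ring).
  apply (Rmult_ge_compat_r (snd t)) in HN; [|lra].
  replace (Rabs Y / snd t * snd t) with (Rabs Y) in HN by (field; lra). generalize (Rle_abs Y); lra.
Qed.

Lemma HH_pow (t : C) (n : nat) : HH t -> HH (RtoC (2 ^ n) * t).
Proof.
  intros H. unfold HH in *. replace (snd (RtoC (2 ^ n) * t)%C) with (2 ^ n * snd t) by (destruct t; simpl; ring).
  apply Rmult_lt_0_compat; auto. apply pow_lt; lra.
Qed.

(** The points t, 2 t, 4 t, ... run into the neighbourhood of the cusp, where [P] is excluded. *)
Lemma doubling_principle (P : C -> Prop) (Y : R) :
  (forall t, HH t -> P t -> P (2 * t)%C) -> (forall t, HH t -> Y <= snd t -> ~ P t) -> forall t, HH t -> ~ P t.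
Proof.
  intros D N t Ht Pt.
  assert (K : forall n, P (RtoC (2 ^ n) * t)%C).
  { induction n.
    - simpl. replace (1 * t)%C with t by ring. auto.
    - replace (RtoC (2 ^ S n) * t)%C with (2 * (RtoC (2 ^ n) * t))%C by (simpl; rewrite RtoC_mult; ring).
      apply D; auto. now apply HH_pow. }
  destruct (dbl_large t Y Ht) as [n Hn]. apply (N _ (HH_pow t n Ht) Hn (K n)).
Qed.

Lemma cusp_small (eta : R) : 0 < eta -> exists Y, 1 <= Y /\ forall t : C, Y <= snd t ->
  exp (- (PI * snd t - 1)) < eta.
Proof. intros He. destruct (exp_PI_small eta He) as [Y [H1 H2]]. exists Y; split; auto. Qed.

Lemma th3_near1 (t : C) (eta : R) : 1 <= snd t -> exp (- (PI * snd t - 1)) < eta -> eta <= 1 / 2 -> Cmod (th3 t - 1) <= 6 * eta.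
Proof.
  intros H1 H2 H3. eapply Rle_trans; [apply th3_cusp; lra|]. lra.
Qed.

Lemma th4_near1 (t : C) (eta : R) : 1 <= snd t -> exp (- (PI * snd t - 1)) < eta -> eta <= 1 / 2 -> Cmod (th4 t - 1) <= 6 * eta.
Proof.
  intros H1 H2 H3. unfold th4. assert (E : snd (t + 1)%C = snd t) by (destruct t; simpl; ring).
  apply th3_near1; rewrite ?E; auto.
Qed.

Lemma th4_neq0 (t : C) : HH t -> th4 t <> 0%C.
Proof.
  destruct (cusp_small (1/12)) as [Y [HY K]]; [lra|].
  intros Ht. apply (doubling_principle (fun t => th4 t = 0%C) Y); auto.
  - intros s Hs E. assert (Q := th34_sq s Hs). rewrite E in Q.
    destruct (classic (th4 (2 * s) = 0%C)) as [|N]; auto. exfalso.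
    apply (Cmult_neq_0 _ _ (Cmult_neq_0 _ _ N N) (Cmult_neq_0 _ _ N N)). rewrite <- Q. ring.
  - intros s Hs L E. assert (Q := th4_near1 s (1/12) ltac:(lra) (K s L) ltac:(lra)). rewrite E in Q.
    replace (0 - 1)%C with (- (1))%C in Q by ring. rewrite Cmod_opp, Cmod_1 in Q. lra.
Qed.

Lemma th3_neq0 (t : C) : HH t -> th3 t <> 0%C.
Proof. intros Ht. rewrite <- th4_plus1. now apply th4_neq0, HH_plus1. Qed.

Lemma th2_neq0 (t : C) : HH t -> th2 t <> 0%C.
Proof.
  intros Ht E. assert (Hu := HH_inv t Ht).
  assert (Q := theta_inversion t (- / t) Ht Hu ltac:(field; now apply HH_neq0)). rewrite E in Q.
  apply (Cmult_neq_0 (th3 t) (th4 (- / t))); [now apply th3_neq0 | now apply th4_neq0|]. rewrite <- Q. ring.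
Qed.

Definition pow4 (z : C) : C := (z * z * (z * z))%C.

Definition lam (t : C) : C := (pow4 (th2 t) / pow4 (th3 t))%C.

Lemma pow4_neq0 (z : C) : z <> 0%C -> pow4 z <> 0%C.
Proof. intros H. unfold pow4. repeat apply Cmult_neq_0; auto. Qed.

Lemma lam_1m (t : C) : HH t -> (1 - lam t)%C = (pow4 (th4 t) / pow4 (th3 t))%C.
Proof.
  intros Ht. assert (J := jacobi t Ht). unfold lam. fold (pow4 (th2 t)) (pow4 (th3 t)) (pow4 (th4 t)) in J.
  rewrite <- J. field. now apply pow4_neq0, th3_neq0.
Qed.

Lemma Cdiv_neq0 (a b : C) : a <> 0%C -> b <> 0%C -> (a / b)%C <> 0%C.
Proof.
  intros Ha Hb E. apply Ha. replace a with (a / b * b)%C by (field; auto). rewrite E. ring.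
Qed.

Lemma lam_neq0 (t : C) : HH t -> lam t <> 0%C.
Proof. intros Ht. apply Cdiv_neq0; apply pow4_neq0; [now apply th2_neq0 | now apply th3_neq0]. Qed.

Lemma lam_neq1 (t : C) : HH t -> lam t <> 1%C.
Proof.
  intros Ht E. assert (Q := lam_1m t Ht). rewrite E in Q.
  apply (Cdiv_neq0 (pow4 (th4 t)) (pow4 (th3 t))); try apply pow4_neq0; try now apply th4_neq0 || now apply th3_neq0.
  rewrite <- Q. ring.
Qed.

Lemma lam_T (t : C) : HH t -> lam (t + 1) = (lam t / (lam t - 1))%C.
Proof.
  intros Ht. assert (N3 := pow4_neq0 _ (th3_neq0 t Ht)). assert (N4 := pow4_neq0 _ (th4_neq0 t Ht)).
  replace (lam t - 1)%C with (- (pow4 (th4 t) / pow4 (th3 t)))%C by (rewrite <- lam_1m by auto; ring).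
  unfold lam. fold (th4 t).
  assert (E2 : pow4 (th2 (t + 1)) = (- pow4 (th2 t))%C).
  { rewrite th2_plus1 by auto. assert (Q := cexp_quarter). set (c := cexp (Ipi * RtoC (1/4))) in *.
    unfold pow4. transitivity (c * c * (c * c) * pow4 (th2 t))%C; [unfold pow4; ring|]. rewrite Q. unfold pow4. ring. }
  rewrite E2. change (th3 (t + 1)) with (th4 t). field. auto.
Qed.

Lemma lam_S (t : C) : HH t -> lam (- / t) = (1 - lam t)%C.
Proof.
  intros Ht. assert (Hu := HH_inv t Ht).
  assert (Q := theta_inversion (- / t) t Hu Ht ltac:(field; now apply HH_neq0)).
  rewrite lam_1m by auto. unfold lam.
  assert (N3 := th3_neq0 t Ht). assert (N3' := th3_neq0 _ Hu).
  assert (N := pow4_neq0 _ N3). assert (N' := pow4_neq0 _ N3').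
  assert (E : (pow4 (th2 (- / t)) * pow4 (th3 t))%C = (pow4 (th3 (- / t)) * pow4 (th4 t))%C).
  { transitivity (pow4 (th2 (- / t) * th3 t)); [unfold pow4; ring|]. rewrite Q. unfold pow4; ring. }
  transitivity ((pow4 (th2 (- / t)) * pow4 (th3 t)) / (pow4 (th3 (- / t)) * pow4 (th3 t)))%C; [field; auto|].
  rewrite E. field; auto.
Qed.

(** * Reflection *)

Lemma cexp_conj (z : C) : cexp (Cconj z) = Cconj (cexp z).
Proof. cparts; rewrite ?cos_neg, ?sin_neg; ring. Qed.

Lemma Cconj_mult (x y : C) : Cconj (x * y) = (Cconj x * Cconj y)%C.
Proof. cparts; ring. Qed.

Lemma zsum_conj (f : Z -> C) (K r : R) : zgeo K r f -> zsum (fun n => Cconj (f n)) = Cconj (zsum f).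
Proof.
  intros H. apply zsum_eq. intros e He. destruct (zgeo_sum _ _ _ H e He) as [N0 HN]. exists N0. intros N L.
  assert (E : forall N, zpart (fun n => Cconj (f n)) N = Cconj (zpart f N)).
  { clear. induction N; cbn [zpart]; auto. rewrite IHN. cparts; ring. }
  rewrite E. replace (Cconj (zpart f N) - Cconj (zsum f))%C with (Cconj (zpart f N - zsum f)) by (cparts; ring).
  rewrite Cmod_conj. auto.
Qed.

(** The reflection of the upper half-plane in the imaginary axis. It conjugates the values of [lam],
    and later it pins lifts with real values to the axis. *)
Definition refl (t : C) : C := (- Cconj t)%C.

Lemma HH_refl (t : C) : HH t -> HH (refl t).
Proof. unfold HH, refl. destruct t; simpl. lra. Qed.

Lemma Theta0_refl (a : R) (t : C) : -1 <= a <= 1 -> HH t -> Theta 0 a (refl t) = Cconj (Theta 0 a t).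
Proof.
  intros Ha Ht. rewrite !Theta0. destruct (tt_geo a t Ha Ht) as [K [r G]].
  rewrite <- (zsum_conj _ K r) by auto. apply zsum_ext. intros n. unfold tt. rewrite <- cexp_conj. f_equal.
  unfold refl. destruct t as [x y]. cparts; ring.
Qed.

Lemma pow4_conj (z : C) : pow4 (Cconj z) = Cconj (pow4 z).
Proof. unfold pow4. now rewrite !Cconj_mult. Qed.

Lemma Cconj_neq0 (z : C) : z <> 0%C -> Cconj z <> 0%C.
Proof. intros H. apply Cmod_gt_0. rewrite Cmod_conj. now apply Cmod_gt_0. Qed.

Lemma lam_refl (t : C) : HH t -> lam (refl t) = Cconj (lam t).
Proof.
  intros Ht. unfold lam, th2, th3. rewrite !Theta0_refl by (auto; lra). rewrite !pow4_conj.
  assert (N := pow4_neq0 _ (th3_neq0 t Ht)). unfold th3 in N. set (b := pow4 (Theta 0 0 t)) in *. set (a := pow4 (Theta 0 (1/2) t)).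
  replace a with (a / b * b)%C at 1 by (field; auto). rewrite Cconj_mult. field. now apply Cconj_neq0.
Qed.

(** * The derivative of lambda *)

(** The Wronskian of theta_3 and theta_4; it vanishes exactly where the derivative of [ratio] does.
    Since lam = 1 - ratio^2, it controls the critical points of [lam]. *)
Definition Wr (t : C) : C := (Theta 1 0 (t + 1) * th3 t - Theta 1 0 t * th4 t)%C.

Definition ratio (t : C) : C := (th4 t * th4 t / (th3 t * th3 t))%C.

Lemma th3_cder (t : C) : HH t -> cder th3 t (Theta 1 0 t).
Proof. intros Ht. apply Theta_cder; auto; lra. Qed.

Lemma th4_cder (t : C) : HH t -> cder th4 t (Theta 1 0 (t + 1)).
Proof.
  intros Ht. eapply cder_eq.
  - apply (cder_comp (fun t => t + 1)%C th3); [apply cder_plus; [apply cder_id | apply cder_const]|].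
    apply th3_cder. now apply HH_plus1.
  - ring.
Qed.

Lemma ratio_cder (t : C) : HH t -> cder ratio t (2 * th4 t * Wr t / (th3 t * th3 t * th3 t))%C.
Proof.
  intros Ht. assert (N := th3_neq0 t Ht).
  eapply cder_eq.
  - apply (cder_mult (fun t => th4 t * th4 t)%C (fun t => / (th3 t * th3 t))%C).
    + apply cder_mult; now apply th4_cder.
    + apply (cder_inv (fun t => th3 t * th3 t)%C); [now apply Cmult_neq_0|]. apply cder_mult; now apply th3_cder.
  - unfold Wr. field. auto.
Qed.

Lemma cder_unique (f : C -> C) (z a b : C) : cder f z a -> cder f z b -> a = b.
Proof.
  intros Ha Hb. apply Cmod_sub_small. intros e He.
  destruct (Ha (e / 4)) as [d1 [D1 K1]]; [lra|]. destruct (Hb (e / 4)) as [d2 [D2 K2]]; [lra|].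
  set (h := Rmin d1 d2 / 2). assert (Hh : 0 < h) by (unfold h; assert (0 < Rmin d1 d2) by (now apply Rmin_pos); lra).
  assert (E : (z + h - z)%C = RtoC h) by ring.
  assert (L : Cmod (z + h - z) = h) by (rewrite E, Cmod_R, Rabs_pos_eq; lra).
  assert (M1 := Rmin_l d1 d2). assert (M2 := Rmin_r d1 d2).
  specialize (K1 (z + h)%C ltac:(rewrite L; unfold h; lra)). specialize (K2 (z + h)%C ltac:(rewrite L; unfold h; lra)).
  rewrite L, E in K1, K2. apply (Rmult_lt_reg_r h); auto.
  rewrite <- (Rabs_pos_eq h) at 1 by lra. rewrite <- Cmod_R, <- Cmod_mult.
  replace ((a - b) * h)%C with ((f (z + h) - f z - b * h) + - (f (z + h) - f z - a * h))%C by ring.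
  eapply Rle_lt_trans; [apply Cmod_triangle|]. rewrite Cmod_opp. nra.
Qed.

Lemma C2_neq0 : RtoC 2 <> 0%C.
Proof. intros X; apply RtoC_inj in X; lra. Qed.

Lemma th34_sum_neq0 (t : C) : HH t -> (th3 t * th3 t + th4 t * th4 t)%C <> 0%C.
Proof.
  intros Ht. rewrite th3_sq, th4_sq by auto. assert (N := th3_neq0 _ (HH_double t Ht)).
  replace (th3 (2 * t) * th3 (2 * t) + th2 (2 * t) * th2 (2 * t) + (th3 (2 * t) * th3 (2 * t) - th2 (2 * t) * th2 (2 * t)))%C
    with (2 * (th3 (2 * t) * th3 (2 * t)))%C by ring.
  apply Cmult_neq_0; [apply C2_neq0 | now apply Cmult_neq_0].
Qed.

(** Landen's transformation: theta_3^2 and theta_4^2 at 2 t are, the second up to sign, the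
    arithmetic and the geometric mean of theta_3^2 and theta_4^2 at t. *)
Lemma ratio_double (t : C) : HH t ->
  (ratio (2 * t) * ratio (2 * t) * ((1 + ratio t) * (1 + ratio t)))%C = (4 * ratio t)%C.
Proof.
  intros Ht. assert (N := th3_neq0 t Ht). assert (N2 := th3_neq0 _ (HH_double t Ht)).
  assert (S1 := th3_sq t Ht). assert (S2 := th4_sq t Ht). assert (S3 := th34_sq t Ht).
  unfold ratio. set (a := th3 t) in *. set (b := th4 t) in *. set (A := th3 (2 * t)) in *. set (B := th4 (2 * t)) in *.
  assert (E : (a * a + b * b)%C = (2 * (A * A))%C) by (rewrite S1, S2; ring).
  transitivity ((B * B * (B * B)) * ((a * a + b * b) * (a * a + b * b)) / (A * A * (A * A) * (a * a * (a * a))))%C; [field; auto|].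
  rewrite E, <- S3. field; auto.
Qed.

(** Differentiate [ratio_double]: a critical point of [ratio] at t forces one at 2 t, because the
    cofactors ratio(2 t) and 1 + ratio(t) do not vanish. *)
Lemma Wr_double (t : C) : HH t -> Wr t = 0%C -> Wr (2 * t) = 0%C.
Proof.
  intros Ht W. assert (H2 := HH_double t Ht).
  assert (D := ratio_cder t Ht). rewrite W in D.
  assert (N := th3_neq0 t Ht). assert (N2 := th3_neq0 _ H2). assert (N4 := th4_neq0 _ H2).
  set (d := (2 * th4 (2 * t) * Wr (2 * t) / (th3 (2 * t) * th3 (2 * t) * th3 (2 * t)))%C).
  assert (D2 : cder (fun t => ratio (2 * t)) t (d * (2 * 1))%C).
  { apply (cder_comp (fun t => 2 * t)%C ratio); [apply cder_scal, cder_id | now apply ratio_cder]. }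
  replace (2 * th4 t * 0 / (th3 t * th3 t * th3 t))%C with (RtoC 0) in D by (field; auto).
  assert (D3 : cder (fun t => ratio (2 * t) * ratio (2 * t) * ((1 + ratio t) * (1 + ratio t)))%C t
    (4 * d * ratio (2 * t) * ((1 + ratio t) * (1 + ratio t)))%C).
  { assert (D1 : cder (fun t => 1 + ratio t)%C t (0 + 0)%C) by (apply cder_plus; [apply cder_const | auto]).
    eapply cder_eq; [apply cder_mult; apply cder_mult; [apply D2 | apply D2 | apply D1 | apply D1]|]. cbv beta. ring. }
  assert (D4 : cder (fun t => ratio (2 * t) * ratio (2 * t) * ((1 + ratio t) * (1 + ratio t)))%C t (4 * 0)%C).
  { apply (cder_ext_loc (fun t => 4 * ratio t)%C _ _ _ (snd t)); auto; [|now apply cder_scal].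
    intros w Hw. symmetry. apply ratio_double. unfold HH in *.
    assert (Q := Cmod_snd (w - t)). simpl in Q. assert (Q' := Rle_lt_trans _ _ _ Q Hw). apply Rabs_lt_between in Q'. lra. }
  assert (E := cder_unique _ _ _ _ D3 D4).
  assert (R1 : ratio (2 * t) <> 0%C) by (unfold ratio; apply Cdiv_neq0; now apply Cmult_neq_0).
  assert (R2 : (1 + ratio t)%C <> 0%C).
  { intros X. apply (th34_sum_neq0 t Ht). unfold ratio in X.
    replace (th3 t * th3 t + th4 t * th4 t)%C with ((1 + th4 t * th4 t / (th3 t * th3 t)) * (th3 t * th3 t))%C by (field; auto).
    rewrite X. ring. }
  assert (Ed : d = 0%C).
  { destruct (classic (d = 0%C)) as [|Nd]; auto. exfalso.
    apply (Cmult_neq_0 (4 * d * ratio (2 * t)) ((1 + ratio t) * (1 + ratio t))).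
    - apply Cmult_neq_0; auto. apply Cmult_neq_0; auto. intros X; apply RtoC_inj in X; lra.
    - now apply Cmult_neq_0.
    - rewrite E. ring. }
  destruct (classic (Wr (2 * t) = 0%C)) as [|Nw]; auto. exfalso.
  apply (Cdiv_neq0 (2 * th4 (2 * t) * Wr (2 * t)) (th3 (2 * t) * th3 (2 * t) * th3 (2 * t))); auto.
  - apply Cmult_neq_0; auto. apply Cmult_neq_0; auto. apply C2_neq0.
  - repeat apply Cmult_neq_0; auto.
Qed.

Lemma near1_mult (x y : C) (a b : R) : Cmod (x - 1) <= a -> Cmod (y - 1) <= b -> Cmod (x * y - 1) <= a + b + a * b.
Proof.
  intros Hx Hy. assert (X0 := Cmod_ge_0 (x - 1)). assert (Y0 := Cmod_ge_0 (y - 1)).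
  replace (x * y - 1)%C with ((x - 1) + (y - 1) + (x - 1) * (y - 1))%C by ring.
  cmod_tri. eapply Rle_trans; [apply Rplus_le_compat_r, Cmod_triangle|].
  rewrite Cmod_mult. nra.
Qed.

Lemma Wr_neq0 (t : C) : HH t -> Wr t <> 0%C.
Proof.
  destruct (cusp_small (1/40)) as [Y [HY K]]; [lra|].
  intros Ht. apply (doubling_principle (fun t => Wr t = 0%C) Y); auto using Wr_double.
  intros s Hs L E. specialize (K s L).
  assert (T3 := th3_near1 s (1/40) ltac:(lra) K ltac:(lra)). assert (T4 := th4_near1 s (1/40) ltac:(lra) K ltac:(lra)).
  assert (E1 := th3'_cusp s ltac:(lra) ltac:(lra)).
  assert (Es : snd (s + 1)%C = snd s) by (destruct s; simpl; ring).
  (* Passing from s to s + 1 changes the sign of exp(i PI s); therefore the two products in [Wr] add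
     up to about -2 c instead of cancelling. *)
  assert (E2 := th3'_cusp (s + 1) ltac:(rewrite Es; lra) ltac:(rewrite Es; lra)). rewrite Es in E2.
  replace (cexp (Ipi * (s + 1))) with (- cexp (Ipi * s))%C in E2.
  2:{ replace (Ipi * (s + 1))%C with (Ipi * s + Ipi)%C by ring. rewrite cexp_add, cexp_pi. ring. }
  assert (Nq := cexp_neq0 (Ipi * s)). assert (NI := Ipi_neq0).
  set (c := (2 * Ipi * cexp (Ipi * s))%C) in *.
  assert (Nc : c <> 0%C) by (unfold c; repeat apply Cmult_neq_0; auto using C2_neq0).
  replace (2 * Ipi * - cexp (Ipi * s))%C with (- c)%C in E2 by (unfold c; ring).
  set (a := (Theta 1 0 s / c)%C) in *. set (b := (Theta 1 0 (s + 1) / - c)%C) in *.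
  assert (W : Wr s = (- c * (b * th3 s + a * th4 s))%C) by (unfold Wr, a, b; field; auto).
  rewrite E in W.
  assert (B1 := near1_mult b (th3 s) (2/40) (6/40) ltac:(lra) ltac:(lra)).
  assert (B2 := near1_mult a (th4 s) (2/40) (6/40) ltac:(lra) ltac:(lra)).
  assert (Z : (b * th3 s + a * th4 s)%C = 0%C).
  { destruct (classic ((b * th3 s + a * th4 s)%C = 0%C)) as [|N]; auto. exfalso.
    apply (Cmult_neq_0 (- c) (b * th3 s + a * th4 s)); auto.
    intros X. apply Nc. replace c with (- - c)%C by ring. rewrite X. ring. }
  assert (T := Cmod_triangle (b * th3 s - 1) (a * th4 s - 1)).
  replace (b * th3 s - 1 + (a * th4 s - 1))%C with (- RtoC 2)%C in T by (replace (b * th3 s - 1 + (a * th4 s - 1))%C with ((b * th3 s + a * th4 s) - 2)%C by ring; rewrite Z; ring).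
  rewrite Cmod_opp, Cmod_R, Rabs_pos_eq in T by lra. lra.
Qed.

Definition dlam (t : C) : C := (- 2 * ratio t * (2 * th4 t * Wr t / (th3 t * th3 t * th3 t)))%C.

Lemma lam_ratio (t : C) : HH t -> lam t = (1 - ratio t * ratio t)%C.
Proof.
  intros Ht. assert (Q := lam_1m t Ht). assert (N := th3_neq0 t Ht).
  replace (lam t) with (1 - (1 - lam t))%C by ring. rewrite Q. unfold ratio, pow4. field. auto.
Qed.

Lemma HH_near (t w : C) : HH t -> Cmod (w - t) < snd t -> HH w.
Proof.
  unfold HH. intros Ht Hw. assert (Q := Cmod_snd (w - t)). simpl in Q.
  assert (Q' := Rle_lt_trans _ _ _ Q Hw). apply Rabs_lt_between in Q'. lra.
Qed.

Lemma lam_cder (t : C) : HH t -> cder lam t (dlam t).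
Proof.
  intros Ht. apply (cder_ext_loc (fun t => 1 + -1 * (ratio t * ratio t))%C _ _ _ (snd t)); auto.
  - intros w Hw. rewrite lam_ratio; [ring|]. now apply (HH_near t).
  - eapply cder_eq; [apply cder_plus; [apply cder_const | apply cder_scal; apply cder_mult; now apply ratio_cder]|].
    unfold dlam. ring.
Qed.

Lemma dlam_neq0 (t : C) : HH t -> dlam t <> 0%C.
Proof.
  intros Ht. unfold dlam. assert (N3 := th3_neq0 t Ht). assert (N4 := th4_neq0 t Ht). assert (NW := Wr_neq0 t Ht).
  apply Cmult_neq_0; [apply Cmult_neq_0|].
  - intros X. apply RtoC_inj in X. lra.
  - unfold ratio. apply Cdiv_neq0; now apply Cmult_neq_0.
  - apply Cdiv_neq0; repeat apply Cmult_neq_0; auto using C2_neq0.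
Qed.

Lemma dlam_cont : contC HH dlam.
Proof.
  assert (C3 : contC HH th3) by (apply contC_cder; intros z Hz; eexists; now apply th3_cder).
  assert (C4 : contC HH th4) by (apply contC_cder; intros z Hz; eexists; now apply th4_cder).
  assert (CT : contC HH (Theta 1 0)) by (apply contC_cder; intros z Hz; eexists; apply Theta_cder; auto; lra).
  assert (CT' : contC HH (fun t => Theta 1 0 (t + 1))).
  { apply (contC_comp HH HH (fun t => t + 1)%C); auto using HH_plus1.
    apply contC_plus; [apply contC_id | apply contC_const]. }
  assert (CW : contC HH Wr).
  { apply contC_minus; apply contC_mult; auto. }
  unfold dlam. apply contC_mult; [apply contC_mult; [apply contC_const|]|].
  - apply contC_div; try (apply contC_mult; auto). intros z Hz. apply Cmult_neq_0; now apply th3_neq0.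
  - apply contC_div; [apply contC_mult; auto; apply contC_scal; auto | repeat apply contC_mult; auto |].
    intros z Hz. repeat apply Cmult_neq_0; now apply th3_neq0.
Qed.

Lemma lam_cont : contC HH lam.
Proof. apply contC_cder. intros z Hz. eexists. now apply lam_cder. Qed.

(** * Lambda near the cusp and on the imaginary axis *)

(** Near the cusp theta_2 is close to 2 exp(i PI t / 4) and theta_3 to 1; the fourth power explains
    16 exp(i PI t). *)
Lemma lam_cusp : exists Y, 1 <= Y /\ forall t, Y <= snd t ->
  Cmod (lam t - 16 * cexp (Ipi * t)) < Cmod (16 * cexp (Ipi * t)).
Proof.
  destruct (cusp_small (1/200)) as [Y [HY K]]; [lra|]. exists Y; split; auto. intros t L. specialize (K t L).
  assert (Ht : HH t) by (unfold HH; lra).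
  assert (T3 := th3_near1 t (1/200) ltac:(lra) K ltac:(lra)).
  assert (T2 := th2_cusp t ltac:(lra) ltac:(lra)).
  assert (N3 := th3_neq0 t Ht).
  set (c := cexp (Ipi * t * RtoC (1/4))) in *. assert (Nc : c <> 0%C) by apply cexp_neq0.
  set (a := (th2 t / (2 * c))%C) in *.
  assert (E2 : th2 t = (2 * c * a)%C) by (unfold a; field; auto).
  assert (Ec : pow4 c = cexp (Ipi * t)).
  { unfold pow4, c. rewrite <- !cexp_add. f_equal. cparts; field. }
  assert (A1 : Cmod (a - 1) <= 3/200) by lra.
  assert (A2 := near1_mult a a _ _ A1 A1). assert (A4 := near1_mult _ _ _ _ A2 A2).
  assert (B1 : Cmod (th3 t - 1) <= 6/200) by lra.
  assert (B2 := near1_mult _ _ _ _ B1 B1). assert (B4 := near1_mult _ _ _ _ B2 B2).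
  fold (pow4 a) in A4. fold (pow4 (th3 t)) in B4.
  set (p := pow4 a) in *. set (s := pow4 (th3 t)) in *.
  assert (Ns : s <> 0%C) by now apply pow4_neq0.
  assert (E : lam t = (16 * cexp (Ipi * t) * (p / s))%C).
  { unfold lam. fold s. rewrite E2, <- Ec. unfold p, pow4. field. auto. }
  rewrite E. set (q := (16 * cexp (Ipi * t))%C).
  assert (Nq : q <> 0%C) by (unfold q; apply Cmult_neq_0; [intros X; apply RtoC_inj in X; lra | apply cexp_neq0]).
  replace (q * (p / s) - q)%C with (q * ((p - s) / s))%C by (field; auto).
  rewrite Cmod_mult, Cmod_div by auto.
  assert (Ms : 1 - Cmod (s - 1) <= Cmod s).
  { assert (R := Cmod_rev 1 (1 - s)). replace (1 - (1 - s))%C with s in R by ring. rewrite Cmod_1, (Cmod_sym 1 s) in R. lra. }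
  assert (Mp : Cmod (p - s) <= Cmod (p - 1) + Cmod (s - 1)).
  { eapply Rle_trans; [apply (Cmod_tri _ 1)|]. rewrite (Cmod_sym 1 s). lra. }
  rewrite <- (Rmult_1_r (Cmod q)) at 2. apply Rmult_lt_compat_l; [now apply Cmod_pos|].
  apply (Rmult_lt_reg_r (Cmod s)); [lra|]. unfold Rdiv. rewrite Rmult_assoc, Rinv_l by lra. lra.
Qed.

Lemma lam_small (e : R) : 0 < e -> exists Y, 1 <= Y /\ forall t, Y <= snd t -> Cmod (lam t) < e.
Proof.
  intros He. destruct lam_cusp as [Y1 [HY1 K1]]. destruct (cusp_small (e / 32)) as [Y2 [HY2 K2]]; [lra|].
  exists (Rmax Y1 Y2); split; [eapply Rle_trans; [apply HY1 | apply Rmax_l]|]. intros t L.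
  specialize (K1 t (Rle_trans _ _ _ (Rmax_l _ _) L)). specialize (K2 t (Rle_trans _ _ _ (Rmax_r _ _) L)).
  assert (Q : Cmod (16 * cexp (Ipi * t)) <= e / 2).
  { rewrite Cmod_mult, Cmod_R, Rabs_pos_eq, Cmod_cexp by lra.
    replace (fst (Ipi * t)%C) with (- (PI * snd t)) by (destruct t; simpl; ring).
    assert (exp (- (PI * snd t)) <= exp (- (PI * snd t - 1))) by (apply exp_le_incr; lra). lra. }
  replace (lam t) with ((lam t - 16 * cexp (Ipi * t)) + 16 * cexp (Ipi * t))%C by ring.
  eapply Rle_lt_trans; [apply Cmod_triangle|]. lra.
Qed.

Lemma real_of_conj (z : C) : Cconj z = z -> z = RtoC (fst z).
Proof. destruct z as [x y]. unfold Cconj; simpl. intros H. inversion H. cparts; lra. Qed.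

Lemma refl_im (y : R) : refl (0, y) = (0, y).
Proof. unfold refl. cparts; ring. Qed.

Lemma lam_im_real (y : R) : 0 < y -> exists v, 0 < v < 1 /\ lam (0, y) = RtoC v.
Proof.
  intros Hy. assert (Ht : HH (0, y)) by (unfold HH; simpl; lra).
  assert (R2 : th2 (0, y) = RtoC (fst (th2 (0, y)))).
  { apply real_of_conj. unfold th2. rewrite <- Theta0_refl by (auto; lra). now rewrite refl_im. }
  assert (R3 : th3 (0, y) = RtoC (fst (th3 (0, y)))).
  { apply real_of_conj. unfold th3. rewrite <- Theta0_refl by (auto; lra). now rewrite refl_im. }
  assert (R4 : th4 (0, y) = RtoC (fst (th4 (0, y)))).
  { apply real_of_conj. unfold th4, th3. rewrite <- Theta0_refl by (try lra; now apply HH_plus1).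
    fold (th3 (refl ((0, y) + 1))) (th3 ((0, y) + 1)).
    rewrite <- (th3_period (refl ((0, y) + 1))). f_equal. unfold refl. cparts; ring. }
  assert (N2 := th2_neq0 _ Ht). assert (N3 := th3_neq0 _ Ht). assert (N4 := th4_neq0 _ Ht).
  assert (L1 := lam_1m _ Ht). unfold lam in *. rewrite R2, R3 in *. rewrite R4 in L1, N4.
  set (a := fst (th2 (0, y))) in *. set (b := fst (th3 (0, y))) in *. set (c := fst (th4 (0, y))) in *.
  assert (a <> 0) by (intros X; apply N2; now rewrite X). assert (b <> 0) by (intros X; apply N3; now rewrite X).
  assert (c <> 0) by (intros X; apply N4; now rewrite X).
  assert (P4 : forall x, pow4 (RtoC x) = RtoC (x ^ 4)).
  { intros x. unfold pow4. rewrite <- !RtoC_mult. f_equal. ring. }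
  assert (Q4 : forall x, x <> 0 -> 0 < x ^ 4).
  { intros x Hx. replace (x ^ 4) with ((x * x) * (x * x)) by ring. assert (0 < x * x) by nra. nra. }
  assert (Db : forall x, (RtoC (x ^ 4) / RtoC (b ^ 4))%C = RtoC (x ^ 4 / b ^ 4))
    by (intros x; symmetry; apply RtoC_div, Rgt_not_eq, Q4; auto).
  rewrite !P4, !Db in *. exists (a ^ 4 / b ^ 4). split; auto.
  rewrite <- RtoC_minus in L1. apply RtoC_inj in L1.
  assert (0 < c ^ 4 / b ^ 4) by (apply Rdiv_lt_0_compat; auto).
  assert (0 < a ^ 4 / b ^ 4) by (apply Rdiv_lt_0_compat; auto). lra.
Qed.

Definition phi (y : R) : R := fst (lam (0, y)).

Lemma lam_phi (y : R) : 0 < y -> lam (0, y) = RtoC (phi y) /\ 0 < phi y < 1.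
Proof. intros Hy. destruct (lam_im_real y Hy) as [v [Hv E]]. unfold phi. rewrite E. simpl. auto. Qed.

Lemma phi_inv (y : R) : 0 < y -> phi (/ y) = 1 - phi y.
Proof.
  intros Hy. unfold phi. assert (Q := lam_S (0, y) Hy).
  replace (- / (0, y))%C with ((0, / y) : C) in Q by (cparts; field; lra).
  rewrite Q. simpl. ring.
Qed.

Lemma lam_i : lam (0, 1) = RtoC (1/2).
Proof.
  destruct (lam_phi 1 ltac:(lra)) as [E _]. rewrite E. f_equal. assert (Q := phi_inv 1 ltac:(lra)). rewrite Rinv_1 in Q. lra.
Qed.

Lemma im_ray (y : R) : ((0, 0) + RtoC y * (0, 1))%C = (0, y).
Proof. cparts; ring. Qed.

Lemma phi_derive (y : R) : 0 < y -> is_derive phi y (fst (dlam (0, y) * (0, 1))%C) /\ snd (dlam (0, y) * (0, 1))%C = 0.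
Proof.
  intros Hy.
  assert (H : cder lam ((0, 0) + RtoC y * (0, 1)) (dlam (0, y))) by (rewrite im_ray; apply lam_cder; unfold HH; simpl; lra).
  apply cder_ray in H. destruct H as [H1 H2]. split.
  - eapply is_derive_ext; [|apply H1]. intros t. simpl. unfold phi. now rewrite im_ray.
  (* [lam] is real on the axis, so its velocity has imaginary part 0; combined with [dlam_neq0] the
     derivative of [phi] cannot vanish. *)
  - assert (H3 : is_derive (fun _ : R => 0) y (snd (dlam (0, y) * (0, 1))%C)).
    { eapply is_derive_ext_loc; [|apply H2]. exists (mkposreal y Hy). intros t Bt. rewrite im_ray.
      assert (0 < t). { unfold ball in Bt; simpl in Bt. unfold AbsRing_ball, abs, minus, plus, opp in Bt; simpl in Bt.
        apply Rabs_lt_between in Bt. lra. }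
      destruct (lam_phi t H) as [-> _]. reflexivity. }
    apply is_derive_unique in H3. rewrite <- H3. apply Derive_const.
Qed.

Lemma phi_inj (a b : R) : 0 < a -> 0 < b -> phi a = phi b -> a = b.
Proof.
  assert (K : forall a b, 0 < a -> a < b -> phi a <> phi b).
  { intros a' b' Ha Hab E.
    destruct (MVT_gen phi a' b' (fun y => fst (dlam (0, y) * (0, 1))%C)) as [c [Hc Q]].
    - rewrite Rmin_left, Rmax_right by lra. intros x Hx. apply phi_derive. lra.
    - rewrite Rmin_left, Rmax_right by lra. intros x Hx.
      apply continuity_pt_filterlim, (ex_derive_continuous (V := R_NormedModule) phi). eexists. apply phi_derive. lra.
    - rewrite Rmin_left, Rmax_right in Hc by lra.
      assert (Z : fst (dlam (0, c) * (0, 1))%C = 0).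
      { rewrite E, Rminus_diag in Q. symmetry in Q. apply Rmult_integral in Q. destruct Q; auto; lra. }
      destruct (phi_derive c ltac:(lra)) as [_ Z2].
      apply (Cmult_neq_0 (dlam (0, c)) (0, 1)).
      + apply dlam_neq0. unfold HH; simpl; lra.
      + intros X. inversion X. lra.
      + apply Ceq; auto. }
  intros Ha Hb E. destruct (Rtotal_order a b) as [L|[L|L]]; auto; exfalso.
  - now apply (K a b).
  - now apply (K b a).
Qed.

Lemma lam_im_inj (a b : R) : 0 < a -> 0 < b -> lam (0, a) = lam (0, b) -> a = b.
Proof. intros Ha Hb E. apply phi_inj; auto. unfold phi. now rewrite E. Qed.

(** [phi] is small far up on the axis, and phi(1/y) = 1 - phi(y) brings it close to 1 near 0; the
    rest is the intermediate value theorem. *)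
Lemma phi_surj (v : R) : 0 < v < 1 -> exists y, 0 < y /\ phi y = v.
Proof.
  intros Hv. destruct (lam_small (Rmin v (1 - v))) as [Y [HY K]]; [apply Rmin_pos; lra|].
  set (Z := Y + 1).
  assert (KY : phi Z < Rmin v (1 - v)).
  { eapply Rle_lt_trans; [apply Rle_abs|]. eapply Rle_lt_trans; [apply Cmod_fst|]. apply K. simpl. unfold Z; lra. }
  assert (M1 := Rmin_l v (1 - v)). assert (M2 := Rmin_r v (1 - v)).
  assert (Z1 : 1 < Z) by (unfold Z; lra).
  assert (KI := phi_inv Z ltac:(lra)).
  assert (0 < / Z) by (apply Rinv_0_lt_compat; lra). assert (/ Z < 1) by (rewrite <- Rinv_1; apply Rinv_lt_contravar; lra).
  destruct (IVT_interv (fun y => v - phi y) (/ Z) Z) as [y [Hy E]]; try lra.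
  - intros a Ha. apply continuity_pt_minus; [apply continuity_pt_const; intros ? ?; reflexivity|].
    apply continuity_pt_filterlim, (ex_derive_continuous (V := R_NormedModule) phi). eexists. apply phi_derive. lra.
  - exists y. split; lra.
Qed.

Lemma lam_im_surj (v : R) : 0 < v < 1 -> exists y, 0 < y /\ lam (0, y) = RtoC v.
Proof. intros Hv. destruct (phi_surj v Hv) as [y [Hy E]]. exists y; split; auto. rewrite <- E. now apply lam_phi. Qed.

(** * Lifting through a covering relation over a rectangle *)

Lemma contC_paste (D : C -> Prop) (h : C -> R) (m : R) (l1 l2 : C -> C) :
  (forall z w, Rabs (h z - h w) <= Cmod (z - w)) ->
  contC (fun z => D z /\ h z <= m) l1 -> contC (fun z => D z /\ m <= h z) l2 ->
  (forall z, D z -> h z = m -> l1 z = l2 z) ->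
  contC D (fun z => if Rle_dec (h z) m then l1 z else l2 z).
Proof.
  intros Hh H1 H2 E x Dx e He.
  destruct (Rtotal_order (h x) m) as [L|[L|L]].
  - destruct (H1 x (conj Dx (Rlt_le _ _ L)) e He) as [d [P K]].
    exists (Rmin d (m - h x)); split; [apply Rmin_pos; lra|]. intros y Dy Ly.
    assert (Q := Hh y x). destruct (Rmin_Rgt_l _ _ _ Ly) as [L1 L2].
    assert (Hy : h y <= m) by (apply Rabs_le_between in Q; lra).
    destruct (Rle_dec (h x) m); [|lra]. destruct (Rle_dec (h y) m); [|lra]. apply K; auto.
  - destruct (H1 x (conj Dx (Req_le _ _ L)) e He) as [d1 [P1 K1]].
    destruct (H2 x (conj Dx (Req_le _ _ (eq_sym L))) e He) as [d2 [P2 K2]].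
    exists (Rmin d1 d2); split; [now apply Rmin_pos|]. intros y Dy Ly.
    destruct (Rmin_Rgt_l _ _ _ Ly) as [L1 L2].
    destruct (Rle_dec (h x) m); [|lra]. destruct (Rle_dec (h y) m).
    + apply K1; auto.
    + rewrite (E x Dx L). apply K2; auto. split; auto; lra.
  - destruct (H2 x (conj Dx (Rlt_le _ _ L)) e He) as [d [P K]].
    exists (Rmin d (h x - m)); split; [apply Rmin_pos; lra|]. intros y Dy Ly.
    assert (Q := Hh y x). destruct (Rmin_Rgt_l _ _ _ Ly) as [L1 L2].
    assert (Hy : m < h y) by (apply Rabs_le_between in Q; lra).
    destruct (Rle_dec (h x) m); [lra|]. destruct (Rle_dec (h y) m); [lra|]. apply K; auto. split; auto; lra.
Qed.

(** A covering presented as a relation. The radius [d] depends on the base point alone, not on the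
    point [e] of a possibly infinite fibre. The instances are [rlam], [rexp] and [rroot]. *)
Definition evenly {B : Type} (dB : B -> B -> R) (inB : B -> Prop) (rel : B -> C -> Prop) : Prop :=
  forall b, inB b -> exists d, 0 < d /\ forall x0 e, inB x0 -> dB b x0 < d -> rel x0 e ->
    exists s : B -> C, s x0 = e /\ forall x, inB x -> dB b x < d -> rel x (s x) /\
      forall eps, 0 < eps -> exists eta, 0 < eta /\ forall x', inB x' -> dB b x' < d -> dB x x' < eta ->
        Cmod (s x - s x') < eps.

Section Lifting.

Variable B : Type.
Variable dB : B -> B -> R.
Variable inB : B -> Prop.
Variable rel : B -> C -> Prop.
Hypothesis Hev : evenly dB inB rel.
Hypothesis Hsep : forall b e, rel b e -> inB b -> exists eps, 0 < eps /\ exists del, 0 < del /\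
  forall b' e1 e2, inB b' -> dB b b' < del -> rel b' e1 -> rel b' e2 ->
    Cmod (e - e1) < eps -> Cmod (e - e2) < eps -> e1 = e2.

Definition is_lift (D : C -> Prop) (m : C -> B) (l : C -> C) : Prop :=
  contC D l /\ forall z, D z -> rel (m z) (l z).

Lemma lift_unique (x0 x1 y0 y1 : R) (m : C -> B) (l1 l2 : C -> C) (z0 : C) :
  contD (closed_rect x0 x1 y0 y1) dB m -> (forall z, closed_rect x0 x1 y0 y1 z -> inB (m z)) ->
  is_lift (closed_rect x0 x1 y0 y1) m l1 -> is_lift (closed_rect x0 x1 y0 y1) m l2 ->
  closed_rect x0 x1 y0 y1 z0 -> l1 z0 = l2 z0 -> forall z, closed_rect x0 x1 y0 y1 z -> l1 z = l2 z.
Proof.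
  intros Hm Hin [C1 R1] [C2 R2] D0 E0 z Dz.
  apply (rect_connected (fun z => l1 z = l2 z) x0 x1 y0 y1) with z0; auto.
  clear z Dz. intros z Dz. destruct (classic (l1 z = l2 z)) as [E|N].
  - destruct (Hsep _ _ (R1 z Dz) (Hin z Dz)) as [eps [P1 [del [P2 K]]]].
    destruct (Hm z Dz del P2) as [d1 [Q1 K1]]. destruct (C1 z Dz eps P1) as [d2 [Q2 K2]].
    destruct (C2 z Dz eps P1) as [d3 [Q3 K3]].
    exists (Rmin d1 (Rmin d2 d3)); split; [repeat apply Rmin_pos; auto|].
    intros w Dw L. split; auto. intros _.
    destruct (Rmin_Rgt_l _ _ _ L) as [L1 L'].
    destruct (Rmin_Rgt_l _ _ _ L') as [L2 L3].
    apply (K (m w)); auto. + apply (K2 w); auto. + rewrite E. apply (K3 w); auto.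
  - assert (P : 0 < Cmod (l1 z - l2 z)).
    { apply Cmod_pos. intros X. apply N. replace (l1 z) with (l1 z - l2 z + l2 z)%C by ring. rewrite X. ring. }
    set (c := Cmod (l1 z - l2 z)) in *.
    destruct (C1 z Dz (c / 2)) as [d2 [Q2 K2]]; [lra|]. destruct (C2 z Dz (c / 2)) as [d3 [Q3 K3]]; [lra|].
    exists (Rmin d2 d3); split; [apply Rmin_pos; auto|]. intros w Dw L. split; [|tauto]. intros Ew. exfalso.
    assert (L2 := K2 w Dw (Rlt_le_trans _ _ _ L (Rmin_l _ _))). assert (L3 := K3 w Dw (Rlt_le_trans _ _ _ L (Rmin_r _ _))).
    unfold dC in *. rewrite Ew in L2.
    assert (T := Cmod_tri (l1 z) (l2 w) (l2 z)). rewrite (Cmod_sym (l2 w)) in T. fold c in T. lra.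
Qed.

Definition liftable (m : C -> B) (D : C -> Prop) : Prop :=
  forall z0 e0, D z0 -> rel (m z0) e0 -> exists l, is_lift D m l /\ l z0 = e0.

(** The two lifts are chosen to agree at the point z1 of the common edge; uniqueness makes them
    agree along the whole edge, so they can be pasted. *)
Lemma lift_glue (m : C -> B) (D : C -> Prop) (h : C -> R) (c : R) (z1 : C) :
  (forall z w, Rabs (h z - h w) <= Cmod (z - w)) ->
  liftable m (fun z => D z /\ h z <= c) -> liftable m (fun z => D z /\ c <= h z) ->
  D z1 -> h z1 = c ->
  (forall l1 l2, is_lift (fun z => D z /\ h z = c) m l1 -> is_lift (fun z => D z /\ h z = c) m l2 ->
     l1 z1 = l2 z1 -> forall z, D z -> h z = c -> l1 z = l2 z) ->
  liftable m D.
Proof.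
  intros Hh L1 L2 D1 E1 U z0 e0 D0 R0.
  assert (K : exists l1 l2, is_lift (fun z => D z /\ h z <= c) m l1 /\ is_lift (fun z => D z /\ c <= h z) m l2 /\
     l1 z1 = l2 z1 /\ (if Rle_dec (h z0) c then l1 z0 else l2 z0) = e0).
  { destruct (Rle_dec (h z0) c) as [L|L].
    - destruct (L1 z0 e0 (conj D0 L) R0) as [l1 [A1 B1]].
      destruct (L2 z1 (l1 z1)) as [l2 [A2 B2]]; [split; auto; lra | apply A1; split; auto; lra|].
      exists l1, l2. auto.
    - destruct (L2 z0 e0 (conj D0 (Rlt_le _ _ (Rnot_le_lt _ _ L))) R0) as [l2 [A2 B2]].
      destruct (L1 z1 (l2 z1)) as [l1 [A1 B1]]; [split; auto; lra | apply A2; split; auto; lra|].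
      exists l1, l2. auto. }
  destruct K as [l1 [l2 [A1 [A2 [E E0]]]]].
  exists (fun z => if Rle_dec (h z) c then l1 z else l2 z). split; [|exact E0]. split.
  - apply contC_paste; auto; [apply A1 | apply A2 |]. intros z Dz Ez. apply (U l1 l2); auto.
    + split; [apply (contD_sub (fun z => D z /\ h z <= c)); [intros w [? ?]; split; auto; lra | apply A1]|].
      intros w [Dw Ew]. apply A1. split; auto; lra.
    + split; [apply (contD_sub (fun z => D z /\ c <= h z)); [intros w [? ?]; split; auto; lra | apply A2]|].
      intros w [Dw Ew]. apply A2. split; auto; lra.
  - intros z Dz. destruct (Rle_dec (h z) c); [apply A1 | apply A2]; split; auto; lra.
Qed.

Lemma liftable_equiv (m : C -> B) (D D' : C -> Prop) : (forall z, D z <-> D' z) -> liftable m D -> liftable m D'.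
Proof.
  intros E L z0 e0 D0 R0. destruct (L z0 e0 (proj2 (E z0) D0) R0) as [l [[Cl Rl] El]].
  exists l; split; auto. split.
  - apply (contD_sub D); auto. intros z Dz; now apply E.
  - intros z Dz. apply Rl. now apply E.
Qed.

Theorem lift_exists (x0 x1 y0 y1 : R) (m : C -> B) : x0 <= x1 -> y0 <= y1 ->
  contD (closed_rect x0 x1 y0 y1) dB m -> (forall z, closed_rect x0 x1 y0 y1 z -> inB (m z)) ->
  liftable m (closed_rect x0 x1 y0 y1).
Proof.
  intros Hx Hy Hm Hin.
  apply (bisect2d (fun a b c d => liftable m (closed_rect a b c d)) x0 x1 y0 y1); auto.
  - intros a k b c d H1 H2 H3 H4 Q1 Q2. apply (lift_glue m _ fst k (k, c)).
    + intros z w. apply (Cmod_fst (z - w)).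
    + eapply liftable_equiv; [|apply Q1]. intros z. unfold closed_rect. lra.
    + eapply liftable_equiv; [|apply Q2]. intros z. unfold closed_rect. lra.
    + unfold closed_rect; simpl; lra.
    + reflexivity.
    + intros l1 l2 A1 A2 E z Dz Ez.
      assert (S : forall w, closed_rect k k c d w -> closed_rect a b c d w /\ fst w = k) by (intros w; unfold closed_rect; lra).
      apply (lift_unique k k c d m l1 l2 (k, c)); auto.
      * apply (contD_sub (closed_rect x0 x1 y0 y1)); auto. intros w; unfold closed_rect; lra.
      * intros w Hw. apply Hin. unfold closed_rect in *; lra.
      * split; [apply (contD_sub _ _ _ _ S); apply A1 | intros w Hw; apply A1, S; auto].
      * split; [apply (contD_sub _ _ _ _ S); apply A2 | intros w Hw; apply A2, S; auto].
      * unfold closed_rect; simpl; lra.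
      * unfold closed_rect in *; lra.
  - intros a b c k d H1 H2 H3 H4 Q1 Q2. apply (lift_glue m _ snd k (a, k)).
    + intros z w. apply (Cmod_snd (z - w)).
    + eapply liftable_equiv; [|apply Q1]. intros z. unfold closed_rect. lra.
    + eapply liftable_equiv; [|apply Q2]. intros z. unfold closed_rect. lra.
    + unfold closed_rect; simpl; lra.
    + reflexivity.
    + intros l1 l2 A1 A2 E z Dz Ez.
      assert (S : forall w, closed_rect a b k k w -> closed_rect a b c d w /\ snd w = k) by (intros w; unfold closed_rect; lra).
      apply (lift_unique a b k k m l1 l2 (a, k)); auto.
      * apply (contD_sub (closed_rect x0 x1 y0 y1)); auto. intros w; unfold closed_rect; lra.
      * intros w Hw. apply Hin. unfold closed_rect in *; lra.
      * split; [apply (contD_sub _ _ _ _ S); apply A1 | intros w Hw; apply A1, S; auto].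
      * split; [apply (contD_sub _ _ _ _ S); apply A2 | intros w Hw; apply A2, S; auto].
      * unfold closed_rect; simpl; lra.
      * unfold closed_rect in *; lra.
  - intros x y Rx Ry. assert (D0 : closed_rect x0 x1 y0 y1 (x, y)) by (split; simpl; assumption).
    destruct (Hev (m (x, y)) (Hin _ D0)) as [d [Pd K]]. destruct (Hm _ D0 d Pd) as [del [P1 K1]].
    exists (del / 2); split; [lra|]. intros a b c e Ha Hb Hc Hd S1 S2 _ z0 e0 Dz0 R0.
    assert (Sub : forall w, closed_rect a b c e w -> closed_rect x0 x1 y0 y1 w) by (intros w; unfold closed_rect; lra).
    assert (Nr : forall w, closed_rect a b c e w -> dB (m (x, y)) (m w) < d).
    { intros w Dw. apply K1; auto. eapply Rle_lt_trans; [apply (near_rect a b c e x y); auto; lra|]. lra. }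
    destruct (K (m z0) e0 (Hin _ (Sub _ Dz0)) (Nr _ Dz0) R0) as [s [Es Ks]].
    exists (fun z => s (m z)). split; auto. split.
    + intros w Dw eps Heps. destruct (Ks (m w) (Hin _ (Sub _ Dw)) (Nr _ Dw)) as [_ Kc].
      destruct (Kc eps Heps) as [eta [Peta Ke]]. destruct (Hm w (Sub _ Dw) eta Peta) as [d2 [Pd2 Kd2]].
      exists d2; split; auto. intros w' Dw' Lw. apply Ke; auto.
    + intros w Dw. apply Ks; auto.
Qed.

End Lifting.

(** * Inverse function theorem *)

Lemma ball_convex (z0 z w : C) (r t : R) : 0 <= t <= 1 -> Cmod (z - z0) < r -> Cmod (w - z0) < r ->
  Cmod (z + t * (w - z) - z0) < r.
Proof.
  intros Ht Hz Hw.
  replace (z + t * (w - z) - z0)%C with ((1 - t)%R * (z - z0) + t * (w - z0))%C by (rewrite RtoC_minus; ring).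
  eapply Rle_lt_trans; [apply Cmod_triangle|]. rewrite !Cmod_mult, !Cmod_R, !Rabs_pos_eq by lra.
  destruct (Req_dec t 0) as [->|N]; [lra|].
  assert (t * Cmod (w - z0) < t * r) by (apply Rmult_lt_compat_l; lra).
  assert ((1 - t) * Cmod (z - z0) <= (1 - t) * r) by (apply Rmult_le_compat_l; lra). lra.
Qed.

Lemma inverse_function (F F' : C -> C) (z0 : C) (R0 : R) : 0 < R0 ->
  (forall z, Cmod (z - z0) < R0 -> cder F z (F' z)) -> F' z0 <> 0%C ->
  (forall e, 0 < e -> exists d, 0 < d /\ forall z, Cmod (z - z0) < d -> Cmod (F' z - F' z0) < e) ->
  exists r k d, 0 < r <= R0 /\ 0 < k /\ 0 < d /\
    (forall z w, Cmod (z - z0) < r -> Cmod (w - z0) < r -> k * Cmod (z - w) <= Cmod (F z - F w)) /\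
    forall z1, Cmod (z1 - z0) < r / 2 -> forall x, Cmod (x - F z1) < d -> exists z, Cmod (z - z0) < r /\ F z = x.
Proof.
  intros HR HF Na Hc. set (a := F' z0) in *. assert (Pa := Cmod_pos a Na).
  destruct (Hc (Cmod a / 2)) as [d0 [D0 K0]]; [lra|].
  set (r := Rmin R0 d0). assert (Pr : 0 < r) by (now apply Rmin_pos).
  assert (Lin : forall z w, Cmod (z - z0) < r -> Cmod (w - z0) < r ->
     Cmod (F w - F z - a * (w - z)) <= Cmod a / 2 * Cmod (w - z)).
  { intros z w Hz Hw. apply (cder_mean_value F F').
    - intros t Ht. apply HF. eapply Rlt_le_trans; [now apply (ball_convex z0 z w r) | apply Rmin_l].
    - intros t Ht. left. apply K0. eapply Rlt_le_trans; [now apply (ball_convex z0 z w r) | apply Rmin_r]. }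
  exists r, (Cmod a / 2), (Cmod a * r / 8).
  split; [split; auto; apply Rmin_l|]. split; [lra|]. split; [nra|]. split.
  - intros z w Hz Hw. assert (Q := Lin w z Hw Hz).
    assert (T := Cmod_rev (a * (z - w)) (- (F z - F w - a * (z - w)))).
    replace (a * (z - w) - - (F z - F w - a * (z - w)))%C with (F z - F w)%C in T by ring.
    rewrite Cmod_opp, Cmod_mult in T. lra.
  - intros z1 Hz1 x Hx.
    set (step := fun z => (z + (x - F z) / a)%C).
    set (v := fun n => Nat.iter n step z1).
    (* The bound on the steps halves each time, so the iterates stay within r/4 of z1, inside the
       ball where [Lin] holds. *)
    assert (V : forall n, Cmod (v n - z1) <= r / 4 * (1 - / 2 ^ n) /\ Cmod (v (S n) - v n) <= r / 8 * / 2 ^ n).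
    { assert (B : forall n, Cmod (v n - z1) <= r / 4 -> Cmod (v n - z0) < r).
      { intros n Hn. eapply Rle_lt_trans; [apply (Cmod_tri _ z1)|]. lra. }
      induction n as [|n [I1 I2]].
      - simpl. split.
        + replace (z1 - z1)%C with (RtoC 0) by ring. rewrite Cmod_0. lra.
        + unfold step. replace (z1 + (x - F z1) / a - z1)%C with ((x - F z1) / a)%C by ring.
          rewrite Cmod_div by auto. apply (Rmult_le_reg_r (Cmod a)); auto.
          unfold Rdiv at 1. rewrite Rmult_assoc, Rinv_l by lra. lra.
      - assert (P2 : 0 < / 2 ^ n) by (apply Rinv_0_lt_compat, pow_lt; lra).
        assert (E2 : / 2 ^ S n = / 2 ^ n / 2) by (simpl; field; apply pow_nonzero; lra).
        assert (J1 : Cmod (v (S n) - z1) <= r / 4 * (1 - / 2 ^ S n)).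
        { eapply Rle_trans; [apply (Cmod_tri _ (v n))|]. rewrite E2. lra. }
        split; auto.
        assert (B1 : Cmod (v n - z0) < r) by (apply B; nra).
        assert (P3 : 0 < / 2 ^ S n) by (rewrite E2; lra).
        assert (B2 : Cmod (v (S n) - z0) < r) by (apply B; nra).
        assert (Q := Lin (v n) (v (S n)) B1 B2).
        assert (Ev : forall k, v (S k) = (v k + (x - F (v k)) / a)%C) by reflexivity.
        rewrite (Ev (S n)).
        replace (v (S n) + (x - F (v (S n))) / a - v (S n))%C with (- (F (v (S n)) - F (v n) - a * (v (S n) - v n)) / a)%C
          by (rewrite (Ev n); field; auto).
        rewrite Cmod_div, Cmod_opp by auto. apply (Rmult_le_reg_r (Cmod a)); auto.
        unfold Rdiv at 1. rewrite Rmult_assoc, Rinv_l, Rmult_1_r by lra.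
        eapply Rle_trans; [apply Q|]. rewrite E2.
        assert (Cmod a / 2 * Cmod (v (S n) - v n) <= Cmod a / 2 * (r / 8 * / 2 ^ n)) by (apply Rmult_le_compat_l; lra). lra. }
    assert (Vd : forall n k, Cmod (v (n + k)%nat - v n) <= r / 4 * (/ 2 ^ n - / 2 ^ (n + k))).
    { intros n. induction k.
      - rewrite Nat.add_0_r. replace (v n - v n)%C with (RtoC 0) by ring. rewrite Cmod_0. lra.
      - rewrite Nat.add_succ_r. eapply Rle_trans; [apply (Cmod_tri _ (v (n + k)%nat))|].
        destruct (V (n + k)%nat) as [_ Q].
        assert (E2 : / 2 ^ S (n + k) = / 2 ^ (n + k) / 2) by (simpl; field; apply pow_nonzero; lra). rewrite E2. lra. }
    destruct (C_complete v) as [l Hl].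
    { intros e He. destruct (halving (r / 4) e He) as [N HN]. exists N.
      assert (K : forall n m, (N <= n)%nat -> (n <= m)%nat -> Cmod (v m - v n) < e).
      { intros n m Hn Hm. replace m with (n + (m - n))%nat by lia. eapply Rle_lt_trans; [apply Vd|].
        assert (0 < / 2 ^ (n + (m - n))) by (apply Rinv_0_lt_compat, pow_lt; lra).
        assert (/ 2 ^ n <= / 2 ^ N) by (apply Rinv_le_contravar; [apply pow_lt; lra | apply Rle_pow; [lra|auto]]).
        unfold Rdiv in HN. nra. }
      intros n m Hn Hm. destruct (Nat.le_ge_cases n m); [rewrite Cmod_sym|]; apply K; auto. }
    assert (Bl : Cmod (l - z1) <= r / 4).
    { apply le_epsilon. intros e He. destruct (Hl e He) as [N HN]. specialize (HN N (le_n _)). destruct (V N) as [Q _].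
      assert (0 < / 2 ^ N) by (apply Rinv_0_lt_compat, pow_lt; lra).
      eapply Rle_trans; [apply (Cmod_tri _ (v N))|]. rewrite Cmod_sym in HN. nra. }
    assert (Bl0 : Cmod (l - z0) < r) by (eapply Rle_lt_trans; [apply (Cmod_tri _ z1)|]; lra).
    exists l. split; auto. symmetry. apply Cmod_sub_small. intros e He.
    (* x - F (v n) = a (v (n+1) - v n) tends to 0 *)
    destruct (cder_cont _ _ _ (HF l (Rlt_le_trans _ _ _ Bl0 (Rmin_l _ _))) (e / 2)) as [d1 [D1 K1]]; [lra|].
    destruct (Hl d1 D1) as [N1 H1]. destruct (halving (Cmod a * r / 8) (e / 2)) as [N2 H2]; [lra|].
    set (n := max N1 N2). specialize (H1 n ltac:(lia)). specialize (K1 (v n) H1).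
    destruct (V n) as [_ Q].
    replace (x - F l)%C with (a * (v (S n) - v n) + (F (v n) - F l))%C
      by (change (v (S n)) with (v n + (x - F (v n)) / a)%C; field; auto).
    eapply Rle_lt_trans; [apply Cmod_triangle|]. rewrite Cmod_mult.
    assert (Hn : / 2 ^ n <= / 2 ^ N2) by (apply Rinv_le_contravar; [apply pow_lt; lra | apply Rle_pow; [lra|lia]]).
    assert (Cmod a * Cmod (v (S n) - v n) <= Cmod a * (r / 8 * / 2 ^ n)) by (apply Rmult_le_compat_l; lra).
    assert (0 <= Cmod a * r / 8) by nra.
    assert (Cmod a * r / 8 * / 2 ^ n <= Cmod a * r / 8 * / 2 ^ N2) by (apply Rmult_le_compat_l; auto).
    unfold Rdiv in H2 at 1. unfold Rdiv in *. lra.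
Qed.

(** The radius of the ball around [F z1] is explicit so that it can be made uniform by
    compactness. *)
Definition sec_at (F : C -> C) (U : C -> Prop) (z1 : C) (d : R) : Prop :=
  exists s : C -> C, s (F z1) = z1 /\ forall x, Cmod (F z1 - x) < d -> U (s x) /\ F (s x) = x /\
    forall e, 0 < e -> exists eta, 0 < eta /\ forall x', Cmod (F z1 - x') < d -> Cmod (x - x') < eta ->
      Cmod (s x - s x') < e.

Lemma local_section (F F' : C -> C) (z0 : C) (R0 : R) : 0 < R0 ->
  (forall z, Cmod (z - z0) < R0 -> cder F z (F' z)) -> F' z0 <> 0%C ->
  (forall e, 0 < e -> exists d, 0 < d /\ forall z, Cmod (z - z0) < d -> Cmod (F' z - F' z0) < e) ->
  exists r d, 0 < r /\ 0 < d /\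
    (forall z w, Cmod (z - z0) < r -> Cmod (w - z0) < r -> F z = F w -> z = w) /\
    forall z1, Cmod (z1 - z0) < r -> sec_at F (fun z => Cmod (z - z0) < R0) z1 d.
Proof.
  intros HR HF Na Hc. destruct (inverse_function F F' z0 R0 HR HF Na Hc) as [r [k [d [Hr [Hk [Hd [Inj Sur]]]]]]].
  assert (Inj' : forall z w, Cmod (z - z0) < r -> Cmod (w - z0) < r -> F z = F w -> z = w).
  { intros z w Hz Hw E. specialize (Inj z w Hz Hw). rewrite E in Inj.
    replace (F w - F w)%C with (RtoC 0) in Inj by ring. rewrite Cmod_0 in Inj.
    apply Cmod_sub0. generalize (Cmod_ge_0 (z - w)); nra. }
  exists (r / 2), d. split; [lra|]. split; auto. split.
  { intros z w Hz Hw. apply Inj'; lra. }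
  intros z1 Hz1. set (s := fun x => epsilon (inhabits (RtoC 0)) (fun z => Cmod (z - z0) < r /\ F z = x)).
  assert (Hs : forall x, Cmod (F z1 - x) < d -> Cmod (s x - z0) < r /\ F (s x) = x).
  { intros x Hx. unfold s. apply epsilon_spec. apply (Sur z1); auto. now rewrite Cmod_sym. }
  exists s. split.
  { destruct (Hs (F z1)) as [A1 A2].
    - replace (F z1 - F z1)%C with (RtoC 0) by ring. now rewrite Cmod_0.
    - apply Inj'; auto; lra. }
  intros x Hx. destruct (Hs x Hx) as [A1 A2]. split; [lra|]. split; auto.
  intros e He. exists (k * e); split; [nra|]. intros x' Hx' L. destruct (Hs x' Hx') as [B1 B2].
  specialize (Inj _ _ A1 B1). rewrite A2, B2 in Inj. apply (Rmult_lt_reg_l k); auto. lra.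
Qed.

Lemma lam_local (z0 : C) : HH z0 -> exists r d, 0 < r /\ 0 < d /\
    (forall z w, Cmod (z - z0) < r -> Cmod (w - z0) < r -> lam z = lam w -> z = w) /\
    forall z1, Cmod (z1 - z0) < r -> sec_at lam HH z1 d.
Proof.
  intros H0. destruct (local_section lam dlam z0 (snd z0) H0) as [r [d [Pr [Pd [I S]]]]].
  - intros z Hz. apply lam_cder. now apply (HH_near z0).
  - now apply dlam_neq0.
  - intros e He. destruct (dlam_cont z0 H0 e He) as [d [P K]].
    exists (Rmin d (snd z0)); split; [now apply Rmin_pos|]. intros z Hz.
    rewrite Cmod_sym. apply K; [|eapply Rlt_le_trans; [apply Hz | apply Rmin_l]].
    apply (HH_near z0); auto. eapply Rlt_le_trans; [apply Hz | apply Rmin_r].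
  - exists r, d. repeat split; auto. intros z1 Hz1. destruct (S z1 Hz1) as [s [E K]].
    exists s. split; auto. intros x Hx. destruct (K x Hx) as [A B]. split; auto. now apply (HH_near z0).
Qed.

Lemma sec_at_le (F : C -> C) (U : C -> Prop) (z1 : C) (d d' : R) : d' <= d -> sec_at F U z1 d -> sec_at F U z1 d'.
Proof.
  intros L [s [E K]]. exists s; split; auto. intros x Hx. destruct (K x ltac:(lra)) as [A [B Cc]].
  repeat split; auto. intros e He. destruct (Cc e He) as [eta [P Q]]. exists eta; split; auto.
  intros x' Hx'. apply Q. lra.
Qed.

(** Compactness of the rectangle: by bisection, finitely many radii from [lam_local] suffice, and
    the minimum is taken. *)
Lemma lam_uniform (x0 x1 y0 y1 : R) : x0 <= x1 -> y0 <= y1 -> 0 < y0 ->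
  exists d, 0 < d /\ forall z, closed_rect x0 x1 y0 y1 z -> sec_at lam HH z d.
Proof.
  intros Hx Hy P0.
  apply (bisect2d (fun a b c e => exists d, 0 < d /\ forall z, closed_rect a b c e z -> sec_at lam HH z d) x0 x1 y0 y1); auto.
  - intros a m b c e _ _ _ _ [d1 [P1 K1]] [d2 [P2 K2]]. exists (Rmin d1 d2); split; [now apply Rmin_pos|].
    intros z Hz. destruct (Rle_or_lt (fst z) m).
    + apply (sec_at_le _ _ _ d1); [apply Rmin_l|]. apply K1. unfold closed_rect in *; lra.
    + apply (sec_at_le _ _ _ d2); [apply Rmin_r|]. apply K2. unfold closed_rect in *; lra.
  - intros a b c m e _ _ _ _ [d1 [P1 K1]] [d2 [P2 K2]]. exists (Rmin d1 d2); split; [now apply Rmin_pos|].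
    intros z Hz. destruct (Rle_or_lt (snd z) m).
    + apply (sec_at_le _ _ _ d1); [apply Rmin_l|]. apply K1. unfold closed_rect in *; lra.
    + apply (sec_at_le _ _ _ d2); [apply Rmin_r|]. apply K2. unfold closed_rect in *; lra.
  - intros x y Rx Ry. destruct (lam_local (x, y)) as [r [d [Pr [Pd [_ S]]]]]; [unfold HH; simpl; lra|].
    exists (r / 2); split; [lra|]. intros a b c e Ha Hb Hc He S1 S2 _. exists d; split; auto.
    intros z Hz. apply S. eapply Rle_lt_trans; [apply (near_rect a b c e x y); auto; lra|]. lra.
Qed.

(** * The six anharmonic substitutions *)

(** The action of the symmetric group S_3 on the ratio of a triple. Composition with 1 - x or x / (x
    - 1) permutes the six maps; every index from 5 on denotes the last one. *)
Definition anh (k : nat) (x : C) : C :=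
  match k with
  | 0%nat => x | 1%nat => 1 - x | 2%nat => x / (x - 1) | 3%nat => / x | 4%nat => / (1 - x) | _ => (x - 1) / x
  end%C.

Lemma Cinv_neq0 (z : C) : z <> 0%C -> (/ z)%C <> 0%C.
Proof.
  intros H E. assert (Q : (z * / z)%C = 1%C) by (field; auto). rewrite E in Q.
  assert (Z : RtoC 0 = 1%C) by (rewrite <- Q; ring). apply RtoC_inj in Z. lra.
Qed.

Lemma Copp_neq0 (z : C) : z <> 0%C -> (- z)%C <> 0%C.
Proof. intros H E. apply H. replace z with (- - z)%C by ring. rewrite E. ring. Qed.

Lemma anh_side (x : C) : x <> 0%C -> x <> 1%C -> (x - 1)%C <> 0%C /\ (1 - x)%C <> 0%C.
Proof.
  intros H0 H1. split; intros E; apply H1.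
  - replace x with (x - 1 + 1)%C by ring. rewrite E. ring.
  - replace x with (1 - (1 - x))%C by ring. rewrite E. ring.
Qed.

Lemma anh_s (k : nat) : exists k', forall x : C, x <> 0%C -> x <> 1%C -> anh k (1 - x) = anh k' x.
Proof.
  destruct k as [|[|[|[|[|k]]]]]; [exists 1%nat|exists 0%nat|exists 5%nat|exists 4%nat|exists 3%nat|exists 2%nat];
  intros x H0 H1; simpl; destruct (anh_side x H0 H1) as [S1 S2]; try solve [field; repeat split; auto].
  replace (1 - x - 1)%C with (- x)%C by ring. field; repeat split; auto using Copp_neq0.
Qed.

Lemma anh_t (k : nat) : exists k', forall x : C, x <> 0%C -> x <> 1%C -> anh k (x / (x - 1)) = anh k' x.
Proof.
  destruct k as [|[|[|[|[|k]]]]]; [exists 2%nat|exists 4%nat|exists 0%nat|exists 5%nat|exists 1%nat|exists 3%nat];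
  intros x H0 H1; simpl; destruct (anh_side x H0 H1) as [S1 S2];
  assert (E1 : (x / (x - 1) - 1)%C = (/ (x - 1))%C) by (field; auto);
  assert (E2 : (1 - x / (x - 1))%C = (- / (x - 1))%C) by (field; auto);
  rewrite ?E1, ?E2; try solve [field; repeat split; auto].
Qed.

Lemma anh_range (k : nat) (x : C) : x <> 0%C -> x <> 1%C -> anh k x <> 0%C.
Proof.
  intros H0 H1. destruct (anh_side x H0 H1) as [S1 S2].
  destruct k as [|[|[|[|[|k]]]]]; simpl; auto.
  - now apply Cdiv_neq0.
  - now apply Cinv_neq0.
  - now apply Cinv_neq0.
  - now apply Cdiv_neq0.
Qed.

Lemma anh_inv (k : nat) : exists k', forall x : C, x <> 0%C -> x <> 1%C -> anh k' (anh k x) = x.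
Proof.
  destruct k as [|[|[|[|[|k]]]]]; [exists 0%nat|exists 1%nat|exists 2%nat|exists 3%nat|exists 5%nat|exists 4%nat];
  intros x H0 H1; simpl; destruct (anh_side x H0 H1) as [S1 S2].
  - auto.
  - ring.
  - assert (E1 : (x / (x - 1) - 1)%C = (/ (x - 1))%C) by (field; auto). rewrite E1. field. auto.
  - field. auto.
  - field. auto.
  - assert (E1 : (1 - (x - 1) / x)%C = (/ x)%C) by (field; auto). rewrite E1. field. auto.
Qed.

Lemma anh_inj (k : nat) (x y : C) : x <> 0%C -> x <> 1%C -> y <> 0%C -> y <> 1%C -> anh k x = anh k y -> x = y.
Proof.
  intros. destruct (anh_inv k) as [k' K]. rewrite <- (K x), <- (K y); auto. now f_equal.
Qed.

Definition not01 (x : C) : Prop := x <> 0%C /\ x <> 1%C.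

Lemma anh_cont (k : nat) : contC not01 (anh k).
Proof.
  assert (S : forall x, not01 x -> (x - 1)%C <> 0%C /\ (1 - x)%C <> 0%C) by (intros x [? ?]; now apply anh_side).
  destruct k as [|[|[|[|[|k]]]]]; simpl.
  - apply contC_id.
  - apply contC_minus; [apply contC_const | apply contC_id].
  - apply contC_div; [apply contC_id | apply contC_minus; [apply contC_id | apply contC_const] | intros; now apply S].
  - apply (contD_ext _ _ (fun x => 1 / x)%C); [intros x [Hx _]; unfold anh; cbv beta; field; auto|].
    apply contC_div; [apply contC_const | apply contC_id | intros z [Hz _]; auto].
  - apply (contD_ext _ _ (fun x => 1 / (1 - x))%C); [intros x Hx; unfold anh; cbv beta; field; now apply S|].
    apply contC_div; [apply contC_const | apply contC_minus; [apply contC_const | apply contC_id] | intros; now apply S].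
  - apply contC_div; [apply contC_minus; [apply contC_id | apply contC_const] | apply contC_id | intros z [Hz _]; auto].
Qed.

Lemma lam_not01 (t : C) : HH t -> not01 (lam t).
Proof. split; [now apply lam_neq0 | now apply lam_neq1]. Qed.

(* [ph] is a modular substitution with inverse [ps], acting on lambda by the [k]-th anharmonic map. *)
Definition equivariant (k : nat) (ph ps : C -> C) : Prop :=
  contC HH ps /\ (forall t, HH t -> HH (ph t) /\ HH (ps t) /\ ph (ps t) = t /\ ps (ph t) = t /\ lam (ph t) = anh k (lam t)).

Lemma equivariant_id : equivariant 0 (fun t => t) (fun t => t).
Proof. split; [apply contC_id|]. intros t Ht. repeat split; auto. Qed.

Lemma inv_cont : contC HH (fun t => - / t)%C.
Proof.
  apply contC_opp. apply (contD_ext _ _ (fun x => 1 / x)%C); [intros x Hx; unfold anh; cbv beta; field; now apply HH_neq0|].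
  apply contC_div; [apply contC_const | apply contC_id | intros; now apply HH_neq0].
Qed.

Lemma inv_inv (t : C) : HH t -> (- / - / t)%C = t.
Proof.
  intros Ht. assert (N := HH_neq0 t Ht).
  transitivity (- (-1 / (/ t)))%C; [|field; auto]. f_equal.
  assert (N1 := Cinv_neq0 t N). assert (N2 := Copp_neq0 _ N1).
  replace (- / t)%C with (-1 * / t)%C by ring. field. auto.
Qed.

Lemma equivariant_S (k : nat) (ph ps : C -> C) : equivariant k ph ps ->
  exists k', equivariant k' (fun t => ph (- / t)%C) (fun t => - / ps t)%C.
Proof.
  intros [Hc H]. destruct (anh_s k) as [k' K]. exists k'. split.
  - apply (contC_comp HH HH ps (fun t => - / t)%C); auto; [apply inv_cont|]. intros z Hz. now apply H.
  - intros t Ht. destruct (H t Ht) as [A [B [D [E F]]]]. destruct (H _ (HH_inv t Ht)) as [A' [B' [D' [E' F']]]].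
    repeat split; auto using HH_inv.
    + rewrite inv_inv; auto.
    + rewrite E'. now apply inv_inv.
    + rewrite F', lam_S by auto. apply K; apply lam_not01; auto.
Qed.

Lemma HH_trans (t : C) (x : R) : HH t -> HH (t + RtoC x).
Proof. unfold HH; destruct t; simpl; lra. Qed.

Lemma lam_Tinv (t : C) : HH t -> lam (t - 1) = (lam t / (lam t - 1))%C.
Proof.
  intros Ht. assert (H1 : HH (t - 1)) by (unfold HH in *; destruct t; simpl in *; lra).
  assert (E := lam_T _ H1). replace (t - 1 + 1)%C with t in E by ring.
  destruct (anh_side (lam (t - 1))) as [S1 S2]; try now apply lam_not01.
  rewrite E. set (m := lam (t - 1)) in *.
  assert (E1 : (m / (m - 1) - 1)%C = (/ (m - 1))%C) by (field; auto). rewrite E1. field. auto.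
Qed.

Lemma equivariant_T (k : nat) (ph ps : C -> C) (e : R) : (e = 1 \/ e = -1) -> equivariant k ph ps ->
  exists k', equivariant k' (fun t => ph (t + RtoC e)%C) (fun t => ps t - RtoC e)%C.
Proof.
  intros He [Hc H]. destruct (anh_t k) as [k' K]. exists k'. split.
  - apply contC_minus; auto. apply contC_const.
  - intros t Ht. destruct (H t Ht) as [A [B [D [E F]]]]. destruct (H _ (HH_trans t e Ht)) as [A' [B' [D' [E' F']]]].
    repeat split; auto.
    + replace (ps t - RtoC e)%C with (ps t + RtoC (- e))%C by (rewrite RtoC_opp; ring). now apply HH_trans.
    + replace (ps t - RtoC e + RtoC e)%C with (ps t) by ring. auto.
    + rewrite E'. ring.
    + rewrite F'. replace (lam (t + RtoC e)) with (lam t / (lam t - 1))%C; [apply K; apply lam_not01; auto|].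
      destruct He as [-> | ->].
      * now rewrite <- lam_T.
      * rewrite <- lam_Tinv by auto. apply (f_equal lam). cparts; ring.
Qed.

(** The region |Re| <= 1/2, Im >= 1/2 contains the usual fundamental domain. Being larger, it is
    reached by a plain doubling argument on the imaginary part. *)
Definition red (t : C) : Prop := exists k ph ps, equivariant k ph ps /\ Rabs (fst (ph t)) <= 1 / 2 /\ 1 / 2 <= snd (ph t).

Lemma red_T (t : C) (e : R) : (e = 1 \/ e = -1) -> red (t + RtoC e) -> red t.
Proof.
  intros He [k [ph [ps [E H]]]]. destruct (equivariant_T k ph ps e He E) as [k' E'].
  exists k', (fun t => ph (t + RtoC e)%C), (fun t => ps t - RtoC e)%C. auto.
Qed.

Lemma red_translate (t : C) (n : nat) (e : R) : (e = 1 \/ e = -1) -> red (t + RtoC (INR n * e)) -> red t.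
Proof.
  intros He. revert t. induction n; intros t H.
  - simpl in H. replace (t + RtoC (0 * e))%C with t in H by (rewrite RtoC_mult; ring). auto.
  - apply (red_T t e He). apply IHn. replace (t + RtoC e + RtoC (INR n * e))%C with (t + RtoC (INR (S n) * e))%C; auto.
    rewrite S_INR, !RtoC_mult, RtoC_plus. ring.
Qed.

Lemma near_int (x : R) : exists n e, (e = 1 \/ e = -1) /\ Rabs (x + INR n * e) <= 1 / 2.
Proof.
  assert (K : forall x, 0 <= x -> exists n, Rabs (x - INR n) <= 1 / 2).
  { intros y Hy. destruct (nfloor_ex (y + 1/2)) as [n Hn]; [lra|]. exists n. apply Rabs_le. lra. }
  destruct (Rle_or_lt 0 x).
  - destruct (K x H) as [n Hn]. exists n, (-1). split; auto. replace (x + INR n * -1) with (x - INR n) by ring. auto.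
  - destruct (K (- x) ltac:(lra)) as [n Hn]. exists n, 1. split; auto.
    replace (x + INR n * 1) with (- (- x - INR n)) by ring. now rewrite Rabs_Ropp.
Qed.

(* Inverting a point with [|Re| <= 1/2] and [Im < 1/2] at least doubles its imaginary part. *)
Lemma reduction (n : nat) : forall t, HH t -> / 2 ^ n / 2 <= snd t -> red t.
Proof.
  induction n; intros t Ht L.
  - destruct (near_int (fst t)) as [m [e [He Hm]]]. apply (red_translate t m e He).
    exists 0%nat, (fun t => t), (fun t => t). split; [apply equivariant_id|].
    replace (fst (t + RtoC (INR m * e))%C) with (fst t + INR m * e) by (destruct t; simpl; ring).
    replace (snd (t + RtoC (INR m * e))%C) with (snd t) by (destruct t; simpl; ring).
    split; auto. simpl in L. lra.
  - destruct (near_int (fst t)) as [m [e [He Hm]]]. apply (red_translate t m e He).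
    assert (Ht' := HH_trans t (INR m * e) Ht). set (t' := (t + RtoC (INR m * e))%C) in *.
    assert (E1 : fst t' = fst t + INR m * e) by (unfold t'; destruct t; simpl; ring).
    assert (E2 : snd t' = snd t) by (unfold t'; destruct t; simpl; ring).
    destruct (Rle_or_lt (1/2) (snd t')) as [H|H].
    + exists 0%nat, (fun t => t), (fun t => t). split; [apply equivariant_id|]. rewrite E1. auto.
    + destruct (IHn (- / t')%C) as [k [ph [ps [Eq K]]]].
      * now apply HH_inv.
      * replace (snd (- / t')%C) with (snd t' / (fst t' ^ 2 + snd t' ^ 2)).
        2:{ destruct t' as [a b]; simpl in *. unfold HH in Ht'; simpl in Ht'. field. nra. }
        assert (P : 0 < snd t') by apply Ht'. rewrite <- E1 in Hm.
        assert (Q : fst t' ^ 2 + snd t' ^ 2 <= 1 / 2).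
        { assert (fst t' ^ 2 <= 1 / 4) by (rewrite <- (pow2_abs (fst t')); generalize (Rabs_pos (fst t')); nra). nra. }
        assert (Q0 : 0 < fst t' ^ 2 + snd t' ^ 2) by (generalize (pow2_ge_0 (fst t')); nra).
        apply (Rmult_le_reg_r (fst t' ^ 2 + snd t' ^ 2)); auto.
        unfold Rdiv at 2. rewrite Rmult_assoc, Rinv_l, Rmult_1_r by lra.
        rewrite <- E2 in L. assert (P2 : 0 < / 2 ^ n) by (apply Rinv_0_lt_compat, pow_lt; lra).
        assert (E3 : / 2 ^ S n = / 2 ^ n / 2) by (simpl; field; apply pow_nonzero; lra). rewrite E3 in L. nra.
      * destruct (equivariant_S k ph ps Eq) as [k' Eq'].
        exists k', (fun t => ph (- / t)%C), (fun t => - / ps t)%C. auto.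
Qed.

Lemma red_all (t : C) : HH t -> red t.
Proof.
  intros Ht. destruct (halving (1/2) (snd t) Ht) as [n Hn]. apply (reduction n t Ht). unfold Rdiv in *. lra.
Qed.

Definition rlam (x t : C) : Prop := HH t /\ lam t = x.

Lemma finite_min (n : nat) (f : nat -> R) : (forall k, 0 < f k) -> exists m, 0 < m /\ forall k, (k < n)%nat -> m <= f k.
Proof.
  intros Hf. induction n as [|n [m [Pm Hm]]]; [exists 1; split; [lra | lia]|].
  exists (Rmin m (f n)). split; [now apply Rmin_pos|]. intros k Hk. destruct (Nat.eq_dec k n) as [->|N]; [apply Rmin_r|].
  eapply Rle_trans; [apply Rmin_l | apply Hm; lia].
Qed.

(** A point t over x0 is moved by a modular substitution into the reduced region. Its height there
    is bounded, because the transformed value stays away from 0 while [lam] tends to 0 at the cusp.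
    So it lies in a compact rectangle with a uniform section radius, and [ps] carries the section
    back to t. *)
Lemma lam_evenly : evenly dC not01 rlam.
Proof.
  intros b Hb.
  (* Only six substitutions of values occur, so the constants below can be chosen for all of them at
     once, before t is known. *)
  assert (Sat : forall k, exists k', (k' < 6)%nat /\ forall x, anh k x = anh k' x).
  { intros k. destruct k as [|[|[|[|[|k]]]]]; [exists 0%nat|exists 1%nat|exists 2%nat|exists 3%nat|exists 4%nat|exists 5%nat];
    split; try lia; auto. }
  destruct (finite_min 6 (fun k => Cmod (anh k b))) as [mu [Pmu Hmu]].
  { intros k. apply Cmod_pos, anh_range; apply Hb. }
  destruct (lam_small (mu / 2)) as [Y [HY KY]]; [lra|].
  destruct (lam_uniform (-1/2) (1/2) (1/2) Y) as [d0 [Pd0 Kd0]]; try lra.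
  set (e0 := Rmin (mu / 2) (d0 / 2)). assert (Pe0 : 0 < e0) by (unfold e0; apply Rmin_pos; lra).
  assert (Ck : forall k, exists d, 0 < d /\ forall x, not01 x -> Cmod (x - b) < d -> Cmod (anh k b - anh k x) < e0).
  { intros k. destruct (anh_cont k b Hb e0 Pe0) as [d [P K]]. exists d. auto. }
  set (dk := fun k => proj1_sig (constructive_indefinite_description _ (Ck k))).
  assert (Hdk : forall k, 0 < dk k /\ forall x, not01 x -> Cmod (x - b) < dk k -> Cmod (anh k b - anh k x) < e0).
  { intros k. unfold dk. destruct (constructive_indefinite_description _ (Ck k)) as [d Hd]. auto. }
  destruct (finite_min 6 dk) as [d [Pd Hd]]; [intros; apply Hdk|].
  exists d; split; auto. unfold dC. intros x0 t Hx0 Lx0 [Ht Et].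
  destruct (red_all t Ht) as [k0 [ph [ps [[Cps Eq] [R1 R2]]]]].
  destruct (Sat k0) as [k [Hk6 Sk]].
  destruct (Eq t Ht) as [A [B [D [E F]]]]. rewrite Sk, Et in F.
  assert (Near : forall x, not01 x -> Cmod (b - x) < d -> Cmod (anh k b - anh k x) < e0).
  { intros x Nx Lx. apply Hdk; auto. rewrite Cmod_sym. specialize (Hd k Hk6). lra. }
  assert (L0 := Near x0 Hx0 Lx0).
  assert (e1 : e0 <= mu / 2) by apply Rmin_l. assert (e2 : e0 <= d0 / 2) by apply Rmin_r.
  assert (ImY : snd (ph t) <= Y).
  { destruct (Rle_or_lt (snd (ph t)) Y) as [|L]; auto. exfalso.
    specialize (KY (ph t) ltac:(lra)). rewrite F in KY. specialize (Hmu k Hk6).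
    assert (T := Cmod_rev (anh k b) (anh k b - anh k x0)).
    replace (anh k b - (anh k b - anh k x0))%C with (anh k x0) in T by ring. lra. }
  destruct (Kd0 (ph t)) as [s0 [Es0 Ks0]].
  { split; [apply Rabs_le_between in R1; lra | lra]. }
  rewrite F in Es0, Ks0.
  exists (fun x => ps (s0 (anh k x))). split.
  { rewrite Es0. auto. }
  assert (Near2 : forall x, not01 x -> Cmod (b - x) < d -> Cmod (anh k x0 - anh k x) < d0).
  { intros x Nx Lx. assert (Q := Near x Nx Lx). eapply Rle_lt_trans; [apply (Cmod_tri _ (anh k b))|].
    rewrite (Cmod_sym _ (anh k b)). lra. }
  intros x Nx Lx. destruct (Ks0 (anh k x) (Near2 x Nx Lx)) as [U1 [U2 U3]].
  destruct (Eq _ U1) as [A' [B' [D' [E' F']]]]. destruct (Eq _ B') as [_ [_ [_ [_ F'']]]].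
  split.
  - split; auto. rewrite D', U2, Sk in F''.
    symmetry. apply (anh_inj k); try apply Nx; auto; now apply lam_not01.
  - intros e He. destruct (Cps _ U1 e He) as [d1 [Pd1 Kd1]]. destruct (U3 d1 Pd1) as [d2 [Pd2 Kd2]].
    destruct (anh_cont k x Nx d2 Pd2) as [d3 [Pd3 Kd3]].
    exists d3; split; auto. intros x' Nx' Lx' Lxx'.
    destruct (Ks0 (anh k x') (Near2 x' Nx' Lx')) as [U1' _].
    apply Kd1; auto. rewrite Cmod_sym. apply Kd2; auto. apply Kd3; auto. now rewrite Cmod_sym.
Qed.

Lemma lam_sep (b e : C) : rlam b e -> not01 b -> exists eps, 0 < eps /\ exists del, 0 < del /\
  forall b' e1 e2, not01 b' -> dC b b' < del -> rlam b' e1 -> rlam b' e2 ->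
    Cmod (e - e1) < eps -> Cmod (e - e2) < eps -> e1 = e2.
Proof.
  intros [He _] _. destruct (lam_local e He) as [r [d [Pr [_ [I _]]]]]. exists r; split; auto. exists 1; split; [lra|].
  intros b' e1 e2 _ _ [_ E1] [_ E2] L1 L2. apply I; try (rewrite Cmod_sym; auto). congruence.
Qed.

(** * Logarithms *)

Definition rexp (x u : C) : Prop := cexp u = x.

Definition non0 (x : C) : Prop := x <> 0%C.

Lemma exp_local : exists r d, 0 < r /\ 0 < d /\
    (forall z w, Cmod z < r -> Cmod w < r -> cexp z = cexp w -> z = w) /\ sec_at cexp (fun _ => True) 0 d.
Proof.
  destruct (local_section cexp cexp 0 1 ltac:(lra)) as [r [d [Pr [Pd [I S]]]]].
  - intros z _. apply cder_cexp.
  - apply cexp_neq0.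
  - intros e He. apply (cder_cont _ _ _ (cder_cexp 0) e He).
  - exists r, d. repeat split; auto.
    + intros z w Hz Hw. apply I; [replace (z - 0)%C with z by ring | replace (w - 0)%C with w by ring]; auto.
    + destruct (S 0%C) as [s [E K]]; [replace (0 - 0)%C with (RtoC 0) by ring; now rewrite Cmod_0|].
      exists s; split; auto. intros x Hx. destruct (K x Hx) as [_ [A B]]. auto.
Qed.

Lemma exp_sep (b e : C) : rexp b e -> non0 b -> exists eps, 0 < eps /\ exists del, 0 < del /\
  forall b' e1 e2, non0 b' -> dC b b' < del -> rexp b' e1 -> rexp b' e2 ->
    Cmod (e - e1) < eps -> Cmod (e - e2) < eps -> e1 = e2.
Proof.
  intros _ _. destruct exp_local as [r [d [Pr [_ [I _]]]]]. exists r; split; auto. exists 1; split; [lra|].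
  intros b' e1 e2 _ _ E1 E2 L1 L2. unfold rexp in *.
  assert (K : (e1 - e)%C = (e2 - e)%C).
  { apply I; try (rewrite Cmod_sym; auto). unfold Cminus. rewrite !cexp_add. congruence. }
  replace e1 with (e1 - e + e)%C by ring. rewrite K. ring.
Qed.

(** All branches are translates of the logarithm near 1: the section through (x0, e) is log(x / x0)
    + e. *)
Lemma exp_evenly : evenly dC non0 rexp.
Proof.
  intros b Hb. destruct exp_local as [r [d [_ [Pd [_ [s [Es Ks]]]]]]]. assert (Pb := Cmod_pos b Hb).
  set (c := Cmod b) in *. rewrite cexp_0 in Es, Ks.
  set (D := Rmin (c / 2) (d * c / 8)). assert (PD : 0 < D) by (unfold D; apply Rmin_pos; nra).
  assert (D1 : D <= c / 2) by apply Rmin_l. assert (D2 : D <= d * c / 8) by apply Rmin_r.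
  exists D; split; auto. unfold dC. intros x0 e N0 L0 E0.
  assert (C0 : c / 2 <= Cmod x0).
  { assert (T := Cmod_rev b (b - x0)). replace (b - (b - x0))%C with x0 in T by ring. fold c in T. lra. }
  exists (fun x => s (x / x0)%C + e)%C. split.
  { replace (x0 / x0)%C with (RtoC 1) by (field; auto). rewrite Es. ring. }
  assert (Near : forall x, Cmod (b - x) < D -> Cmod (1 - x / x0) < d).
  { intros x Lx. replace (1 - x / x0)%C with ((x0 - x) / x0)%C by (field; auto). rewrite Cmod_div by auto.
    apply (Rmult_lt_reg_r (Cmod x0)); [lra|]. unfold Rdiv. rewrite Rmult_assoc, Rinv_l, Rmult_1_r by lra.
    assert (T := Cmod_tri x0 b x). rewrite (Cmod_sym x0 b) in T. nra. }
  intros x Nx Lx. destruct (Ks _ (Near x Lx)) as [_ [A B]]. split.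
  - unfold rexp. rewrite cexp_add, A, E0. field. auto.
  - intros eps Heps. destruct (B eps Heps) as [eta [Pe Ke]]. exists (eta * (c / 2)); split; [nra|].
    intros x' Nx' Lx' L. replace (s (x / x0)%C + e - (s (x' / x0)%C + e))%C with (s (x / x0)%C - s (x' / x0)%C)%C by ring.
    apply Ke; [now apply Near|]. replace (x / x0 - x' / x0)%C with ((x - x') / x0)%C by (field; auto).
    rewrite Cmod_div by auto. apply (Rmult_lt_reg_r (Cmod x0)); [lra|].
    unfold Rdiv. rewrite Rmult_assoc, Rinv_l, Rmult_1_r by lra. nra.
Qed.

(** * Roots of cubics *)

Definition e1 (q : C3) : C := fst (fst q).

Definition e2 (q : C3) : C := snd (fst q).

Definition e3 (q : C3) : C := snd q.

Definition d3 (p q : C3) : R := Cmod (e1 p - e1 q) + Cmod (e2 p - e2 q) + Cmod (e3 p - e3 q).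

Definition cubic (q : C3) (w : C) : C := (w * w * w - e1 q * (w * w) + e2 q * w - e3 q)%C.

(** The divided difference of the cubic, written as a polynomial so that it makes sense for w = w',
    where it is the derivative. *)
Definition cubic_dq (q : C3) (w w' : C) : C := (w * w + w * w' + w' * w' - e1 q * (w + w') + e2 q)%C.

Definition rroot (q : C3) (w : C) : Prop := cubic q w = 0%C.

Lemma cubic_sym3 (a b c w : C) : cubic (sym3 a b c) w = ((w - a) * (w - b) * (w - c))%C.
Proof. unfold cubic, sym3, e1, e2, e3. cbn [fst snd]. ring. Qed.

Lemma cubic_diff (q : C3) (w w' : C) : (cubic q w - cubic q w')%C = ((w - w') * cubic_dq q w w')%C.
Proof. unfold cubic, cubic_dq. ring. Qed.

Lemma Cprod3_0 (a b c : C) : (a * b * c)%C = 0%C -> a = 0%C \/ b = 0%C \/ c = 0%C.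
Proof.
  intros E. destruct (classic (a = 0%C)); auto. destruct (classic (b = 0%C)); auto.
  destruct (classic (c = 0%C)); auto. exfalso. apply (Cmult_neq_0 (a * b) c); auto. now apply Cmult_neq_0.
Qed.

Lemma Csub0 (a b : C) : (a - b)%C = 0%C -> a = b.
Proof. intros E. replace a with (a - b + b)%C by ring. rewrite E. ring. Qed.

Lemma Csub_neq0 (a b : C) : a <> b -> (a - b)%C <> 0%C.
Proof. intros N E. now apply N, Csub0. Qed.

Lemma rroot_sym3 (a b c w : C) : rroot (sym3 a b c) w <-> w = a \/ w = b \/ w = c.
Proof.
  unfold rroot. rewrite cubic_sym3. split.
  - intros E. destruct (Cprod3_0 _ _ _ E) as [H|[H|H]]; apply Csub0 in H; auto.
  - intros [-> | [-> | ->]]; ring.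
Qed.

Ltac sym3_ring := unfold sym3; apply (f_equal2 pair); [apply (f_equal2 pair)|]; ring.

Lemma three_roots (q : C3) (a b c : C) : inX q -> rroot q a -> rroot q b -> rroot q c ->
  a <> b -> a <> c -> b <> c -> q = sym3 a b c.
Proof.
  intros [u [v [w [_ [_ [_ ->]]]]]] Ha Hb Hc Nab Nac Nbc.
  apply rroot_sym3 in Ha, Hb, Hc.
  destruct Ha as [-> | [-> | ->]]; destruct Hb as [-> | [-> | ->]]; destruct Hc as [-> | [-> | ->]]; try congruence;
  sym3_ring.
Qed.

Lemma simple_root (q : C3) (e : C) : inX q -> rroot q e -> cubic_dq q e e <> 0%C.
Proof.
  intros [u [v [w [N1 [N2 [N3 ->]]]]]] He. apply rroot_sym3 in He.
  assert (K : forall a b c : C, a <> b -> a <> c -> cubic_dq (sym3 a b c) a a <> 0%C).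
  { intros a b c Hb Hc. replace (cubic_dq (sym3 a b c) a a) with ((a - b) * (a - c))%C
      by (unfold cubic_dq, sym3, e1, e2; cbn [fst snd]; ring).
    apply Cmult_neq_0; now apply Csub_neq0. }
  destruct He as [-> | [-> | ->]].
  - now apply K.
  - replace (sym3 u v w) with (sym3 v u w) by (sym3_ring). apply K; auto.
  - replace (sym3 u v w) with (sym3 w u v) by (sym3_ring). apply K; auto.
Qed.

Lemma d3_comp (p q : C3) : Cmod (e1 p - e1 q) <= d3 p q /\ Cmod (e2 p - e2 q) <= d3 p q /\ Cmod (e3 p - e3 q) <= d3 p q.
Proof.
  unfold d3. generalize (Cmod_ge_0 (e1 p - e1 q)) (Cmod_ge_0 (e2 p - e2 q)) (Cmod_ge_0 (e3 p - e3 q)). lra.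
Qed.

(** The divided difference is continuous and does not vanish at a simple root. The bound gives both
    the separation of roots and their Lipschitz dependence on the coefficients. *)
Lemma dq_lower (b : C3) (e : C) : inX b -> rroot b e -> exists eps k del, 0 < eps /\ 0 < k /\ 0 < del /\
  forall q w w', d3 b q < del -> Cmod (w - e) < eps -> Cmod (w' - e) < eps -> k <= Cmod (cubic_dq q w w').
Proof.
  intros Hb He. assert (K0 := Cmod_pos _ (simple_root b e Hb He)). set (k0 := Cmod (cubic_dq b e e)) in *.
  set (M := Cmod e + 1). set (b1 := Cmod (e1 b)). assert (M1 : 1 <= M) by (unfold M; generalize (Cmod_ge_0 e); lra).
  assert (B0 : 0 <= b1) by apply Cmod_ge_0.
  set (eps := Rmin 1 (k0 / (4 * (6 * M + 2 * b1)))). set (del := k0 / (4 * (2 * M + 1))).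
  assert (P1 : 0 < eps) by (unfold eps; apply Rmin_pos; [lra | apply Rdiv_lt_0_compat; lra]).
  assert (P2 : 0 < del) by (unfold del; apply Rdiv_lt_0_compat; lra).
  assert (Q1 : eps <= 1) by apply Rmin_l.
  assert (Q2 : eps * (6 * M + 2 * b1) <= k0 / 4).
  { apply Rle_trans with (k0 / (4 * (6 * M + 2 * b1)) * (6 * M + 2 * b1)).
    - apply Rmult_le_compat_r; [lra | apply Rmin_r].
    - right; field; lra. }
  assert (Q3 : del * (2 * M + 1) = k0 / 4) by (unfold del; field; lra).
  exists eps, (k0 / 2), del. split; auto. split; [lra|]. split; auto.
  clearbody eps del. intros q w w' Hq Hw Hw'.
  destruct (d3_comp b q) as [D1 [D2 _]].
  set (u := (w - e)%C) in *. set (u' := (w' - e)%C) in *.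
  assert (Ew : w = (e + u)%C) by (unfold u; ring). assert (Ew' : w' = (e + u')%C) by (unfold u'; ring).
  set (A := (u * (e + e + u) + (u * (e + u') + e * u') + u' * (e + e + u'))%C).
  set (Bq := ((e1 b - e1 q) * (e + u + (e + u')) + - e1 b * (u + u'))%C).
  assert (E : cubic_dq q w w' = (cubic_dq b e e + (A + Bq + - (e2 b - e2 q)))%C)
    by (rewrite Ew, Ew'; unfold cubic_dq, A, Bq; ring).
  assert (U0 := Cmod_ge_0 u). assert (U0' := Cmod_ge_0 u'). assert (E0 := Cmod_ge_0 e).
  assert (NA : Cmod A <= 6 * M * eps).
  { assert (T1 : Cmod (u * (e + e + u)) <= eps * (2 * M)).
    { rewrite Cmod_mult. apply Rmult_le_compat; auto using Cmod_ge_0; try lra.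
      cmod_tri. assert (T := Cmod_triangle e e). unfold M. lra. }
    assert (T3 : Cmod (u' * (e + e + u')) <= eps * (2 * M)).
    { rewrite Cmod_mult. apply Rmult_le_compat; auto using Cmod_ge_0; try lra.
      cmod_tri. assert (T := Cmod_triangle e e). unfold M. lra. }
    assert (T2 : Cmod (u * (e + u') + e * u') <= eps * (2 * M)).
    { cmod_tri. rewrite !Cmod_mult.
      assert (T := Cmod_triangle e u').
      assert (Cmod u * Cmod (e + u') <= eps * M) by (apply Rmult_le_compat; auto using Cmod_ge_0; unfold M; lra).
      assert (Cmod e * Cmod u' <= M * eps) by (apply Rmult_le_compat; auto; unfold M; lra). lra. }
    unfold A. cmod_tri.
    assert (T := Cmod_triangle (u * (e + e + u)) (u * (e + u') + e * u')). lra. }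
  assert (NB : Cmod Bq <= del * (2 * M) + 2 * b1 * eps).
  { unfold Bq. cmod_tri. rewrite !Cmod_mult, Cmod_opp. fold b1.
    assert (T1 := Cmod_triangle (e + u) (e + u')). assert (T2 := Cmod_triangle e u). assert (T3 := Cmod_triangle e u').
    assert (T4 := Cmod_triangle u u').
    assert (Cmod (e1 b - e1 q) * Cmod (e + u + (e + u')) <= del * (2 * M))
      by (apply Rmult_le_compat; auto using Cmod_ge_0; unfold M; lra).
    assert (b1 * Cmod (u + u') <= b1 * (2 * eps)) by (apply Rmult_le_compat_l; lra). lra. }
  assert (T := Cmod_rev (cubic_dq b e e) (- (A + Bq + - (e2 b - e2 q)))).
  replace (cubic_dq b e e - - (A + Bq + - (e2 b - e2 q)))%C with (cubic_dq q w w') in T by (rewrite E; ring).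
  rewrite Cmod_opp in T. fold k0 in T.
  assert (T1 := Cmod_triangle (A + Bq) (- (e2 b - e2 q))). assert (T2 := Cmod_triangle A Bq). rewrite Cmod_opp in T1. lra.
Qed.

Lemma roots_sep (b : C3) (e : C) : rroot b e -> inX b -> exists eps, 0 < eps /\ exists del, 0 < del /\
  forall b' f1 f2, inX b' -> d3 b b' < del -> rroot b' f1 -> rroot b' f2 ->
    Cmod (e - f1) < eps -> Cmod (e - f2) < eps -> f1 = f2.
Proof.
  intros He Hb. destruct (dq_lower b e Hb He) as [eps [k [del [P1 [P2 [P3 K]]]]]].
  exists eps; split; auto. exists del; split; auto. intros b' f1 f2 _ Hb' R1 R2 L1 L2.
  rewrite Cmod_sym in L1, L2. specialize (K b' f1 f2 Hb' L1 L2).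
  assert (Q := cubic_diff b' f1 f2). rewrite R1, R2 in Q. apply Csub0.
  destruct (classic ((f1 - f2)%C = 0%C)) as [|N]; auto. exfalso.
  apply (Cmult_neq_0 (f1 - f2) (cubic_dq b' f1 f2)); auto.
  - intros Z. rewrite Z, Cmod_0 in K. lra.
  - rewrite <- Q. ring.
Qed.

Lemma cubic_lip (p q : C3) (w : C) (K : R) : 1 <= K -> Cmod w <= K -> Cmod (cubic p w - cubic q w) <= d3 p q * (K * K).
Proof.
  intros K1 Hw. unfold cubic.
  replace (w * w * w - e1 p * (w * w) + e2 p * w - e3 p - (w * w * w - e1 q * (w * w) + e2 q * w - e3 q))%C
    with (- (e1 p - e1 q) * (w * w) + (e2 p - e2 q) * w + - (e3 p - e3 q))%C by ring.
  cmod_tri. eapply Rle_trans; [apply Rplus_le_compat_r, Cmod_triangle|].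
  rewrite !Cmod_mult, !Cmod_opp. unfold d3.
  assert (W := Cmod_ge_0 w). set (x := Cmod w) in *.
  assert (H1 := Cmod_ge_0 (e1 p - e1 q)). assert (H2 := Cmod_ge_0 (e2 p - e2 q)). assert (H3 := Cmod_ge_0 (e3 p - e3 q)).
  assert (x * x <= K * K) by nra. assert (x <= K * K) by nra. assert (1 <= K * K) by nra. nra.
Qed.

Lemma root_bound (q : C3) (w : C) : rroot q w -> Cmod w <= 1 + Cmod (e1 q) + Cmod (e2 q) + Cmod (e3 q).
Proof.
  intros H. assert (H1 := Cmod_ge_0 (e1 q)). assert (H2 := Cmod_ge_0 (e2 q)). assert (H3 := Cmod_ge_0 (e3 q)).
  destruct (Rle_or_lt (Cmod w) 1) as [L|L]; [lra|].
  assert (E : (w * (w * w))%C = (e1 q * (w * w) + - (e2 q * w) + e3 q)%C).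
  { transitivity (cubic q w + (e1 q * (w * w) + - (e2 q * w) + e3 q))%C; [unfold cubic; ring|]. rewrite H. ring. }
  assert (T : Cmod (w * (w * w)) <= Cmod (e1 q) * (Cmod w * Cmod w) + Cmod (e2 q) * Cmod w + Cmod (e3 q)).
  { rewrite E. cmod_tri. eapply Rle_trans; [apply Rplus_le_compat_r, Cmod_triangle|].
    rewrite Cmod_opp, !Cmod_mult. lra. }
  rewrite !Cmod_mult in T. set (x := Cmod w) in *.
  assert (x * (x * x) <= (Cmod (e1 q) + Cmod (e2 q) + Cmod (e3 q)) * (x * x)).
  { assert (x <= x * x) by nra. assert (1 <= x * x) by nra. nra. }
  assert (x <= Cmod (e1 q) + Cmod (e2 q) + Cmod (e3 q)) by (apply (Rmult_le_reg_r (x * x)); nra). lra.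
Qed.

Lemma small_factor (a b c : C) (e : R) : 0 < e -> Cmod (a * b * c) < e * e * e ->
  Cmod a < e \/ Cmod b < e \/ Cmod c < e.
Proof.
  intros He H. destruct (Rlt_or_le (Cmod a) e); auto. destruct (Rlt_or_le (Cmod b) e); auto.
  destruct (Rlt_or_le (Cmod c) e); auto. exfalso. rewrite !Cmod_mult in H.
  assert (e * e <= Cmod a * Cmod b) by nra. nra.
Qed.

Lemma roots_evenly : evenly d3 inX rroot.
Proof.
  intros b Hb. assert (Hb' := Hb). destruct Hb' as [z1 [z2 [z3 [N1 [N2 [N3 Eb]]]]]].
  assert (R1 : rroot b z1) by (rewrite Eb; apply rroot_sym3; auto).
  assert (R2 : rroot b z2) by (rewrite Eb; apply rroot_sym3; auto).
  assert (R3 : rroot b z3) by (rewrite Eb; apply rroot_sym3; auto).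
  destruct (dq_lower b z1 Hb R1) as [s1 [k1 [t1 [A1 [B1 [C1 K1]]]]]].
  destruct (dq_lower b z2 Hb R2) as [s2 [k2 [t2 [A2 [B2 [C2 K2]]]]]].
  destruct (dq_lower b z3 Hb R3) as [s3 [k3 [t3 [A3 [B3 [C3' K3]]]]]].
  set (eps := Rmin s1 (Rmin s2 s3)). set (k := Rmin k1 (Rmin k2 k3)). set (t := Rmin t1 (Rmin t2 t3)).
  assert (Peps : 0 < eps) by (unfold eps; repeat apply Rmin_pos; auto).
  assert (Pk : 0 < k) by (unfold k; repeat apply Rmin_pos; auto).
  assert (Pt : 0 < t) by (unfold t; repeat apply Rmin_pos; auto).
  assert (Le : eps <= s1 /\ eps <= s2 /\ eps <= s3).
  { unfold eps, Rmin; repeat destruct Rle_dec; lra. }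
  assert (Lk : k <= k1 /\ k <= k2 /\ k <= k3).
  { unfold k, Rmin; repeat destruct Rle_dec; lra. }
  assert (Lt : t <= t1 /\ t <= t2 /\ t <= t3).
  { unfold t, Rmin; repeat destruct Rle_dec; lra. }
  clearbody eps k t.
  assert (KK : forall z, z = z1 \/ z = z2 \/ z = z3 -> forall q w w', d3 b q < t -> Cmod (w - z) < eps -> Cmod (w' - z) < eps ->
     k <= Cmod (cubic_dq q w w')).
  { intros z [-> | [-> | ->]] q w w' Hq Hw Hw'.
    - apply Rle_trans with k1; [lra|]. apply K1; lra.
    - apply Rle_trans with k2; [lra|]. apply K2; lra.
    - apply Rle_trans with k3; [lra|]. apply K3; lra. }
  set (M := 4 + Cmod (e1 b) + Cmod (e2 b) + Cmod (e3 b)).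
  assert (M1 : 1 <= M).
  { unfold M. generalize (Cmod_ge_0 (e1 b)) (Cmod_ge_0 (e2 b)) (Cmod_ge_0 (e3 b)); lra. }
  set (d := Rmin 1 (Rmin t (eps * eps * eps / (M * M)))).
  assert (Pd : 0 < d).
  { unfold d. repeat apply Rmin_pos; auto; [lra|]. apply Rdiv_lt_0_compat; [repeat apply Rmult_lt_0_compat; auto | nra]. }
  assert (D1 : d <= 1) by apply Rmin_l.
  assert (D2 : d <= t) by (eapply Rle_trans; [apply Rmin_r | apply Rmin_l]).
  assert (D3 : d * (M * M) <= eps * eps * eps).
  { apply Rle_trans with (eps * eps * eps / (M * M) * (M * M)).
    - apply Rmult_le_compat_r; [nra|]. eapply Rle_trans; [apply Rmin_r | apply Rmin_r].
    - right; field; lra. }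
  clearbody d. clear K1 K2 K3.
  assert (MM : 0 < M * M) by nra.
  assert (Bd : forall q w, d3 b q < d -> rroot q w -> Cmod w <= M).
  { intros q w Hq Hw. eapply Rle_trans; [apply (root_bound q w Hw)|]. destruct (d3_comp b q) as [X1 [X2 X3]].
    assert (Y : forall x y : C, Cmod y <= Cmod x + Cmod (x - y)).
    { intros x y. replace y with (x + - (x - y))%C at 1 by ring. cmod_tri. rewrite Cmod_opp. lra. }
    assert (Y1 := Y (e1 b) (e1 q)). assert (Y2 := Y (e2 b) (e2 q)). assert (Y3 := Y (e3 b) (e3 q)). unfold M. lra. }
  (* A root w of q makes [cubic b w] small; this is the product of the differences from z1, z2, z3,
     so one of them is small. *)
  assert (Nearest : forall q w, d3 b q < d -> rroot q w -> exists z, (z = z1 \/ z = z2 \/ z = z3) /\ Cmod (w - z) < eps).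
  { intros q w Hq Hw. assert (Q := cubic_lip b q w M M1 (Bd q w Hq Hw)). rewrite Hw in Q.
    replace (cubic b w - 0)%C with (cubic b w) in Q by ring. rewrite Eb, cubic_sym3 in Q. rewrite <- Eb in Q.
    assert (L : Cmod ((w - z1) * (w - z2) * (w - z3)) < eps * eps * eps).
    { eapply Rle_lt_trans; [apply Q|]. eapply Rlt_le_trans; [|apply D3]. apply Rmult_lt_compat_r; auto. }
    destruct (small_factor _ _ _ eps Peps L) as [F|[F|F]]; [exists z1|exists z2|exists z3]; auto. }
  (* The same argument with b and q exchanged: every root of b has a root of q nearby. *)
  assert (Exist : forall z, z = z1 \/ z = z2 \/ z = z3 -> forall q, inX q -> d3 b q < d -> exists w, rroot q w /\ Cmod (w - z) < eps).
  { intros z Hz q Hq Lq. assert (Rz : rroot b z) by (destruct Hz as [-> | [-> | ->]]; auto).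
    assert (Z0 : Cmod z <= M).
    { eapply Rle_trans; [apply (root_bound b z Rz)|]. unfold M. lra. }
    assert (Q := cubic_lip b q z M M1 Z0). rewrite Rz in Q.
    destruct Hq as [w1 [w2 [w3 [_ [_ [_ Eq]]]]]].
    replace (0 - cubic q z)%C with (- cubic q z)%C in Q by ring. rewrite Cmod_opp in Q. rewrite Eq, cubic_sym3 in Q at 1.
    assert (L : Cmod ((z - w1) * (z - w2) * (z - w3)) < eps * eps * eps).
    { eapply Rle_lt_trans; [apply Q|]. eapply Rlt_le_trans; [|apply D3]. apply Rmult_lt_compat_r; auto. }
    destruct (small_factor _ _ _ eps Peps L) as [F|[F|F]]; rewrite Cmod_sym in F;
      [exists w1|exists w2|exists w3]; split; auto; rewrite Eq; apply rroot_sym3; auto. }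
  exists d; split; auto. intros q0 e Hq0 Lq0 Re.
  destruct (Nearest q0 e Lq0 Re) as [z [Hz Lz]].
  set (s := fun q => epsilon (inhabits (RtoC 0)) (fun w => rroot q w /\ Cmod (w - z) < eps)).
  assert (Hs : forall q, inX q -> d3 b q < d -> rroot q (s q) /\ Cmod (s q - z) < eps).
  { intros q Hq Lq. unfold s. apply epsilon_spec. now apply Exist. }
  assert (Lip : forall q q' w w', d3 b q < d -> d3 b q' < d -> rroot q w -> rroot q' w' -> Cmod (w - z) < eps -> Cmod (w' - z) < eps ->
     Cmod (w - w') * k <= d3 q q' * (M * M)).
  { intros q q' w w' Lq Lq' Rw Rw' Hw Hw'.
    assert (Kq := KK z Hz q w w' ltac:(lra) Hw Hw').
    apply Rle_trans with (Cmod (w - w') * Cmod (cubic_dq q w w')); [apply Rmult_le_compat_l; auto using Cmod_ge_0|].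
    rewrite <- Cmod_mult, <- cubic_diff, Rw, <- Rw', Cmod_sym. apply cubic_lip; auto. apply (Bd q'); auto. }
  exists s. split.
  - destruct (Hs q0 Hq0 Lq0) as [Rs Ls]. assert (Q := Lip q0 q0 (s q0) e Lq0 Lq0 Rs Re Ls Lz).
    replace (d3 q0 q0) with 0 in Q.
    2:{ unfold d3. replace (e1 q0 - e1 q0)%C with (RtoC 0) by ring. replace (e2 q0 - e2 q0)%C with (RtoC 0) by ring.
        replace (e3 q0 - e3 q0)%C with (RtoC 0) by ring. rewrite Cmod_0. ring. }
    apply Cmod_sub0. generalize (Cmod_ge_0 (s q0 - e)); nra.
  - intros q Hq Lq. destruct (Hs q Hq Lq) as [Rs Ls]. split; auto. intros eta Heta.
    exists (eta * k / (M * M)); split; [apply Rdiv_lt_0_compat; nra|]. intros q' Hq' Lq' Lqq.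
    destruct (Hs q' Hq' Lq') as [Rs' Ls']. assert (Q := Lip q q' (s q) (s q') Lq Lq' Rs Rs' Ls Ls').
    apply (Rmult_lt_reg_r k); auto. eapply Rle_lt_trans; [apply Q|].
    apply (Rmult_lt_compat_r (M * M)) in Lqq; auto.
    replace (eta * k / (M * M) * (M * M)) with (eta * k) in Lqq by (field; lra). auto.
Qed.

(** * Ordered lifts *)

Definition distinct3 (a b c : C) : Prop := a <> b /\ a <> c /\ b <> c.

Definition ord_lift (D : C -> Prop) (f : C -> C3) (a b c : C -> C) : Prop :=
  contC D a /\ contC D b /\ contC D c /\
  forall z, D z -> distinct3 (a z) (b z) (c z) /\ f z = sym3 (a z) (b z) (c z).

Lemma sym3_inX (a b c : C) : distinct3 a b c -> inX (sym3 a b c).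
Proof. intros [N1 [N2 N3]]. exists a, b, c. auto. Qed.

(** The three roots are continued separately; they remain distinct because two lifts that meet once
    agree everywhere. *)
Lemma ord_lift_exists (x0 x1 y0 y1 : R) (f : C -> C3) (z0 a0 b0 c0 : C) :
  contD (closed_rect x0 x1 y0 y1) d3 f -> (forall z, closed_rect x0 x1 y0 y1 z -> inX (f z)) ->
  closed_rect x0 x1 y0 y1 z0 -> distinct3 a0 b0 c0 -> f z0 = sym3 a0 b0 c0 ->
  exists a b c, ord_lift (closed_rect x0 x1 y0 y1) f a b c /\ a z0 = a0 /\ b z0 = b0 /\ c z0 = c0.
Proof.
  intros Hf Hin D0 [N1 [N2 N3]] E0.
  assert (X : x0 <= x1) by (unfold closed_rect in D0; lra). assert (Y : y0 <= y1) by (unfold closed_rect in D0; lra).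
  assert (L := lift_exists C3 d3 inX rroot roots_evenly roots_sep x0 x1 y0 y1 f X Y Hf Hin).
  destruct (L z0 a0 D0) as [a [La Ea]]; [rewrite E0; apply rroot_sym3; auto|].
  destruct (L z0 b0 D0) as [b [Lb Eb]]; [rewrite E0; apply rroot_sym3; auto|].
  destruct (L z0 c0 D0) as [c [Lc Ec]]; [rewrite E0; apply rroot_sym3; auto|].
  exists a, b, c. split; [|auto].
  assert (U := fun l1 l2 z => lift_unique C3 d3 inX rroot roots_sep x0 x1 y0 y1 f l1 l2 z Hf Hin).
  split; [apply La|]. split; [apply Lb|]. split; [apply Lc|]. intros z Dz.
  assert (Dis : distinct3 (a z) (b z) (c z)).
  { repeat split; intros E.
    - apply N1. rewrite <- Ea, <- Eb. apply (U a b z); auto.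
    - apply N2. rewrite <- Ea, <- Ec. apply (U a c z); auto.
    - apply N3. rewrite <- Eb, <- Ec. apply (U b c z); auto. }
  split; auto. destruct Dis as [M1 [M2 M3]]. apply three_roots; auto; [apply La | apply Lb | apply Lc]; auto.
Qed.

Lemma ord_lift_roots (D : C -> Prop) (f : C -> C3) (a b c : C -> C) : ord_lift D f a b c ->
  is_lift C3 rroot D f a /\ is_lift C3 rroot D f b /\ is_lift C3 rroot D f c.
Proof.
  intros [Ca [Cb [Cc H]]].
  repeat split; auto; intros w Dw; destruct (H w Dw) as [_ ->]; apply rroot_sym3; auto.
Qed.

Lemma ord_lift_unique (x0 x1 y0 y1 : R) (f : C -> C3) (a b c a' b' c' : C -> C) (z0 : C) :
  contD (closed_rect x0 x1 y0 y1) d3 f ->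
  ord_lift (closed_rect x0 x1 y0 y1) f a b c -> ord_lift (closed_rect x0 x1 y0 y1) f a' b' c' ->
  closed_rect x0 x1 y0 y1 z0 -> a z0 = a' z0 -> b z0 = b' z0 -> c z0 = c' z0 ->
  forall z, closed_rect x0 x1 y0 y1 z -> a z = a' z /\ b z = b' z /\ c z = c' z.
Proof.
  intros Hf H H' D0 Ea Eb Ec z Dz.
  assert (Hin : forall z, closed_rect x0 x1 y0 y1 z -> inX (f z)).
  { intros w Dw. destruct H as [_ [_ [_ K]]]. destruct (K w Dw) as [Q ->]. now apply sym3_inX. }
  destruct (ord_lift_roots _ _ _ _ _ H) as [L1 [L2 L3]]. destruct (ord_lift_roots _ _ _ _ _ H') as [L1' [L2' L3']].
  assert (U := fun l1 l2 => lift_unique C3 d3 inX rroot roots_sep x0 x1 y0 y1 f l1 l2 z0 Hf Hin).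
  split; [|split]; apply U; auto.
Qed.

Lemma sym3_cont (D : C -> Prop) (a b c : C -> C) : contC D a -> contC D b -> contC D c ->
  contD D d3 (fun z => sym3 (a z) (b z) (c z)).
Proof.
  intros Ha Hb Hc.
  assert (H1 : contC D (fun z => a z + b z + c z)%C) by (repeat apply contC_plus; auto).
  assert (H2 : contC D (fun z => a z * b z + a z * c z + b z * c z)%C) by (repeat apply contC_plus; apply contC_mult; auto).
  assert (H3 : contC D (fun z => a z * b z * c z)%C) by (repeat apply contC_mult; auto).
  intros z Dz e He. destruct (H1 z Dz (e / 3)) as [d1 [P1 K1]]; [lra|].
  destruct (H2 z Dz (e / 3)) as [d2 [P2 K2]]; [lra|]. destruct (H3 z Dz (e / 3)) as [d3' [P3 K3]]; [lra|].
  exists (Rmin d1 (Rmin d2 d3')); split; [repeat apply Rmin_pos; auto|]. intros w Dw L.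
  destruct (Rmin_Rgt_l _ _ _ L) as [L1 L'].
  destruct (Rmin_Rgt_l _ _ _ L') as [L2 L3].
  specialize (K1 w Dw L1). specialize (K2 w Dw L2). specialize (K3 w Dw L3). unfold dC in *.
  unfold d3, sym3, e1, e2, e3. cbn [fst snd]. lra.
Qed.

Lemma ord_lift_cont (D : C -> Prop) (f : C -> C3) (a b c : C -> C) : ord_lift D f a b c -> contD D d3 f.
Proof.
  intros [Ca [Cb [Cc H]]]. apply (contD_ext _ _ (fun z => sym3 (a z) (b z) (c z))).
  - intros z Dz. symmetry. now apply H.
  - now apply sym3_cont.
Qed.

Lemma ball_C (x y : C) (e : R) : Cmod (y - x) < e -> ball x e y.
Proof. intros H. apply C_NormedModule_mixin_compat1. exact H. Qed.

Lemma ball_C_inv (x y : C) (e : R) : 0 < e -> @ball C_UniformSpace x e y -> Cmod (x - y) < 2 * e.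
Proof.
  intros He [H1 H2]. rewrite Cmod_sym. eapply Rle_lt_trans; [apply Cmod_le_abs|].
  unfold ball in H1, H2; simpl in H1, H2. unfold AbsRing_ball, abs, minus, plus, opp in H1, H2; simpl in *. lra.
Qed.

Lemma cont_on_contD (D : C -> Prop) (f : C -> C3) : cont_on (T := C_UniformSpace) D f -> contD D d3 f.
Proof.
  (* Three components, each off by less than 2 (e / 8) according to [ball_C_inv]. *)
  intros H x Dx e He. assert (He' : 0 < e / 8) by lra.
  destruct (H x Dx _ (locally_ball (f x) (mkposreal _ He'))) as [d Hd].
  exists d; split; [apply cond_pos|]. intros y Dy L. specialize (Hd y (ball_C x y d L) Dy).
  destruct Hd as [[B1 B2] B3]. simpl in B1, B2, B3.
  apply ball_C_inv in B1; auto. apply ball_C_inv in B2; auto. apply ball_C_inv in B3; auto.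
  unfold d3, e1, e2, e3. lra.
Qed.

Lemma contD_cont_on (D : C -> Prop) (f : C -> C3) : contD D d3 f -> cont_on (T := C_UniformSpace) D f.
Proof.
  intros H x Dx P [e He]. destruct (H x Dx e (cond_pos e)) as [d [Pd K]].
  assert (Pd2 : 0 < d / 2) by lra.
  exists (mkposreal _ Pd2). intros y By Dy. apply He.
  assert (L : Cmod (y - x) < d).
  { rewrite Cmod_sym. apply ball_C_inv in By; simpl in *; lra. }
  specialize (K y Dy L). destruct (d3_comp (f x) (f y)) as [X1 [X2 X3]].
  split; [split|]; match goal with |- ball ?u _ ?v => apply (ball_C u v) end; rewrite Cmod_sym; unfold e1, e2, e3 in *; simpl in *; try lra.
Qed.

(** * Cauchy's theorem for maps into a strip *)

(** Uniform continuity at a horizontal line, obtained by bisecting the degenerate rectangle [a, b] x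
    {ye}. *)
Lemma edge_near (f : C -> C) (x0 x1 y0 y1 a b ye e : R) :
  contC (closed_rect x0 x1 y0 y1) f -> x0 <= a -> a <= b -> b <= x1 -> y0 <= ye <= y1 -> 0 < e ->
  exists d, 0 < d /\ forall x y, a <= x <= b -> y0 <= y <= y1 -> Rabs (y - ye) < d ->
    Cmod (f (x, y) - f (x, ye)) < e.
Proof.
  intros Hf Ha Hab Hb Hy He.
  apply (bisect2d (fun a b _ _ => exists d, 0 < d /\ forall x y, a <= x <= b -> y0 <= y <= y1 -> Rabs (y - ye) < d ->
    Cmod (f (x, y) - f (x, ye)) < e) a b ye ye); try lra.
  - intros p m r _ _ _ _ _ _ [d1 [P1 K1]] [d2 [P2 K2]]. exists (Rmin d1 d2). split; [now apply Rmin_pos|].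
    intros x y Hx Hy' L. destruct (Rmin_Rgt_l _ _ _ L) as [L1 L2].
    destruct (Rle_or_lt x m); [apply K1 | apply K2]; auto; lra.
  - intros. assumption.
  - intros x y Hx Hy'. replace y with ye by lra.
    destruct (Hf (x, ye)) with (eps := e / 2) as [d [Pd K]]; [split; simpl; lra | lra |].
    exists (d / 2); split; [lra|]. intros p r _ _ Hp Hr _ _ L _ _. exists (d / 2); split; [lra|].
    intros u v Hu Hv Lv.
    assert (K1 := K (u, v)). assert (K2 := K (u, ye)). unfold dC in *.
    assert (Hu1 : Rabs (u - x) < d / 2) by (apply Rabs_lt_between; lra).
    assert (L1 : Cmod (f (x, ye) - f (u, v)) < e / 2).
    { apply K1; [split; simpl; lra|]. eapply Rle_lt_trans; [apply Cmod_le_abs|]. simpl. unfold Rminus in *. lra. }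
    assert (L2 : Cmod (f (x, ye) - f (u, ye)) < e / 2).
    { apply K2; [split; simpl; lra|]. eapply Rle_lt_trans; [apply Cmod_le_abs|]. simpl.
      rewrite Rplus_opp_r, Rabs_R0. unfold Rminus in *. lra. }
    eapply Rle_lt_trans; [apply (Cmod_tri _ (f (x, ye)))|]. rewrite (Cmod_sym (f (u, v))). lra.
Qed.

Lemma RInt_const_R (m a b : R) : RInt (fun _ => m) a b = m * (b - a).
Proof. rewrite (RInt_const (V := R_CompleteNormedModule)). unfold scal; simpl; unfold mult; simpl. ring. Qed.

Lemma RInt_const_le (g : R -> R) (a b M : R) : a <= b -> ex_RInt g a b ->
  (forall x, a < x < b -> g x <= M) -> RInt g a b <= M * (b - a).
Proof.
  intros L H B. rewrite <- (RInt_const_R M a b). apply RInt_le; auto. apply ex_RInt_const.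
Qed.

Lemma RInt_const_ge (g : R -> R) (a b M : R) : a <= b -> ex_RInt g a b ->
  (forall x, a < x < b -> M <= g x) -> M * (b - a) <= RInt g a b.
Proof.
  intros L H B. rewrite <- (RInt_const_R M a b). apply RInt_le; auto. apply ex_RInt_const.
Qed.

(** Imaginary part of Cauchy's theorem: the rise of Im f, integrated over x, equals the difference
    of the integrals of Re f along the two vertical sides, which is at most PI times their length.
    As f is holomorphic only in the interior, this is done on inner rectangles. *)
Lemma length_area (f : C -> C) (x0 x1 y0 y1 h : R) : x0 < x1 -> y0 < y1 ->
  contC (closed_rect x0 x1 y0 y1) f -> holo_on (open_rect x0 x1 y0 y1) f ->
  (forall z, open_rect x0 x1 y0 y1 z -> - PI < fst (f z) < 0) ->
  (forall x, x0 < x < x1 -> snd (f (x, y0)) = 0 /\ snd (f (x, y1)) = h) ->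
  h * (x1 - x0) <= PI * (y1 - y0).
Proof.
  intros X Y Hc Hh Hb He. assert (Pp := PI_RGT_0).
  assert (K : forall a b e, x0 < a -> a < b -> b < x1 -> 0 < e -> (h - 2 * e) * (b - a) <= PI * (y1 - y0)).
  { intros a b e Ha Hab Hb1 Pe.
    destruct (edge_near f x0 x1 y0 y1 a b y0 e Hc) as [d0 [P0 K0]]; try lra.
    destruct (edge_near f x0 x1 y0 y1 a b y1 e Hc) as [d1 [P1 K1]]; try lra.
    set (s := Rmin (Rmin d0 d1) (y1 - y0) / 3).
    assert (S1 : 0 < s) by (unfold s; apply Rdiv_lt_0_compat; [repeat apply Rmin_pos|]; lra).
    assert (S2 : 3 * s <= d0 /\ 3 * s <= d1 /\ 3 * s <= y1 - y0).
    { unfold s. assert (T1 := Rmin_l (Rmin d0 d1) (y1 - y0)). assert (T2 := Rmin_r (Rmin d0 d1) (y1 - y0)).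
      assert (T3 := Rmin_l d0 d1). assert (T4 := Rmin_r d0 d1). lra. }
    clearbody s. set (c := y0 + s). set (d := y1 - s).
    assert (Hin : holo_on (closed_rect a b c d) f).
    { intros z [H1 H2]. apply Hh. unfold c, d in *. split; lra. }
    assert (G := goursat f a b c d ltac:(lra) ltac:(unfold c, d; lra) Hin).
    assert (R1 : rc (hor f c) a b) by (apply hor_rc; intros x Hx; apply Hin; unfold c, d; split; simpl; lra).
    assert (R2 : rc (hor f d) a b) by (apply hor_rc; intros x Hx; apply Hin; unfold c, d; split; simpl; lra).
    assert (R3 : rc (ver f a) c d) by (apply ver_rc; intros x Hx; apply Hin; split; simpl; lra).
    assert (R4 : rc (ver f b) c d) by (apply ver_rc; intros x Hx; apply Hin; split; simpl; lra).
    assert (Lcd : c <= d) by (unfold c, d; lra).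
    assert (I1 : RInt (fun x => snd (hor f c x)) a b <= e * (b - a)).
    { apply RInt_const_le; [lra | apply rc_int2; auto; lra |]. intros x Hx.
      assert (Q := K0 x c ltac:(lra) ltac:(unfold c; lra) ltac:(unfold c; apply Rabs_lt_between; lra)).
      assert (T := Cmod_snd (f (x, c) - f (x, y0))). simpl in T. destruct (He x) as [E0 _]; [lra|]. rewrite E0 in T.
      assert (T2 := Rle_abs (snd (f (x, c)) + - 0)). unfold hor. lra. }
    assert (I2 : (h - e) * (b - a) <= RInt (fun x => snd (hor f d x)) a b).
    { apply RInt_const_ge; [lra | apply rc_int2; auto; lra |]. intros x Hx.
      assert (Q := K1 x d ltac:(lra) ltac:(unfold d; lra) ltac:(unfold d; apply Rabs_lt_between; lra)).
      assert (T := Cmod_snd (f (x, d) - f (x, y1))). simpl in T. destruct (He x) as [_ E0]; [lra|]. rewrite E0 in T.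
      assert (T2 := Rle_abs (- (snd (f (x, d)) + - h))). rewrite Rabs_Ropp in T2. unfold hor. lra. }
    assert (I3 : RInt (fun y => fst (ver f b y)) c d <= 0 * (d - c)).
    { apply RInt_const_le; auto; [apply rc_int1; auto|]. intros y Hy. unfold ver.
      apply Rlt_le, Hb. unfold c, d in *. split; simpl; lra. }
    assert (I4 : - PI * (d - c) <= RInt (fun y => fst (ver f a y)) c d).
    { apply RInt_const_ge; auto; [apply rc_int1; auto|]. intros y Hy. unfold ver.
      apply Rlt_le, Hb. unfold c, d in *. split; simpl; lra. }
    apply (f_equal snd) in G. unfold bdry, CI in G. simpl in G.
    assert (PI * (d - c) <= PI * (y1 - y0)) by (apply Rmult_le_compat_l; unfold c, d; lra). lra. }
  (* A positive gap g would survive a margin t with h t <= g / 8 on each side and an error e with e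
     W = g / 8. *)
  apply Rnot_lt_le. intros N.
  set (W := x1 - x0) in *. set (A := PI * (y1 - y0)) in *.
  assert (A0 : 0 < A) by (unfold A; apply Rmult_lt_0_compat; lra). assert (W0 : 0 < W) by (unfold W; lra).
  assert (H0 : 0 < h) by (apply (Rmult_lt_reg_r W); lra).
  set (g := h * W - A) in *. assert (g0 : 0 < g) by (unfold g; lra).
  set (e := g / (8 * W)). set (t := Rmin (g / (8 * h)) (W / 4)).
  assert (t0 : 0 < t) by (unfold t; apply Rmin_pos; [apply Rdiv_lt_0_compat|]; lra).
  assert (t1 : h * t <= g / 8).
  { apply Rle_trans with (h * (g / (8 * h))); [apply Rmult_le_compat_l; [lra | apply Rmin_l] | right; field; lra]. }
  assert (t2 : t <= W / 4) by apply Rmin_r.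
  assert (e0 : 0 < e) by (unfold e; apply Rdiv_lt_0_compat; lra).
  assert (e1 : e * W = g / 8) by (unfold e; field; lra). clearbody t e.
  assert (Q := K (x0 + t) (x1 - t) e ltac:(lra) ltac:(unfold W in *; lra) ltac:(lra) e0). fold A in Q.
  replace (x1 - t - (x0 + t)) with (W - 2 * t) in Q by (unfold W; ring).
  assert (0 < e * t) by (apply Rmult_lt_0_compat; auto).
  replace ((h - 2 * e) * (W - 2 * t)) with (h * W - 2 * (h * t) - 2 * (e * W) + 4 * (e * t)) in Q by ring.
  unfold g in *. lra.
Qed.

(** * The action of braid words on the modular lift *)

Definition isreal (z : C) : Prop := snd z = 0.

Lemma isreal_plus (a b : C) : isreal a -> isreal b -> isreal (a + b)%C.
Proof. unfold isreal. simpl. lra. Qed.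

Lemma isreal_opp (a : C) : isreal a -> isreal (- a)%C.
Proof. unfold isreal. simpl. lra. Qed.

Lemma isreal_minus (a b : C) : isreal a -> isreal b -> isreal (a - b)%C.
Proof. unfold isreal. simpl. lra. Qed.

Lemma isreal_mult (a b : C) : isreal a -> isreal b -> isreal (a * b)%C.
Proof. unfold isreal. simpl. intros -> ->. ring. Qed.

Lemma isreal_inv (a : C) : isreal a -> isreal (/ a)%C.
Proof. unfold isreal. simpl. intros ->. unfold Rdiv. ring. Qed.

Lemma isreal_div (a b : C) : isreal a -> isreal b -> isreal (a / b)%C.
Proof. intros. apply isreal_mult; auto. now apply isreal_inv. Qed.

Lemma isreal_R (x : R) : isreal (RtoC x).
Proof. reflexivity. Qed.

Lemma isreal_eq (a : C) : isreal a -> a = RtoC (fst a).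
Proof. intros H. apply Ceq; auto. Qed.

Lemma isreal_anh (k : nat) (x : C) : isreal x -> isreal (anh k x).
Proof.
  intros H. destruct k as [|[|[|[|[|k]]]]]; simpl; auto using isreal_minus, isreal_div, isreal_inv, isreal_R.
Qed.

(* Where lambda is real, [t] and its reflection [- conj t] are lifts of the same map. *)
Lemma real_stay (k : nat) (ph ps : C -> C) (x0 x1 y0 y1 : R) (t : C -> C) (z0 : C) (y : R) :
  equivariant k ph ps -> contC (closed_rect x0 x1 y0 y1) t ->
  (forall z, closed_rect x0 x1 y0 y1 z -> HH (t z) /\ isreal (lam (t z))) ->
  closed_rect x0 x1 y0 y1 z0 -> 0 < y -> t z0 = ph (0, y) ->
  forall z, closed_rect x0 x1 y0 y1 z -> exists y', 0 < y' /\ t z = ph (0, y').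
Proof.
  intros [Hps He] Ct Ht D0 Hy E0 z Dz.
  set (D := closed_rect x0 x1 y0 y1) in *. set (s := fun z => ps (t z)).
  assert (Cs : contC D s) by (apply (contC_comp D HH t ps); auto; intros; now apply Ht).
  assert (Hs : forall z, D z -> HH (s z)) by (intros w Dw; now apply He, Ht).
  assert (Rs : forall z, D z -> isreal (lam (s z))).
  { intros w Dw. destruct (Ht w Dw) as [H1 H2]. destruct (He _ H1) as [_ [H3 [H4 _]]]. destruct (He _ H3) as [_ [_ [_ [_ H5]]]].
    rewrite H4 in H5. destruct (anh_inv k) as [k' K]. destruct (lam_not01 _ H3) as [N0 N1].
    unfold s. rewrite <- (K (lam (ps (t w)))) by auto. rewrite <- H5. now apply isreal_anh. }
  assert (Es : s z0 = (0, y)).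
  { unfold s. rewrite E0. assert (H1 : HH (0, y)) by (unfold HH; simpl; auto). now apply He. }
  assert (U : s z = refl (s z)).
  { apply (lift_unique C dC not01 rlam lam_sep x0 x1 y0 y1 (fun z => lam (s z)) s (fun z => refl (s z)) z0); auto.
    - apply (contC_comp D HH s lam); auto. apply lam_cont.
    - intros w Dw. now apply lam_not01, Hs.
    - split; auto. intros w Dw. split; auto.
    - split; [apply contC_opp, contC_conj; auto|]. intros w Dw. split; [now apply HH_refl, Hs|].
      rewrite lam_refl by auto. rewrite (isreal_eq _ (Rs w Dw)). cparts; ring.
    - rewrite Es. symmetry. apply refl_im. }
  assert (F : fst (s z) = 0).
  { apply (f_equal fst) in U. unfold refl in U. simpl in U. lra. }
  assert (Hz := Hs z Dz). exists (snd (s z)). split; [exact Hz|].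
  replace ((0, snd (s z)) : C) with (s z) by (cparts; auto).
  symmetry. unfold s. now apply He, Ht.
Qed.

Definition sg (pos : bool) : R := if pos then 1 else -1.

(** The second branch equals t / (1 - e t) with e = [sg (snd x)]; it is written as the conjugate of
    a translation by t -> -1/t so that the rules for [lam_T] and [lam_S] apply directly. *)
Definition act (x : nat * bool) (t : C) : C :=
  if Nat.eqb (fst x) 1 then (t + sg (snd x))%C else (- / (- / t + sg (snd x)))%C.

(** The first letter acts outermost: after its twist the strands are relabelled by [act x], and the
    lift of the remaining word is read through this relabelling. *)
Definition act_w (l : list (nat * bool)) (t : C) : C := fold_right act t l.

Lemma sg_pm (p : bool) : sg p = 1 \/ sg p = -1.
Proof. destruct p; simpl; auto. Qed.

Lemma act_HH (x : nat * bool) (t : C) : HH t -> HH (act x t).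
Proof.
  intros H. unfold act. destruct (Nat.eqb (fst x) 1); [now apply HH_trans|]. now apply HH_inv, HH_trans, HH_inv.
Qed.

Lemma act_w_HH (l : list (nat * bool)) (t : C) : HH t -> HH (act_w l t).
Proof. intros H. induction l; simpl; auto. now apply act_HH. Qed.

Lemma act_cont (x : nat * bool) : contC HH (act x).
Proof.
  unfold act. destruct (Nat.eqb (fst x) 1); [apply contC_plus; [apply contC_id | apply contC_const]|].
  apply (contC_comp HH HH (fun t => - / t + sg (snd x))%C (fun t => - / t)%C); [|apply inv_cont|].
  - apply contC_plus; [apply inv_cont | apply contC_const].
  - intros z Hz. now apply HH_trans, HH_inv.
Qed.

Lemma act_w_equivariant (l : list (nat * bool)) : exists k ps, equivariant k (act_w l) ps.
Proof.
  induction l as [|x l IH] using rev_ind.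
  - exists 0%nat, (fun t => t). apply equivariant_id.
  - destruct IH as [k [ps H]].
    replace (act_w (l ++ [x])) with (fun t => act_w l (act x t))
      by (apply functional_extensionality; intros t; unfold act_w; rewrite fold_right_app; reflexivity).
    unfold act. destruct (Nat.eqb (fst x) 1).
    + destruct (equivariant_T k _ ps (sg (snd x)) (sg_pm _) H) as [k' H']. exists k'. eexists. exact H'.
    + destruct (equivariant_S _ _ _ H) as [k1 H1].
      destruct (equivariant_T _ _ _ (sg (snd x)) (sg_pm _) H1) as [k2 H2].
      destruct (equivariant_S _ _ _ H2) as [k3 H3]. exists k3. eexists. exact H3.
Qed.

Lemma lam_shift (t : C) (p : bool) : HH t -> lam (t + sg p) = (lam t / (lam t - 1))%C.
Proof.
  intros H. destruct p; simpl; [now apply lam_T|]. replace (t + -1)%C with (t - 1)%C by ring. now apply lam_Tinv.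
Qed.

(** * The half twist *)

Definition rot (e t : R) : C := cexp (RtoC (e * t) * Ipi)%C.

Lemma rot_eq (e t : R) : rot e t = (cos (e * (PI * t)), sin (e * (PI * t))).
Proof.
  unfold rot, cexp, Ipi. simpl. replace (e * t * 0 - 0 * PI) with 0 by ring. rewrite exp_0.
  replace (e * t * PI + 0 * 0) with (e * (PI * t)) by ring. now rewrite !Rmult_1_l.
Qed.

Lemma rot_Cmod (e t : R) : Cmod (rot e t) = 1.
Proof.
  unfold rot. rewrite Cmod_cexp. replace (fst (RtoC (e * t) * Ipi)%C) with 0; [apply exp_0|]. unfold Ipi; simpl. ring.
Qed.

Lemma rot_cont (D : C -> Prop) (e : R) : contC D (fun z => rot e (fst z)).
Proof.
  unfold rot. apply contC_cexp. apply (contD_ext _ _ (fun z => RtoC e * Ipi * RtoC (fst z))%C).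
  - intros z _. rewrite RtoC_mult. ring.
  - apply contC_mult; [apply contC_const | apply contC_fst].
Qed.

Lemma fst_inv_pos (w : C) : 0 < fst w -> 0 < fst (/ w)%C.
Proof. intros H. destruct w as [x y]; simpl in *. apply Rdiv_lt_0_compat; nra. Qed.

Lemma fst_scal (s : R) (w : C) : fst (RtoC s * w)%C = s * fst w.
Proof. simpl. ring. Qed.

Lemma fst_ge_Cmod (u : C) : - Cmod u <= fst u <= Cmod u.
Proof. assert (H := Cmod_fst u). apply Rabs_le_between. auto. Qed.

Lemma unit_sides (u : C) : Cmod u = 1 -> u <> 0%C /\ (3 + u)%C <> 0%C /\ (3 - u)%C <> 0%C /\ 2 <= fst (3 + u)%C.
Proof.
  intros H. assert (B := fst_ge_Cmod u). rewrite H in B.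
  split; [intros E; rewrite E, Cmod_0 in H; lra|].
  split; [intros E; apply (f_equal fst) in E; simpl in E; lra|].
  split; [intros E; apply (f_equal fst) in E; simpl in E; lra|]. simpl. lra.
Qed.

(** The ratio (b - a) / (c - a) for the strands (3 - u) / 2, (3 + u) / 2 and 3 of the twist of the
    first two strands, with u = [rot e t]. *)
Definition twist_ratio (e t : R) : C := (2 * rot e t / (3 + rot e t))%C.

Lemma twist_ratio_cont (D : C -> Prop) (e : R) : contC D (fun z => twist_ratio e (fst z)).
Proof.
  unfold twist_ratio. apply contC_div.
  - apply contC_mult; [apply contC_const | apply rot_cont].
  - apply contC_plus; [apply contC_const | apply rot_cont].
  - intros z _. apply unit_sides, rot_Cmod.
Qed.

Lemma twist_ratio_Cmod (e t : R) : Cmod (twist_ratio e t) <= 1.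
Proof.
  destruct (unit_sides (rot e t) (rot_Cmod e t)) as [_ [N [_ L]]].
  unfold twist_ratio. rewrite Cmod_div, Cmod_mult, rot_Cmod, Cmod_R, Rabs_pos_eq by (auto; lra).
  assert (H := fst_ge_Cmod (3 + rot e t)). apply (Rmult_le_reg_r (Cmod (3 + rot e t))); [lra|].
  field_simplify; lra.
Qed.

(* Both [twist_ratio e t] and [lam (e t + iY)] are positive-real-part multiples of [u = exp (i pi e t)]. *)
Lemma twist_homotopy_not01 (e t s Y : R) : 0 <= s <= 1 ->
  Cmod (lam ((e * t)%R, Y) - 16 * cexp (Ipi * ((e * t)%R, Y))) < Cmod (16 * cexp (Ipi * ((e * t)%R, Y))) -> Cmod (lam ((e * t)%R, Y)) < 1 / 2 ->
  not01 (RtoC (1 - s) * twist_ratio e t + RtoC s * lam ((e * t)%R, Y))%C.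
Proof.
  intros Hs Hc Hl. set (u := rot e t). assert (Hu : Cmod u = 1) by apply rot_Cmod.
  destruct (unit_sides u Hu) as [N0 [N3 [_ L3]]].
  set (r := 16 * exp (- (PI * Y))).
  assert (Pr : 0 < r) by (unfold r; generalize (exp_pos (- (PI * Y))); lra).
  assert (Ec : (16 * cexp (Ipi * ((e * t)%R, Y)))%C = (RtoC r * u)%C).
  { unfold u, r, rot, Ipi. cparts;
    replace (e * t * 0 - 0 * PI) with 0 by ring; replace (0 * (e * t) - PI * Y) with (- (PI * Y)) by ring;
    replace (0 * Y + PI * (e * t)) with (e * t * PI + 0 * 0) by ring; rewrite exp_0; ring. }
  rewrite Ec in Hc. set (l := lam ((e * t)%R, Y)) in *.
  rewrite Cmod_mult, Hu, Cmod_R, Rabs_pos_eq, Rmult_1_r in Hc by lra.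
  split.
  - set (K := (RtoC (1 - s) * (2 * / (3 + u)) + RtoC s * (RtoC r + (l - RtoC r * u) / u))%C).
    assert (EK : (RtoC (1 - s) * twist_ratio e t + RtoC s * l)%C = (u * K)%C).
    { unfold twist_ratio, K. fold u. field. auto. }
    rewrite EK. apply Cmult_neq_0; auto. intros E.
    assert (F : 0 < fst K).
    { assert (P1 : 0 < fst (RtoC 2 * / (3 + u))%C) by (rewrite fst_scal; apply Rmult_lt_0_compat; [lra|]; apply fst_inv_pos; lra).
      assert (P2 : 0 < fst (RtoC r + (l - RtoC r * u) / u)%C).
      { assert (Q := fst_ge_Cmod ((l - RtoC r * u) / u)%C). rewrite Cmod_div, Hu in Q by auto.
        unfold Rdiv in Q. rewrite Rinv_1, Rmult_1_r in Q.
        replace (fst (RtoC r + (l - RtoC r * u) / u)%C) with (r + fst ((l - RtoC r * u) / u)%C) by reflexivity. lra. }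
      unfold K. replace (fst _) with ((1 - s) * fst (RtoC 2 * / (3 + u))%C + s * fst (RtoC r + (l - RtoC r * u) / u)%C).
      - destruct (Req_dec s 0) as [->|Ns]; [lra|].
        assert (0 < s * fst (RtoC r + (l - RtoC r * u) / u)%C) by (apply Rmult_lt_0_compat; lra).
        assert (0 <= (1 - s) * fst (RtoC 2 * / (3 + u))%C) by (apply Rmult_le_pos; lra). lra.
      - rewrite <- !fst_scal. reflexivity. }
    rewrite E in F. simpl in F. lra.
  - intros E. destruct (Req_dec s 0) as [->|Ns].
    + assert (E1 : twist_ratio e t = 1%C).
      { rewrite <- E. replace (1 - 0) with 1 by ring. ring. }
      unfold twist_ratio in E1. fold u in E1.
      assert (E2 : u = RtoC 3).
      { replace u with (2 * u / (3 + u) * (3 + u) - u)%C by (field; auto). rewrite E1. ring. }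
      rewrite E2, Cmod_R, Rabs_pos_eq in Hu; lra.
    + assert (T := Cmod_triangle (RtoC (1 - s) * twist_ratio e t) (RtoC s * l)). rewrite E, Cmod_1, !Cmod_mult, !Cmod_R, !Rabs_pos_eq in T by lra.
      assert (T2 := twist_ratio_Cmod e t). assert (T3 := Cmod_ge_0 (twist_ratio e t)).
      assert ((1 - s) * Cmod (twist_ratio e t) <= 1 - s) by nra. assert (s * Cmod l < s * (1 / 2)) by nra. lra.
Qed.

Lemma rot_0 (e : R) : rot e 0 = 1%C.
Proof. rewrite rot_eq. replace (e * (PI * 0)) with 0 by ring. rewrite cos_0, sin_0. reflexivity. Qed.

Lemma rot_1 (p : bool) : rot (sg p) 1 = (-1)%C.
Proof.
  rewrite rot_eq. destruct p; simpl.
  - replace (1 * (PI * 1)) with PI by ring. rewrite cos_PI, sin_PI. reflexivity.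
  - replace (-1 * (PI * 1)) with (- PI) by ring. rewrite cos_neg, sin_neg, cos_PI, sin_PI. cparts; ring.
Qed.

(** The path 2 u / (3 + u) is deformed linearly into [lam] along the segment from iY to e + iY,
    where the lift is the segment itself. The ends of the paths remain real during the deformation,
    so by [real_stay] the lift keeps to iR+ and to e + iR+; the value of [lam] then identifies the
    end point i + e. *)
Lemma twist_path (p : bool) : exists s : C -> C, contC (closed_rect 0 1 0 0) s /\
  (forall z, closed_rect 0 1 0 0 z -> HH (s z) /\ lam (s z) = twist_ratio (sg p) (fst z)) /\
  s (0, 0) = (0, 1) /\ s (1, 0) = ((0, 1) + sg p)%C.
Proof.
  destruct lam_cusp as [Y1 [HY1 K1]]. destruct (lam_small (1/2)) as [Y2 [HY2 K2]]; [lra|].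
  set (Y := Rmax Y1 Y2). assert (LY1 : Y1 <= Y) by apply Rmax_l. assert (LY2 : Y2 <= Y) by apply Rmax_r. clearbody Y.
  set (e := sg p). set (M := fun z : C => (RtoC (1 - snd z) * twist_ratio e (fst z) + RtoC (snd z) * lam ((e * fst z)%R, Y))%C).
  assert (CM : contC (closed_rect 0 1 0 1) M).
  { unfold M. apply contC_plus; apply contC_mult.
    - apply (contD_ext _ _ (fun z => 1 - RtoC (snd z))%C); [intros; now rewrite RtoC_minus|].
      apply contC_minus; [apply contC_const | apply contC_snd].
    - apply twist_ratio_cont.
    - apply contC_snd.
    - apply (contC_comp _ HH (fun z : C => ((e * fst z)%R, Y)) lam); [|apply lam_cont | intros; unfold HH; simpl; lra].
      apply (contD_ext _ _ (fun z => RtoC e * RtoC (fst z) + (0, Y))%C); [intros; cparts; ring|].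
      apply contC_plus; [apply (contC_mult _ (fun _ => RtoC e)); [apply contC_const | apply contC_fst] | apply contC_const]. }
  assert (NM : forall z, closed_rect 0 1 0 1 z -> not01 (M z)).
  { intros [t s] [H1 H2]. simpl in H1, H2. apply twist_homotopy_not01; auto. }
  destruct (lift_exists C dC not01 rlam lam_evenly lam_sep 0 1 0 1 M ltac:(lra) ltac:(lra) CM NM (0, 0) (0, 1)) as [L [[CL HL] E0]].
  { split; simpl; lra. }
  { split; [unfold HH; simpl; lra|]. rewrite lam_i. unfold M, twist_ratio. simpl fst. simpl snd. rewrite rot_0.
    replace (1 - 0) with 1 by ring. replace (RtoC (1/2)) with (/ 2)%C by (cparts; field).
    replace (3 + 1)%C with (RtoC 4) by (cparts; ring).
    match goal with |- context [lam ?a] => generalize (lam a) end. intros x. cparts; field. }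
  assert (HM0 : lam (0, Y) = RtoC (phi Y)) by (apply lam_phi; lra).
  assert (S1 : exists y, 0 < y /\ L (0, 1) = (0, y)).
  { apply (real_stay 0 (fun t => t) (fun t => t) 0 0 0 1 L (0, 0) 1); auto using equivariant_id; try lra; try (split; simpl; lra).
    - apply (contD_sub (closed_rect 0 1 0 1)); auto. intros z Hz. unfold closed_rect in *; lra.
    - intros z Hz. destruct (HL z) as [H1 H2]; [unfold closed_rect in *; lra|]. split; auto. rewrite H2.
      unfold M. replace (fst z) with 0 by (unfold closed_rect in Hz; lra). rewrite Rmult_0_r, HM0.
      unfold twist_ratio. rewrite rot_0. auto 8 using isreal_plus, isreal_mult, isreal_div, isreal_R. }
  assert (S2 : L (0, 1) = (0, Y)).
  { destruct S1 as [y [Py Ey]]. rewrite Ey. f_equal. apply lam_im_inj; [auto | lra |]. rewrite <- Ey.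
    destruct (HL (0, 1)) as [_ ->]; [split; simpl; lra|]. unfold M. simpl. rewrite Rmult_0_r.
    replace (1 - 1) with 0 by ring. ring. }
  (* On the upper edge of the homotopy the horizontal segment is an explicit lift, and uniqueness
     identifies it with L. *)
  assert (S3 : L (1, 1) = (e, Y)).
  { replace ((e, Y) : C) with (((e * fst ((1, 1) : C))%R, Y) : C) by (simpl; f_equal; ring).
    apply (lift_unique C dC not01 rlam lam_sep 0 1 1 1 M L (fun z => ((e * fst z)%R, Y)) (0, 1)); try (split; simpl; lra).
    - apply (contD_sub (closed_rect 0 1 0 1)); auto. intros z Hz. unfold closed_rect in *; lra.
    - intros z Hz. apply NM. unfold closed_rect in *; lra.
    - split; [apply (contD_sub (closed_rect 0 1 0 1)); auto|]; intros z Hz; [|apply HL]; unfold closed_rect in *; lra.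
    - split.
      + apply (contD_ext _ _ (fun z => RtoC e * RtoC (fst z) + (0, Y))%C); [intros; cparts; ring|].
        apply contC_plus; [apply (contC_mult _ (fun _ => RtoC e)); [apply contC_const | apply contC_fst] | apply contC_const].
      + intros z Hz. split; [unfold HH; simpl; lra|]. unfold M. replace (snd z) with 1 by (unfold closed_rect in Hz; lra).
        replace (1 - 1) with 0 by ring. ring.
    - rewrite S2. simpl. f_equal. ring. }
  assert (HeY : lam (e, Y) = (RtoC (phi Y) / (RtoC (phi Y) - 1))%C).
  { rewrite <- HM0. unfold e. rewrite <- (lam_shift _ p) by (unfold HH; simpl; lra). f_equal. cparts; ring. }
  destruct (equivariant_T 0 _ _ e (sg_pm p) equivariant_id) as [k Hk].
  assert (S4 : exists y, 0 < y /\ L (1, 0) = ((0, y) + RtoC e)%C).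
  { apply (real_stay k _ _ 1 1 0 1 L (1, 1) Y Hk); try lra; try (split; simpl; lra).
    - apply (contD_sub (closed_rect 0 1 0 1)); auto. intros z Hz. unfold closed_rect in *; lra.
    - intros z Hz. destruct (HL z) as [H1 H2]; [unfold closed_rect in *; lra|]. split; auto. rewrite H2.
      unfold M. replace (fst z) with 1 by (unfold closed_rect in Hz; lra). rewrite Rmult_1_r, HeY.
      unfold twist_ratio, e. rewrite rot_1. auto 10 using isreal_plus, isreal_mult, isreal_div, isreal_minus, isreal_R, isreal_opp.
    - rewrite S3. cparts; ring. }
  destruct S4 as [y [Py Ey]].
  assert (Ly : lam (0, y) = RtoC (1/2)).
  { destruct (HL (1, 0)) as [_ H2]; [split; simpl; lra|]. rewrite Ey in H2. unfold e in H2. rewrite lam_shift in H2 by (unfold HH; simpl; lra).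
    fold e in H2. unfold M, twist_ratio in H2. simpl fst in H2. simpl snd in H2. unfold e at 1 2 in H2. rewrite rot_1 in H2.
    destruct (lam_phi y Py) as [E1 B]. rewrite E1 in *. set (v := phi y) in *. f_equal.
    revert H2. match goal with |- context [lam ?a] => generalize (lam a) end. intros x H2.
    assert (E2 : (RtoC v / (RtoC v - 1))%C = (-1)%C).
    { rewrite H2. cparts; field. }
    assert (Nv : (RtoC v - 1)%C <> 0%C) by (rewrite <- RtoC_minus; intros E3; apply RtoC_inj in E3; lra).
    assert (E3 : RtoC v = (RtoC v / (RtoC v - 1) * (RtoC v - 1))%C) by (field; auto).
    rewrite E2 in E3. apply (f_equal fst) in E3. simpl in E3. lra. }
  exists L. split; [apply (contD_sub (closed_rect 0 1 0 1)); auto; intros z Hz; unfold closed_rect in *; lra|].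
  split; [|split; auto].
  - intros z Hz. destruct (HL z) as [H1 H2]; [unfold closed_rect in *; lra|]. split; auto. rewrite H2. unfold M.
    replace (snd z) with 0 by (unfold closed_rect in Hz; lra). replace (1 - 0) with 1 by ring. unfold e. ring.
  - rewrite Ey. f_equal. f_equal. apply lam_im_inj; try lra. rewrite Ly. symmetry. apply lam_i.
Qed.

(** * Marked lifts *)

(* The triple [(a, b, c)] is the affine image of [(0, lam t, 1)]. *)
Definition marked (D : C -> Prop) (f : C -> C3) (a b c t : C -> C) : Prop :=
  ord_lift D f a b c /\ contC D t /\
  forall z, D z -> HH (t z) /\ (b z - a z)%C = (lam (t z) * (c z - a z))%C.

Lemma marked_ext (D D' : C -> Prop) (f g : C -> C3) (a b c t : C -> C) :
  (forall z, D' z -> D z) -> (forall z, D' z -> f z = g z) -> marked D f a b c t -> marked D' g a b c t.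
Proof.
  intros S E [[A1 [A2 [A3 A4]]] [A5 A6]]. split; [split; [|split; [|split]]|split].
  - now apply (contD_sub D).
  - now apply (contD_sub D).
  - now apply (contD_sub D).
  - intros z Hz. rewrite <- E by auto. auto.
  - now apply (contD_sub D).
  - auto.
Qed.

Lemma marked_comp (D D' : C -> Prop) (f : C -> C3) (a b c t h : C -> C) :
  contC D' h -> (forall z, D' z -> D (h z)) -> marked D f a b c t ->
  marked D' (fun z => f (h z)) (fun z => a (h z)) (fun z => b (h z)) (fun z => c (h z)) (fun z => t (h z)).
Proof.
  intros Ch S [[A1 [A2 [A3 A4]]] [A5 A6]]. split; [split; [|split; [|split]]|split].
  - now apply (contC_comp D' D).
  - now apply (contC_comp D' D).
  - now apply (contC_comp D' D).
  - intros z Hz. auto.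
  - now apply (contC_comp D' D).
  - intros z Hz. auto.
Qed.

Lemma marked_paste (D : C -> Prop) (f : C -> C3) (m : R) (a b c t a' b' c' t' : C -> C) :
  marked (fun z => D z /\ fst z <= m) f a b c t -> marked (fun z => D z /\ m <= fst z) f a' b' c' t' ->
  (forall z, D z -> fst z = m -> a z = a' z /\ b z = b' z /\ c z = c' z /\ t z = t' z) ->
  marked D f (fun z => if Rle_dec (fst z) m then a z else a' z) (fun z => if Rle_dec (fst z) m then b z else b' z)
    (fun z => if Rle_dec (fst z) m then c z else c' z) (fun z => if Rle_dec (fst z) m then t z else t' z).
Proof.
  intros [[A1 [A2 [A3 A4]]] [A5 A6]] [[B1 [B2 [B3 B4]]] [B5 B6]] E.
  assert (L : forall z w : C, Rabs (fst z - fst w) <= Cmod (z - w)) by (intros z w; apply (Cmod_fst (z - w))).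
  split; [split; [|split; [|split]]|split]; try (apply contC_paste; auto; intros z Dz Ez; now apply E).
  - intros z Dz. destruct (Rle_dec (fst z) m); [apply A4 | apply B4]; split; auto; lra.
  - intros z Dz. destruct (Rle_dec (fst z) m); [apply A6 | apply B6]; split; auto; lra.
Qed.

Lemma marked_exists (x0 x1 y0 y1 : R) (f : C -> C3) (z0 a0 b0 c0 t0 : C) :
  contD (closed_rect x0 x1 y0 y1) d3 f -> (forall z, closed_rect x0 x1 y0 y1 z -> inX (f z)) ->
  closed_rect x0 x1 y0 y1 z0 -> distinct3 a0 b0 c0 -> f z0 = sym3 a0 b0 c0 ->
  HH t0 -> (b0 - a0)%C = (lam t0 * (c0 - a0))%C ->
  exists a b c t, marked (closed_rect x0 x1 y0 y1) f a b c t /\ a z0 = a0 /\ b z0 = b0 /\ c z0 = c0 /\ t z0 = t0.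
Proof.
  intros Hf Hin D0 Dis E0 Ht El.
  destruct (ord_lift_exists x0 x1 y0 y1 f z0 a0 b0 c0 Hf Hin D0 Dis E0) as [a [b [c [L [Ea [Eb Ec]]]]]].
  assert (X : x0 <= x1) by (unfold closed_rect in D0; lra). assert (Y : y0 <= y1) by (unfold closed_rect in D0; lra).
  assert (L' := L). destruct L' as [A1 [A2 [A3 A4]]].
  assert (N : forall z, closed_rect x0 x1 y0 y1 z -> (c z - a z)%C <> 0%C).
  { intros z Dz. destruct (A4 z Dz) as [[_ [Q _]] _]. apply Csub_neq0; auto. }
  set (m := fun z => ((b z - a z) / (c z - a z))%C).
  destruct (lift_exists C dC not01 rlam lam_evenly lam_sep x0 x1 y0 y1 m X Y) with (z0 := z0) (e0 := t0) as [t [[Ct Hl] Et]]; auto.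
  - unfold m. apply contC_div; auto; apply contC_minus; auto.
  - intros z Dz. specialize (N z Dz). destruct (A4 z Dz) as [[Q1 [Q2 Q3]] _]. split.
    + apply Cdiv_neq0; auto. now apply Csub_neq0, not_eq_sym.
    + intros E. apply Q3. apply Csub0. replace (b z - c z)%C with (m z * (c z - a z) - (c z - a z))%C by (unfold m; field; auto).
      rewrite E. ring.
  - split; auto. unfold m. rewrite Ea, Eb, Ec, El. specialize (N z0 D0). rewrite Ea, Ec in N. field. auto.
  - exists a, b, c, t. split; [split; [auto | split; auto]|auto].
    intros z Dz. destruct (Hl z Dz) as [H1 H2]. split; auto. rewrite H2. unfold m. field. auto.
Qed.

Lemma marked_unique (x0 x1 y0 y1 : R) (f : C -> C3) (a b c t a' b' c' t' : C -> C) (z0 : C) :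
  marked (closed_rect x0 x1 y0 y1) f a b c t -> marked (closed_rect x0 x1 y0 y1) f a' b' c' t' ->
  closed_rect x0 x1 y0 y1 z0 -> a z0 = a' z0 -> b z0 = b' z0 -> c z0 = c' z0 -> t z0 = t' z0 ->
  forall z, closed_rect x0 x1 y0 y1 z -> t z = t' z.
Proof.
  intros [L [Ct Ht]] [L' [Ct' Ht']] D0 Ea Eb Ec Et.
  assert (U := ord_lift_unique x0 x1 y0 y1 f a b c a' b' c' z0 (ord_lift_cont _ _ _ _ _ L) L L' D0 Ea Eb Ec).
  assert (N : forall z, closed_rect x0 x1 y0 y1 z -> (c z - a z)%C <> 0%C).
  { intros z Dz. destruct L as [_ [_ [_ A4]]]. destruct (A4 z Dz) as [[_ [Q _]] _]. apply Csub_neq0; auto. }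
  assert (K : forall z, closed_rect x0 x1 y0 y1 z -> lam (t z) = lam (t' z)).
  { intros z Dz. destruct (U z Dz) as [E1 [E2 E3]]. destruct (Ht z Dz) as [_ H1]. destruct (Ht' z Dz) as [_ H2].
    rewrite <- E1, <- E2, <- E3, H1 in H2.
    replace (lam (t z)) with (lam (t z) * (c z - a z) / (c z - a z))%C by (field; auto). rewrite H2. field. auto. }
  apply (lift_unique C dC not01 rlam lam_sep x0 x1 y0 y1 (fun z => lam (t z)) t t' z0); auto.
  - apply (contC_comp _ HH t lam); auto; [apply lam_cont | intros; now apply Ht].
  - intros z Dz. apply lam_not01. now apply Ht.
  - split; auto. intros z Dz. split; auto. now apply Ht.
  - split; auto. intros z Dz. split; [now apply Ht' | symmetry; auto].
Qed.

Lemma lam_act (x : nat * bool) (t : C) : HH t ->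
  lam (act x t) = if Nat.eqb (fst x) 1 then (lam t / (lam t - 1))%C else (/ lam t)%C.
Proof.
  intros H. unfold act. destruct (Nat.eqb (fst x) 1); [now apply lam_shift|].
  assert (H1 := HH_inv t H). rewrite lam_S by now apply HH_trans. rewrite lam_shift, lam_S by auto.
  destruct (lam_not01 t H) as [N0 _]. assert (N1 := Copp_neq0 _ N0). field. split; auto.
  replace (1 - lam t - 1)%C with (- lam t)%C by ring. auto.
Qed.

(** Exchanging a and b turns lambda into lambda / (lambda - 1), exchanging b and c turns it into 1 /
    lambda. The two directions of a twist have the same effect on lambda and differ only in the
    lift. *)
Lemma marked_swap (x : nat * bool) (D : C -> Prop) (f : C -> C3) (a b c t : C -> C) : marked D f a b c t ->
  if Nat.eqb (fst x) 1 then marked D f b a c (fun z => act x (t z)) else marked D f a c b (fun z => act x (t z)).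
Proof.
  intros [[A1 [A2 [A3 A4]]] [A5 A6]].
  assert (Ca : contC D (fun z => act x (t z))).
  { apply (contC_comp D HH t (act x)); auto; [apply act_cont | intros; now apply A6]. }
  assert (S : forall u v w p q r : C, distinct3 u v w -> sym3 u v w = sym3 v u w /\ sym3 u v w = sym3 u w v /\
     distinct3 v u w /\ distinct3 u w v).
  { intros u v w _ _ _ [Q1 [Q2 Q3]]. split; [sym3_ring|]. split; [sym3_ring|].
    split; repeat split; auto. }
  assert (K : forall z, D z -> lam (t z) <> 0%C /\ (lam (t z) - 1)%C <> 0%C).
  { intros z Dz. destruct (lam_not01 (t z)) as [N0 N1]; [now apply A6|]. split; auto. now apply Csub_neq0. }
  assert (Act := fun z Dz => lam_act x (t z) (proj1 (A6 z Dz))).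
  destruct (Nat.eqb (fst x) 1).
  - split; [split; [auto | split; [auto | split; [auto|]]]|split; auto].
    + intros z Dz. destruct (A4 z Dz) as [Q ->]. destruct (S _ _ _ 0%C 0%C 0%C Q) as [-> [_ [? _]]]. auto.
    + intros z Dz. destruct (A6 z Dz) as [Q1 Q2]. split; [now apply act_HH|]. rewrite Act by auto.
      destruct (K z Dz) as [N0 N1].
      replace (c z - b z)%C with (c z - a z - (b z - a z))%C by ring. replace (a z - b z)%C with (- (b z - a z))%C by ring.
      rewrite Q2. field. auto.
  - split; [split; [auto | split; [auto | split; [auto|]]]|split; auto].
    + intros z Dz. destruct (A4 z Dz) as [Q E]. destruct (S _ _ _ 0%C 0%C 0%C Q) as [_ [E2 [_ ?]]]. rewrite <- E2. auto.
    + intros z Dz. destruct (A6 z Dz) as [Q1 Q2]. split; [now apply act_HH|]. rewrite Act by auto.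
      destruct (K z Dz) as [N0 N1]. rewrite Q2. field. auto.
Qed.

Lemma half_twist_rot (i : nat) (p : bool) (t : R) : half_twist i p t =
  if Nat.eqb i 1 then sym3 (RtoC (3/2) - RtoC (1/2) * rot (sg p) t) (RtoC (3/2) + RtoC (1/2) * rot (sg p) t) (RtoC 3)
  else sym3 (RtoC 1) (RtoC (5/2) - RtoC (1/2) * rot (sg p) t) (RtoC (5/2) + RtoC (1/2) * rot (sg p) t).
Proof.
  unfold half_twist. rewrite rot_eq.
  assert (E : (if p then PI * t else - (PI * t)) = sg p * (PI * t)) by (destruct p; simpl; ring). rewrite E.
  set (th := sg p * (PI * t)). destruct (Nat.eqb i 1).
  - f_equal; cparts; field.
  - replace (5 / 2 - cos th / 2, - sin th / 2) with ((RtoC (5/2) - RtoC (1/2) * (cos th, sin th))%C) by (cparts; field).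
    replace (5 / 2 + cos th / 2, sin th / 2) with ((RtoC (5/2) + RtoC (1/2) * (cos th, sin th))%C) by (cparts; field).
    sym3_ring.
Qed.

Lemma Chalf_neq (x y u : C) : (y - x)%C = u -> u <> 0%C -> x <> y.
Proof. intros E N Exy. apply N. rewrite <- E, Exy. ring. Qed.

Lemma Chalf : RtoC (1/2) = (/ 2)%C.
Proof. cparts; field. Qed.

(** Where the labelled strands stand after a half twist that started from (1, 2, 3). *)
Definition swapped (x : nat * bool) (a b c : C) : Prop :=
  if Nat.eqb (fst x) 1 then a = RtoC 2 /\ b = RtoC 1 /\ c = RtoC 3 else a = RtoC 1 /\ b = RtoC 3 /\ c = RtoC 2.

Lemma marked_twist (x : nat * bool) : exists a b c t,
  marked (closed_rect 0 1 0 0) (fun z => half_twist (fst x) (snd x) (fst z)) a b c t /\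
  (a (0, 0) = RtoC 1 /\ b (0, 0) = RtoC 2 /\ c (0, 0) = RtoC 3 /\ t (0, 0) = (0, 1)) /\
  swapped x (a (1, 0)) (b (1, 0)) (c (1, 0)) /\ t (1, 0) = act x (0, 1).
Proof.
  destruct x as [i p]. simpl fst. simpl snd. destruct (twist_path p) as [s [Cs [Hs [S0 S1]]]].
  set (u := fun z : C => rot (sg p) (fst z)). assert (Cu : contC (closed_rect 0 1 0 0) u) by apply rot_cont.
  assert (Hu : forall z, u z <> 0%C /\ (3 + u z)%C <> 0%C /\ (3 - u z)%C <> 0%C).
  { intros z. destruct (unit_sides (u z) (rot_Cmod _ _)) as [? [? [? _]]]. auto. }
  assert (U0 : u (0, 0) = 1%C) by apply rot_0. assert (U1 : u (1, 0) = (-1)%C) by apply rot_1.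
  assert (Ck : forall k : R, contC (closed_rect 0 1 0 0) (fun z => RtoC k - RtoC (1/2) * u z)%C /\ contC (closed_rect 0 1 0 0) (fun z => RtoC k + RtoC (1/2) * u z)%C).
  { intros k. split; [apply contC_minus | apply contC_plus]; try apply contC_const; apply contC_mult; auto; apply contC_const. }
  assert (Dh : (/ 2)%C <> 0%C) by (apply Cinv_neq0, C2_neq0).
  unfold swapped, act. simpl fst. simpl snd. destruct (Nat.eqb i 1) eqn:Ei.
  - exists (fun z => RtoC (3/2) - RtoC (1/2) * u z)%C, (fun z => RtoC (3/2) + RtoC (1/2) * u z)%C, (fun _ => RtoC 3), s.
    split; [|rewrite U0, U1; repeat split; auto; cparts; field].
    split; [split; [apply Ck | split; [apply Ck | split; [apply contC_const|]]]|split; auto].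
    + intros z Dz. rewrite half_twist_rot, Ei. split; auto. destruct (Hu z) as [N0 [N1 N2]]. repeat split.
      * apply (Chalf_neq _ _ (u z)); auto. rewrite Chalf. field.
      * apply (Chalf_neq _ _ (/ 2 * (3 + u z))); [|now apply Cmult_neq_0].
        replace (RtoC (3/2)) with (3 * / 2)%C by (rewrite <- Chalf; cparts; field). rewrite Chalf. field.
      * apply (Chalf_neq _ _ (/ 2 * (3 - u z))); [|now apply Cmult_neq_0].
        replace (RtoC (3/2)) with (3 * / 2)%C by (rewrite <- Chalf; cparts; field). rewrite Chalf. field.
    + intros z Dz. destruct (Hs z Dz) as [H1 H2]. split; auto. rewrite H2. unfold twist_ratio. fold (u z).
      destruct (Hu z) as [N0 [N1 N2]].
      replace (RtoC (3/2)) with (3 * / 2)%C by (rewrite <- Chalf; cparts; field). rewrite Chalf. field. auto.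
  (* For sigma_2 the ratio is (3 - u) / (3 + u) = 1 - 2 u / (3 + u), which is what t -> -1/t does to
     [lam]. *)
  - exists (fun _ => RtoC 1), (fun z => RtoC (5/2) - RtoC (1/2) * u z)%C, (fun z => RtoC (5/2) + RtoC (1/2) * u z)%C, (fun z => - / s z)%C.
    assert (Inv_i : (- / (0, 1))%C = (0, 1)) by (cparts; field).
    split; [|rewrite U0, U1, S0, S1, Inv_i; repeat split; auto; cparts; field].
    split; [split; [apply contC_const | split; [apply Ck | split; [apply Ck|]]]|split; auto].
    + intros z Dz. rewrite half_twist_rot, Ei. split; auto. destruct (Hu z) as [N0 [N1 N2]]. repeat split.
      * apply (Chalf_neq _ _ (/ 2 * (3 - u z))); [|now apply Cmult_neq_0].
        replace (RtoC (5/2)) with (5 * / 2)%C by (rewrite <- Chalf; cparts; field). rewrite Chalf. field.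
      * apply (Chalf_neq _ _ (/ 2 * (3 + u z))); [|now apply Cmult_neq_0].
        replace (RtoC (5/2)) with (5 * / 2)%C by (rewrite <- Chalf; cparts; field). rewrite Chalf. field.
      * apply (Chalf_neq _ _ (u z)); auto. rewrite Chalf. field.
    + apply (contC_comp _ HH s (fun t => - / t)%C); auto; [apply inv_cont | intros; now apply Hs].
    + intros z Dz. destruct (Hs z Dz) as [H1 H2]. split; [now apply HH_inv|]. rewrite lam_S, H2 by auto. unfold twist_ratio. fold (u z).
      destruct (Hu z) as [N0 [N1 N2]].
      replace (RtoC (5/2)) with (5 * / 2)%C by (rewrite <- Chalf; cparts; field). rewrite Chalf. field. auto.
Qed.

Lemma half_twist_0 (i : nat) (p : bool) : half_twist i p 0 = base.
Proof.
  rewrite half_twist_rot, rot_0. unfold base. destruct (Nat.eqb i 1); f_equal; cparts; field.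
Qed.

Lemma letters_path_0 (l : list (nat * bool)) : letters_path l 0 = base.
Proof. destruct l as [|[i p] l]; simpl; auto. destruct (Rle_dec 0 1); [apply half_twist_0 | lra]. Qed.

(** Induction on the word. The lift for the tail starts at the labels 1, 2, 3 and at i, so
    [marked_swap] relabels it before it is attached to the end of the first twist. The starting
    point i comes from lambda(i) = 1/2, the ratio of the triple 1, 2, 3. *)
Lemma word_marked (l : list (nat * bool)) : exists a b c t,
  marked (closed_rect 0 (INR (length l)) 0 0) (fun z => letters_path l (fst z)) a b c t /\
  (a (0, 0) = RtoC 1 /\ b (0, 0) = RtoC 2 /\ c (0, 0) = RtoC 3 /\ t (0, 0) = (0, 1)) /\
  (isreal (a (INR (length l), 0)) /\ isreal (b (INR (length l), 0)) /\ isreal (c (INR (length l), 0))) /\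
  t (INR (length l), 0) = act_w l (0, 1).
Proof.
  induction l as [|x l [a' [b' [c' [t' [IH [[A0 [B0 [C0 T0]]] [[A1 [B1 C1]] T1]]]]]]]].
  - exists (fun _ => RtoC 1), (fun _ => RtoC 2), (fun _ => RtoC 3), (fun _ => (0, 1)).
    split; [|repeat split]. split; [split; [|split; [|split]]|split]; try apply contC_const.
    + intros z _. split; [|reflexivity]. repeat split; intros E; apply RtoC_inj in E; lra.
    + intros z _. split; [unfold HH; simpl; lra|]. rewrite lam_i. cparts; field.
  - destruct (marked_twist x) as [a [b [c [t [M [[E1 [E2 [E3 E4]]] [W T]]]]]]].
    set (N := INR (length l)). assert (N0 : 0 <= N) by apply pos_INR.
    assert (EN : INR (length (x :: l)) = N + 1) by (simpl length; now rewrite S_INR).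
    rewrite EN. set (h := fun z : C => (z - 1)%C).
    fold N in IH, A1, B1, C1, T1.
    assert (Q : exists a2 b2 c2 t2, marked (closed_rect 0 N 0 0) (fun z => letters_path l (fst z)) a2 b2 c2 t2 /\
      swapped x (a2 (0, 0)) (b2 (0, 0)) (c2 (0, 0)) /\ t2 (0, 0) = act x (0, 1) /\
      (isreal (a2 (N, 0)) /\ isreal (b2 (N, 0)) /\ isreal (c2 (N, 0))) /\ t2 (N, 0) = act x (act_w l (0, 1))).
    { assert (Sw := marked_swap x _ _ _ _ _ _ IH). unfold swapped. destruct (Nat.eqb (fst x) 1);
      do 4 eexists; (split; [exact Sw|]); cbv beta; rewrite T0, T1; auto 8. }
    destruct Q as [a2 [b2 [c2 [t2 [M2 [W2 [T2 [R2 F2]]]]]]]].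
    set (D := closed_rect 0 (N + 1) 0 0).
    assert (M1 : marked (fun z => D z /\ fst z <= 1) (fun z => letters_path (x :: l) (fst z)) a b c t).
    { apply (marked_ext (closed_rect 0 1 0 0) _ (fun z => half_twist (fst x) (snd x) (fst z))); auto.
      - intros z Hz. unfold D, closed_rect in *. lra.
      - intros z [_ Hz]. simpl. destruct (Rle_dec (fst z) 1); [reflexivity|lra]. }
    assert (M3 : marked (fun z => D z /\ 1 <= fst z) (fun z => letters_path (x :: l) (fst z))
       (fun z => a2 (h z)) (fun z => b2 (h z)) (fun z => c2 (h z)) (fun z => t2 (h z))).
    { apply (marked_ext (fun z => D z /\ 1 <= fst z) _ (fun z => letters_path l (fst (h z)))); auto.
      - intros z [_ Hz]. unfold h. replace (fst (z - 1)%C) with (fst z - 1) by (simpl; ring). simpl.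
        destruct (Rle_dec (fst z) 1); [|reflexivity]. replace (fst z) with 1 by lra.
        replace (1 - 1) with 0 by ring. rewrite letters_path_0, half_twist_rot, rot_1. unfold base.
        destruct (Nat.eqb (fst x) 1).
        + replace (sym3 1 2 3) with (sym3 2 1 3) by sym3_ring. f_equal; cparts; field.
        + replace (sym3 1 2 3) with (sym3 1 3 2) by sym3_ring. f_equal; cparts; field.
      - apply (marked_comp (closed_rect 0 N 0 0) _ (fun z => letters_path l (fst z)) a2 b2 c2 t2 h); auto.
        + apply contC_minus; [apply contC_id | apply contC_const].
        + intros z Hz. unfold D, h, closed_rect in *. simpl. lra. }
    assert (P := marked_paste D _ 1 _ _ _ _ _ _ _ _ M1 M3).
    do 4 eexists. split; [apply P|].
    + intros z Dz Ez. assert (Hz : z = (1, 0)) by (unfold D, closed_rect in Dz; cparts; lra).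
      subst z. replace (h (1, 0)) with ((0, 0) : C) by (cparts; ring).
      rewrite T, T2. unfold swapped in *. destruct (Nat.eqb (fst x) 1);
      destruct W as [-> [-> ->]]; destruct W2 as [-> [-> ->]]; auto.
    + cbv beta. cbn [fst]. destruct (Rle_dec 0 1) as [_|]; [|lra]. split; [auto|].
      destruct (Rle_dec (N + 1) 1) as [L|L].
      * assert (N = 0) by lra. replace (N + 1, 0) with (1, 0) by (f_equal; lra).
        rewrite H in *. assert (l = []) as -> by (destruct l; auto; unfold N in H; simpl length in H; rewrite S_INR in H; generalize (pos_INR (length l)); lra).
        rewrite T. unfold swapped in W. destruct (Nat.eqb (fst x) 1); destruct W as [-> [-> ->]]; repeat split.
      * replace (h (N + 1, 0)) with ((N, 0) : C) by (cparts; ring). split; auto.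
Qed.

Lemma std_marked (w : bword) : exists a b c t,
  marked (closed_rect 0 1 0 0) (fun z => std_path w (fst z)) a b c t /\
  (a (0, 0) = RtoC 1 /\ b (0, 0) = RtoC 2 /\ c (0, 0) = RtoC 3 /\ t (0, 0) = (0, 1)) /\
  (isreal (a (1, 0)) /\ isreal (b (1, 0)) /\ isreal (c (1, 0))) /\
  t (1, 0) = act_w (letters w) (0, 1).
Proof.
  destruct (word_marked (letters w)) as [a [b [c [t [M [H0 [H1 H2]]]]]]].
  set (N := INR (length (letters w))) in *. assert (PN : 0 <= N) by apply pos_INR.
  set (h := fun z : C => (RtoC N * RtoC (fst z))%C).
  assert (Mc := marked_comp (closed_rect 0 N 0 0) (closed_rect 0 1 0 0) _ a b c t h
    ltac:(apply contC_mult; [apply contC_const | apply contC_fst])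
    ltac:(intros [u v] [Hz1 Hz2]; unfold h; simpl in *; split; simpl; nra) M).
  exists (fun z => a (h z)), (fun z => b (h z)), (fun z => c (h z)), (fun z => t (h z)).
  replace (h (0, 0)) with ((0, 0) : C) by (cparts; ring).
  replace (h (1, 0)) with ((N, 0) : C) by (cparts; ring).
  split; [|auto]. eapply marked_ext; [intros z Hz; exact Hz | | exact Mc].
  intros z _. cbv beta. unfold std_path. fold N. f_equal. unfold h. simpl. ring.
Qed.

(** * Monodromy along paths and rectangles *)

Lemma pos_stay (x0 x1 y0 y1 : R) (d : C -> C) (z0 : C) : contC (closed_rect x0 x1 y0 y1) d ->
  (forall z, closed_rect x0 x1 y0 y1 z -> isreal (d z) /\ d z <> 0%C) -> closed_rect x0 x1 y0 y1 z0 -> 0 < fst (d z0) ->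
  forall z, closed_rect x0 x1 y0 y1 z -> 0 < fst (d z).
Proof.
  intros Cd Hd D0 P0 z Dz.
  apply (rect_connected (fun z => 0 < fst (d z)) x0 x1 y0 y1) with z0; auto.
  intros u Du. destruct (Hd u Du) as [R1 N1].
  assert (N2 : fst (d u) <> 0) by (intros E; apply N1, Ceq; auto).
  destruct (Cd u Du (Rabs (fst (d u)))) as [del [Pd K]]; [now apply Rabs_pos_lt|].
  exists del; split; auto. intros w Dw L. specialize (K w Dw L). unfold dC in K.
  assert (Q := Rle_lt_trans _ _ _ (Cmod_fst (d u - d w)) K). simpl in Q.
  unfold Rabs in Q. destruct (Rcase_abs (fst (d u))); destruct (Rcase_abs (fst (d u) + - fst (d w))); lra.
Qed.

Lemma real_triple (D : C -> Prop) (f : C -> C3) (a b c t : C -> C) (z : C) : marked D f a b c t -> D z -> inEtr (f z) ->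
  isreal (a z) /\ isreal (b z) /\ isreal (c z) /\ isreal (lam (t z)) /\ (c z - a z)%C <> 0%C.
Proof.
  intros [[A1 [A2 [A3 A4]]] [A5 A6]] Dz [r1 [r2 [r3 [_ [_ [_ E]]]]]]. destruct (A4 z Dz) as [[N1 [N2 N3]] E2].
  assert (K : forall u, rroot (f z) u -> isreal u).
  { intros u Hu. rewrite E in Hu. apply rroot_sym3 in Hu. destruct Hu as [-> | [-> | ->]]; apply isreal_R. }
  assert (Ra : isreal (a z)) by (apply K; rewrite E2; apply rroot_sym3; auto).
  assert (Rb : isreal (b z)) by (apply K; rewrite E2; apply rroot_sym3; auto).
  assert (Rc : isreal (c z)) by (apply K; rewrite E2; apply rroot_sym3; auto).
  assert (N : (c z - a z)%C <> 0%C) by (apply Csub_neq0; auto).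
  repeat split; auto. destruct (A6 z Dz) as [_ Q].
  replace (lam (t z)) with ((b z - a z) / (c z - a z))%C by (rewrite Q; field; auto).
  auto using isreal_div, isreal_minus.
Qed.

(** On iR+ the values of [lam] lie between 0 and 1, which places b between a and c; the sign of c -
    a then fixes the order. *)
Lemma base_triple (a b c : C) (y : R) : distinct3 a b c -> base = sym3 a b c -> 0 < fst (c - a)%C -> 0 < y ->
  (b - a)%C = (lam (0, y) * (c - a))%C -> a = RtoC 1 /\ b = RtoC 2 /\ c = RtoC 3 /\ y = 1.
Proof.
  intros [N1 [N2 N3]] E P Py El. destruct (lam_phi y Py) as [El2 B]. rewrite El2 in El.
  assert (K : forall u, rroot base u -> u = RtoC 1 \/ u = RtoC 2 \/ u = RtoC 3) by (intros u; apply rroot_sym3).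
  assert (Ka : rroot base a) by (rewrite E; apply rroot_sym3; auto).
  assert (Kb : rroot base b) by (rewrite E; apply rroot_sym3; auto).
  assert (Kc : rroot base c) by (rewrite E; apply rroot_sym3; auto).
  apply K in Ka, Kb, Kc. apply (f_equal fst) in El.
  destruct Ka as [-> | [-> | ->]]; destruct Kb as [-> | [-> | ->]]; destruct Kc as [-> | [-> | ->]]; try congruence; simpl in El, P; try lra.
  repeat split. apply lam_im_inj; try lra. rewrite lam_i, El2. f_equal. lra.
Qed.

(** Lift the homotopy. Along its side of initial points the triple stays real with c > a and tau
    stays in iR+, so the lift reaches the standard path with labels 1, 2, 3 and tau = i. The
    standard lift ends at [act_w] of i, and along the side of end points tau can only move within
    the image of iR+. *)
Lemma monodromy (g : R -> C3) (w : bword) (a b c t : C -> C) (y : R) :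
  rel_homotopic g (std_path w) -> marked (closed_rect 0 1 0 0) (fun z => g (fst z)) a b c t ->
  0 < fst (c (0, 0) - a (0, 0))%C -> 0 < y -> t (0, 0) = (0, y) ->
  exists y', 0 < y' /\ t (1, 0) = act_w (letters w) (0, y').
Proof.
  intros [H [HC [HX [HE HG]]]] M P0 Py E0.
  set (D := closed_rect 0 1 0 1).
  assert (Z00 : closed_rect 0 1 0 0 (0, 0)) by (split; simpl; lra). assert (Z10 : closed_rect 0 1 0 0 (1, 0)) by (split; simpl; lra).
  assert (CH : contD D d3 H) by (apply (cont_on_contD unit_sq), HC).
  assert (G0 : H (0, 0) = g 0) by (apply HG; lra).
  assert (M' := M). destruct M' as [[_ [_ [_ M4]]] [_ M6]].
  destruct (M4 _ Z00) as [Dis Eg]. destruct (M6 _ Z00) as [_ El]. simpl fst in Eg. rewrite E0 in El.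
  destruct (marked_exists 0 1 0 1 H (0, 0) (a (0, 0)) (b (0, 0)) (c (0, 0)) (0, y)) as [A [B [Cc [T [MT [EA [EB [EC ET]]]]]]]]; auto.
  { split; simpl; lra. } { congruence. }
  fold D in MT.
  set (h0 := fun z : C => (Ci * RtoC (fst z))%C).
  assert (Ch0 : contC (closed_rect 0 1 0 0) h0) by (apply contC_mult; [apply contC_const | apply contC_fst]).
  assert (Eh0 : forall z : C, h0 z = (0, fst z)) by (intros; cparts; ring).
  assert (S0 : T (0, 1) = t (1, 0)).
  { assert (Mc := marked_comp D (closed_rect 0 1 0 0) H A B Cc T h0 Ch0 ltac:(intros z Hz; rewrite Eh0; unfold D, closed_rect in *; simpl; lra) MT).
    assert (Mc' : marked (closed_rect 0 1 0 0) (fun z => H (h0 z)) a b c t).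
    { apply (marked_ext (closed_rect 0 1 0 0) _ (fun z => g (fst z))); auto. intros z Hz. rewrite Eh0. symmetry. apply HG. apply Hz. }
    assert (Q := marked_unique 0 1 0 0 _ _ _ _ _ _ _ _ _ (0, 0) Mc Mc' Z00). cbv beta in Q.
    rewrite Eh0 in Q. simpl fst in Q. specialize (Q EA EB EC ltac:(congruence) (1, 0) Z10). rewrite Eh0 in Q. exact Q. }
  assert (Sub0 : forall z, closed_rect 0 1 0 0 z -> D z) by (intros z Hz; unfold D, closed_rect in *; lra).
  assert (R0 : forall z, closed_rect 0 1 0 0 z -> inEtr (H z)).
  { intros [u v] [Hz1 Hz2]. simpl in Hz1, Hz2. replace v with 0 by lra. now apply HE. }
  destruct (MT) as [[CA [CB [CC MT4]]] [CT MT6]].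
  destruct (real_stay 0 (fun t => t) (fun t => t) 0 1 0 0 T (0, 0) y equivariant_id (contD_sub _ _ _ _ Sub0 CT)) with (z := (1, 0) : C) as [y2 [Py2 Ey2]]; auto.
  { intros z Hz. split; [apply MT6; auto|]. eapply (real_triple D H); eauto. }
  assert (P1 : 0 < fst (Cc (1, 0) - A (1, 0))%C).
  { apply (pos_stay 0 1 0 0 (fun z => Cc z - A z)%C (0, 0)); auto.
    - apply (contD_sub D); auto. apply contC_minus; auto.
    - intros z Hz. destruct (real_triple D H A B Cc T z MT (Sub0 z Hz) (R0 z Hz)) as [R1 [R2 [R3 [_ R4]]]].
      split; auto using isreal_minus.
    - now rewrite EA, EC. }
  assert (G1 : forall v, 0 <= v <= 1 -> H (1, v) = std_path w v) by (intros v Hv; now apply HG).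
  destruct (MT4 (1, 0) (Sub0 _ Z10)) as [Dis1 Es1]. destruct (MT6 (1, 0) (Sub0 _ Z10)) as [_ El1]. rewrite Ey2 in El1.
  assert (Eb : H (1, 0) = base).
  { rewrite G1 by lra. unfold std_path. rewrite Rmult_0_r. apply letters_path_0. }
  rewrite Eb in Es1. destruct (base_triple _ _ _ _ Dis1 Es1 P1 Py2 El1) as [F1 [F2 [F3 F4]]]. subst y2.
  destruct (std_marked w) as [a' [b' [c' [t' [MS [[I1 [I2 [I3 I4]]] [_ I5]]]]]]].
  set (h1 := fun z : C => (1 + Ci * RtoC (fst z))%C).
  assert (Ch1 : contC (closed_rect 0 1 0 0) h1) by (apply contC_plus; [apply contC_const | apply contC_mult; [apply contC_const | apply contC_fst]]).
  assert (Eh1 : forall z : C, h1 z = (1, fst z)) by (intros; cparts; ring).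
  assert (S1 : T (1, 1) = act_w (letters w) (0, 1)).
  { rewrite <- I5. assert (Mc := marked_comp D (closed_rect 0 1 0 0) H A B Cc T h1 Ch1 ltac:(intros z Hz; rewrite Eh1; unfold D, closed_rect in *; simpl; lra) MT).
    assert (Mc' : marked (closed_rect 0 1 0 0) (fun z => H (h1 z)) a' b' c' t').
    { apply (marked_ext (closed_rect 0 1 0 0) _ (fun z => std_path w (fst z))); auto. intros z Hz. rewrite Eh1. symmetry. apply G1. apply Hz. }
    assert (Q := marked_unique 0 1 0 0 _ _ _ _ _ _ _ _ _ (0, 0) Mc Mc' Z00). cbv beta in Q.
    rewrite Eh1 in Q. simpl fst in Q. rewrite F1, F2, F3, Ey2, I1, I2, I3, I4 in Q.
    specialize (Q eq_refl eq_refl eq_refl eq_refl (1, 0) Z10). rewrite Eh1 in Q. exact Q. }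
  assert (Sub1 : forall z, closed_rect 0 1 1 1 z -> D z) by (intros z Hz; unfold D, closed_rect in *; lra).
  destruct (act_w_equivariant (letters w)) as [k [ps Hk]]. rewrite <- S0.
  apply (real_stay k _ ps 0 1 1 1 T (1, 1) 1 Hk (contD_sub _ _ _ _ Sub1 CT)); try lra; auto; try (split; simpl; lra).
  intros z Hz. split; [apply MT6; auto|]. eapply (real_triple D H); eauto.
  destruct z as [u v]. destruct Hz as [Hz1 Hz2]. simpl in Hz1, Hz2. replace v with 1 by lra. now apply HE.
Qed.

Lemma sort_triple (p : C3) : inEtr p -> exists x1 x2 x3, x1 < x2 < x3 /\ p = sym3 (RtoC x1) (RtoC x2) (RtoC x3).
Proof.
  intros [a [b [c [N1 [N2 [N3 ->]]]]]].
  assert (P : sym3 a b c = sym3 a c b /\ sym3 a b c = sym3 b a c /\ sym3 a b c = sym3 b c a /\ sym3 a b c = sym3 c a b /\ sym3 a b c = sym3 c b a)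
    by (repeat split; sym3_ring). destruct P as [P1 [P2 [P3 [P4 P5]]]].
  destruct (Rtotal_order a b) as [L1|[L1|L1]]; destruct (Rtotal_order a c) as [L2|[L2|L2]]; destruct (Rtotal_order b c) as [L3|[L3|L3]]; try lra.
  - exists a, b, c; auto.
  - exists a, c, b; auto.
  - exists c, a, b; auto.
  - exists b, a, c; auto.
  - exists b, c, a; auto.
  - exists c, b, a; auto.
Qed.

(** The marking is fixed at one interior point of the lower side by the increasing order of its real
    triple. It keeps c > a and tau in iR+ along that side, so [monodromy] applies to every vertical
    segment. *)
Lemma rect_marked (x0 x1 y0 y1 : R) (f : C -> C3) (w : bword) : x0 < x1 -> y0 < y1 -> represents x0 x1 y0 y1 f w ->
  exists a b c t, marked (closed_rect x0 x1 y0 y1) f a b c t /\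
    forall x, x0 < x < x1 -> (exists y, 0 < y /\ t (x, y0) = (0, y)) /\
      (exists y, 0 < y /\ t (x, y1) = act_w (letters w) (0, y)).
Proof.
  intros X Y [Cf [Xf [_ [Ef Hf]]]]. set (D := closed_rect x0 x1 y0 y1) in *.
  set (xm := (x0 + x1) / 2). assert (Hm : x0 < xm < x1) by (unfold xm; lra). clearbody xm.
  destruct (sort_triple _ (proj1 (Ef xm Hm))) as [r1 [r2 [r3 [Hr Er]]]].
  assert (Hv : 0 < (r2 - r1) / (r3 - r1) < 1).
  { split; [apply Rdiv_lt_0_compat; lra|]. apply (Rmult_lt_reg_r (r3 - r1)); [lra|]. unfold Rdiv. rewrite Rmult_assoc, Rinv_l by lra. lra. }
  destruct (lam_im_surj _ Hv) as [y [Py Ey]].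
  destruct (marked_exists x0 x1 y0 y1 f (xm, y0) (RtoC r1) (RtoC r2) (RtoC r3) (0, y)) as [a [b [c [t [M [Ea [Eb [Ec Et]]]]]]]]; auto.
  { now apply cont_on_contD. } { split; simpl; lra. }
  { repeat split; intros E; apply RtoC_inj in E; lra. }
  { rewrite Ey. cparts; field; lra. }
  fold D in M. exists a, b, c, t. split; auto. intros x Hx.
  assert (M' := M). destruct M' as [[CA [CB [CC M4]]] [CT M6]].
  set (u := Rmin x xm). set (v := Rmax x xm).
  assert (U : x0 < u /\ u <= x /\ u <= xm /\ x <= v /\ xm <= v /\ v < x1).
  { unfold u, v, Rmin, Rmax. destruct (Rle_dec x xm); lra. } clearbody u v.
  assert (Sub : forall z, closed_rect u v y0 y0 z -> D z) by (intros z Hz; unfold D, closed_rect in *; lra).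
  assert (Zm : closed_rect u v y0 y0 (xm, y0)) by (split; simpl; lra). assert (Zx : closed_rect u v y0 y0 (x, y0)) by (split; simpl; lra).
  assert (RT : forall z, closed_rect u v y0 y0 z -> inEtr (f z)).
  { intros [p q] [H1 H2]. simpl in H1, H2. replace q with y0 by lra. apply Ef. lra. }
  assert (B : exists y, 0 < y /\ t (x, y0) = (0, y)).
  { apply (real_stay 0 (fun t => t) (fun t => t) u v y0 y0 t (xm, y0) y equivariant_id (contD_sub _ _ _ _ Sub CT)); auto.
    intros z Hz. split; [apply M6; auto|]. eapply (real_triple D f); eauto. }
  split; auto. destruct B as [y2 [Py2 Ey2]].
  assert (P1 : 0 < fst (c (x, y0) - a (x, y0))%C).
  { apply (pos_stay u v y0 y0 (fun z => c z - a z)%C (xm, y0)); auto.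
    - apply (contD_sub D); auto. apply contC_minus; auto.
    - intros z Hz. destruct (real_triple D f a b c t z M (Sub z Hz) (RT z Hz)) as [R1 [R2 [R3 [_ R4]]]].
      split; auto using isreal_minus.
    - rewrite Ea, Ec. simpl. lra. }
  set (h := fun z : C => ((x, y0) + (0, (y1 - y0)%R) * RtoC (fst z))%C).
  assert (Eh : forall z, h z = (x, y0 + fst z * (y1 - y0))) by (intros; cparts; ring).
  assert (Mc := marked_comp D (closed_rect 0 1 0 0) f a b c t h
    ltac:(apply contC_plus; [apply contC_const | apply contC_mult; [apply contC_const | apply contC_fst]])
    ltac:(intros [p q] [Hz1 Hz2]; rewrite Eh; simpl in *; split; simpl; nra) M).
  assert (Mc' : marked (closed_rect 0 1 0 0) (fun z => f (x, y0 + fst z * (y1 - y0))) (fun z => a (h z)) (fun z => b (h z)) (fun z => c (h z)) (fun z => t (h z))).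
  { apply (marked_ext (closed_rect 0 1 0 0) _ (fun z => f (h z))); auto. intros z Hz. now rewrite Eh. }
  destruct (monodromy (fun s => f (x, y0 + s * (y1 - y0))) w _ _ _ _ y2 (Hf x Hx) Mc') as [y3 [P3 E3]]; auto;
    rewrite ?Eh; simpl fst; rewrite ?Rmult_0_l, ?Rplus_0_r; auto.
  exists y3. split; auto. rewrite <- E3, Eh. simpl. f_equal. f_equal. ring.
Qed.

(** * Holomorphy of the modular lift *)

Definition cont_at (f : C -> C) (z : C) : Prop :=
  forall e, 0 < e -> exists d, 0 < d /\ forall w, Cmod (w - z) < d -> Cmod (f w - f z) < e.

Lemma cont_at_comp (f g : C -> C) (z l : C) : cont_at f z -> cder g (f z) l -> cont_at (fun w => g (f w)) z.
Proof.
  intros Hf Hg e He. destruct (cder_cont _ _ _ Hg e He) as [d [P K]]. destruct (Hf d P) as [d' [P' K']].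
  exists d'; split; auto.
Qed.

Lemma cont_at_cder (f : C -> C) (z l : C) : cder f z l -> cont_at f z.
Proof. intros H. exact (cder_cont _ _ _ H). Qed.

Lemma cont_at_plus (f g : C -> C) (z : C) : cont_at f z -> cont_at g z -> cont_at (fun w => f w + g w)%C z.
Proof.
  intros Hf Hg e He. destruct (Hf (e / 2)) as [d1 [P1 K1]]; [lra|]. destruct (Hg (e / 2)) as [d2 [P2 K2]]; [lra|].
  exists (Rmin d1 d2); split; [now apply Rmin_pos|]. intros w L.
  specialize (K1 w (Rlt_le_trans _ _ _ L (Rmin_l _ _))). specialize (K2 w (Rlt_le_trans _ _ _ L (Rmin_r _ _))).
  replace (f w + g w - (f z + g z))%C with ((f w - f z) + (g w - g z))%C by ring.
  eapply Rle_lt_trans; [apply Cmod_triangle|]. lra.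
Qed.

Lemma cont_at_scal (k : C) (f : C -> C) (z : C) : cont_at f z -> cont_at (fun w => k * f w)%C z.
Proof. intros Hf. eapply (cont_at_comp f (fun w => k * w)%C); auto. apply cder_scal, cder_id. Qed.

Lemma cont_at_mult (f g : C -> C) (z : C) : cont_at f z -> cont_at g z -> cont_at (fun w => f w * g w)%C z.
Proof.
  intros Hf Hg.
  assert (S : forall h, cont_at h z -> cont_at (fun w => h w * h w)%C z).
  { intros h Hh. eapply (cont_at_comp h (fun w => w * w)%C); auto. apply cder_sq. }
  assert (Q := cont_at_scal (RtoC (1/4)) _ _ (cont_at_plus _ _ _ (S _ (cont_at_plus _ _ _ Hf Hg))
     (cont_at_scal (-1) _ _ (S _ (cont_at_plus _ _ _ Hf (cont_at_scal (-1) _ _ Hg)))))).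
  cbv beta in Q. intros e He. destruct (Q e He) as [d [P K]]. exists d; split; auto. intros w L. specialize (K w L).
  assert (E : forall a b : C, (RtoC (1/4) * ((a + b) * (a + b) + -1 * ((a + -1 * b) * (a + -1 * b))))%C = (a * b)%C)
    by (intros; cparts; field).
  rewrite !E in K. auto.
Qed.

(** Caratheodory's form of the derivative, a slope function continuous at z. It turns the implicit
    function argument for roots into algebra. *)
Lemma cder_caratheodory (f : C -> C) (z l : C) : cder f z l ->
  exists ph, cont_at ph z /\ ph z = l /\ forall w, (f w - f z)%C = (ph w * (w - z))%C.
Proof.
  intros H. exists (fun w => if excluded_middle_informative (w = z) then l else ((f w - f z) / (w - z))%C).
  split; [|split].
  - intros e He. destruct (H (e / 2)) as [d [P K]]; [lra|]. exists d; split; auto. intros w L.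
    destruct (excluded_middle_informative (z = z)) as [_|]; [|congruence].
    destruct (excluded_middle_informative (w = z)) as [->|N].
    + replace (l - l)%C with (RtoC 0) by ring. now rewrite Cmod_0.
    + assert (N' := Csub_neq0 _ _ N). assert (Pw := Cmod_pos _ N'). specialize (K w L).
      replace ((f w - f z) / (w - z) - l)%C with ((f w - f z - l * (w - z)) / (w - z))%C by (field; auto).
      rewrite Cmod_div by auto. apply (Rmult_lt_reg_r (Cmod (w - z))); auto. unfold Rdiv.
      rewrite Rmult_assoc, Rinv_l, Rmult_1_r by lra. eapply Rle_lt_trans; [apply K|]. apply Rmult_lt_compat_r; lra.
  - destruct (excluded_middle_informative (z = z)); congruence.
  - intros w. destruct (excluded_middle_informative (w = z)) as [->|N]; [ring|]. field. now apply Csub_neq0.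
Qed.

Lemma caratheodory_cder (f ph : C -> C) (z : C) (r : R) : 0 < r -> cont_at ph z ->
  (forall w, Cmod (w - z) < r -> (f w - f z)%C = (ph w * (w - z))%C) -> cder f z (ph z).
Proof.
  intros Pr Hc E e He. destruct (Hc e He) as [d [P K]]. exists (Rmin r d); split; [now apply Rmin_pos|]. intros w L.
  rewrite E by (apply (Rlt_le_trans _ _ _ L (Rmin_l _ _))).
  replace (ph w * (w - z) - ph z * (w - z))%C with ((ph w - ph z) * (w - z))%C by ring. rewrite Cmod_mult.
  apply Rmult_le_compat_r; [apply Cmod_ge_0|]. apply Rlt_le, K. apply (Rlt_le_trans _ _ _ L (Rmin_r _ _)).
Qed.

(** Dividing [cubic_diff] by the divided difference, nonzero near a simple root, expresses the slope
    of the root through the slopes of the coefficients. *)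
Lemma cder_root (f : C -> C3) (A : C -> C) (z l1 l2 l3 : C) (r : R) : 0 < r ->
  cder (fun w => e1 (f w)) z l1 -> cder (fun w => e2 (f w)) z l2 -> cder (fun w => e3 (f w)) z l3 ->
  cont_at A z -> (forall w, Cmod (w - z) < r -> rroot (f w) (A w)) -> cubic_dq (f z) (A z) (A z) <> 0%C ->
  exists l, cder A z l.
Proof.
  intros Pr H1 H2 H3 HA Hr Nz.
  destruct (cder_caratheodory _ _ _ H1) as [p1 [C1 [_ E1]]]. destruct (cder_caratheodory _ _ _ H2) as [p2 [C2 [_ E2]]].
  destruct (cder_caratheodory _ _ _ H3) as [p3 [C3' [_ E3]]].
  set (Q := fun w => cubic_dq (f z) (A w) (A z)).
  assert (CK : forall k : C, cont_at (fun _ => k) z) by (intros; eapply cont_at_cder, cder_const).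
  assert (CQ : cont_at Q z).
  { unfold Q, cubic_dq. intros e He.
    assert (X : cont_at (fun w => A w * A w + A w * A z + A z * A z + (- e1 (f z)) * (A w + A z) + e2 (f z))%C z).
    { repeat first [apply cont_at_plus | apply cont_at_mult | apply CK | apply HA]. }
    destruct (X e He) as [d [P K]]. exists d; split; auto. intros w L. specialize (K w L).
    eapply Rle_lt_trans; [right|exact K]. f_equal. ring. }
  set (N := fun w => (p1 w * (A w * A w) + (-1 * p2 w) * A w + p3 w)%C).
  assert (CN : cont_at N z).
  { unfold N. repeat first [apply cont_at_plus | apply cont_at_mult | apply CK]; auto. }
  assert (Nz' : Q z <> 0%C) by exact Nz.
  destruct (CQ (Cmod (Q z))) as [d [Pd Kd]]; [now apply Cmod_pos|].
  assert (NQ : forall w, Cmod (w - z) < d -> Q w <> 0%C).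
  { intros w L E. specialize (Kd w L). rewrite E in Kd. replace (0 - Q z)%C with (- Q z)%C in Kd by ring. rewrite Cmod_opp in Kd. lra. }
  exists (N z * / Q z)%C. apply (caratheodory_cder A (fun w => N w * / Q w)%C z (Rmin r d)); [now apply Rmin_pos | |].
  - apply cont_at_mult; auto. eapply (cont_at_comp Q (fun w => / w)%C); auto. now apply cder_Cinv.
  - intros w L. destruct (Rmin_Rgt_l _ _ _ L) as [L1 L2].
    assert (R1 := Hr w L1). assert (R0 : rroot (f z) (A z)).
    { apply Hr. replace (z - z)%C with (RtoC 0) by ring. now rewrite Cmod_0. }
    assert (G := NQ w L2). assert (D := cubic_diff (f z) (A w) (A z)). rewrite R0 in D. fold (Q w) in D.
    assert (X : cubic (f z) (A w) = ((e1 (f w) - e1 (f z)) * (A w * A w) - (e2 (f w) - e2 (f z)) * A w + (e3 (f w) - e3 (f z)))%C).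
    { transitivity (cubic (f z) (A w) - cubic (f w) (A w))%C; [rewrite R1; ring | unfold cubic; ring]. }
    rewrite E1, E2, E3 in X.
    replace (A w - A z)%C with ((A w - A z) * Q w * / Q w)%C by (field; auto). rewrite <- D, X. unfold N. field. auto.
Qed.

(** The product norm is a nested Euclidean norm; its comparison with the moduli of the components is
    all that differentiability requires. *)
Lemma C3_norm (u : C3) : let n := @norm C_AbsRing (prod_NormedModule C_AbsRing (prod_NormedModule C_AbsRing C_NormedModule C_NormedModule) C_NormedModule) u in
  Cmod (e1 u) <= n /\ Cmod (e2 u) <= n /\ Cmod (e3 u) <= n /\ n <= Cmod (e1 u) + Cmod (e2 u) + Cmod (e3 u).
Proof.
  destruct u as [[a b] c]. cbv zeta. unfold e1, e2, e3. simpl fst. simpl snd.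
  change (norm (a, b, c)) with (sqrt (sqrt (Cmod a ^ 2 + Cmod b ^ 2) ^ 2 + Cmod c ^ 2)).
  assert (Ha := Cmod_ge_0 a). assert (Hb := Cmod_ge_0 b). assert (Hc := Cmod_ge_0 c).
  assert (B : forall x y, 0 <= x -> 0 <= y -> x <= sqrt (x ^ 2 + y ^ 2) /\ y <= sqrt (x ^ 2 + y ^ 2) /\ sqrt (x ^ 2 + y ^ 2) <= x + y).
  { intros x y Hx Hy. split; [|split].
    - rewrite <- (sqrt_pow2 x) at 1 by auto. apply sqrt_le_1_alt. nra.
    - rewrite <- (sqrt_pow2 y) at 1 by auto. apply sqrt_le_1_alt. nra.
    - rewrite <- (sqrt_pow2 (x + y)) by lra. apply sqrt_le_1_alt. nra. }
  destruct (B _ _ Ha Hb) as [B1 [B2 B3]]. destruct (B _ _ (sqrt_pos (Cmod a ^ 2 + Cmod b ^ 2)) Hc) as [B4 [B5 B6]]. lra.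
Qed.

Lemma ex_derive_cder (f : C -> C3) (z : C) : ex_derive (K := C_AbsRing) f z <-> exists l1 l2 l3,
  cder (fun w => e1 (f w)) z l1 /\ cder (fun w => e2 (f w)) z l2 /\ cder (fun w => e3 (f w)) z l3.
Proof.
  split.
  - intros Hex. assert (Hd' : exists l : C3, is_derive (K := C_AbsRing) f z l) by exact Hex.
    destruct Hd' as [l [_ H]]. specialize (H z (fun P HP => HP)). exists (e1 l), (e2 l), (e3 l).
    assert (K : forall e, 0 < e -> exists d, 0 < d /\ forall w : C, Cmod (w - z) < d ->
      @norm C_AbsRing (prod_NormedModule C_AbsRing (prod_NormedModule C_AbsRing C_NormedModule C_NormedModule) C_NormedModule)
        (minus (minus (f w) (f z)) (scal (minus w z) l)) <= e * Cmod (w - z)).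
    { intros e He. destruct (H (mkposreal e He)) as [d Hd]. exists d; split; [apply cond_pos|]. intros w L. exact (Hd w L). }
    repeat split; intros e He; destruct (K e He) as [d [Pd Kd]]; exists d; split; auto; intros w L; specialize (Kd w L);
    destruct (C3_norm (minus (minus (f w) (f z)) (scal (minus w z) l))) as [N1 [N2 [N3 _]]]; cbv zeta in *.
    + eapply Rle_trans; [|eapply Rle_trans; [apply N1 | apply Kd]]. right. f_equal. unfold e1.
      change (fst (fst (minus (minus (f w) (f z)) (scal (minus w z) l)))) with (fst (fst (f w)) - fst (fst (f z)) - (w - z) * fst (fst l))%C. ring.
    + eapply Rle_trans; [|eapply Rle_trans; [apply N2 | apply Kd]]. right. f_equal. unfold e2.
      change (snd (fst (minus (minus (f w) (f z)) (scal (minus w z) l)))) with (snd (fst (f w)) - snd (fst (f z)) - (w - z) * snd (fst l))%C. ring.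
    + eapply Rle_trans; [|eapply Rle_trans; [apply N3 | apply Kd]]. right. f_equal. unfold e3.
      change (snd (minus (minus (f w) (f z)) (scal (minus w z) l))) with (snd (f w) - snd (f z) - (w - z) * snd l)%C. ring.
  - intros [l1 [l2 [l3 [H1 [H2 H3]]]]]. exists (l1, l2, l3). split; [apply is_linear_scal_l|].
    intros x Hx. apply (is_filter_lim_locally_unique (V := AbsRing_NormedModule C_AbsRing)) in Hx. subst x. intros [e He].
    destruct (H1 (e / 3)) as [d1 [P1 K1]]; [lra|]. destruct (H2 (e / 3)) as [d2 [P2 K2]]; [lra|]. destruct (H3 (e / 3)) as [d3' [P3 K3]]; [lra|].
    assert (Pd : 0 < Rmin d1 (Rmin d2 d3')) by (repeat apply Rmin_pos; auto).
    exists (mkposreal _ Pd). intros w L. change (Cmod (w - z) < Rmin d1 (Rmin d2 d3')) in L.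
    destruct (Rmin_Rgt_l _ _ _ L) as [L1 L'].
    destruct (Rmin_Rgt_l _ _ _ L') as [L2 L3].
    specialize (K1 w L1). specialize (K2 w L2). specialize (K3 w L3). simpl pos.
    destruct (C3_norm (minus (minus (f w) (f z)) (scal (minus w z) (l1, l2, l3)))) as [_ [_ [_ N]]]. cbv zeta in N.
    change (@norm C_AbsRing (AbsRing_NormedModule C_AbsRing) (minus w z)) with (Cmod (w - z)).
    eapply Rle_trans; [apply N|].
    change (e1 (minus (minus (f w) (f z)) (scal (minus w z) (l1, l2, l3)))) with (e1 (f w) - e1 (f z) - (w - z) * l1)%C.
    change (e2 (minus (minus (f w) (f z)) (scal (minus w z) (l1, l2, l3)))) with (e2 (f w) - e2 (f z) - (w - z) * l2)%C.
    change (e3 (minus (minus (f w) (f z)) (scal (minus w z) (l1, l2, l3)))) with (e3 (f w) - e3 (f z) - (w - z) * l3)%C.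
    rewrite !(Cmult_comm (w - z)). lra.
Qed.

Lemma contC_cont_at (D : C -> Prop) (g : C -> C) (z : C) (r : R) : 0 < r -> (forall w, Cmod (w - z) < r -> D w) ->
  contC D g -> cont_at g z.
Proof.
  intros Pr B H e He. destruct (H z) with (eps := e) as [d [P K]]; auto.
  { apply B. replace (z - z)%C with (RtoC 0) by ring. now rewrite Cmod_0. }
  exists (Rmin r d); split; [now apply Rmin_pos|]. intros w L. rewrite Cmod_sym. apply K.
  - apply B. apply (Rlt_le_trans _ _ _ L (Rmin_l _ _)).
  - apply (Rlt_le_trans _ _ _ L (Rmin_r _ _)).
Qed.

Lemma open_rect_ball (x0 x1 y0 y1 : R) (z : C) : open_rect x0 x1 y0 y1 z ->
  exists r, 0 < r /\ forall w, Cmod (w - z) < r -> open_rect x0 x1 y0 y1 w.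
Proof.
  intros [H1 H2]. set (r := Rmin (Rmin (fst z - x0) (x1 - fst z)) (Rmin (snd z - y0) (y1 - snd z))).
  exists r. split; [unfold r; repeat apply Rmin_pos; lra|]. intros w L.
  assert (F := Rle_lt_trans _ _ _ (Cmod_fst (w - z)) L). assert (S := Rle_lt_trans _ _ _ (Cmod_snd (w - z)) L).
  apply Rabs_lt_between in F, S. simpl in F, S.
  assert (Q1 := Rmin_l (Rmin (fst z - x0) (x1 - fst z)) (Rmin (snd z - y0) (y1 - snd z))).
  assert (Q2 := Rmin_r (Rmin (fst z - x0) (x1 - fst z)) (Rmin (snd z - y0) (y1 - snd z))). fold r in Q1, Q2.
  assert (Q3 := Rmin_l (fst z - x0) (x1 - fst z)). assert (Q4 := Rmin_r (fst z - x0) (x1 - fst z)).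
  assert (Q5 := Rmin_l (snd z - y0) (y1 - snd z)). assert (Q6 := Rmin_r (snd z - y0) (y1 - snd z)).
  split; lra.
Qed.

(** The ordered roots are holomorphic, hence so is their ratio, and [cder_lift] with [dlam_neq0]
    passes this on to the lift through [lam]. *)
Lemma marked_holo (D : C -> Prop) (f : C -> C3) (a b c t : C -> C) (z : C) (r : R) :
  marked D f a b c t -> 0 < r -> (forall w, Cmod (w - z) < r -> D w) -> ex_derive (K := C_AbsRing) f z ->
  exists l, cder t z l.
Proof.
  intros [L [Ct Ht]] Pr B E. apply ex_derive_cder in E. destruct E as [l1 [l2 [l3 [H1 [H2 H3]]]]].
  destruct (ord_lift_roots _ _ _ _ _ L) as [[Ca Ra] [[Cb Rb] [Cc Rc]]]. destruct L as [_ [_ [_ HL]]].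
  assert (Dz : D z) by (apply B; replace (z - z)%C with (RtoC 0) by ring; now rewrite Cmod_0).
  assert (Xz : inX (f z)) by (destruct (HL z Dz) as [Q ->]; now apply sym3_inX).
  assert (R : forall u, contC D u -> (forall w, D w -> rroot (f w) (u w)) -> exists l, cder u z l).
  { intros u Cu Ru. apply (cder_root f u z l1 l2 l3 r); auto.
    - now apply (contC_cont_at D _ _ r).
    - apply simple_root; auto. }
  destruct (R a Ca Ra) as [a' Ha]. destruct (R b Cb Rb) as [b' Hb]. destruct (R c Cc Rc) as [c' Hc].
  assert (N : (c z + -1 * a z)%C <> 0%C).
  { replace (c z + -1 * a z)%C with (c z - a z)%C by ring. apply Csub_neq0. destruct (HL z Dz) as [[_ [Q _]] _]. auto. }
  assert (Hm : exists l, cder (fun w => (b w + -1 * a w) * / (c w + -1 * a w))%C z l).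
  { eexists. apply cder_mult; [apply cder_plus; [apply Hb | apply cder_scal, Ha]|].
    apply cder_inv; auto. apply cder_plus; [apply Hc | apply cder_scal, Ha]. }
  destruct Hm as [l Hm]. eexists.
  apply (cder_lift lam t (fun w => (b w + -1 * a w) * / (c w + -1 * a w))%C z (dlam (t z)) l r); auto.
  - intros w Lw. specialize (B w Lw). destruct (Ht w B) as [_ Q]. destruct (HL w B) as [[_ [Q2 _]] _].
    assert (Nw : (c w - a w)%C <> 0%C) by (apply Csub_neq0; auto).
    replace (b w + -1 * a w)%C with (b w - a w)%C by ring. replace (c w + -1 * a w)%C with (c w - a w)%C by ring.
    rewrite Q. field. auto.
  - now apply (contC_cont_at D _ _ r).
  - apply lam_cder. now apply Ht.
  - apply dlam_neq0. now apply Ht.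
Qed.

Section Growth.
Local Open Scope Z_scope.

(** * Growth of the matrix entries along a reduced word *)

Local Arguments Z.mul : simpl never.
Local Arguments Z.sub : simpl never.
Local Arguments Z.add : simpl never.
Local Arguments Z.of_nat : simpl never.
Local Arguments Z.eqb : simpl never.

(** A column of the matrix of b_1, up to signs and order of the entries (see [colpair]). The head of
    the list is the first term of b_1 and is applied last. *)
Fixpoint pr (p : Z * Z) (l : list Z) : Z * Z :=
  match l with
  | [] => p
  | n :: r => (2 * n * fst (pr p r) - snd (pr p r), fst (pr p r))
  end.

Definition syl_prod (l : list (Z * nat)) : Z := fold_right (fun md acc => (4 * Z.of_nat (snd md) - 1) * acc) 1 l.

Definition nz (l : list Z) : Prop := List.Forall (fun n => n <> 0) l.

Lemma syl_pos (l : list Z) : nz l -> List.Forall (fun md => (1 <= snd md)%nat /\ (Z.abs (fst md) <= 1)) (syllables l).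
Proof.
  induction 1 as [|n t Hn Ht IH]; simpl; auto. destruct (Z.leb_spec 2 (Z.abs n)) as [L|L].
  - constructor; auto. simpl. lia.
  - destruct (syllables t) as [|[m d] s']; [repeat constructor; simpl; lia|].
    inversion IH; subst. simpl in *. destruct (Z.eqb m n); repeat constructor; simpl; auto; lia.
Qed.

Lemma syl_prod_pos (l : list (Z * nat)) (P : Z * nat -> Prop) : List.Forall (fun md => (1 <= snd md)%nat /\ P md) l -> 1 <= syl_prod l.
Proof. induction 1 as [|[m d] t [H1 H2] H IH]; simpl in *; [lia|]. nia. Qed.

Lemma syl_prod_ge1 (l : list Z) : nz l -> 1 <= syl_prod (syllables l).
Proof. intros H. eapply syl_prod_pos. apply (syl_pos l H). Qed.

Lemma syl_prod_cons (n : Z) (l : list Z) : nz l -> n <> 0 ->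
  syl_prod (syllables l) <= syl_prod (syllables (n :: l)) <= (4 * Z.abs n - 1) * syl_prod (syllables l) /\
  3 <= syl_prod (syllables (n :: l)) /\
  (2 <= Z.abs n -> syl_prod (syllables (n :: l)) = (4 * Z.abs n - 1) * syl_prod (syllables l)).
Proof.
  intros Hl Hn. assert (P := syl_pos l Hl). assert (Q := syl_prod_ge1 l Hl). simpl.
  destruct (Z.leb_spec 2 (Z.abs n)) as [L|L].
  - simpl. rewrite Zabs2Nat.id_abs. nia.
  - destruct (syllables l) as [|[m d] s']; simpl in *; [lia|].
    inversion P as [|? ? [P1 P2] P3]; subst. assert (1 <= syl_prod s') by (eapply syl_prod_pos; exact P3). simpl in P1.
    destruct (Z.eqb m n); simpl; split; try split; try lia; try nia.
Qed.

(** Invariant for the leading syllable, with [r] the finished ones. A term with |n| = N >= 2 gains a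
    factor 9/7, because (2 N - 1)^2 >= (9/7) (4 N - 1) with equality at N = 2. Along a run the
    absolute values form an arithmetic progression starting at s0 with difference del. After a large
    term only del >= 2 s0 / 3 is available, and the factor 9/7 makes up for it; otherwise del >=
    s0. *)
Definition lower_inv (p : Z * Z) (l : list (Z * nat)) : Prop :=
  let s := fst p in let s' := snd p in
  match l with
  | [] => s = 1 /\ s' = 0
  | (m, d) :: r =>
     (1 <= d)%nat /\
     if Z.eqb m 0 then 9 * ((4 * Z.of_nat d - 1) * syl_prod r) <= 7 * (s * s) /\ 3 * Z.abs s' <= Z.abs s
     else (m = 1 \/ m = -1) /\ 0 <= m * (s * s') /\ exists s0 del, 0 < s0 /\
       Z.abs s = s0 + Z.of_nat d * del /\ Z.abs s' = s0 + (Z.of_nat d - 1) * del /\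
       (9 * syl_prod r <= 7 * (s0 * s0) /\ 2 * s0 <= 3 * del \/ syl_prod r <= s0 * s0 /\ s0 <= del)
  end.

Lemma sq_mono (x y : Z) : 0 <= x -> x <= y -> x * x <= y * y.
Proof. intros. apply Z.mul_le_mono_nonneg; lia. Qed.

(** Rests on (3 + 2 D)^2 - 7 (4 D - 1) = 4 (D - 2)^2, sharp at D = 2: the factor 9/7 is exactly what
    a difference of 2 s0 / 3 requires. *)
Lemma run_ineq1 (D S s0 del : Z) : 1 <= D -> 1 <= S -> 0 < s0 -> 9 * S <= 7 * (s0 * s0) -> 2 * s0 <= 3 * del ->
  (4 * D - 1) * S <= (s0 + D * del) * (s0 + D * del).
Proof.
  intros HD HS P0 H1 H2. set (x := s0 + D * del).
  assert (K : s0 * (3 + 2 * D) <= 3 * x).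
  { unfold x. assert (D * (2 * s0) <= D * (3 * del)) by (apply Z.mul_le_mono_nonneg_l; lia). lia. }
  apply sq_mono in K; [|apply Z.mul_nonneg_nonneg; lia].
  set (Q := (3 + 2 * D) * (3 + 2 * D)). assert (Q0 : 0 <= Q) by apply Z.square_nonneg.
  assert (K2 : 7 * (4 * D - 1) <= Q) by (assert (S2 := Z.square_nonneg (D - 2)); unfold Q; lia).
  assert (K3 : 9 * S * Q <= 7 * (s0 * s0) * Q) by (apply Z.mul_le_mono_nonneg_r; lia).
  assert (K4 : S * (7 * (4 * D - 1)) <= S * Q) by (apply Z.mul_le_mono_nonneg_l; lia).
  replace (s0 * (3 + 2 * D) * (s0 * (3 + 2 * D))) with (s0 * s0 * Q) in K by (unfold Q; ring). lia.
Qed.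

Lemma run_ineq2 (D S s0 del : Z) : 1 <= D -> 1 <= S -> 0 < s0 -> S <= s0 * s0 -> s0 <= del ->
  (4 * D - 1) * S <= (s0 + D * del) * (s0 + D * del).
Proof.
  intros HD HS P0 H1 H2. set (x := s0 + D * del).
  assert (K : s0 * (1 + D) <= x).
  { unfold x. assert (D * s0 <= D * del) by (apply Z.mul_le_mono_nonneg_l; lia). lia. }
  apply sq_mono in K; [|apply Z.mul_nonneg_nonneg; lia].
  set (Q := (1 + D) * (1 + D)). assert (Q0 : 0 <= Q) by apply Z.square_nonneg.
  assert (K2 : 4 * D - 1 <= Q) by (assert (S2 := Z.square_nonneg (D - 1)); unfold Q; lia).
  assert (K3 : S * Q <= s0 * s0 * Q) by (apply Z.mul_le_mono_nonneg_r; lia).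
  assert (K4 : S * (4 * D - 1) <= S * Q) by (apply Z.mul_le_mono_nonneg_l; lia).
  replace (s0 * (1 + D) * (s0 * (1 + D))) with (s0 * s0 * Q) in K by (unfold Q; ring). lia.
Qed.

Lemma lower_inv_out (p : Z * Z) (l : list (Z * nat)) : lower_inv p l -> List.Forall (fun md => (1 <= snd md)%nat /\ True) l ->
  Z.abs (snd p) < Z.abs (fst p) /\ syl_prod l <= fst p * fst p.
Proof.
  destruct p as [s s']. unfold lower_inv. simpl. destruct l as [|[m d] r].
  - intros [-> ->] _. simpl. lia.
  - intros [Hd H] P. inversion P as [|? ? _ P2]; subst. assert (Q := syl_prod_pos r _ P2).
    set (D := Z.of_nat d) in *. assert (HD : 1 <= D) by lia. simpl. fold D.
    destruct (Z.eqb m 0).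
    + destruct H as [H1 H2]. assert (1 <= (4 * D - 1) * syl_prod r) by nia. split; [|lia].
      assert (s <> 0) by nia. lia.
    + destruct H as [_ [_ [s0 [del [P0 [E1 [E2 H]]]]]]]. assert (Pd : 0 < del) by lia.
      split; [nia|]. assert (E : s * s = Z.abs s * Z.abs s) by (rewrite <- Z.abs_mul; nia). rewrite E, E1.
      destruct H as [[H1 H2]|[H1 H2]].
      * now apply run_ineq1.
      * now apply run_ineq2.
Qed.

Lemma forall_weak (l : list (Z * nat)) (P : Z * nat -> Prop) :
  List.Forall (fun md => (1 <= snd md)%nat /\ P md) l -> List.Forall (fun md => (1 <= snd md)%nat /\ True) l.
Proof. induction 1 as [|? ? []]; constructor; auto. Qed.

Lemma abs_case (x : Z) : (0 <= x /\ Z.abs x = x) \/ (x < 0 /\ Z.abs x = - x).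
Proof. lia. Qed.

Lemma run_sign (p p' e : Z) : (e = 1 \/ e = -1) -> Z.abs p' < Z.abs p -> 0 <= e * ((2 * e * p - p') * p).
Proof.
  intros He H. assert (K : Z.abs (p' * p) <= p * p).
  { rewrite Z.abs_mul, <- (Z.abs_square p). apply Z.mul_le_mono_nonneg_r; lia. }
  destruct He as [-> | ->]; lia.
Qed.

Lemma step_abs (n p p' : Z) : n <> 0 -> Z.abs p' < Z.abs p ->
  2 * Z.abs p - Z.abs p' <= Z.abs (2 * n * p - p').
Proof.
  intros Hn H. assert (E : Z.abs (2 * n * p) = 2 * (Z.abs n * Z.abs p)) by (rewrite !Z.abs_mul; simpl; ring).
  assert (1 * Z.abs p <= Z.abs n * Z.abs p) by (apply Z.mul_le_mono_nonneg_r; lia). lia.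
Qed.

(** A run begins after nothing, after a large term, or after a run of the opposite sign. In the last
    case 2 e p and -p' do not have opposite signs, so the absolute value grows by at least |p|. *)
Lemma lower_run_start (p p' e P : Z) : (e = 1 \/ e = -1) -> Z.abs p' < Z.abs p -> P <= p * p ->
  (p' = 0 \/ (9 * P <= 7 * (p * p) /\ 3 * Z.abs p' <= Z.abs p) \/ e * (p * p') <= 0) ->
  0 <= e * ((2 * e * p - p') * p) /\ exists s0 del, 0 < s0 /\ Z.abs (2 * e * p - p') = s0 + 1 * del /\ Z.abs p = s0 + (1 - 1) * del /\
    (9 * P <= 7 * (s0 * s0) /\ 2 * s0 <= 3 * del \/ P <= s0 * s0 /\ s0 <= del).
Proof.
  intros He Hp HP H. assert (Pp : Z.abs p * Z.abs p = p * p) by (rewrite <- Z.abs_mul; nia).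
  split.
  - now apply run_sign.
  - exists (Z.abs p), (Z.abs (2 * e * p - p') - Z.abs p). rewrite Pp. split; [lia|]. split; [lia|]. split; [lia|].
    destruct H as [H|[[H1 H2]|H]].
    + right. destruct He as [-> | ->]; lia.
    + left. split; auto. destruct He as [-> | ->]; lia.
    + right. split; auto.
      destruct He as [-> | ->]; destruct (abs_case p) as [[? A]|[? A]]; destruct (abs_case p') as [[? B]|[? B]]; nia.
Qed.

Lemma lower_inv_all (l : list Z) : nz l -> lower_inv (pr (1, 0) l) (syllables l).
Proof.
  induction 1 as [|n t Hn Ht IH]; [simpl; auto|].
  assert (F := forall_weak _ _ (syl_pos t Ht)). assert (Fp := syl_pos t Ht).
  destruct (lower_inv_out _ _ IH F) as [O1 O2]. simpl.
  destruct (pr (1, 0) t) as [p p'] eqn:Ep. simpl fst in *. simpl snd in *.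
  destruct (Z.leb_spec 2 (Z.abs n)) as [L|L].
  - unfold lower_inv. simpl fst. simpl snd. split; [lia|]. simpl. rewrite Zabs2Nat.id_abs.
    set (P := syl_prod (syllables t)) in *. assert (P1 : 1 <= P) by (now apply syl_prod_ge1).
    assert (K : (2 * Z.abs n - 1) * Z.abs p <= Z.abs (2 * n * p - p')).
    { assert (Z.abs (2 * n * p) <= Z.abs (2 * n * p - p') + Z.abs p') by lia. rewrite !Z.abs_mul in H. simpl (Z.abs 2) in H. nia. }
    split; [|nia].
    assert (E : (2 * n * p - p') * (2 * n * p - p') = Z.abs (2 * n * p - p') * Z.abs (2 * n * p - p')) by (rewrite <- Z.abs_mul; nia).
    assert (E2 : p * p = Z.abs p * Z.abs p) by (rewrite <- Z.abs_mul; nia).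
    set (v := Z.abs (2 * n * p - p')) in *. set (u := Z.abs p) in *. set (N := Z.abs n) in *.
    assert (K2 : (2 * N - 1) * u * ((2 * N - 1) * u) <= v * v) by (apply Z.mul_le_mono_nonneg; nia).
    rewrite E. assert (K3 : 9 * (4 * N - 1) <= 7 * ((2 * N - 1) * (2 * N - 1))) by nia.
    assert (K4 : P * (9 * (4 * N - 1)) <= P * (7 * ((2 * N - 1) * (2 * N - 1)))) by (apply Z.mul_le_mono_nonneg_l; lia).
    assert (K5 : P * (7 * ((2 * N - 1) * (2 * N - 1))) <= u * u * (7 * ((2 * N - 1) * (2 * N - 1)))) by (apply Z.mul_le_mono_nonneg_r; nia). nia.
  - assert (He : n = 1 \/ n = -1) by lia.
    assert (N0 : Z.eqb n 0 = false) by (apply Z.eqb_neq; auto).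
    destruct (syllables t) as [|[m d] r] eqn:Es.
    + simpl in IH. destruct IH as [-> ->]. unfold lower_inv. rewrite N0. simpl fst. simpl snd.
      split; [lia|]. split; auto. apply lower_run_start; auto; simpl; lia.
    + destruct (Z.eqb_spec m n) as [E|E].
      * subst m. unfold lower_inv in *. rewrite N0 in *. simpl fst in *. simpl snd in *.
        destruct IH as [Hd [_ [I1 [s0 [del [P0 [I2 [I3 I4]]]]]]]]. split; [lia|]. split; auto.
        (* Inside a run e p and p' have the same sign, so absolute values continue the arithmetic
           progression. *)
        assert (A : Z.abs (2 * n * p - p') = 2 * Z.abs p - Z.abs p').
        { destruct He as [-> | ->]; destruct (abs_case p) as [[? A]|[? A]]; destruct (abs_case p') as [[? B]|[? B]]; rewrite A, B in *; try nia. }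
        split.
        -- now apply run_sign.
        -- exists s0, del. rewrite A, I2, I3. rewrite Nat2Z.inj_succ. split; auto. split; [lia|]. split; [lia|]. auto.
      * inversion F as [|? ? [F1 _] F2]; subst. inversion Fp as [|? ? [_ G1] _]; subst. simpl in F1, G1.
        unfold lower_inv. rewrite N0. simpl fst. simpl snd. split; [lia|]. split; auto.
        apply lower_run_start; auto. unfold lower_inv in IH. simpl fst in IH. simpl snd in IH.
        destruct IH as [_ IH]. destruct (Z.eqb_spec m 0) as [->|M0].
        -- right. left. simpl. lia.
        -- right. right. destruct IH as [Hm [I1 _]]. destruct He as [-> | ->]; destruct Hm as [-> | ->]; try lia.
Qed.

(** Along a run |s - m s'| is constant, so the entries grow linearly in the degree; 1 + 2 d <= 4 d -
    1 then brings the bound back to the product over syllables. *)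
Definition upper_inv (p : Z * Z) (l : list (Z * nat)) : Prop :=
  let s := fst p in let s' := snd p in
  match l with
  | [] => Z.abs s <= 1 /\ Z.abs s' <= 1
  | (m, d) :: r =>
     (1 <= d)%nat /\
     if Z.eqb m 0 then Z.abs s <= (4 * Z.of_nat d - 1) * syl_prod r /\ Z.abs s' <= (4 * Z.of_nat d - 1) * syl_prod r
     else (m = 1 \/ m = -1) /\ Z.abs (s - m * s') <= 2 * syl_prod r /\
       Z.abs s <= (1 + 2 * Z.of_nat d) * syl_prod r /\ Z.abs s' <= (1 + 2 * Z.of_nat d) * syl_prod r
  end.

Lemma upper_inv_out (p : Z * Z) (l : list (Z * nat)) : upper_inv p l -> List.Forall (fun md => (1 <= snd md)%nat /\ True) l ->
  Z.abs (fst p) <= syl_prod l /\ Z.abs (snd p) <= syl_prod l.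
Proof.
  destruct p as [s s']. unfold upper_inv. simpl. destruct l as [|[m d] r]; [simpl; lia|].
  intros [Hd H] P. inversion P as [|? ? _ P2]; subst. assert (Q := syl_prod_pos r _ P2). simpl.
  destruct (Z.eqb m 0); [lia|]. destruct H as [_ [_ [H1 H2]]].
  assert ((1 + 2 * Z.of_nat d) * syl_prod r <= (4 * Z.of_nat d - 1) * syl_prod r) by (apply Z.mul_le_mono_nonneg_r; lia). lia.
Qed.

Lemma upper_inv_all (i : Z * Z) (l : list Z) : Z.abs (fst i) <= 1 -> Z.abs (snd i) <= 1 -> nz l -> upper_inv (pr i l) (syllables l).
Proof.
  intros H1 H2. induction 1 as [|n t Hn Ht IH]; [simpl; auto|].
  assert (F := forall_weak _ _ (syl_pos t Ht)). assert (Fp := syl_pos t Ht).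
  destruct (upper_inv_out _ _ IH F) as [O1 O2]. simpl.
  destruct (pr i t) as [p p'] eqn:Ep. simpl fst in *. simpl snd in *.
  destruct (Z.leb_spec 2 (Z.abs n)) as [L|L].
  - unfold upper_inv. simpl fst. simpl snd. split; [lia|]. simpl. rewrite Zabs2Nat.id_abs.
    set (P := syl_prod (syllables t)) in *. assert (P1 : 1 <= P) by (now apply syl_prod_ge1).
    assert (K : Z.abs (2 * n * p - p') <= 2 * Z.abs n * Z.abs p + Z.abs p').
    { assert (Z.abs (2 * n * p) = 2 * Z.abs n * Z.abs p) by (rewrite !Z.abs_mul; reflexivity). lia. }
    split; nia.
  - assert (He : n = 1 \/ n = -1) by lia.
    assert (N0 : Z.eqb n 0 = false) by (apply Z.eqb_neq; auto).
    destruct (syllables t) as [|[m d] r] eqn:Es.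
    + unfold upper_inv. rewrite N0. simpl in *. destruct He as [-> | ->]; lia.
    + destruct (Z.eqb_spec m n) as [E|E].
      * subst m. unfold upper_inv in *. rewrite N0 in *. simpl fst in *. simpl snd in *.
        destruct IH as [Hd [_ [I1 [I2 I3]]]]. rewrite Nat2Z.inj_succ. split; [lia|]. split; auto.
        destruct He as [-> | ->]; lia.
      * unfold upper_inv. rewrite N0. simpl fst. simpl snd. set (P := syl_prod ((m, d) :: r)) in *. split; [lia|]. split; auto.
        destruct He as [-> | ->]; lia.
Qed.

Lemma pr_det (l : list Z) : fst (pr (1, 0) l) * snd (pr (0, 1) l) - snd (pr (1, 0) l) * fst (pr (0, 1) l) = 1.
Proof. induction l; simpl; auto. lia. Qed.

Lemma pr_other (l : list Z) : nz l -> l <> [] -> Z.abs (snd (pr (0, 1) l)) + 1 <= Z.abs (fst (pr (0, 1) l)).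
Proof.
  induction 1 as [|n t Hn Ht IH]; [congruence|]. intros _. destruct t as [|n' t]; [simpl; lia|].
  specialize (IH ltac:(discriminate)). revert IH. generalize (n' :: t). intros t' IH. simpl. destruct (pr (0, 1) t') as [p p']. simpl in *.
  assert (K := step_abs n p p' Hn ltac:(lia)). lia.
Qed.

Lemma pr_snd_pos (l : list Z) : nz l -> l <> [] -> 2 <= Z.abs (fst (pr (1, 0) l)).
Proof.
  intros H N. destruct l as [|n t]; [congruence|]. inversion H; subst.
  destruct (lower_inv_out _ _ (lower_inv_all t H3) (forall_weak _ _ (syl_pos t H3))) as [O1 O2].
  simpl. assert (Q := syl_prod_ge1 t H3). destruct (pr (1, 0) t) as [p p']. simpl in *.
  assert (K := step_abs n p p' H2 O1). lia.
Qed.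

End Growth.

Section Matrices.
Local Open Scope Z_scope.

(** * Braid words as Moebius transformations *)

Definition mat : Type := (Z * Z * (Z * Z))%type.

Definition mm (M M' : mat) : mat :=
  let '((a, b), (c, d)) := M in let '((a', b'), (c', d')) := M' in
  ((a * a' + b * c', a * b' + b * d'), (c * a' + d * c', c * b' + d * d')).

Definition m1 : mat := ((1, 0), (0, 1)).

Definition mdet (M : mat) : Z := let '((a, b), (c, d)) := M in a * d - b * c.

(** For determinant 1, [1 + 4 * mprod M] is the square of ad + bc, the quantity that carries the
    hyperbolic distance. *)
Definition mprod (M : mat) : Z := let '((a, b), (c, d)) := M in a * b * (c * d).

Definition tm (ie : nat * Z) : mat := if Nat.eqb (fst ie) 1 then ((1, snd ie), (0, 1)) else ((1, 0), (- snd ie, 1)).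

Definition lm (x : nat * bool) : mat := tm (fst x, if snd x then 1 else -1).

Definition ml (l : list (nat * bool)) : mat := fold_right (fun x M => mm (lm x) M) m1 l.

Definition mw (w : bword) : mat := fold_right (fun x M => mm (tm x) M) m1 w.

Arguments mm : simpl never.
Arguments tm : simpl never.
Arguments m1 : simpl never.

Lemma mat_eq (a b c d a' b' c' d' : Z) : a = a' -> b = b' -> c = c' -> d = d' -> ((a, b), (c, d)) = ((a', b'), (c', d')).
Proof. congruence. Qed.

Lemma mm_assoc (A B D : mat) : mm (mm A B) D = mm A (mm B D).
Proof. destruct A as [[? ?] [? ?]], B as [[? ?] [? ?]], D as [[? ?] [? ?]]. unfold mm. apply mat_eq; ring. Qed.

Lemma mm_1l (A : mat) : mm m1 A = A.
Proof. destruct A as [[? ?] [? ?]]. unfold mm, m1. apply mat_eq; ring. Qed.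

Lemma mm_1r (A : mat) : mm A m1 = A.
Proof. destruct A as [[? ?] [? ?]]. unfold mm, m1. apply mat_eq; ring. Qed.

Lemma mdet_mm (A B : mat) : mdet (mm A B) = mdet A * mdet B.
Proof. destruct A as [[? ?] [? ?]], B as [[? ?] [? ?]]. unfold mm, mdet. ring. Qed.

Lemma mdet_tm (x : nat * Z) : mdet (tm x) = 1.
Proof. unfold tm. destruct (Nat.eqb (fst x) 1); unfold mdet; ring. Qed.

Lemma ml_app (l l' : list (nat * bool)) : ml (l ++ l') = mm (ml l) (ml l').
Proof. induction l; simpl; [now rewrite mm_1l|]. now rewrite IHl, mm_assoc. Qed.

Lemma mw_app (l l' : bword) : mw (l ++ l') = mm (mw l) (mw l').
Proof. induction l; simpl; [now rewrite mm_1l|]. now rewrite IHl, mm_assoc. Qed.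

Lemma mdet_ml (l : list (nat * bool)) : mdet (ml l) = 1.
Proof. induction l; simpl; auto. rewrite mdet_mm, IHl. unfold lm. now rewrite mdet_tm. Qed.

Lemma tm_add (i : nat) (e e' : Z) : mm (tm (i, e)) (tm (i, e')) = tm (i, e + e').
Proof. unfold tm. simpl fst. simpl snd. destruct (Nat.eqb i 1); apply mat_eq; ring. Qed.

Lemma ml_repeat (i : nat) (p : bool) (n : nat) : ml (repeat (i, p) n) = tm (i, (if p then 1 else -1) * Z.of_nat n).
Proof.
  induction n as [|n IH].
  - simpl. unfold tm. simpl fst. simpl snd. destruct (Nat.eqb i 1), p; reflexivity.
  - change (ml (repeat (i, p) (S n))) with (mm (lm (i, p)) (ml (repeat (i, p) n))). rewrite IH. unfold lm. simpl fst. simpl snd.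
    rewrite tm_add. f_equal. f_equal. rewrite Nat2Z.inj_succ. destruct p; ring.
Qed.

Lemma ml_letters (w : bword) : ml (letters w) = mw w.
Proof.
  induction w as [|[i e] w IH]; auto.
  change (letters ((i, e) :: w)) with (repeat (i, Z.ltb 0 e) (Z.abs_nat e) ++ letters w).
  rewrite ml_app, IH, ml_repeat. simpl. f_equal. f_equal. f_equal. rewrite Zabs2Nat.id_abs.
  destruct (Z.ltb_spec 0 e); lia.
Qed.

(** Right multiplication by the matrix [0 1; -1 0] of Delta, or by its inverse, exchanges the two
    columns up to a sign. *)
Lemma mprod_delta (M : mat) (n : nat) (e : Z) : e = 1 \/ e = -1 ->
  mprod (mm M (mw (concat (repeat [(1%nat, e); (2%nat, e); (1%nat, e)] n)))) = mprod M.
Proof.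
  intros He. revert M. induction n as [|n IH]; intros M; simpl repeat; simpl concat.
  - simpl mw. now rewrite mm_1r.
  - change (mw ((1%nat, e) :: (2%nat, e) :: (1%nat, e) :: concat (repeat [(1%nat, e); (2%nat, e); (1%nat, e)] n)))
      with (mm (tm (1%nat, e)) (mm (tm (2%nat, e)) (mm (tm (1%nat, e)) (mw (concat (repeat [(1%nat, e); (2%nat, e); (1%nat, e)] n)))))).
    rewrite <- !mm_assoc, IH. destruct M as [[a b] [c d]]. unfold tm. cbn [Nat.eqb fst snd]. unfold mm, mprod.
    destruct He as [-> | ->]; ring.
Qed.

Lemma mprod_delta_pow (M : mat) (l : Z) : mprod (mm M (mw (delta_pow l))) = mprod M.
Proof. unfold delta_pow. destruct (Z.leb 0 l); apply mprod_delta; auto. Qed.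

Definition half_exp (b1 : bword) : list Z := map (fun ie => Z.div (snd ie) 2) b1.

Lemma even_half (e : Z) : Z.Even e -> e = 2 * (e / 2).
Proof. intros [m ->]. rewrite Z.mul_comm, Z.div_mul; lia. Qed.

(** Signs and order of the entries depend on the generator [j] that multiplies next from the
    left. *)
Definition colpair (j : nat) (x y : Z) (e : Z) (p : Z * Z) : Prop :=
  if Nat.eqb j 1 then y = e * fst p /\ - x = e * snd p else x = e * fst p /\ y = e * snd p.

(** The disjunction records which column grows from (1, 0); this depends on the last generator of
    b_1, or on [j] if b_1 is empty. *)
Lemma alt_columns (j : nat) (b1 : bword) : (j = 1%nat \/ j = 2%nat) -> alt_even j b1 ->
  exists e f, (e = 1 \/ e = -1) /\ (f = 1 \/ f = -1) /\
    let '((a, b), (c, d)) := mw b1 in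
    colpair j a c e (pr (1, 0) (half_exp b1)) /\ colpair j b d f (pr (0, 1) (half_exp b1)) \/
    colpair j a c e (pr (0, 1) (half_exp b1)) /\ colpair j b d f (pr (1, 0) (half_exp b1)).
Proof.
  revert j. induction b1 as [|[i x] b1 IH]; intros j Hj.
  - intros _. destruct Hj as [-> | ->]; unfold colpair; simpl.
    + exists (-1), 1. split; [lia|]. split; [lia|]. right. lia.
    + exists 1, 1. split; [lia|]. split; [lia|]. left. lia.
  - intros [Hi [Nij [_ [Ev Hr]]]]. destruct (IH i Hi Hr) as [e [f [He [Hf H]]]].
    apply even_half in Ev. change (mw ((i, x) :: b1)) with (mm (tm (i, x)) (mw b1)). change (half_exp ((i, x) :: b1)) with (x / 2 :: half_exp b1). cbn [pr]. rewrite <- Ev.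
    destruct (mw b1) as [[a b] [c d]]. set (F := pr (1, 0) (half_exp b1)) in *. set (U := pr (0, 1) (half_exp b1)) in *.
    destruct F as [s s'], U as [u u']. unfold tm. simpl fst in *. simpl snd in *.
    destruct Hj as [-> | ->]; destruct Hi as [-> | ->]; try congruence; unfold colpair in *; simpl Nat.eqb in *; cbv iota in *; unfold mm;
    simpl fst in *; simpl snd in *.
    + exists (- e), (- f). split; [lia|]. split; [lia|]. destruct H as [[[-> ->] [-> ->]]|[[-> ->] [-> ->]]]; [left|right]; repeat split; ring.
    + exists e, f. split; [lia|]. split; [lia|].
      assert (X : forall p q g h : Z, - p = g * q -> p = - (g * q)) by (intros; lia).
      destruct H as [[[-> E1] [-> E2]]|[[-> E1] [-> E2]]]; apply X in E1, E2; auto; subst; [left|right]; repeat split; ring.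
Qed.

Lemma mprod_braid (j : nat) (k l : Z) (b1 : bword) : (j = 1%nat \/ j = 2%nat) -> alt_even j b1 ->
  let F := pr (1, 0) (half_exp b1) in let U := pr (0, 1) (half_exp b1) in
  mprod (mw (braid_nf j k b1 l)) = (k * fst F - snd F) * fst F * ((k * fst U - snd U) * fst U).
Proof.
  intros Hj Ha F U. unfold braid_nf. change ((j, k) :: b1 ++ delta_pow l) with (((j, k) :: b1) ++ delta_pow l).
  rewrite mw_app, mprod_delta_pow. simpl mw. destruct (alt_columns j b1 Hj Ha) as [e [f [He [Hf H]]]]. fold F U in H.
  destruct (mw b1) as [[a b] [c d]]. destruct F as [s s'], U as [u u']. unfold tm, colpair in *. simpl fst in *. simpl snd in *.
  assert (X : forall p q g : Z, - p = g * q -> p = - (g * q)) by (intros; lia).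
  assert (Q : (e * e) * (f * f) = 1) by (destruct He as [-> | ->]; destruct Hf as [-> | ->]; reflexivity).
  destruct Hj as [-> | ->]; simpl Nat.eqb in *; cbv iota in *; unfold mm, mprod.
  - destruct H as [[[-> E1] [-> E2]]|[[-> E1] [-> E2]]]; apply X in E1, E2; subst;
    transitivity ((e * e) * (f * f) * ((k * s - s') * s * ((k * u - u') * u))); try ring; rewrite Q; ring.
  - destruct H as [[[-> ->] [-> ->]]|[[-> ->] [-> ->]]];
    transitivity ((e * e) * (f * f) * ((k * s - s') * s * ((k * u - u') * u))); try ring; rewrite Q; ring.
Qed.

Lemma half_exp_nz (j : nat) (b1 : bword) : alt_even j b1 -> nz (half_exp b1).
Proof.
  revert j. induction b1 as [|[i x] b1 IH]; intros j; simpl; [constructor|].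
  intros [_ [_ [N [Ev H]]]]. constructor; [|now apply (IH i)]. simpl. apply even_half in Ev. lia.
Qed.

Lemma freduce_alt (j : nat) (b1 : bword) : alt_even j b1 ->
  freduce (map (fun ie => (fst ie, Z.div (snd ie) 2)) b1) = map (fun ie => (fst ie, Z.div (snd ie) 2)) b1.
Proof.
  revert j. induction b1 as [|[i x] b1 IH]; intros j; simpl; auto.
  intros [_ [_ [N [Ev H]]]]. rewrite (IH i H). apply even_half in Ev.
  destruct (Z.eqb_spec (x / 2) 0); [lia|]. destruct b1 as [|[i' x'] b1]; auto. simpl in *.
  destruct (Nat.eqb_spec i i') as [->|]; auto. destruct H as [_ [H _]]. congruence.
Qed.

Lemma pb_image_exp (j : nat) (k : Z) (b1 : bword) : alt_even j b1 ->
  map snd (pb_image (vartheta j k b1)) = if Z.eqb (q k / 2) 0 then half_exp b1 else (q k / 2) :: half_exp b1.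
Proof.
  intros H. unfold pb_image, vartheta. simpl. rewrite (freduce_alt j b1 H).
  assert (E : map snd (map (fun ie : nat * Z => (fst ie, snd ie / 2)) b1) = half_exp b1) by (rewrite map_map; reflexivity).
  destruct (Z.eqb_spec (q k / 2) 0); auto.
  destruct b1 as [|[i' x'] b1]; auto. simpl in *. destruct (Nat.eqb_spec j i') as [->|]; [|simpl; now rewrite E].
  destruct H as [_ [H _]]. congruence.
Qed.

(** Rounding k towards 0 to an even number loses at most 1 in absolute value; the result is 0 for k
    = 1 and k = -1. *)
Lemma q_half (k : Z) : k <> 0 -> 2 * Z.abs (q k / 2) <= Z.abs k <= 2 * Z.abs (q k / 2) + 1.
Proof.
  intros Hk. unfold q. destruct (Z.even k) eqn:E.
  - apply Z.even_spec in E. apply even_half in E. lia.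
  - assert (O : Z.Odd k) by (apply Z.odd_spec; rewrite <- Z.negb_even, E; reflexivity). destruct O as [m ->].
    destruct (Z.lt_trichotomy (2 * m + 1) 0) as [L|[L|L]]; [|lia|].
    + rewrite (Z.sgn_neg _ L). replace (2 * m + 1 - -1) with ((m + 1) * 2) by ring. rewrite Z.div_mul; lia.
    + rewrite (Z.sgn_pos _ L). replace (2 * m + 1 - 1) with (m * 2) by ring. rewrite Z.div_mul; lia.
Qed.

(** The power sigma_j^k acts as a last step of the recursion with k in place of 2 n. Since k may be
    odd, and q(k) may be 0, the entries are first compared with the product [P0] belonging to b_1
    alone. *)
Lemma braid_growth (j : nat) (k l : Z) (b1 : bword) : (j = 1%nat \/ j = 2%nat) -> k <> 0 -> alt_even j b1 -> b1 <> [] ->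
  exists N, let P := syl_prod (syllables (map snd (pb_image (vartheta j k b1)))) in
    let K := mprod (mw (braid_nf j k b1 l)) in
    0 < K /\ 0 < N /\ N * N = 1 + 4 * K /\ P <= N * N /\ N <= 9 * (P * P * P) /\ 3 <= P.
Proof.
  intros Hj Hk Ha Nb. cbv zeta. rewrite mprod_braid, pb_image_exp by auto.
  assert (Hn := half_exp_nz j b1 Ha). assert (Nn : half_exp b1 <> []) by (destruct b1; simpl; congruence).
  assert (D := pr_det (half_exp b1)). assert (O := pr_other _ Hn Nn). assert (S2 := pr_snd_pos _ Hn Nn).
  destruct (lower_inv_out _ _ (lower_inv_all _ Hn) (forall_weak _ _ (syl_pos _ Hn))) as [_ L2].
  destruct (upper_inv_out _ _ (upper_inv_all (1, 0) _ ltac:(simpl; lia) ltac:(simpl; lia) Hn) (forall_weak _ _ (syl_pos _ Hn))) as [U1 _].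
  destruct (upper_inv_out _ _ (upper_inv_all (0, 1) _ ltac:(simpl; lia) ltac:(simpl; lia) Hn) (forall_weak _ _ (syl_pos _ Hn))) as [U2 _].
  assert (Q := q_half k Hk). set (m := q k / 2) in *. set (ns := half_exp b1) in *.
  set (P0 := syl_prod (syllables ns)) in *. assert (P1 : 1 <= P0) by (now apply syl_prod_ge1).
  assert (P3 : 3 <= P0).
  { unfold P0. destruct ns as [|n t]; [congruence|]. inversion Hn; subst. now apply syl_prod_cons. }
  destruct (pr (1, 0) ns) as [s s']. destruct (pr (0, 1) ns) as [u u']. simpl fst in *. simpl snd in *.
  set (Xu := k * u - u') in *.
  (* By determinant 1 the products (k s - s') u and y = (k u - u') s differ by 1; hence abcd = y (y
     + 1) and |ad + bc| = |2 y + 1|. *)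
  assert (EX : (k * s - s') * u = Xu * s + 1) by (unfold Xu; lia).
  assert (BX : Z.abs k <= Z.abs Xu <= (Z.abs k + 1) * Z.abs u).
  { assert (E : Z.abs (k * u) = Z.abs k * Z.abs u) by apply Z.abs_mul. unfold Xu.
    assert ((Z.abs k - 1) * 1 <= (Z.abs k - 1) * Z.abs u) by (apply Z.mul_le_mono_nonneg_l; lia). lia. }
  assert (EY : Z.abs (Xu * s) = Z.abs Xu * Z.abs s) by apply Z.abs_mul.
  assert (BY1 : Z.abs k * Z.abs s <= Z.abs Xu * Z.abs s) by (apply Z.mul_le_mono_nonneg_r; lia).
  assert (BY2 : Z.abs Xu * Z.abs s <= (Z.abs k + 1) * Z.abs u * Z.abs s) by (apply Z.mul_le_mono_nonneg_r; lia).
  assert (Ks : 1 * Z.abs s <= Z.abs k * Z.abs s) by (apply Z.mul_le_mono_nonneg_r; lia).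
  set (y := Xu * s) in *.
  assert (EK : (k * s - s') * s * (Xu * u) = y * (y + 1)).
  { transitivity ((k * s - s') * u * y); [unfold y; ring | rewrite EX; ring]. }
  rewrite EK. set (N := Z.abs (2 * y + 1)). exists N.
  assert (NN : N * N = 1 + 4 * (y * (y + 1))).
  { unfold N. rewrite <- Z.abs_mul, Z.abs_eq by apply Z.square_nonneg. ring. }
  set (ak := Z.abs k) in *. assert (k1 : 1 <= ak) by (unfold ak; lia).
  assert (NL : (2 * ak - 1) * Z.abs s <= N).
  { unfold N. assert (2 * Z.abs y <= Z.abs (2 * y + 1) + 1) by lia. lia. }
  assert (NU : N <= 2 * ((ak + 1) * (P0 * P0)) + 1).
  { assert (Z1 : Z.abs u * Z.abs s <= P0 * P0) by (apply Z.mul_le_mono_nonneg; lia).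
    apply (Z.mul_le_mono_nonneg_l _ _ (ak + 1)) in Z1; [|lia]. unfold N. lia. }
  assert (SN : (2 * ak - 1) * (2 * ak - 1) * (s * s) <= N * N).
  { apply sq_mono in NL; [|apply Z.mul_nonneg_nonneg; lia]. rewrite <- (Z.abs_square s). lia. }
  assert (SN2 : (2 * ak - 1) * (2 * ak - 1) * P0 <= (2 * ak - 1) * (2 * ak - 1) * (s * s)).
  { apply Z.mul_le_mono_nonneg_l; auto. apply Z.square_nonneg. }
  split.
  { assert (Y2 : 2 <= Z.abs y) by (clear - EY BY1 Ks S2; lia).
    destruct (Z.le_gt_cases 0 y); [apply Z.mul_pos_pos | apply Z.mul_neg_neg]; clear - Y2 H; lia. }
  split; [unfold N; lia|]. split; auto.
  (* The product for the whole word is [P0] if q(k) = 0, and otherwise lies between [P0] and (4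
     |q(k)/2| - 1) [P0]. The three hypotheses on P are what both cases have in common. *)
  assert (Main : forall P, P0 <= P -> P <= (2 * ak - 1) * (2 * ak - 1) * P0 -> ak + 1 <= 4 * P -> P <= N * N /\ N <= 9 * (P * P * P) /\ 3 <= P).
  { intros P A1 A2 A3. split; [lia|]. split; [|lia].
    assert (B1 : P0 * P0 <= P * P) by (apply sq_mono; lia).
    assert (B2 : (ak + 1) * (P0 * P0) <= 4 * P * (P * P)) by (apply Z.mul_le_mono_nonneg; lia).
    assert (B3 : 1 * 1 <= P * P) by (apply sq_mono; lia).
    assert (B4 : 1 * 1 <= P * P * P) by (apply Z.mul_le_mono_nonneg; lia).
    clear - NU B2 B4. lia. }
  assert (Sq : 1 * (2 * ak - 1) <= (2 * ak - 1) * (2 * ak - 1)) by (apply Z.mul_le_mono_nonneg_r; lia).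
  clear - Main Q P1 Hn Sq k1.
  destruct (Z.eqb_spec m 0) as [M0|M0].
  - apply Main; fold P0; [lia | | lia].
    assert (1 * P0 <= (2 * ak - 1) * (2 * ak - 1) * P0) by (apply Z.mul_le_mono_nonneg_r; lia). lia.
  - destruct (syl_prod_cons m ns Hn M0) as [[C1 C2] [C3 C4]]. fold P0 in C1, C2, C4.
    apply Main; auto.
    + eapply Z.le_trans; [apply C2|]. apply Z.mul_le_mono_nonneg_r; lia.
    (* If |q(k)/2| = 1, then |k| <= 3 and P >= 3 is enough. *)
    + destruct (Z.le_gt_cases 2 (Z.abs m)) as [M2|M2]; [|lia]. rewrite C4 by auto.
      assert ((4 * Z.abs m - 1) * 1 <= (4 * Z.abs m - 1) * P0) by (apply Z.mul_le_mono_nonneg_l; lia). lia.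
Qed.

End Matrices.

(** * Moebius transformations *)

Definition mob (a b c d : R) (t : C) : C := ((RtoC a * t + RtoC b) / (RtoC c * t + RtoC d))%C.

Lemma den_neq0 (c d : R) (t : C) : HH t -> (c <> 0 \/ d <> 0) -> (RtoC c * t + RtoC d)%C <> 0%C.
Proof.
  unfold HH. intros H N E. destruct t as [x y]. simpl in H. assert (E1 := f_equal fst E). assert (E2 := f_equal snd E). simpl in E1, E2.
  assert (c * y = 0) by lra. destruct (Rmult_integral _ _ H0) as [->|]; [|lra]. destruct N; lra.
Qed.

Lemma det_den (a b c d : R) : a * d - b * c = 1 -> (c <> 0 \/ d <> 0) /\ (a <> 0 \/ b <> 0).
Proof.
  intros H. split.
  - destruct (Req_dec c 0) as [->|]; auto. destruct (Req_dec d 0) as [->|]; auto. lra.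
  - destruct (Req_dec a 0) as [->|]; auto. destruct (Req_dec b 0) as [->|]; auto. lra.
Qed.

Lemma HH_mob (a b c d : R) (t : C) : a * d - b * c = 1 -> HH t -> HH (mob a b c d t).
Proof.
  intros D H. assert (N := den_neq0 c d t H (proj1 (det_den a b c d D))).
  assert (P : 0 < (c * fst t + d) ^ 2 + (c * snd t) ^ 2).
  { assert (Q := Cmod_pos _ N). assert (E := Cmod_sq (RtoC c * t + RtoC d)%C). simpl fst in E. simpl snd in E.
    assert (0 < Cmod (c * t + d) ^ 2) by (apply pow_lt; auto). rewrite E in H0. destruct t as [x y]. simpl in *.
    replace (c * x - 0 * y + d) with (c * x + d) in H0 by ring. replace (c * y + 0 * x + 0) with (c * y) in H0 by ring. exact H0. }
  unfold HH in *. destruct t as [x y]. unfold mob. simpl in *.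
  match goal with |- 0 < ?v => replace v with ((a * d - b * c) * y / ((c * x + d) ^ 2 + (c * y) ^ 2)) end.
  - rewrite D. apply Rdiv_lt_0_compat; lra.
  - field. intros E; apply (Rlt_not_eq _ _ P); rewrite <- E; ring.
Qed.

Lemma act_mob (x : nat * bool) (a b c d : Z) (t : C) : (a * d - b * c = 1)%Z -> HH t ->
  let '((a', b'), (c', d')) := mm (lm x) ((a, b), (c, d)) in
  act x (mob (IZR a) (IZR b) (IZR c) (IZR d) t) = mob (IZR a') (IZR b') (IZR c') (IZR d') t.
Proof.
  intros D H. assert (DR : IZR a * IZR d - IZR b * IZR c = 1) by (rewrite <- !mult_IZR, <- minus_IZR, D; reflexivity).
  assert (Dm := mdet_mm (lm x) ((a, b), (c, d))). unfold lm in *. rewrite mdet_tm in Dm.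
  unfold act, tm in *. destruct x as [i p]. cbn [fst snd] in *.
  assert (Ep : IZR (if p then 1 else -1) = sg p) by (destruct p; reflexivity).
  assert (DD := det_den _ _ _ _ DR).
  assert (N1 := den_neq0 _ _ t H (proj1 DD)). assert (N2 := den_neq0 _ _ t H (proj2 DD)).
  destruct (Nat.eqb i 1); unfold mm in *; unfold mob; rewrite !plus_IZR, !mult_IZR, ?opp_IZR, !Ep, !RtoC_plus, !RtoC_mult, ?RtoC_opp.
  - field. intros E. apply N1. rewrite <- E. ring.
  - assert (N3 : (- (IZR a * t + IZR b) * sg p + (IZR c * t + IZR d))%C <> 0%C).
    (* Together with (a, b) the new second row has determinant 1, so the new denominator does not
       vanish. *)
    { assert (X : (a * (- (if p then 1 else -1) * b + 1 * d) - b * (- (if p then 1 else -1) * a + 1 * c) = 1)%Z) by lia.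
      assert (XR : IZR a * IZR (- (if p then 1 else -1) * b + 1 * d) - IZR b * IZR (- (if p then 1 else -1) * a + 1 * c) = 1)
        by (rewrite <- !mult_IZR, <- minus_IZR, X; reflexivity).
      assert (N3 := den_neq0 _ _ t H (proj1 (det_den _ _ _ _ XR))). rewrite !plus_IZR, !mult_IZR, !opp_IZR, !Ep, !RtoC_plus, !RtoC_mult, !RtoC_opp in N3.
      intros E. apply N3. rewrite <- E. ring. }
    assert (E1 : (- / ((IZR a * t + IZR b) / (IZR c * t + IZR d)) + sg p)%C = (- (- (IZR a * t + IZR b) * sg p + (IZR c * t + IZR d)) / (IZR a * t + IZR b))%C) by (field; auto).
    rewrite E1.
    transitivity ((IZR a * t + IZR b) / (- (IZR a * t + IZR b) * sg p + (IZR c * t + IZR d)))%C.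
    { set (u := (IZR a * t + IZR b)%C) in *. set (v := (- u * sg p + (IZR c * t + IZR d))%C) in *.
      clearbody u v. field. auto. }
    f_equal; try ring.
Qed.

Lemma act_w_mob (l : list (nat * bool)) (t : C) : HH t ->
  let '((a, b), (c, d)) := ml l in act_w l t = mob (IZR a) (IZR b) (IZR c) (IZR d) t.
Proof.
  intros H. induction l as [|x l IH].
  - simpl. unfold m1, mob. field.
  - change (ml (x :: l)) with (mm (lm x) (ml l)). assert (D := mdet_ml l). destruct (ml l) as [[a b] [c d]].
    simpl act_w. rewrite IH. apply act_mob; auto.
Qed.

(** * The logarithm on the upper half-plane *)

Lemma contR (D : C -> Prop) (u : C -> R) (g : R -> R) : contC D (fun z => RtoC (u z)) ->
  (forall z, D z -> continuity_pt g (u z)) -> contC D (fun z => RtoC (g (u z))).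
Proof.
  intros Hu Hg z Dz e He. destruct (Hg z Dz e He) as [d [Pd K]]. destruct (Hu z Dz d Pd) as [d' [Pd' K']].
  exists d'; split; auto. intros w Dw L. specialize (K' w Dw L). unfold dC in *. rewrite <- RtoC_minus, Cmod_R in *.
  destruct (Req_dec (u z) (u w)) as [E|N].
  - rewrite E. replace (g (u w) - g (u w)) with 0 by ring. now rewrite Rabs_R0.
  - rewrite Rabs_minus_sym. apply K. split; [split; [exact I | exact N]|]. simpl. unfold R_dist. now rewrite Rabs_minus_sym.
Qed.

(** PI / 2 - atan (x / y) is the argument in (0, PI), given by one continuous formula on the whole
    upper half-plane. *)
Definition clog (w : C) : C := (ln (Cmod w), PI / 2 - atan (fst w / snd w)).

Lemma clog_exp (w : C) : HH w -> cexp (clog w) = w.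
Proof.
  unfold HH. intros H. set (r := Cmod w).
  assert (Pr : 0 < r) by (apply Cmod_pos; intros E; rewrite E in H; simpl in H; lra).
  assert (Er : r * r = fst w * fst w + snd w * snd w) by (unfold r; assert (Q := Cmod_sq w); simpl in Q; lra).
  unfold cexp, clog. simpl fst. simpl snd. fold r. rewrite exp_ln by auto.
  rewrite cos_shift, sin_shift, sin_atan, cos_atan.
  destruct w as [x y]. simpl in *.
  assert (Es : sqrt (1 + (x / y)²) = r / y).
  { apply sqrt_lem_1; [|apply Rdiv_le_0_compat; lra|]; unfold Rsqr.
    - assert (Q := Rle_0_sqr (x / y)). unfold Rsqr in Q. lra.
    - replace (r / y * (r / y)) with (r * r / (y * y)) by (field; lra). rewrite Er. field. lra. }
  rewrite Es. cparts; field; lra.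
Qed.

Lemma clog_arg (w : C) : 0 < snd (clog w) < PI.
Proof. unfold clog. simpl. assert (B := atan_bound (fst w / snd w)). lra. Qed.

Lemma clog_cont : contC HH clog.
Proof.
  apply (contD_ext _ _ (fun w => RtoC (ln (Cmod w)) + Ci * (RtoC (PI / 2) - RtoC (atan (fst w / snd w))))%C).
  { intros w _. unfold clog. cparts; ring. }
  apply contC_plus; [|apply contC_mult; [apply contC_const | apply contC_minus; [apply contC_const|]]].
  - apply (contR HH (fun w => Cmod w) ln).
    + apply contC_lip with 1. intros u v. rewrite <- RtoC_minus, Cmod_R, Rmult_1_l.
      apply Rabs_le. assert (A := Cmod_rev u v). assert (B := Cmod_rev v u). rewrite (Cmod_sym v u) in B. lra.
    + intros z Hz. apply derivable_continuous_pt. exists (/ Cmod z). apply derivable_pt_lim_ln, Cmod_pos.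
      intros E. rewrite E in Hz. unfold HH in Hz; simpl in Hz; lra.
  - apply (contR HH (fun w => fst w / snd w) atan).
    + apply (contD_ext _ _ (fun w => RtoC (fst w) / RtoC (snd w))%C); [intros z Hz; now rewrite RtoC_div by (unfold HH in Hz; lra)|].
      apply contC_div; [apply contC_fst | apply contC_snd|]. intros z Hz E. apply RtoC_inj in E. unfold HH in Hz; lra.
    + intros z _. apply derivable_continuous_pt, derivable_pt_atan.
Qed.

Lemma exp_HH (z : C) : 0 < snd z < PI -> HH (cexp z).
Proof. intros H. unfold HH, cexp. simpl. apply Rmult_lt_0_compat; [apply exp_pos | apply sin_gt_0; lra]. Qed.

Lemma exp_clog (z : C) : 0 < snd z < PI -> clog (cexp z) = z.
Proof.
  intros H. unfold clog. rewrite Cmod_cexp, ln_exp. apply Ceq; [reflexivity|]. unfold cexp. simpl.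
  assert (S0 := sin_gt_0 (snd z) ltac:(lra) ltac:(lra)). assert (E0 := exp_pos (fst z)).
  replace (exp (fst z) * cos (snd z) / (exp (fst z) * sin (snd z))) with (tan (PI / 2 - snd z)).
  - rewrite atan_tan; lra.
  - unfold tan. rewrite sin_shift, cos_shift. field. lra.
Qed.

(** * Strips between two geodesics *)

Definition strip (z : C) : Prop := - PI < fst z < 0.

(* [ga] maps [Om] onto the upper half-plane; the line [snd z = 0] goes to the imaginary axis
   and the line [snd z = h] to the curve [G]. *)
Definition uniformizes (Om : C -> Prop) (ga ps : C -> C) (h : R) (G : C -> Prop) : Prop :=
  (forall z, Om z -> HH (ga z) /\ exists l, cder ga z l /\ l <> 0%C) /\
  (forall t, HH t -> Om (ps t) /\ ga (ps t) = t) /\ contC HH ps /\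
  (forall z, Om z -> snd z = 0 <-> fst (ga z) = 0) /\
  (forall z, Om z -> snd z = h <-> G (ga z)).

(** The equation Re (M^-1 t) = 0 cleared of denominators: the half-circle or line orthogonal to the
    real axis with end points a / c and b / d. *)
Definition geodesic (a b c d : R) (t : C) : Prop := c * d * Cmod t ^ 2 - (a * d + b * c) * fst t + a * b = 0.

Lemma mob_geodesic (a b c d : R) (t : C) : a * d - b * c = 1 -> HH t ->
  (geodesic a b c d t <-> exists y, 0 < y /\ t = mob a b c d (0, y)).
Proof.
  intros D H. split.
  - intros G. assert (D' : d * a - (- b) * (- c) = 1) by lra.
    set (u := mob d (- b) (- c) a t). assert (Hu : HH u) by (now apply HH_mob).
    assert (N := den_neq0 (- c) a t H (proj1 (det_den _ _ _ _ D'))).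
    assert (Fu : fst u = 0).
    { unfold u, mob. set (n := (RtoC d * t + RtoC (- b))%C). set (m := (RtoC (- c) * t + RtoC a)%C) in *.
      assert (E : (n / m)%C = (RtoC (/ Cmod m ^ 2) * (n * Cconj m))%C).
      { assert (Em : (m * Cconj m)%C = RtoC (Cmod m ^ 2)) by (rewrite Cmod_sq; cparts; ring).
        assert (Pm : 0 < Cmod m ^ 2) by (apply pow_lt, Cmod_pos; auto).
        rewrite RtoC_inv by lra. rewrite <- Em. field. split; auto. now apply Cconj_neq0. }
      rewrite E, fst_scal. apply Rmult_eq_0_compat_l.
      unfold geodesic in G. rewrite Cmod_sq in G. unfold n, m. destruct t as [x y]. simpl in *. lra. }
    exists (snd u). split; [exact Hu|]. replace ((0, snd u) : C) with u by (cparts; auto).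
    assert (Nu := den_neq0 c d u Hu (proj1 (det_den _ _ _ _ D))).
    unfold mob in *. fold u in Nu |- *. unfold u in *. clear u Hu Fu. rewrite RtoC_opp, RtoC_opp in *.
    assert (DC : (RtoC a * RtoC d - RtoC b * RtoC c)%C = 1%C) by (rewrite <- !RtoC_mult, <- RtoC_minus, D; reflexivity).
    set (m := (- RtoC c * t + RtoC a)%C) in *.
    assert (E1 : (RtoC c * ((RtoC d * t + - RtoC b) / m) + RtoC d)%C = (/ m)%C).
    { transitivity ((RtoC a * RtoC d - RtoC b * RtoC c) / m)%C; [unfold m; field; auto | rewrite DC; field; auto]. }
    assert (E2 : (RtoC a * ((RtoC d * t + - RtoC b) / m) + RtoC b)%C = (t / m)%C).
    { transitivity ((RtoC a * RtoC d - RtoC b * RtoC c) * t / m)%C; [unfold m; field; auto | rewrite DC; field; auto]. }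
    rewrite E1, E2. field. auto.
  - intros [y [Py ->]]. unfold geodesic. rewrite Cmod_sq.
    assert (N := den_neq0 c d (0, y) Py (proj1 (det_den _ _ _ _ D))). apply Cmod_pos in N. apply (pow_lt _ 2) in N.
    rewrite Cmod_sq in N. simpl in N.
    assert (Pk : 0 < d ^ 2 + c ^ 2 * y ^ 2) by lra.
    assert (F1 : fst (mob a b c d (0, y)) = (a * c * y ^ 2 + b * d) / (d ^ 2 + c ^ 2 * y ^ 2)).
    { unfold mob. simpl. field. lra. }
    assert (F2 : snd (mob a b c d (0, y)) = (a * d - b * c) * y / (d ^ 2 + c ^ 2 * y ^ 2)).
    { unfold mob. simpl. field. lra. }
    rewrite F1, F2. field. lra.
Qed.

Lemma cayley_HH (k : R) (w : C) : 0 < k -> HH w -> HH (RtoC k * ((w - 1) / (w + 1)))%C /\ (w + 1)%C <> 0%C.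
Proof.
  intros Hk H. assert (N : (w + 1)%C <> 0%C) by (intros E; apply (f_equal snd) in E; unfold HH in H; simpl in E; lra).
  split; auto. unfold HH in *. destruct w as [x y]. simpl in *.
  match goal with |- 0 < ?v => replace v with (k * (2 * y / ((x + 1) ^ 2 + y ^ 2))) end.
  - apply Rmult_lt_0_compat; auto. apply Rdiv_lt_0_compat; [lra|].
    assert (Q := pow2_ge_0 (x + 1)). assert (0 < y ^ 2) by (apply pow_lt; lra). lra.
  - field. assert (Q := pow2_ge_0 (x + 1)). assert (0 < y ^ 2) by (apply pow_lt; lra). lra.
Qed.

Lemma cayley_inv_HH (k : R) (t : C) : 0 < k -> HH t -> HH ((RtoC k + t) / (RtoC k - t))%C /\ (RtoC k - t)%C <> 0%C.
Proof.
  intros Hk H. assert (N : (RtoC k - t)%C <> 0%C) by (intros E; apply (f_equal snd) in E; unfold HH in H; simpl in E; lra).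
  split; auto. unfold HH in *. destruct t as [x y]. simpl in *.
  match goal with |- 0 < ?v => replace v with (2 * k * y / ((k - x) ^ 2 + y ^ 2)) end.
  - apply Rdiv_lt_0_compat; [nra|].
    assert (Q := pow2_ge_0 (k - x)). assert (0 < y ^ 2) by (apply pow_lt; lra). lra.
  - field. assert (Q := pow2_ge_0 (k - x)). assert (0 < y ^ 2) by (apply pow_lt; lra). lra.
Qed.

Lemma cayley_12 (k : R) (t : C) : 0 < k -> (RtoC k - t)%C <> 0%C ->
  (RtoC k * (((RtoC k + t) / (RtoC k - t) - 1) / ((RtoC k + t) / (RtoC k - t) + 1)))%C = t.
Proof.
  intros Hk N. assert (Nk : RtoC k <> 0%C) by (intros E; apply RtoC_inj in E; lra).
  set (w := ((RtoC k + t) / (RtoC k - t))%C).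
  assert (E1 : (w - 1)%C = (2 * t / (RtoC k - t))%C) by (unfold w; field; auto).
  assert (E2 : (w + 1)%C = (2 * RtoC k / (RtoC k - t))%C) by (unfold w; field; auto).
  rewrite E1, E2. field. auto.
Qed.

Lemma cayley_21 (k : R) (w : C) : 0 < k -> (w + 1)%C <> 0%C ->
  ((RtoC k + RtoC k * ((w - 1) / (w + 1))) / (RtoC k - RtoC k * ((w - 1) / (w + 1))))%C = w.
Proof.
  intros Hk N. assert (Nk : RtoC k <> 0%C) by (intros E; apply RtoC_inj in E; lra).
  assert (E1 : (RtoC k + RtoC k * ((w - 1) / (w + 1)))%C = (2 * RtoC k * w / (w + 1))%C) by (field; auto).
  assert (E2 : (RtoC k - RtoC k * ((w - 1) / (w + 1)))%C = (2 * RtoC k / (w + 1))%C) by (field; auto).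
  rewrite E1, E2. field. auto.
Qed.

Lemma exp_sq_inj (x y : R) : exp x * exp x = exp y * exp y -> x = y.
Proof. rewrite <- !exp_plus. intros E. apply exp_inv in E. lra. Qed.

(** arcosh |ad + bc|, because (ad + bc)^2 - 1 = 4 abcd when the determinant is 1. *)
Definition width (a b c d : R) : R := ln (Rabs (a * d + b * c) + 2 * sqrt (a * b * (c * d))).

(** The numbers k and -k are the end points of the common perpendicular |t| = k of the two
    geodesics. The map (k + t) / (k - t) sends them to infinity and 0, hence the geodesics to
    concentric half-circles, which a logarithm turns into parallel segments. The sign hypothesis
    puts the second geodesic into Re t > 0, on the side of positive h. *)
Lemma uniformize_pos (a b c d : R) : a * d - b * c = 1 -> 0 < a * b * (c * d) -> 0 < (a * d + b * c) * (c * d) ->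
  exists ga ps, uniformizes strip ga ps (width a b c d) (geodesic a b c d).
Proof.
  intros D PK PS. set (r := c * d) in *. set (s := a * b) in *. set (n := a * d + b * c) in *.
  assert (r0 : r <> 0) by (intros E; rewrite E in PK; lra).
  assert (n2 : n * n = 1 + 4 * (s * r)).
  { unfold n, s, r. replace 1 with ((a * d - b * c) * (a * d - b * c)) by (rewrite D; ring). ring. }
  assert (Psr : 0 < s / r).
  { replace (s / r) with (s * r / (r * r)) by (field; auto). apply Rdiv_lt_0_compat; auto. nra. }
  set (k := sqrt (s / r)). assert (Pk : 0 < k) by (now apply sqrt_lt_R0).
  assert (k2 : k * k = s / r) by (apply sqrt_sqrt; lra).
  assert (kr : k * k * r = s) by (rewrite k2; field; auto).
  set (m := n / r). assert (mr : m * r = n) by (unfold m; field; auto).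
  assert (Pm : 0 < m).
  { unfold m. replace (n / r) with (n * r / (r * r)) by (field; auto). apply Rdiv_lt_0_compat; auto. nra. }
  set (Rr := Rabs n + 2 * sqrt (s * r)).
  assert (ER : Rr = Rabs r * (m + 2 * k)).
  { unfold Rr. replace (sqrt (s * r)) with (Rabs r * k).
    - rewrite <- mr, Rabs_mult, (Rabs_pos_eq m) by lra. ring.
    - symmetry. apply sqrt_lem_1; [lra | apply Rmult_le_pos; [apply Rabs_pos | lra] |].
      rewrite <- kr. replace (Rabs r * k * (Rabs r * k)) with (Rabs r * Rabs r * (k * k)) by ring.
      rewrite <- Rabs_mult, Rabs_pos_eq by nra. ring. }
  assert (PR : 0 < Rr) by (rewrite ER; apply Rmult_lt_0_compat; [now apply Rabs_pos_lt | lra]).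
  assert (mk : r * r * (m * m - 4 * (k * k)) = 1).
  { replace (r * r * (m * m - 4 * (k * k))) with (m * r * (m * r) - 4 * (k * k * r * r)) by ring. rewrite mr, kr, n2. ring. }
  assert (Pmk : 0 < m - 2 * k).
  { assert (0 < m * m - 4 * (k * k)) by nra. nra. }
  (* On the geodesic |t|^2 + k^2 = m Re t, so |k + t|^2 / |k - t|^2 has there the constant value (m
     + 2 k) / (m - 2 k); this has to be Rr^2. *)
  assert (R2 : Rr * Rr * (m - 2 * k) = m + 2 * k).
  { rewrite ER. replace (Rabs r * (m + 2 * k) * (Rabs r * (m + 2 * k)) * (m - 2 * k)) with
      (Rabs r * Rabs r * (m * m - 4 * (k * k)) * (m + 2 * k)) by ring.
    rewrite <- Rabs_mult, (Rabs_pos_eq (r * r)) by nra. rewrite mk. ring. }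
  set (h := ln Rr). assert (Eh : exp h = Rr) by (now apply exp_ln).
  set (W := fun z : C => cexp (- Ci * z)).
  set (ga := fun z : C => (RtoC k * ((W z - 1) / (W z + 1)))%C).
  set (ps := fun t : C => (Ci * clog ((RtoC k + t) / (RtoC k - t)))%C).
  assert (HW : forall z, strip z -> HH (W z) /\ clog (W z) = (- Ci * z)%C).
  { intros z Hz. unfold strip in Hz. assert (A : 0 < snd (- Ci * z)%C < PI) by (destruct z; simpl in *; lra).
    split; [now apply exp_HH | now apply exp_clog]. }
  assert (HG : forall z, strip z -> HH (ga z) /\ (W z + 1)%C <> 0%C).
  { intros z Hz. apply (cayley_HH k (W z) Pk). now apply HW. }
  assert (EW : forall z, strip z -> Cmod (RtoC k + ga z) ^ 2 = exp (snd z) * exp (snd z) * Cmod (RtoC k - ga z) ^ 2 /\ 0 < Cmod (RtoC k - ga z) ^ 2).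
  { intros z Hz. destruct (HG z Hz) as [H1 H2]. destruct (cayley_inv_HH k (ga z) Pk H1) as [_ N].
    assert (E := cayley_21 k (W z) Pk H2). fold (ga z) in E.
    assert (P := Cmod_pos _ N). split; [|now apply pow_lt].
    assert (M : Cmod (W z) = exp (snd z)) by (unfold W; rewrite Cmod_cexp; f_equal; destruct z; simpl; ring).
    rewrite <- M, <- E, Cmod_div by auto. field. lra. }
  assert (Q : forall z, strip z -> 4 * k * fst (ga z) = Cmod (RtoC k + ga z) ^ 2 - Cmod (RtoC k - ga z) ^ 2 /\
     (m - 2 * k) * (Cmod (RtoC k + ga z) ^ 2 - Rr * Rr * Cmod (RtoC k - ga z) ^ 2) * r =
      - (4 * k) * (r * Cmod (ga z) ^ 2 - n * fst (ga z) + s)).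
  { intros z Hz. split.
    - rewrite !Cmod_sq. destruct (ga z) as [x y]. simpl. ring.
    - replace ((m - 2 * k) * (Cmod (RtoC k + ga z) ^ 2 - Rr * Rr * Cmod (RtoC k - ga z) ^ 2) * r)
        with ((m * r - 2 * k * r) * Cmod (RtoC k + ga z) ^ 2 - (Rr * Rr * (m - 2 * k)) * r * Cmod (RtoC k - ga z) ^ 2) by ring.
      rewrite R2, <- kr, <- mr, !Cmod_sq. destruct (ga z) as [x y]. simpl. ring. }
  exists ga, ps. change (width a b c d) with h. split; [|split; [|split; [|split]]].
  - intros z Hz. destruct (HG z Hz) as [H1 H2]. split; auto.
    assert (CW : cder W z (W z * (- Ci * 1))%C).
    { apply (cder_comp (fun z => - Ci * z)%C cexp); [apply cder_scal, cder_id | apply cder_cexp]. }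
    assert (Nz : (- Ci * 1 * W z)%C <> 0%C).
    { apply Cmult_neq_0; [|apply cexp_neq0]. intros E. apply (f_equal snd) in E. simpl in E. lra. }
    exists (RtoC k * (2 * (- Ci * 1 * W z) / ((W z + 1) * (W z + 1))))%C. split.
    + apply (cder_scal (RtoC k) (fun z => (W z - 1) / (W z + 1))%C). eapply cder_eq.
      * apply (cder_mult (fun z => W z - 1)%C (fun z => / (W z + 1))%C).
        -- apply (cder_plus W (fun _ => - (1))%C); [exact CW | apply cder_const].
        -- apply (cder_inv (fun z => W z + 1)%C); auto. apply (cder_plus W (fun _ => RtoC 1)); [exact CW | apply cder_const].
      * set (w := W z) in *. clearbody w. field. auto.
    + apply Cmult_neq_0; [intros E; apply RtoC_inj in E; lra|].
      apply Cdiv_neq0; [apply Cmult_neq_0; auto using C2_neq0 | now apply Cmult_neq_0].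
  - intros t Ht. destruct (cayley_inv_HH k t Pk Ht) as [H1 H2]. split.
    + unfold strip, ps. set (w := clog _). assert (A : 0 < snd w < PI) by apply clog_arg.
      replace (fst (Ci * w)%C) with (- snd w) by (simpl; ring). lra.
    + unfold ga, W, ps. set (w := ((RtoC k + t) / (RtoC k - t))%C) in *.
      replace (- Ci * (Ci * clog w))%C with (clog w) by (cparts; ring).
      rewrite clog_exp by auto. now apply cayley_12.
  - unfold ps. apply contC_scal. apply (contC_comp HH HH (fun t => (RtoC k + t) / (RtoC k - t))%C clog); [|apply clog_cont|].
    + apply contC_div; [apply contC_plus; [apply contC_const | apply contC_id] | apply contC_minus; [apply contC_const | apply contC_id]|].
      intros z Hz. now apply cayley_inv_HH.
    + intros z Hz. now apply cayley_inv_HH.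
  - intros z Hz. destruct (EW z Hz) as [E1 E2]. destruct (Q z Hz) as [Q1 _]. split; intros E.
    + rewrite E, exp_0 in E1. apply (Rmult_eq_reg_l (4 * k)); [rewrite Q1, E1; ring | lra].
    + rewrite E in Q1. apply exp_sq_inj. rewrite exp_0.
      apply (Rmult_eq_reg_r (Cmod (RtoC k - ga z) ^ 2)); [rewrite <- E1; lra | lra].
  - intros z Hz. destruct (EW z Hz) as [E1 E2]. destruct (Q z Hz) as [_ Q2].
    unfold geodesic. fold r s n. split; intros E.
    + rewrite E, Eh in E1. rewrite E1 in Q2.
      apply (Rmult_eq_reg_l (- (4 * k))); [rewrite <- Q2; ring | lra].
    + rewrite E in Q2. apply exp_sq_inj. rewrite Eh.
      apply (Rmult_eq_reg_r (Cmod (RtoC k - ga z) ^ 2)); [|lra]. rewrite <- E1.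
      assert (Z : (m - 2 * k) * r <> 0) by (apply Rmult_integral_contrapositive; split; lra).
      apply (Rmult_eq_reg_l ((m - 2 * k) * r)); auto. lra.
Qed.

Lemma Cinv_parts (t : C) : HH t -> 0 < Cmod t ^ 2 /\ Cmod (- / t) ^ 2 = / Cmod t ^ 2 /\ fst (- / t)%C = - (fst t / Cmod t ^ 2).
Proof.
  intros H. assert (P : 0 < Cmod t ^ 2) by (apply pow_lt, Cmod_pos; now apply HH_neq0). split; auto.
  rewrite !Cmod_sq in *. destruct t as [x y]. simpl in *. split; field; nra.
Qed.

Lemma uniformizes_inv (Om : C -> Prop) (ga ps : C -> C) (h : R) (G G' : C -> Prop) :
  (forall t, HH t -> G t <-> G' (- / t)%C) -> uniformizes Om ga ps h G ->
  uniformizes Om (fun z => - / ga z)%C (fun t => ps (- / t)%C) h G'.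
Proof.
  intros HG [U1 [U2 [U3 [U4 U5]]]]. split; [|split; [|split; [|split]]].
  - intros z Hz. destruct (U1 z Hz) as [H1 [l [H2 Nl]]]. split; [now apply HH_inv|]. assert (N := HH_neq0 _ H1).
    exists (-1 * (- / (ga z * ga z) * l))%C. split.
    + apply (cder_ext_loc (fun z => -1 * / ga z)%C _ _ _ 1); [lra | intros; ring|].
      apply cder_scal, cder_inv; auto.
    + apply Cmult_neq_0; [intros E; apply (f_equal fst) in E; simpl in E; lra|].
      apply Cmult_neq_0; auto. apply Copp_neq0, Cinv_neq0. now apply Cmult_neq_0.
  - intros t Ht. destruct (U2 _ (HH_inv t Ht)) as [H1 H2]. split; auto. rewrite H2. now apply inv_inv.
  - apply (contC_comp HH HH (fun t => - / t)%C ps); [apply inv_cont | auto | apply HH_inv].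
  - intros z Hz. rewrite U4 by auto. destruct (U1 z Hz) as [H1 _]. destruct (Cinv_parts _ H1) as [P1 [_ ->]].
    set (v := Cmod (ga z) ^ 2) in *. clearbody v.
    split; intros E; [rewrite E; unfold Rdiv; ring|].
    replace (fst (ga z)) with (- - (fst (ga z) / v) * v) by (field; lra). rewrite E. ring.
  - intros z Hz. rewrite U5 by auto. apply HG. now apply U1.
Qed.

(* The inversion [- 1 / t] exchanges the two signs of the endpoints of the geodesic. *)
Lemma uniformize (a b c d : R) : a * d - b * c = 1 -> 0 < a * b * (c * d) ->
  exists ga ps, uniformizes strip ga ps (width a b c d) (geodesic a b c d).
Proof.
  intros D PK.
  destruct (Rlt_or_le 0 ((a * d + b * c) * (c * d))) as [P|P]; [now apply uniformize_pos|].
  assert (n2 : (a * d + b * c) * (a * d + b * c) = 1 + 4 * (a * b * (c * d))).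
  { replace 1 with ((a * d - b * c) * (a * d - b * c)) by (rewrite D; ring). ring. }
  destruct (uniformize_pos (- c) (- d) a b) as [ga [ps U]]; [lra | lra | |].
  { set (n := a * d + b * c) in *. replace ((- c * b + - d * a) * (a * b)) with (- (n * (a * b))) by (unfold n; ring).
    assert (N : (n * (a * b)) * (n * (c * d)) = n * n * (a * b * (c * d))) by ring.
    assert (0 < n * n * (a * b * (c * d))) by (apply Rmult_lt_0_compat; lra).
    assert (n * (c * d) <> 0) by (intros E; rewrite E in N; lra). nra. }
  assert (EW : width (- c) (- d) a b = width a b c d).
  { unfold width. f_equal. f_equal; [|f_equal; f_equal; ring].
    replace (- c * b + - d * a) with (- (a * d + b * c)) by ring. apply Rabs_Ropp. }
  rewrite EW in U. exists (fun z => - / ga z)%C, (fun t => ps (- / t)%C). refine (uniformizes_inv _ _ _ _ _ _ _ U).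
  intros t Ht. unfold geodesic. destruct (Cinv_parts _ Ht) as [P1 [-> ->]].
  set (x := fst t) in *. set (v := Cmod t ^ 2) in *. clearbody x v.
  replace (c * d * / v - (a * d + b * c) * - (x / v) + a * b) with ((a * b * v - (- c * b + - d * a) * x + - c * - d) / v) by (field; lra).
  split; intros E; [rewrite E; unfold Rdiv; ring|].
  match goal with |- ?u = 0 => replace u with (u / v * v) by (field; lra) end. rewrite E. ring.
Qed.

(** The degenerate case: a vertical line shares the end point infinity with iR+. A linear map
    uniformizes, and its domain is a half-plane, with room for rectangles of height 1 and any
    width. *)
Lemma half_plane (k : R) : k <> 0 ->
  exists ga ps, uniformizes (fun z => k * fst z < 0) ga ps 1 (fun t => fst t = k).
Proof.
  intros Hk. assert (Nk : RtoC k <> 0%C) by (intros E; apply RtoC_inj in E; auto).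
  exists (fun z => - Ci * RtoC k * z)%C, (fun t => Ci * / RtoC k * t)%C. split; [|split; [|split; [|split]]].
  - intros z Hz. split; [unfold HH; simpl; lra|]. exists (- Ci * RtoC k * 1)%C. split; [apply cder_scal, cder_id|].
    intros E. apply (f_equal snd) in E. simpl in E. lra.
  - intros t Ht. split.
    + unfold HH in Ht. replace (k * fst (Ci * / RtoC k * t)%C) with (- snd t) by (simpl; field; auto). lra.
    + transitivity (- (Ci * Ci) * t)%C; [field; auto | cparts; ring].
  - apply contC_scal, contC_id.
  - intros z Hz. replace (fst (- Ci * RtoC k * z)%C) with (k * snd z) by (simpl; ring). split; intros E; [rewrite E; ring|].
    apply (Rmult_eq_reg_l k); auto. lra.
  - intros z Hz. replace (fst (- Ci * RtoC k * z)%C) with (k * snd z) by (simpl; ring). split; intros E; [rewrite E; ring|].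
    apply (Rmult_eq_reg_l k); auto. lra.
Qed.

(** * Bounds obtained from a uniformization *)

Definition geod (M : mat) (t : C) : Prop :=
  let '((a, b), (c, d)) := M in geodesic (IZR a) (IZR b) (IZR c) (IZR d) t.

Lemma act_w_geod (l : list (nat * bool)) (t : C) : HH t ->
  (geod (ml l) t <-> exists y, 0 < y /\ t = act_w l (0, y)).
Proof.
  intros H. assert (A := fun y => act_w_mob l (0, y)). assert (D := mdet_ml l). unfold geod.
  destruct (ml l) as [[a b] [c d]]. simpl in D.
  rewrite mob_geodesic by (auto; rewrite <- !mult_IZR, <- minus_IZR, D; reflexivity).
  split; intros [y [Py E]]; exists y; split; auto; rewrite E; [symmetry|]; now apply A.
Qed.

Section Bounds.

Variables (w : bword) (Om : C -> Prop) (ga ps : C -> C) (h : R).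
Hypothesis U : uniformizes Om ga ps h (geod (ml (letters w))).

(** [ps] is only known to be continuous; the identity ga (ps t) = t and the nonvanishing derivative
    of [ga] make its composition with the modular lift holomorphic, so that [length_area]
    applies. *)
Lemma lower_bound (x0 x1 y0 y1 : R) (f : C -> C3) : (forall z, Om z -> - PI < fst z < 0) ->
  x0 < x1 -> y0 < y1 -> represents x0 x1 y0 y1 f w -> h * (x1 - x0) <= PI * (y1 - y0).
Proof.
  destruct U as [U1 [U2 [U3 [U4 U5]]]]. intros HO X Y Hr.
  destruct (rect_marked x0 x1 y0 y1 f w X Y Hr) as [a [b [c [t [M He]]]]].
  set (D := closed_rect x0 x1 y0 y1) in *. assert (Ct : contC D t) by apply M.
  assert (Ht : forall z, D z -> HH (t z)) by (intros z Dz; now apply M).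
  assert (Cp : contC D (fun z => ps (t z))) by (apply (contC_comp D HH t ps); auto).
  apply (length_area (fun z => ps (t z)) x0 x1 y0 y1 h); auto.
  - intros z Hz. destruct (open_rect_ball _ _ _ _ _ Hz) as [r [Pr B]].
    assert (BD : forall v, Cmod (v - z) < r -> D v).
    { intros v Hv. specialize (B v Hv). unfold D, open_rect, closed_rect in *. lra. }
    destruct Hr as [_ [_ [Hd _]]]. destruct (marked_holo D f a b c t z r M Pr BD (Hd z Hz)) as [l Hl].
    assert (Dz : D z) by (unfold D, open_rect, closed_rect in *; lra).
    destruct (U2 _ (Ht z Dz)) as [O1 _]. destruct (U1 _ O1) as [_ [g [Hg Ng]]]. eexists.
    apply (cder_lift ga (fun z => ps (t z)) t z g l r); auto.
    + intros v Hv. now apply U2, Ht, BD.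
    + exact (contC_cont_at D _ _ r Pr BD Cp).
  - intros z Hz. apply HO, U2, Ht. unfold D, open_rect, closed_rect in *. lra.
  - intros x Hx. destruct (He x Hx) as [[y [Py Ey]] Et].
    assert (D0 : D (x, y0)) by (split; simpl; lra). assert (D1 : D (x, y1)) by (split; simpl; lra).
    destruct (U2 _ (Ht _ D0)) as [O0 G0]. destruct (U2 _ (Ht _ D1)) as [O1 G1]. split.
    + apply U4; auto. rewrite G0, Ey. reflexivity.
    + apply U5; auto. rewrite G1. apply act_w_geod; auto.
Qed.

Hypothesis Conv : forall z v s, Om z -> Om v -> 0 <= s <= 1 -> Om (RtoC (1 - s) * z + RtoC s * v)%C.

Lemma lam_real_0 (z : C) : Om z -> snd z = 0 -> isreal (lam (ga z)).
Proof.
  destruct U as [U1 [U2 [U3 [U4 U5]]]]. intros Oz E. apply U4 in E; auto. destruct (U1 z Oz) as [H _].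
  replace (ga z) with ((0, snd (ga z)) : C) by (cparts; auto). destruct (lam_phi _ H) as [-> _]. apply isreal_R.
Qed.

Lemma lam_real_h (z : C) : Om z -> snd z = h -> isreal (lam (ga z)).
Proof.
  destruct U as [U1 [U2 [U3 [U4 U5]]]]. intros Oz E. apply U5 in E; auto. destruct (U1 z Oz) as [H _].
  apply act_w_geod in E; auto. destruct E as [y [Py ->]]. destruct (act_w_equivariant (letters w)) as [k [p [_ He]]].
  assert (Hy : HH (0, y)) by exact Py. destruct (He _ Hy) as [_ [_ [_ [_ ->]]]]. apply isreal_anh.
  destruct (lam_phi y Py) as [-> _]. apply isreal_R.
Qed.

Lemma inEtr_real (a b c : C) : isreal a -> isreal b -> isreal c -> distinct3 a b c -> inEtr (sym3 a b c).
Proof.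
  destruct a as [a a'], b as [b b'], c as [c c']. unfold isreal. simpl. intros -> -> -> [N1 [N2 N3]].
  exists a, b, c. repeat split; intros E; [apply N1 | apply N2 | apply N3]; now rewrite E.
Qed.

Lemma distinct_lam (v e t : C) : HH t -> e <> 0%C -> distinct3 v (v + e * lam t)%C (v + e)%C.
Proof.
  intros Ht Ne. destruct (lam_not01 t Ht) as [N0 N1]. repeat split.
  - apply (Chalf_neq _ _ (e * lam t)); [ring | now apply Cmult_neq_0].
  - apply (Chalf_neq _ _ e); [ring | auto].
  - apply (Chalf_neq _ _ (e * (1 - lam t))); [ring|]. apply Cmult_neq_0; auto. apply Csub_neq0; auto.
Qed.

Lemma cexp_real (z : C) (n : Z) : snd z = IZR n * PI -> isreal (cexp z).
Proof. intros E. unfold isreal, cexp. simpl. rewrite E, sin_eq_0_1; [ring|]. now exists n. Qed.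

(** The integer n counts the half-turns of c - a along the standard path. The ratio lambda does not
    see them, but a representative has to reproduce them. *)
Lemma std_log : exists a b c t l n,
  marked (closed_rect 0 1 0 0) (fun z => std_path w (fst z)) a b c t /\ contC (closed_rect 0 1 0 0) l /\
  (forall z, closed_rect 0 1 0 0 z -> cexp (l z) = (c z - a z)%C) /\
  isreal (a (0, 0)) /\ isreal (a (1, 0)) /\ snd (l (0, 0)) = 0 /\ snd (l (1, 0)) = IZR n * PI /\
  t (0, 0) = (0, 1) /\ t (1, 0) = act_w (letters w) (0, 1).
Proof.
  destruct (std_marked w) as [a [b [c [t [M [[A0 [_ [C0 T0]]] [[A1 [_ C1]] T1]]]]]]].
  assert (M' := M). destruct M' as [[CA [_ [CC M4]]] _].
  destruct (lift_exists C dC non0 rexp exp_evenly exp_sep 0 1 0 0 (fun z => c z - a z)%C ltac:(lra) ltac:(lra)) with (z0 := (0, 0) : C) (e0 := RtoC (ln 2))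
    as [l [[Cl Hl] El]].
  - apply contC_minus; auto.
  - intros z Dz. destruct (M4 z Dz) as [[_ [N _]] _]. apply Csub_neq0; auto.
  - split; simpl; lra.
  - unfold rexp. rewrite A0, C0. unfold cexp. simpl. rewrite exp_ln, cos_0, sin_0 by lra. cparts; ring.
  - assert (E1 : snd (cexp (l (1, 0))) = 0).
    { rewrite Hl by (split; simpl; lra). now apply isreal_minus. }
    unfold cexp in E1. simpl in E1. apply Rmult_integral in E1. destruct E1 as [E1|E1]; [generalize (exp_pos (fst (l (1, 0)))); lra|].
    apply sin_eq_0_0 in E1. destruct E1 as [n En].
    exists a, b, c, t, l, n. split; auto. split; auto. split; [exact Hl|]. rewrite A0, El. repeat split; auto.
Qed.

(** The representative is the triple 0, exp(k z) lambda(ga z), exp(k z). Its homotopy to the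
    standard path interpolates linearly the position a, the logarithm of c - a and, in the convex
    domain [Om], the uniformizing coordinate. At both ends of the paths the heights and the phases
    to be interpolated agree, so the ends remain real triples. *)
Lemma upper_bound (x0 x1 : R) : x0 < x1 -> 0 < h -> (forall x y, x0 <= x <= x1 -> Om (x, y)) ->
  exists f, represents x0 x1 0 h f w.
Proof.
  intros X Ph HO. destruct std_log as [a [b [c [t [l [n [M [Cl [El [Ra0 [Ra1 [L0 [L1 [T0 T1]]]]]]]]]]]]]].
  assert (M' := M). destruct M' as [[CA [_ [_ M4]]] [Ct M6]].
  assert (U' := U). destruct U' as [U1 [U2 [U3 [U4 U5]]]].
  (* c - a has to turn by n PI while the height rises from 0 to h. *)
  set (k := IZR n * PI / h). assert (kh : k * h = IZR n * PI) by (unfold k; field; lra).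
  set (E := fun z : C => cexp (RtoC k * z)).
  assert (Cga : contC Om ga) by (apply contC_cder; intros z Hz; destruct (U1 z Hz) as [_ [g [Hg _]]]; eauto).
  assert (Clam : contC Om (fun z => lam (ga z))) by (apply (contC_comp Om HH ga lam); auto; [apply lam_cont | intros; now apply U1]).
  set (f := fun z => sym3 0 (0 + E z * lam (ga z)) (0 + E z)).
  set (D := closed_rect x0 x1 0 h).
  assert (DO : forall z, D z -> Om z) by (intros [x y] [H1 _]; now apply HO).
  assert (Etr : forall z, Om z -> snd z = 0 \/ snd z = h -> inEtr (f z)).
  { intros z Oz Hz. assert (RE : isreal (E z)).
    { unfold E. destruct Hz as [Hz|Hz].
      - apply (cexp_real _ 0). simpl. rewrite Hz. ring.
      - apply (cexp_real _ n). rewrite <- kh. simpl. rewrite Hz. ring. }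
    assert (RL : isreal (lam (ga z))) by (destruct Hz; [now apply lam_real_0 | now apply lam_real_h]).
    apply inEtr_real; auto using isreal_plus, isreal_mult, isreal_R. apply distinct_lam; [now apply U1 | apply cexp_neq0]. }
  exists f. split; [|split; [|split; [|split]]].
  - apply contD_cont_on. unfold f. assert (CE : contC D E) by (apply contC_cexp, contC_scal, contC_id).
    apply sym3_cont; [apply contC_const | apply contC_plus; [apply contC_const|] | apply contC_plus; [apply contC_const | auto]].
    apply contC_mult; auto. now apply (contD_sub Om).
  - intros z Dz. apply sym3_inX, distinct_lam; [now apply U1, DO | apply cexp_neq0].
  - intros z Dz. assert (Oz : Om z) by (destruct z as [x y]; apply HO; unfold open_rect in Dz; simpl in Dz; lra).
    destruct (U1 z Oz) as [Hz [g [Hg _]]]. apply ex_derive_cder.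
    assert (DE : exists l, cder E z l) by (eexists; apply (cder_comp (fun z => RtoC k * z)%C cexp); [apply cder_scal, cder_id | apply cder_cexp]).
    destruct DE as [e He]. assert (DL := cder_comp ga lam z _ _ Hg (lam_cder _ Hz)).
    assert (DP := cder_mult _ _ _ _ _ He DL).
    eexists. eexists. exists 0%C. split; [|split].
    + apply (cder_ext_loc (fun v => E v * lam (ga v) + E v)%C _ _ _ 1); [lra | intros; unfold f, sym3, e1; simpl fst; ring|].
      apply cder_plus; eassumption.
    + apply (cder_ext_loc (fun v => E v * lam (ga v) * E v)%C _ _ _ 1); [lra | intros; unfold f, sym3, e2; simpl fst; simpl snd; ring|].
      apply cder_mult; eassumption.
    + apply (cder_ext_loc (fun v => 0)%C _ _ _ 1); [lra | intros; unfold f, sym3, e3; simpl snd; ring|]. apply cder_const.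
  - intros x Hx. split; apply Etr; auto; apply HO; lra.
  - intros x Hx.
    (* On the square [S] the first coordinate is the homotopy parameter and the second the time;
       [tz] regards the time as a point of [closed_rect 0 1 0 0]. *)
    set (tz := fun z : C => RtoC (snd z)). set (S := closed_rect 0 1 0 1).
    assert (CT : contC S tz) by apply contC_snd.
    assert (ST : forall z, S z -> closed_rect 0 1 0 0 (tz z)) by (intros z Hz; unfold S, closed_rect, tz in *; simpl; lra).
    assert (Cs : contC S (fun z => RtoC (fst z))) by apply contC_fst.
    assert (Cs1 : contC S (fun z => RtoC (1 - fst z))).
    { apply (contD_ext _ _ (fun z => 1 - RtoC (fst z))%C); [intros; now rewrite RtoC_minus|]. apply contC_minus; [apply contC_const | auto]. }
    set (p := fun z : C => ((x, (h * snd z)%R) : C)).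
    assert (Cp : contC S p).
    { apply (contD_ext _ _ (fun z => RtoC x + (0, h) * RtoC (snd z))%C); [intros; cparts; ring|].
      apply contC_plus; [apply contC_const | apply contC_mult; [apply contC_const | apply contC_snd]]. }
    set (Zf := fun z : C => (RtoC (1 - fst z) * p z + RtoC (fst z) * ps (t (tz z)))%C).
    set (Lf := fun z : C => (RtoC (1 - fst z) * (RtoC k * p z) + RtoC (fst z) * l (tz z))%C).
    set (Vf := fun z : C => (RtoC (fst z) * a (tz z))%C).
    assert (Htt : forall z, S z -> HH (t (tz z))) by (intros z Hz; apply M6; auto).
    assert (OZ : forall z, S z -> Om (Zf z)).
    { intros z Hz. apply Conv; [apply HO; lra | apply U2; auto | apply Hz]. }
    assert (CZ : contC S Zf).
    { unfold Zf. apply contC_plus; apply contC_mult; auto.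
      apply (contC_comp S HH (fun z => t (tz z)) ps); auto. apply (contC_comp S (closed_rect 0 1 0 0) tz t); auto. }
    assert (CL : contC S Lf).
    { unfold Lf. apply contC_plus; apply contC_mult; auto; [apply contC_scal; auto|].
      apply (contC_comp S (closed_rect 0 1 0 0) tz l); auto. }
    assert (CV : contC S Vf).
    { unfold Vf. apply contC_mult; auto. apply (contC_comp S (closed_rect 0 1 0 0) tz a); auto. }
    exists (fun z : C => sym3 (Vf z) (Vf z + cexp (Lf z) * lam (ga (Zf z))) (Vf z + cexp (Lf z))).
    assert (Ends : forall z, S z -> snd z = 0 \/ snd z = 1 -> inEtr (sym3 (Vf z) (Vf z + cexp (Lf z) * lam (ga (Zf z))) (Vf z + cexp (Lf z)))).
    { intros z Sz Hz.
      assert (Et : tz z = (0, 0) \/ tz z = (1, 0)) by (unfold tz; destruct Hz as [-> | ->]; auto).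
      assert (Rm : forall (s : R) (v : C), snd (RtoC s * v)%C = s * snd v) by (intros; simpl; ring).
      assert (Rp : forall (u v : C), snd (u + v)%C = snd u + snd v) by (intros; reflexivity).
      assert (RV : isreal (Vf z)).
      { unfold Vf. apply isreal_mult; [apply isreal_R|]. destruct Et as [-> | ->]; auto. }
      assert (RE : isreal (cexp (Lf z))).
      { destruct Hz as [Hz|Hz].
        - apply (cexp_real _ 0). unfold Lf. rewrite Rp, !Rm. unfold p, tz. rewrite Hz. simpl snd at 1.
          change (RtoC 0) with ((0, 0) : C). rewrite L0. ring.
        - apply (cexp_real _ n). unfold Lf. rewrite Rp, !Rm. unfold p, tz. rewrite Hz. simpl snd at 1.
          change (RtoC 1) with ((1, 0) : C). rewrite L1, <- kh. ring. }
      assert (RL : isreal (lam (ga (Zf z)))).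
      { destruct Hz as [Hz|Hz].
        - apply lam_real_0; auto. unfold Zf. rewrite Rp, !Rm. unfold p, tz. rewrite Hz. simpl snd at 1.
          change (RtoC 0) with ((0, 0) : C). rewrite T0.
          assert (Q : HH (0, 1)) by (unfold HH; simpl; lra). destruct (U2 _ Q) as [Q1 Q2].
          assert (Q3 : snd (ps (0, 1)) = 0) by (apply U4; auto; rewrite Q2; reflexivity). rewrite Q3. ring.
        - apply lam_real_h; auto. unfold Zf. rewrite Rp, !Rm. unfold p, tz. rewrite Hz. simpl snd at 1.
          change (RtoC 1) with ((1, 0) : C). rewrite T1.
          assert (Q : HH (act_w (letters w) (0, 1))) by (apply act_w_HH; unfold HH; simpl; lra). destruct (U2 _ Q) as [Q1 Q2].
          assert (Q3 : snd (ps (act_w (letters w) (0, 1))) = h).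
          { apply U5; auto. rewrite Q2. apply act_w_geod; auto. exists 1. split; [lra | reflexivity]. }
          rewrite Q3. ring. }
      apply inEtr_real; auto using isreal_plus, isreal_mult. apply distinct_lam; [now apply U1, OZ | apply cexp_neq0]. }
    split; [|split; [|split]].
    + apply (contD_cont_on S). apply sym3_cont; auto.
      * apply contC_plus; auto. apply contC_mult; [now apply contC_cexp|].
        apply (contC_comp S Om Zf (fun z => lam (ga z))); auto.
      * apply contC_plus; auto. now apply contC_cexp.
    + intros z Sz. apply sym3_inX, distinct_lam; [now apply U1, OZ | apply cexp_neq0].
    + intros s Hs. split; apply Ends; auto; split; simpl; lra.
    + intros s Hs. assert (S0 : S (0, s)) by (split; simpl; lra). assert (S1 : S (1, s)) by (split; simpl; lra). split.
      * assert (EV : Vf (0, s) = 0%C) by (unfold Vf; simpl fst; ring).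
        assert (EZ : Zf (0, s) = (x, 0 + s * (h - 0))).
        { unfold Zf. simpl fst. replace (1 - 0) with 1 by ring. unfold p. simpl snd.
          replace (0 + s * (h - 0)) with (h * s) by ring. ring. }
        assert (EL : Lf (0, s) = (RtoC k * (x, (0 + s * (h - 0))%R))%C).
        { unfold Lf. simpl fst. replace (1 - 0) with 1 by ring. unfold p. simpl snd.
          replace (0 + s * (h - 0)) with (h * s) by ring. ring. }
        rewrite EV, EZ, EL. reflexivity.
      * assert (Dt : closed_rect 0 1 0 0 (s, 0)) by (split; simpl; lra).
        assert (EV : Vf (1, s) = a (s, 0)) by (unfold Vf, tz; simpl fst; simpl snd; change (RtoC s) with ((s, 0) : C); ring).
        assert (EZ : ga (Zf (1, s)) = t (s, 0)).
        { destruct (U2 (t (s, 0))) as [_ Q]; [now apply M6|]. rewrite <- Q at 1. f_equal.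
          unfold Zf, tz. simpl fst. simpl snd. replace (1 - 1) with 0 by ring. change (RtoC s) with ((s, 0) : C).
          ring. }
        assert (EL : cexp (Lf (1, s)) = (c (s, 0) - a (s, 0))%C).
        { rewrite <- El by auto. f_equal. unfold Lf, tz. simpl fst. simpl snd. replace (1 - 1) with 0 by ring. change (RtoC s) with ((s, 0) : C). ring. }
        rewrite EV, EZ, EL. destruct (M4 _ Dt) as [_ Ew]. simpl fst in Ew. rewrite Ew. destruct (M6 _ Dt) as [_ Eb].
        f_equal; [rewrite Cmult_comm, <- Eb|]; ring.
Qed.

End Bounds.

(** * Powers of Delta and the case of trivial b_1 *)

(** Delta exchanges the columns of the matrix, that is the two end points of the geodesic; its
    equation only changes sign. *)
Lemma geod_delta (M : mat) (n : nat) (e : Z) (t : C) : (e = 1 \/ e = -1)%Z ->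
  geod (mm M (mw (concat (repeat [(1%nat, e); (2%nat, e); (1%nat, e)] n)))) t <-> geod M t.
Proof.
  intros He. revert M. induction n as [|n IH]; intros M; simpl repeat; simpl concat.
  - simpl mw. now rewrite mm_1r.
  - change (mw ((1%nat, e) :: (2%nat, e) :: (1%nat, e) :: concat (repeat [(1%nat, e); (2%nat, e); (1%nat, e)] n)))
      with (mm (tm (1%nat, e)) (mm (tm (2%nat, e)) (mm (tm (1%nat, e)) (mw (concat (repeat [(1%nat, e); (2%nat, e); (1%nat, e)] n)))))).
    rewrite <- !mm_assoc, IH. destruct M as [[a b] [c d]]. unfold tm. cbn [Nat.eqb fst snd]. unfold mm, geod, geodesic.
    destruct He as [-> | ->]; repeat rewrite ?plus_IZR, ?mult_IZR, ?opp_IZR;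
    match goal with |- ?u = 0 <-> ?v = 0 => replace u with (- v) by ring end; lra.
Qed.

Lemma geod_delta_pow (M : mat) (l : Z) (t : C) : geod (mm M (mw (delta_pow l))) t <-> geod M t.
Proof. unfold delta_pow. destruct (Z.leb 0 l); apply geod_delta; auto. Qed.

Lemma uniformizes_ext (Om : C -> Prop) (ga ps : C -> C) (h : R) (G G' : C -> Prop) :
  (forall t, HH t -> G t <-> G' t) -> uniformizes Om ga ps h G -> uniformizes Om ga ps h G'.
Proof.
  intros E [U1 [U2 [U3 [U4 U5]]]]. split; [exact U1|]. split; [exact U2|]. split; [exact U3|]. split; [exact U4|].
  intros z Hz. rewrite U5 by auto. apply E. now apply U1.
Qed.

Lemma convex_neg (x y s : R) : x < 0 -> y < 0 -> 0 <= s <= 1 -> (1 - s) * x + s * y < 0.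
Proof.
  intros Hx Hy Hs. destruct (Req_dec s 0) as [->|N]; [lra|].
  assert (0 < s * - y) by (apply Rmult_lt_0_compat; lra). assert (0 <= (1 - s) * - x) by (apply Rmult_le_pos; lra). lra.
Qed.

Lemma degenerate_upper (j : nat) (k l : Z) (W : R) : (j = 1%nat \/ j = 2%nat) -> k <> 0%Z -> 0 < W ->
  exists x0 x1 f, x1 - x0 = W /\ represents x0 x1 0 1 f (braid_nf j k [] l).
Proof.
  intros Hj Hk HW. assert (Nk : IZR k <> 0) by (apply not_0_IZR; auto).
  destruct (half_plane (IZR k) Nk) as [ga [ps U]].
  assert (Q : exists ga ps, uniformizes (fun z => IZR k * fst z < 0) ga ps 1 (geod (ml (letters (braid_nf j k [] l))))).
  { rewrite ml_letters. unfold braid_nf. change ((j, k) :: [] ++ delta_pow l) with ([(j, k)] ++ delta_pow l). rewrite mw_app.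
    simpl (mw [(j, k)]). rewrite mm_1r. destruct Hj as [-> | ->].
    - exists ga, ps. refine (uniformizes_ext _ _ _ _ _ _ _ U).
      intros t Ht. rewrite geod_delta_pow. unfold tm, geod, geodesic. simpl. split; lra.
    - exists (fun z => - / ga z)%C, (fun t => ps (- / t)%C). refine (uniformizes_inv _ _ _ _ _ _ _ U).
      intros t Ht. rewrite geod_delta_pow. unfold tm, geod, geodesic. cbn [Nat.eqb fst snd]. rewrite opp_IZR.
      destruct (Cinv_parts t Ht) as [P1 [-> ->]]. set (v := Cmod t ^ 2) in *. clearbody v.
      match goal with |- _ <-> ?u = 0 => replace u with ((fst t - IZR k) / v) by (field; lra) end.
      split; intros E; [rewrite E; field; lra|].
      replace (fst t) with ((fst t - IZR k) / v * v + IZR k) by (field; lra). rewrite E. ring. }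
  clear ga ps U. destruct Q as [ga [ps U]].
  assert (Conv : forall (z v : C) (s : R), IZR k * fst z < 0 -> IZR k * fst v < 0 -> 0 <= s <= 1 ->
     IZR k * fst (RtoC (1 - s) * z + RtoC s * v)%C < 0).
  { intros z v s Hz Hv Hs. replace (IZR k * fst (RtoC (1 - s) * z + RtoC s * v)%C) with ((1 - s) * (IZR k * fst z) + s * (IZR k * fst v)) by (simpl; ring).
    now apply convex_neg. }
  assert (X : exists x0 x1 : R, x1 - x0 = W /\ (forall x : R, x0 <= x <= x1 -> IZR k * x < 0)).
  { destruct (Rdichotomy _ _ Nk) as [L|L]; [exists 1, (W + 1) | exists (- W - 1), (-1)]; (split; [ring|]); intros x Hx; nra. }
  destruct X as [x0 [x1 [Ex Hx]]]. exists x0, x1.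
  destruct (upper_bound _ _ ga ps 1 U Conv x0 x1 ltac:(lra) ltac:(lra)) as [f Hf].
  - intros x y Hxy. simpl. auto.
  - exists f. split; auto.
Qed.

(** * The two-sided estimate *)

Lemma syl_deg (l : list Z) : List.Forall (fun md => (1 <= snd md)%nat /\ True) (syllables l).
Proof.
  induction l as [|n t IH]; simpl; auto. destruct (Z.leb_spec 2 (Z.abs n)) as [L|L].
  - constructor; auto. simpl. split; auto. lia.
  - destruct (syllables t) as [|[m d] s']; [repeat constructor|].
    inversion IH; subst. destruct (Z.eqb m n); constructor; simpl; auto with arith.
Qed.

(** The sum of logarithms becomes the logarithm of one integer, to which the growth estimates over
    the integers apply. *)
Lemma Lcal_prod (v : list (nat * Z)) : Lcal v = ln (IZR (syl_prod (syllables (map snd v)))).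
Proof.
  unfold Lcal. generalize (syl_deg (map snd v)). generalize (syllables (map snd v)). intros s.
  induction 1 as [|[m d] s [H _] Hs IH]; [simpl; now rewrite ln_1|].
  assert (P := syl_prod_pos s _ Hs). simpl fold_right. rewrite IH.
  change (syl_prod ((m, d) :: s)) with ((4 * Z.of_nat d - 1) * syl_prod s)%Z. simpl in H.
  rewrite mult_IZR, ln_mult.
  - f_equal. f_equal. rewrite minus_IZR, mult_IZR, <- INR_IZR_INZ. reflexivity.
  - apply IZR_lt. lia.
  - apply IZR_lt. lia.
Qed.

Lemma ln_le_incr (x y : R) : 0 < x -> x <= y -> ln x <= ln y.
Proof. intros Hx [H| ->]; [left; now apply ln_increasing | lra]. Qed.

(* Both sides of the estimate compare with the distance [h / PI] between the two geodesics. *)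
Lemma main_upper_lower (j : nat) (k l : Z) (b1 : bword) : (j = 1%nat \/ j = 2%nat) -> k <> 0%Z -> alt_even j b1 -> b1 <> [] ->
  exists h, let b := braid_nf j k b1 l in let L := Lcal (pb_image (vartheta j k b1)) in
    L / 2 <= h <= 6 * L /\ 0 <= L /\
    (forall x0 x1 y0 y1 f, x0 < x1 -> y0 < y1 -> represents x0 x1 y0 y1 f b -> h * (x1 - x0) <= PI * (y1 - y0)) /\
    exists f, 0 < h /\ represents (-2) (-1) 0 h f b.
Proof.
  intros Hj Hk Ha Nb. destruct (braid_growth j k l b1 Hj Hk Ha Nb) as [N [PK [PN [EN [L1 [L2 L3]]]]]].
  cbv zeta. rewrite Lcal_prod. set (P := syl_prod _) in *.
  set (b := braid_nf j k b1 l) in *. assert (D := mdet_ml (letters b)). assert (EM := ml_letters b).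
  assert (GM : exists h, 0 < h /\ ln (IZR P) / 2 <= h <= 6 * ln (IZR P) /\ exists ga ps, uniformizes strip ga ps h (geod (ml (letters b)))).
  { rewrite EM in *. unfold geod. destruct (mw b) as [[a b'] [c d]]. simpl in D, PK, EN.
    assert (DR : IZR a * IZR d - IZR b' * IZR c = 1) by (rewrite <- !mult_IZR, <- minus_IZR, D; reflexivity).
    assert (PKR : 0 < IZR a * IZR b' * (IZR c * IZR d)) by (rewrite <- !mult_IZR; now apply IZR_lt).
    assert (ENR : IZR N * IZR N = 1 + 4 * (IZR a * IZR b' * (IZR c * IZR d))) by (rewrite <- !mult_IZR, <- plus_IZR; now f_equal).
    assert (PNR : 1 <= IZR N) by (apply IZR_le; lia). assert (P3 : 3 <= IZR P) by (now apply IZR_le).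
    assert (L1R : IZR P <= IZR N * IZR N) by (rewrite <- mult_IZR; now apply IZR_le).
    assert (L2R : IZR N <= 9 * (IZR P * IZR P * IZR P)) by (rewrite <- !mult_IZR; now apply IZR_le).
    exists (width (IZR a) (IZR b') (IZR c) (IZR d)). unfold width.
    set (K := IZR a * IZR b' * (IZR c * IZR d)) in *.
    assert (En : Rabs (IZR a * IZR d + IZR b' * IZR c) = IZR N).
    { set (n := IZR a * IZR d + IZR b' * IZR c). assert (n * n = IZR N * IZR N).
      { rewrite ENR. unfold n, K. replace 1 with ((IZR a * IZR d - IZR b' * IZR c) * (IZR a * IZR d - IZR b' * IZR c)) by (rewrite DR; ring). ring. }
      rewrite <- (Rabs_pos_eq (IZR N)) by lra. now apply Rsqr_eq_abs_0. }
    assert (S0 := sqrt_lt_R0 K PKR). assert (S2 := sqrt_sqrt K (Rlt_le _ _ PKR)).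
    assert (S3 : 2 * sqrt K <= IZR N) by (apply Rnot_lt_le; intros Z; nra).
    split; [|split; [|now apply uniformize]].
    - rewrite En, <- ln_1. apply ln_increasing; lra.
    - rewrite En. split.
      + assert (A : ln (IZR P) <= ln (IZR N * IZR N)) by (apply ln_le_incr; lra). rewrite ln_mult in A by lra.
        assert (B : ln (IZR N) <= ln (IZR N + 2 * sqrt K)) by (apply ln_le_incr; lra). lra.
      + set (p := IZR P) in *. assert (E6 : 6 * ln p = ln (p * p * p * (p * p * p))).
        { assert (0 < p * p) by nra. assert (0 < p * p * p) by (apply Rmult_lt_0_compat; lra).
          rewrite !ln_mult; try lra. }
        rewrite E6. apply ln_le_incr; [lra|].
        (* N + 2 sqrt K <= 2 N <= 18 P^3 <= P^6, because P^3 >= 27. *)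
        assert (27 <= p * p * p) by (assert (9 <= p * p) by nra; nra). nra. }
  destruct GM as [h [Ph [Hh [ga [ps U]]]]]. exists h. split; auto.
  assert (L0 : 0 <= ln (IZR P)) by (rewrite <- ln_1; apply ln_le_incr; [lra | apply (IZR_le 1); lia]).
  split; auto. split.
  - intros x0 x1 y0 y1 f X Y Hr. apply (lower_bound b strip ga ps h U x0 x1 y0 y1 f); auto.
  (* The rectangle -2 <= x <= -1 lies in -PI < x < 0 and has width 1, so its ratio of sides is h. *)
  - destruct (upper_bound b strip ga ps h U) with (x0 := -2) (x1 := -1) as [f Hf]; auto; try lra; [| |exists f; auto].
    + intros z v s Hz Hv Hs. unfold strip in *. replace (fst (RtoC (1 - s) * z + RtoC s * v)%C) with ((1 - s) * fst z + s * fst v) by (simpl; ring).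
      assert (A := convex_neg (fst z) (fst v) s ltac:(lra) ltac:(lra) Hs).
      assert (B := convex_neg (- PI - fst z) (- PI - fst v) s ltac:(lra) ltac:(lra) Hs). lra.
    + intros x y Hx. unfold strip. simpl. assert (Q := PI_4). assert (Q2 := PI2_3_2). lra.
Qed.

Theorem theorem3 (j : nat) (k : Z) (b1 : bword) (l : Z) :
  (j = 1%nat \/ j = 2%nat) -> k <> 0%Z -> alt_even j b1 ->
  let b := braid_nf j k b1 l in
  let w := pb_image (vartheta j k b1) in
  (b1 = [] -> Lambda_tr b = Finite 0) /\
  (b1 <> [] ->
     Rbar_le (Finite (Lcal w / (2 * PI))) (Lambda_tr b) /\
     Rbar_le (Lambda_tr b) (Finite (300 * Lcal w))).
Proof.
  intros Hj Hk Ha b w. split.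
  - intros ->. apply is_glb_Rbar_unique. split.
    + intros x [x0 [x1 [y0 [y1 [f [X [Y [-> _]]]]]]]]. simpl. apply Rlt_le, Rdiv_lt_0_compat; lra.
    + intros c Hc.
      assert (K : forall W, 0 < W -> Rbar_le c (Finite (/ W))).
      { intros W HW. apply Hc. destruct (degenerate_upper j k l W Hj Hk HW) as [x0 [x1 [f [E Hf]]]].
        exists x0, x1, 0, 1, f. split; [lra|]. split; [lra|]. split; auto. rewrite E. field. lra. }
      destruct c as [r| |]; simpl in *; auto.
      (* A positive lower bound r is contradicted by a rectangle of height 1 and width 2 / r. *)
      * apply Rnot_lt_le. intros L. specialize (K (2 / r) ltac:(apply Rdiv_lt_0_compat; lra)).
        replace (/ (2 / r)) with (r / 2) in K by (field; lra). lra.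
      * exact (K 1 Rlt_0_1).
  - intros Nb. destruct (main_upper_lower j k l b1 Hj Hk Ha Nb) as [h [Hh [L0 [Low [f [Ph Up]]]]]]. fold b w in Hh, L0, Low, Up.
    unfold Lambda_tr. set (S := fun lam => _). destruct (Glb_Rbar_correct S) as [G1 G2]. assert (Pp := PI_RGT_0). split.
    + apply G2. intros x [x0 [x1 [y0 [y1 [g [X [Y [-> Hr]]]]]]]]. simpl. specialize (Low x0 x1 y0 y1 g X Y Hr).
      apply (Rmult_le_reg_r (2 * PI * (x1 - x0))); [apply Rmult_lt_0_compat; lra|].
      replace (Lcal w / (2 * PI) * (2 * PI * (x1 - x0))) with (Lcal w * (x1 - x0)) by (field; lra).
      replace ((y1 - y0) / (x1 - x0) * (2 * PI * (x1 - x0))) with (2 * (PI * (y1 - y0))) by (field; lra). nra.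
    (* The rectangle of width 1 and height h is a competitor, and h <= 6 L <= 300 L since L >= 0. *)
    + apply (Rbar_le_trans _ (Finite h)); [|simpl; lra]. apply G1.
      exists (-2), (-1), 0, h, f. split; [lra|]. split; auto. split; auto. field.
Qed.
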